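(* Let $d\ge3$ be an integer, $M$ a finite set, $\mu\in\mathcal I_d(M)$ and $(r_k)_{k\ge1}$ an increasing sequence of integers $r_k\ge1$ such that for all invariant couplings $\nu$ of $\mu$ and $\mu$ and all $k\ge1$ we have $\Sigma_{r_k}(\nu)\le2\Sigma_{r_k}(\mu)$. Then $\mu$ is strongly typical.
   Context: **Processes.** $T_d$ is the infinite $d$-regular tree with root $o$, whose neighbors are labeled $1,\dots,d$. For a finite set $M$, $\mathcal I_d(M)$ is the set of probability measures on $M^{T_d}$ invariant under all automorphisms of $T_d$. An invariant coupling of $\mu$ and $\mu$ is a measure $\nu\in\mathcal I_d(M\times M)$ such that if $(Y_1,Y_2)\sim\nu$ then $Y_1\sim\mu$ and $Y_2\sim\mu$. **Annealed entropy.** $B_r(S)$ is the set of vertices of $T_d$ at distance at most $r$ from $S$; for $r\ge1$, $S_r=B_r(o)$ and $E_r=B_{r-1}(\{o,1\})$. $H$ is Shannon entropy (natural logarithm). For a finite color set, $X$ an invariant process with law $\mu$ and $r\ge1$, $\Sigma_r(\mu)=H(X_{S_r})-\frac d2H(X_{E_r})$, where $X_S$ is the restriction of $X$ to $S$ (the same definition with color set $M\times M$ gives $\Sigma_r(\nu)$). **Random labeling and topology.** Let $\mathbb N=\{1,2,\dots\}$ and $\mathbb N^f=\bigcup_{k\ge0}\mathbb N^k$ with $\mathbb N^0=\{o\}$. A rooted $M$-colored graph $(G,f,v)$ is a connected graph $G$ with a map $f$ from its vertices to $M$ and a distinguished vertex $v$. If $G$ is locally finite, its randomly labeled version is the isomorphic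 random rooted colored graph on a subset of $\mathbb N^f$ given by the breadth-first search from the root with ties broken uniformly at random: the root gets label $o$, and the $j$-th offspring of the vertex labeled $(i_1,\dots,i_{k-1})$ gets label $(i_1,\dots,i_{k-1},j)$. $\mathcal G^\bullet_M$ is the set of rooted colored graphs arising as such labelings, with metric $\sum_{r\ge0}2^{-r}\mathbf 1_{g_r\ne g'_r}$, where $g_r$ is the restriction of $g$ to vertices at distance at most $r$ from the root. Fix a distance $\mathrm d$ on $\mathcal P(\mathcal G^\bullet_M)$ (probability measures) generating the weak topology (e.g. Lévy–Prohorov). $T_d$ is built on a subset of $\mathbb N^f$ in this way, and $\mu\in\mathcal I_d(M)$ is identified with the law of $(T_d,X,o)$, $X\sim\mu$. For a finite graph $G$ with vertex set $V$ and $f:V\to M$, $\mathrm{distr}_G(f)=\frac1{|V|}\sum_{v\in V}\mathrm{distr}_{G,v}(f)$, where $\mathrm{distr}_{G,v}(f)$ is the law of the randomly labeled version of the connected component of $v$ in $(G,f)$, rooted at $v$. **Strong typicality.** For $n\ge d+1$ with $nd$ even, $\mathcal G_n(d)$ is the set of simple $d$-regular graphs on $\{1,\dots,n\}$ and $G_n$ is uniform on $\mathcal G_n(d)$. $\mu\in\mathcal I_d(M)$ is strongly typical if $\lim_{\epsilon\to0}\lim_{n\to\infty}\mathbb P(\exists f\in M^n:\mathrm d(\mathrm{distr}_{G_n}(f),\mu)\le\epsilon)=1$ (limit along $n$ with $nd$ even). This does not depend on the choice of $\mathrm d$. *)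

(* Defs.v *)
From HB Require Import structures.
From mathcomp Require Import all_boot all_order all_algebra all_fingroup finmap.
From mathcomp Require Import all_classical all_reals all_analysis.

Set Implicit Arguments.
Unset Strict Implicit.
Unset Printing Implicit Defensive.

Import Order.TTheory GRing.Theory Num.Theory.
Import numFieldNormedType.Exports.

Local Open Scope classical_set_scope.
Local Open Scope ring_scope.

(* The measurable types of MathComp-Analysis are inhabited, so finite color
   sets carry a point. There is no process with an empty color set. *)
#[short(type="colorType")]
HB.structure Definition Color := {M of Finite M & isPointed M}.

HB.instance Definition _ (M N : colorType) := Pointed.on (M * N)%type.

(* The vertices at distance at most [r] from [S]. *)
Fixpoint gball (V : Type) (adj : V -> V -> Prop) (S : set V) (r : nat) : set V :=
  if r is r'.+1 then
    gball adj S r' `|` [set v | exists2 u, gball adj S r' u & adj u v]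
  else S.

Section Tree.
Variable d : nat.

(* The vertices of the tree are words of positive integers: the root [[::]] has
   children 1 .. d, every other vertex has children 1 .. d-1. *)
Definition tree_word (w : seq nat) : bool :=
  if w is i :: s then (1 <= i <= d)%N && all (fun j => 1 <= j <= d.-1)%N s
  else true.

Definition tree := {w : seq nat | tree_word w}.

Definition tree_child (u v : tree) : bool :=
  val v == rcons (val u) (last 0 (val v))%N.

Definition tree_adj : rel tree := fun u v => tree_child u v || tree_child v u.

Definition tree_aut (phi : tree -> tree) : Prop :=
  bijective phi /\ forall u v, tree_adj (phi u) (phi v) = tree_adj u v.

Definition vertex_ball (r : nat) : set tree :=
  gball tree_adj [set v | val v = [::]] r.

Definition edge_ball (r : nat) : set tree :=
  gball tree_adj [set v | val v = [::] \/ val v = [:: 1%N]] r.-1.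

End Tree.
Arguments vertex_ball d r : clear implicits.
Arguments edge_ball d r : clear implicits.

Section Processes.
Variables (R : realType) (d : nat).

Definition cylinder (M : Type) : set (set (tree d -> M)) :=
  [set A | exists v m, A = [set x | x v = m]].

Definition config (M : colorType) := g_sigma_algebraType (@cylinder M).

Definition invariant_process (M : colorType) (mu : probability (config M) R) : Prop :=
  forall phi : tree d -> tree d, tree_aut phi ->
  forall A : set (config M), measurable A ->
    mu [set x | A (fun v => x (phi v))] = mu A.

Definition invariant_coupling (M : colorType) (mu : probability (config M) R)
    (nu : probability (config (M * M)%type) R) : Prop :=
  [/\ invariant_process nu,
      forall A : set (config M), measurable A ->
        nu [set y | A (fun v => (y v).1)] = mu A &
      forall A : set (config M), measurable A ->
        nu [set y | A (fun v => (y v).2)] = mu A].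

(* [ln 0 = 0], so the patterns of probability 0 contribute 0. *)
Definition entropy (M : colorType) (mu : probability (config M) R)
    (S : {fset tree d}) : R :=
  - \sum_(y : {ffun S -> M})
      let p := fine (mu [set x | forall s : S, x (val s) = y s]) in p * ln p.

Definition annealed_entropy (M : colorType) (mu : probability (config M) R)
    (r : nat) : R :=
  entropy mu (fset_set (vertex_ball d r)) -
  d%:R / 2 * entropy mu (fset_set (edge_ball d r)).

End Processes.

(* Labeled colored graphs on subsets of the set of words, rooted at [[::]];
   [lcolor] is the graph of the coloring, its domain is the vertex set. *)
Record lgraph (M : Type) := LGraph {
  lcolor : set (seq nat * M);
  ledge : seq nat -> seq nat -> Prop }.

Section LGraphTheory.
Variable M : Type.
Implicit Type g : lgraph M.

Definition lball g (r : nat) : set (seq nat) := gball (ledge g) [set [::]] r.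

Definition lrestrict g (r : nat) : lgraph M :=
  LGraph [set p | lcolor g p /\ lball g r p.1]
         (fun l l' => [/\ ledge g l l', lball g r l & lball g r l']).

End LGraphTheory.

(* Breadth-first search. [nb u] lists the neighbors of [u] in the order in which
   they are explored from [u]. The state is the queue of all discovered
   vertices with their labels, in order of discovery; step [k] explores the
   [k]-th of them. Only the connected component of the root is discovered. *)
Section BFS.
Variables (V : eqType) (nb : V -> seq V) (root : V).

Definition bfs_step (q : seq (V * seq nat)) (k : nat) :=
  if onth q k is Some (u, l) then
    let new := [seq y <- nb u | y \notin unzip1 q] in
    q ++ zip new [seq rcons l j | j <- iota 1 (size new)]
  else q.

Fixpoint bfs (k : nat) : seq (V * seq nat) :=
  if k is k'.+1 then bfs_step (bfs k') k' else [:: (root, [::])].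

Definition bfs_label (x : V) (l : seq nat) : Prop := exists k, (x, l) \in bfs k.

Definition bfs_graph (M : Type) (f : V -> M) : lgraph M :=
  LGraph [set p | exists2 x, bfs_label x p.1 & f x = p.2]
         (fun l l' => exists x y, [/\ bfs_label x l, bfs_label y l' & y \in nb x]).

End BFS.

(* [g] arises as the labeling of the connected component of [root] in a locally
   finite simple graph [e] colored by [f]. *)
Definition labeling (M : Type) (g : lgraph M) : Prop :=
  exists (V : eqType) (e : rel V) (nb : V -> seq V) (root : V) (f : V -> M),
    [/\ symmetric e, irreflexive e,
        forall u, uniq (nb u) /\ nb u =i e u & g = bfs_graph nb root f].

(* The space of rooted colored graphs; [R] only serves to give it the structure
   of a metric space over [R]. *)
Definition rooted_graph (R : realType) (M : Type) := {g : lgraph M | labeling g}.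

Section RGraph.
Variables (R : realType).

HB.instance Definition _ (M : Type) := gen_eqMixin (rooted_graph R M).
HB.instance Definition _ (M : Type) := gen_choiceMixin (rooted_graph R M).

Lemma point_labeling (M : pointedType) :
  labeling (bfs_graph (fun _ : unit => [::]) tt (fun=> @point M)).
Proof.
by exists unit, (fun _ _ => false), (fun=> [::]), tt, (fun=> point); split.
Qed.

HB.instance Definition _ (M : pointedType) :=
  isPointed.Build (rooted_graph R M) (exist _ _ (point_labeling M)).

Section Metric.
Variable M : Type.
Implicit Types g h : rooted_graph R M.

Definition rdist_term g h (r : nat) : R :=
  (2 ^+ r)^-1 * (`[< lrestrict (sval g) r <> lrestrict (sval h) r >])%:R.

Definition rdist g h : R := limn (series (rdist_term g h)).

Lemma rdist_term_ge0 g h r : 0 <= rdist_term g h r.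
Proof. by rewrite mulr_ge0// invr_ge0 exprn_ge0. Qed.

Lemma rdist_term_le g h r : rdist_term g h r <= geometric 1 2^-1 r.
Proof.
rewrite /rdist_term /geometric /= mul1r exprVn.
by case: asbool; rewrite ?mulr1// mulr0 invr_ge0 exprn_ge0.
Qed.

Lemma is_cvg_rdist g h : cvgn (series (rdist_term g h)).
Proof.
apply: (series_le_cvg _ _ (rdist_term_le g h)).
- exact: rdist_term_ge0.
- by move=> n; rewrite /geometric /= mul1r exprn_ge0.
- by apply: is_cvg_geometric_series; rewrite gtr0_norm// invf_lt1// ltr1n.
Qed.

Lemma rdist_term_le_rdist g h r : rdist_term g h r <= rdist g h.
Proof.
apply: (@le_trans _ _ (series (rdist_term g h) r.+1)).
  by rewrite /series /= big_nat_recr //= lerDr sumr_ge0// => i _; exact: rdist_term_ge0.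
apply: nondecreasing_cvgn_le; last exact: is_cvg_rdist.
by apply: nondecreasing_series => n _ _; exact: rdist_term_ge0.
Qed.

Lemma rdistxx g : rdist g g = 0.
Proof.
rewrite /rdist (_ : series _ = cst 0) ?lim_cst//.
apply/funext => n; rewrite /series /= big1// => i _.
by rewrite /rdist_term (_ : `[< _ >] = false) ?mulr0//; apply/asboolPn => /(_ erefl).
Qed.

Lemma rdist_sym g h : rdist g h = rdist h g.
Proof.
rewrite /rdist; congr (limn (series _)); apply/funext => r; rewrite /rdist_term.
by congr (_ * (_ : bool)%:R); apply: asbool_equiv_eq; split => gh; exact: nesym.
Qed.

Lemma rdist_triangle h g k : rdist g k <= rdist g h + rdist h k.
Proof.
rewrite /rdist -limD; [|exact: is_cvg_rdist|exact: is_cvg_rdist].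
apply: ler_lim; first exact: is_cvg_rdist.
  by apply: is_cvgD; exact: is_cvg_rdist.
apply: nearW => n; rewrite fctE /series /= -big_split /=.
apply: ler_sum => i _; rewrite /rdist_term -mulrDr ler_wpM2l ?invr_ge0 ?exprn_ge0//.
rewrite -natrD ler_nat.
case: asboolP => // gk; case: asboolP => [_|/contrapT gh]; first by case: asbool.
case: asboolP => // /contrapT hk; exfalso; apply: gk.
by rewrite gh hk.
Qed.

Lemma rdist_lrestrict g h : rdist g h = 0 ->
  forall r, lrestrict (sval g) r = lrestrict (sval h) r.
Proof.
move=> gh0 r; apply: contrapT => gh.
have := rdist_term_le_rdist g h r; rewrite gh0 /rdist_term asboolT// mulr1.
by rewrite leNgt invr_gt0 exprn_gt0.
Qed.

End Metric.
End RGraph.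

Lemma mem_zipP (S T : eqType) (s : seq S) (t : seq T) x y :
  (x, y) \in zip s t -> x \in s /\ y \in t.
Proof.
elim: s t => [|a s IH] [|b t] //=; rewrite !inE => /orP[/eqP[-> ->]|/IH[-> ->]].
  by rewrite !eqxx.
by rewrite !orbT.
Qed.

Lemma bfs_label_ball (V : eqType) (nb : V -> seq V) (root : V) (M : Type)
    (f : V -> M) x l : bfs_label nb root x l ->
  exists r, lball (bfs_graph nb root f) r l.
Proof.
case=> k; elim: k x l => [x l|k IH x l] /=.
  by rewrite inE => /eqP[_ ->]; exists 0%N.
move=> xl; move: (xl); rewrite /bfs_step.
case E : (onth (bfs nb root k) k) => [[u lu]|]; last exact: IH.
rewrite mem_cat => /orP[|]; first exact: IH.
have ulu : (u, lu) \in bfs nb root k.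
  by apply/onthP; exists k.
move/mem_zipP; rewrite mem_filter => -[/andP[_ xu] _].
have [r lur] := IH _ _ ulu.
exists r.+1; right; exists lu => //; exists u, x; split => //.
  by exists k.
by exists k.+1.
Qed.

Lemma rdist_eq0 (R : realType) (M : Type) (g h : rooted_graph R M) :
  rdist g h = 0 -> g = h.
Proof.
move=> /rdist_lrestrict gh; suff : sval g = sval h.
  by case: g h {gh} => [g pg] [h ph] /= gh; exact: eq_exist.
have reach (k : rooted_graph R M) p : lcolor (sval k) p ->
    exists r, lball (sval k) r p.1.
  case: k => /= _ [V] [e] [nb] [root] [f] [_ _ _ ->] /= [x xp _].
  exact: bfs_label_ball xp.
have reach2 (k : rooted_graph R M) l l' : ledge (sval k) l l' ->
    exists r, lball (sval k) r l /\ lball (sval k) r l'.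
  case: k => /= _ [V] [e] [nb] [root] [f] [_ _ _ ->] /=.
  move=> ll'; have [x [y [xl _ _]]] := ll'.
  have [r lr] := bfs_label_ball f xl.
  by exists r.+1; split; [left|right; exists l].
have colorE p : lcolor (sval g) p = lcolor (sval h) p.
  apply/propext; split => [gp|hp].
    have [r pr] := reach _ _ gp.
    have : lcolor (lrestrict (sval g) r) p by [].
    by rewrite gh => -[].
  have [r pr] := reach _ _ hp.
  have : lcolor (lrestrict (sval h) r) p by [].
  by rewrite -gh => -[].
have edgeE l l' : ledge (sval g) l l' = ledge (sval h) l l'.
  apply/propext; split => [gl|hl].
    have [r [lr lr']] := reach2 _ _ _ gl.
    have : ledge (lrestrict (sval g) r) l l' by [].
    by rewrite gh => -[].
  have [r [lr lr']] := reach2 _ _ _ hl.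
  have : ledge (lrestrict (sval h) r) l l' by [].
  by rewrite -gh => -[].
case: (sval g) (sval h) colorE edgeE => [c1 e1] [c2 e2] /= cE eE.
by congr LGraph; [apply/funext|apply/funext => l; apply/funext].
Qed.

HB.instance Definition _ (R : realType) (M : Type) :=
  isMetric.Build R (rooted_graph R M) (@rdistxx R M) (@rdist_eq0 R M)
    (@rdist_sym R M) (@rdist_triangle R M).

Section TreeGraph.
Variable d : nat.
Implicit Types u v x : tree d.

Definition tree_root : tree d := exist _ [::] isT.

Let deg u : nat := if val u is [::] then d else d.-1.

Let children u : seq (tree d) :=
  pmap insub [seq rcons (val u) j | j <- iota 1 (deg u)].

Let parent u : seq (tree d) :=
  [seq p <- pmap insub [:: rev (behead (rev (val u)))] | tree_child p u].

Let tree_nb u := parent u ++ children u.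

Let tree_word_rcons w j : tree_word d (rcons w j) =
  tree_word d w && (1 <= j <= if w is [::] then d else d.-1)%N.
Proof.
case: w => [|i w] //=; first by rewrite andbT.
by rewrite all_rcons [in LHS]andbCA [in RHS]andbC.
Qed.

Let val_children u :
  map val (children u) = [seq rcons (val u) j | j <- iota 1 (deg u)].
Proof.
rewrite pmap_filter; last by move=> w; case: insubP => //.
apply/all_filterP/allP => w /mapP[j]; rewrite mem_iota => jd ->.
case: insubP => //; rewrite tree_word_rcons (valP u) /= /deg.
by move: jd; rewrite add1n ltnS => ->.
Qed.

Let mem_children u v : (v \in children u) = tree_child u v.
Proof.
rewrite mem_pmap_sub; apply/mapP/eqP => [[j _ ->]|vE].
  by rewrite last_rcons.
exists (last 0%N (val v)) => //; rewrite mem_iota add1n ltnS.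
move: (last _ _) vE => j vE; have : tree_word d (val v) by exact: valP.
by rewrite vE tree_word_rcons => /andP[].
Qed.

Let mem_parent u v : (v \in parent u) = tree_child v u.
Proof.
rewrite mem_filter andbC mem_pmap_sub inE; case: eqP => //= uv.
by apply/esym/negP => /eqP uE; apply: uv; rewrite uE rev_rcons /= revK.
Qed.

Let tree_childNrefl u v : tree_child u v -> ~~ tree_child v u.
Proof.
move=> /eqP uv; apply/negP => /eqP /(congr1 size).
by rewrite uv !size_rcons => /eqP; rewrite -addn2 -[X in X == _]addn0 eqn_add2l.
Qed.

Let tree_nb_uniq u : uniq (tree_nb u).
Proof.
rewrite cat_uniq; apply/and3P; split.
- by rewrite filter_uniq// pmap_sub_uniq.
- by apply/hasPn => v; rewrite mem_children mem_parent; exact: tree_childNrefl.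
- by rewrite pmap_sub_uniq // map_inj_uniq ?iota_uniq // => i j /rcons_inj[].
Qed.

Let tree_nbE u : tree_nb u =i tree_adj u.
Proof. by move=> v; rewrite mem_cat mem_parent mem_children orbC. Qed.

Let child_inj u u' v : tree_child u v -> tree_child u' v -> u = u'.
Proof. by move=> /eqP + /eqP; move=> {1}-> /rcons_inj[] /val_inj. Qed.

Let Fixpoint Q k : seq (tree d) :=
  if k is k'.+1 then
    if onth (Q k') k' is Some u then Q k' ++ children u else Q k'
  else [:: tree_root].

Let Q_cat k m : exists s, Q (k + m) = Q k ++ s.
Proof.
elim: m => [|m [s IH]]; first by exists [::]; rewrite addn0 cats0.
rewrite addnS /=; case: (onth _ _) => [u|]; last by exists s.
by exists (s ++ children u); rewrite IH catA.
Qed.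

Let onth_size (T : Type) (s : seq T) i y : onth s i = Some y -> (i < size s)%N.
Proof. by move=> E; rewrite -onthTE E. Qed.

Let onth_cat1 (T : Type) (s t : seq T) i y :
  onth s i = Some y -> onth (s ++ t) i = Some y.
Proof. by move=> E; rewrite onth_cat (onth_size E). Qed.

Let onth_uniq (T : eqType) (s : seq T) i j y : uniq s ->
  onth s i = Some y -> onth s j = Some y -> i = j.
Proof.
move=> us si sj; apply/eqP.
rewrite -(nth_uniq y (onth_size si) (onth_size sj) us).
by rewrite (onth_nth y y _ _ si) (onth_nth y y _ _ sj).
Qed.

Let Q_parent k x : x \in Q k -> val x = [::] \/
  exists p i, [/\ (i < k)%N, onth (Q k) i = Some p & tree_child p x].
Proof.
elim: k x => [x|k IH x] /=; first by rewrite inE => /eqP->; left.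
case E : (onth (Q k) k) => [u|]; last first.
  by case/IH => [|[p [i [ik]]]]; [left|right; exists p, i; split=> //; exact: ltnW].
rewrite mem_cat => /orP[/IH[x0|[p [i [ik Qi px]]]]|ux].
- by left.
- by right; exists p, i; split=> //; [exact: ltnW|exact: onth_cat1].
- by right; exists u, k; split; rewrite -?mem_children //; exact: onth_cat1.
Qed.

Let Q_fresh k u : uniq (Q k) -> onth (Q k) k = Some u ->
  forall c, tree_child u c -> c \notin Q k.
Proof.
move=> uQ Qk c uc; apply/negP => /Q_parent[c0|[p [i [ik Qi pc]]]].
  by move: uc; rewrite /tree_child c0 => /eqP /(congr1 size); rewrite size_rcons.
rewrite (child_inj pc uc) in Qi.
by move: ik; rewrite (onth_uniq uQ Qi Qk) ltnn.
Qed.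

Let Q_uniq k : uniq (Q k).
Proof.
elim: k => //= k IH; case E : (onth (Q k) k) => [u|] //.
rewrite cat_uniq IH /=; apply/andP; split.
  by apply/hasPn => c; rewrite mem_children; exact: Q_fresh.
by have := tree_nb_uniq u; rewrite cat_uniq => /and3P[].
Qed.

Let Q_children k i p : (i < k)%N -> onth (Q k) i = Some p ->
  forall c, tree_child p c -> c \in Q k.
Proof.
elim: k i => // k IH i; rewrite ltnS leq_eqVlt => /orP[/eqP->|ik] /=.
  case E : (onth (Q k) k) => [u|]; last by rewrite E.
  by rewrite (onth_cat1 _ E) => -[<-] c uc; rewrite mem_cat mem_children uc orbT.
case E : (onth (Q k) k) => [u|]; last exact: IH.
rewrite onth_cat (ltn_trans ik (onth_size E)) => Qi c pc.
by rewrite mem_cat (IH _ ik Qi).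
Qed.

Let Q_total x : exists k, x \in Q k.
Proof.
case: x => w; elim/last_ind: w => [|w j IH] wd.
  by exists 0%N; rewrite inE -val_eqE.
have wd' : tree_word d w by move: wd; rewrite tree_word_rcons => /andP[].
have [k /onthP[i Qi]] := IH wd'.
have child : tree_child (exist _ w wd') (exist _ (rcons w j) wd).
  by rewrite /tree_child /= last_rcons.
have [ik|ki] := ltnP i k; first by exists k; exact: Q_children Qi _ child.
exists i.+1; have [s Qs] := Q_cat k (i - k); rewrite subnKC // in Qs.
by apply: (Q_children (ltnSn i) _ child); rewrite /= Qs (onth_cat1 _ Qi) (onth_cat1 _ (onth_cat1 _ Qi)).
Qed.

Let bfs_Q k : bfs tree_nb tree_root k = [seq (x, val x) | x <- Q k].
Proof.
elim: k => //= k ->; rewrite /bfs_step onth_map.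
case E : (onth (Q k) k) => [u|] //=.
rewrite (_ : unzip1 _ = Q k); last by rewrite /unzip1 -map_comp map_id_in.
rewrite (_ : [seq y <- tree_nb u | y \notin Q k] = children u).
  rewrite map_cat; congr cat.
  have -> : [seq rcons (val u) j | j <- iota 1 (size (children u))] = map val (children u).
    by rewrite val_children -(size_map val) val_children size_map size_iota.
  by elim: (children u) => //= c s ->.
rewrite filter_cat (_ : [seq y <- parent u | _] = [::]) /=.
  by apply/all_filterP/allP => c; rewrite mem_children; exact: Q_fresh.
apply/eqP; rewrite -(negbK (_ == _)) -has_filter; apply/hasPn => p.
rewrite mem_parent negbK => pu.
have : u \in Q k by apply/onthP; exists k.
case/Q_parent => [u0|[p' [i [ik Qi p'u]]]].
  by move: pu; rewrite /tree_child u0 => /eqP /(congr1 size); rewrite size_rcons.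
by rewrite (child_inj pu p'u); apply/onthP; exists i.
Qed.

Let bfs_tree x l : bfs_label tree_nb tree_root x l <-> val x = l.
Proof.
split=> [[k]|<-]; first by rewrite bfs_Q => /mapP[y _ [-> ->]].
have [k xk] := Q_total x; exists k; rewrite bfs_Q.
by apply/mapP; exists x.
Qed.

Definition tree_lgraph (M : Type) (f : tree d -> M) : lgraph M :=
  LGraph [set p | exists2 v, val v = p.1 & f v = p.2]
         (fun l l' => exists u v, [/\ val u = l, val v = l' & tree_adj u v]).

Lemma tree_labeling (M : Type) (f : tree d -> M) : labeling (tree_lgraph f).
Proof.
exists (tree d), (@tree_adj d), tree_nb, tree_root, f; split.
- by move=> u v; rewrite /tree_adj orbC.
- move=> u; rewrite /tree_adj orbb; apply/eqP => /(congr1 size).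
  by rewrite size_rcons => /n_Sn.
- by move=> u; split; [exact: tree_nb_uniq|exact: tree_nbE].
- congr LGraph.
    apply/seteqP; split => -[l m] /= [v vl fv]; exists v => //; exact/bfs_tree.
  apply/funext => l; apply/funext => l'; apply/propext; split => -[u [v [ul vl uv]]];
    exists u, v; (split; [exact/bfs_tree|exact/bfs_tree|]); move: uv; by rewrite tree_nbE.
Qed.

Lemma finite_tree_ball (S : set (tree d)) r :
  finite_set S -> finite_set (gball (@tree_adj d) S r).
Proof.
move=> fS; elim: r => //= r IH; rewrite finite_setU; split => //.
rewrite (_ : [set _ | _] =
    \bigcup_(u in gball (@tree_adj d) S r) [set` tree_nb u]).
  by apply: bigcup_finite => // u _; exact: finite_seq.
apply/seteqP; split=> v /= [u Su uv]; exists u => //=.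
  by rewrite tree_nbE.
by move: uv => /=; rewrite tree_nbE.
Qed.

Lemma lball_tree (M : Type) (f : tree d -> M) r l :
  lball (tree_lgraph f) r l -> exists2 v, vertex_ball d r v & val v = l.
Proof.
elim: r l => [l /= ->|r IH l /= [/IH[v rv vl]|[l' /IH[u ru ul']]]].
- by exists tree_root.
- by exists v => //; left.
- move=> [u' [v [u'l' vl uv]]]; exists v => //; right; exists u => //.
  by rewrite (_ : u = u')//; apply: val_inj; rewrite ul'.
Qed.

End TreeGraph.

Section TreeMap.
Variables (R : realType) (d : nat) (M : colorType).
Implicit Types x y : tree d -> M.

Definition rborel := g_sigma_algebraType (@open (rooted_graph R M)).

Definition tree_map (x : config d M) : rborel := exist _ _ (tree_labeling x).

Let gball_le (V : Type) (adj : V -> V -> Prop) (S : set V) r s :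
  (s <= r)%N -> gball adj S s `<=` gball adj S r.
Proof.
move=> /subnK<-; elim: (r - s)%N => // n IH v /IH; rewrite addSn /=; by left.
Qed.

Let lrestrict_tree x y r : (forall v, vertex_ball d r v -> x v = y v) ->
  forall s, (s <= r)%N -> lrestrict (tree_lgraph x) s = lrestrict (tree_lgraph y) s.
Proof.
move=> xy s sr; rewrite /lrestrict; congr LGraph.
have xyE v : lball (tree_lgraph x) s (val v) -> x v = y v.
  move=> /lball_tree[u us /val_inj uv]; apply: xy.
  by rewrite -uv; exact: gball_le us.
apply/seteqP; split=> -[l m] [[v /= vl xv] /= ls]; split=> //; exists v => //=.
  by rewrite -xv; apply/esym/xyE; move: ls; rewrite -vl.
by rewrite -xv; apply/xyE; move: ls; rewrite -vl.
Qed.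

Let rdist_le (g h : rooted_graph R M) r :
  (forall s, (s <= r)%N -> lrestrict (sval g) s = lrestrict (sval h) s) ->
  rdist g h <= (2 ^+ r)^-1.
Proof.
move=> gh.
have term0 s : (s <= r)%N -> rdist_term g h s = 0.
  move=> sr; rewrite /rdist_term (_ : `[< _ >] = false) ?mulr0//.
  by apply/asboolPn => /(_ (gh _ sr)).
have bound m : series (rdist_term g h) (r.+1 + m)%N <= (2 ^+ r)^-1 - (2 ^+ (r + m))^-1.
  elim: m => [|m IH].
    rewrite !addn0 subrr /series /= (eq_big_nat _ _ (F2 := fun=> 0)) ?big1//.
  rewrite addnS /series /= big_nat_recr //=.
  apply: le_trans (lerD IH (rdist_term_le g h _)) _.
  rewrite /geometric /= mul1r addSn addnS exprVn exprS invfM -addrA lerD2l.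
  set a := (_ ^+ _)^-1; rewrite -[X in - X + _](_ : 2^-1 * a + 2^-1 * a = a).
    by rewrite opprD addrNK.
  by rewrite -mulrDl -[2^-1]mul1r -splitr mul1r.
apply: limr_le; first exact: is_cvg_rdist.
exists r.+1 => // n /= rn; rewrite -(subnKC rn).
by apply: le_trans (bound _) _; rewrite lerBlDr lerDl invr_ge0 exprn_ge0.
Qed.

Let cyl (s : seq (tree d * M)) : set (config d M) :=
  [set x | forall p, p \in s -> x p.1 = p.2].

Let measurable_cyl s : measurable (cyl s).
Proof.
elim: s => [|[v m] s IH].
  by rewrite (_ : cyl [::] = setT) //; apply/seteqP; split.
rewrite (_ : cyl _ = [set x | x v = m] `&` cyl s).
  apply: measurableI => //; apply: sub_sigma_algebra.
  by exists v, m.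
apply/seteqP; split=> x /=.
  move=> xs; split; first by apply: (xs (v, m)); rewrite mem_head.
  by move=> p ps; apply: xs; rewrite inE ps orbT.
by move=> [xv xs] p; rewrite inE => /orP[/eqP->//|]; exact: xs.
Qed.

Lemma measurable_tree_map : measurable_fun setT tree_map.
Proof.
apply: (@measurability _ _ _ _ setT tree_map (@open (rooted_graph R M))) => //.
move=> _ [U oU <-]; rewrite setTI.
rewrite (_ : _ @^-1` _ = \bigcup_s
   (if `[< cyl s `<=` tree_map @^-1` U >] then cyl s else set0)).
  apply: countable_bigcupT_measurable => [|s].
    exact: countableP.
  by case: ifP => _; [exact: measurable_cyl|exact: measurable0].
apply/seteqP; split=> x; last first.
  by move=> [s _]; case: asboolP => // sU; exact: sU.
move=> Ux; have : nbhs (tree_map x : rooted_graph R M) U.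
  by apply: open_nbhs_nbhs; split.
move=> /nbhs_ballP[e /= e0 eU].
have [r _ re] := near_infty_natSinv_expn_lt (PosNum e0).
have fB : finite_set (vertex_ball d r).
  apply: finite_tree_ball.
  rewrite (_ : [set _ | _] = [set tree_root d])//.
  apply/seteqP; split=> v /=; last by move=> ->.
  by move=> v0; apply: val_inj.
have [s sB] : exists s : seq (tree d), vertex_ball d r = [set` s].
  by apply/finite_seqP.
exists [seq (v, x v) | v <- s] => //.
rewrite asboolT; first by move=> p /mapP[v _ ->].
move=> y ys; apply: eU; rewrite ballEmdist /=.
apply: (@le_lt_trans _ _ (2 ^+ r)^-1); last first.
  by have /= := re r (leqnn r); rewrite div1r.
apply: rdist_le => t tr; apply: (lrestrict_tree (r := r)) => // v.
rewrite sB /= => vs; apply/esym; apply: (ys (v, x v)).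
by apply/mapP; exists v.
Qed.

HB.instance Definition _ :=
  isMeasurableFun.Build _ _ _ _ tree_map measurable_tree_map.

Definition tree_law (mu : probability (config d M) R) : probability rborel R :=
  distribution mu tree_map.

End TreeMap.

Section Average.
Local Open Scope ereal_scope.
Context dT (T : measurableType dT) (R : realType) (I : finType).
Variables (P : I -> probability T R) (I0 : (0 < #|I|)%N).

Definition average of (0 < #|I|)%N := fun A : set T =>
  (#|I|%:R^-1)%:E * \sum_(i : I) P i A.

Let average0 : average I0 set0 = 0.
Proof. by rewrite /average big1 ?mule0. Qed.

Let average_ge0 A : 0 <= average I0 A.
Proof.
by rewrite /average mule_ge0 ?sume_ge0// lee_fin invr_ge0 ler0n.
Qed.

Let average_sigma_additive : semi_sigma_additive (average I0).
Proof.
move=> F mF tF mUF; rewrite [X in X @ \oo --> _](_ : _ =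
    (fun n => (#|I|%:R^-1)%:E * \sum_(0 <= k < n) \sum_(i : I) P i (F k))).
  apply: cvgeZl => //; rewrite [X in _ --> X](_ : _ =
      lim ((fun n => \sum_(0 <= k < n) \sum_(i : I) P i (F k)) @ \oo)).
    by apply: is_cvg_ereal_nneg_natsum => k _; exact: sume_ge0.
  rewrite nneseries_sum//; apply: eq_bigr => /= i _.
  exact: measure_semi_bigcup.
apply/funext => n; rewrite ge0_sume_distrr// => k _.
by apply: sume_ge0 => i _.
Qed.

HB.instance Definition _ := isMeasure.Build _ _ _ (average I0)
  average0 average_ge0 average_sigma_additive.

Let average_setT : average I0 setT = 1.
Proof.
rewrite /average; under eq_bigr do rewrite probability_setT.
by rewrite sumEFin -EFinM sumr_const mulVf// pnatr_eq0 -lt0n.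
Qed.

HB.instance Definition _ := Measure_isProbability.Build _ _ _
  (average I0) average_setT.

End Average.

Section FiniteGraphs.
Variables (R : realType) (M : colorType).

Section RandomLabeling.
Variables (V : finType) (E : {set {set V}}) (f : V -> M).

Definition edge_rel : rel V := fun x y => (x != y) && ([set x; y]%SET \in E).

(* Each explored vertex [u] orders its neighbors by its own uniform permutation
   [s u], independent of the others. As a vertex is explored at most once, its
   offspring are ordered uniformly at random, independently of the past. *)
Definition shuffled_nb (s : {ffun V -> {perm V}}) (u : V) : seq V :=
  [seq y <- [seq s u z | z <- enum V] | edge_rel u y].

Lemma shuffled_labeling s v : labeling (bfs_graph (shuffled_nb s) v f).
Proof.
exists V, edge_rel, (shuffled_nb s), v, f; split => //.
- by move=> x y; rewrite /edge_rel eq_sym finset.setUC.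
- by move=> x; rewrite /edge_rel eqxx.
- move=> u; split.
    by rewrite filter_uniq // map_inj_uniq ?enum_uniq//; exact: perm_inj.
  move=> y; rewrite mem_filter [X in _ && X](_ : _ = true) ?andbT//.
  by apply/mapP; exists ((s u)^-1 y)%g; rewrite ?mem_enum// permKV.
Qed.

Lemma shuffle_gt0 : (0 < #|{ffun V -> {perm V}}|)%N.
Proof. by apply/card_gt0P; exists [ffun=> 1%g]. Qed.

Definition vertex_distr (v : V) : probability (rborel R M) R :=
  average
    (fun s : {ffun V -> {perm V}} =>
       \d_(exist _ _ (shuffled_labeling s v) : rborel R M))
    shuffle_gt0.

Definition graph_distr (V0 : (0 < #|V|)%N) : probability (rborel R M) R :=
  average vertex_distr V0.

End RandomLabeling.

Definition bounded_continuous :=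
  {phi : rooted_graph R M -> R |
    continuous phi /\ exists C, forall g, `|phi g| <= C}.

Definition expectations (P : probability (rborel R M) R) :
    prod_topology (fun _ : bounded_continuous => R) :=
  fun phi => \int[P]_g sval phi g.

(* Measures are functions on all sets, whose values on non-measurable sets are
   irrelevant: [dist] separates measures up to equality on measurable sets.
   [initial_topology expectations] is the weak topology. *)
Definition weak_metric
    (dist : probability (rborel R M) R -> probability (rborel R M) R -> R) :=
  [/\ forall P Q, dist P Q = 0 <-> (forall A, measurable A -> P A = Q A),
      forall P Q, dist P Q = dist Q P,
      forall P Q S, dist P S <= dist P Q + dist Q S &
      forall P : initial_topology expectations,
        nbhs P = filter_from [set e : R | 0 < e]
                             (fun e => [set Q | dist P Q < e])].

Definition regular_graphs (n d : nat) : {set {set {set 'I_n}}} :=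
  [set E : {set {set 'I_n}} | [forall e in E, #|e| == 2%N] &&
     [forall v, #|[set e in E | v \in e]| == d]]%SET.

Definition typical_prob
    (dist : probability (rborel R M) R -> probability (rborel R M) R -> R)
    (d : nat) (mu : probability (config d M) R) (eps : R) (n : nat) : R :=
  #|[set E in regular_graphs n d |
      `[< exists (n0 : (0 < #|'I_n|)%N) (f : 'I_n -> M),
            dist (graph_distr E f n0) (tree_law mu) <= eps >]]%SET|%:R /
  #|regular_graphs n d|%:R.

(* The inner limit [p eps] runs along the [n] with [n * d] even. *)
Definition strongly_typical
    (dist : probability (rborel R M) R -> probability (rborel R M) R -> R)
    (d : nat) (mu : probability (config d M) R) : Prop :=
  exists p : R -> R,
    (forall eps, 0 < eps ->
       typical_prob dist mu eps n
         @[n --> within [set n | ~~ odd (n * d)] \oo] --> p eps) /\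
    p eps @[eps --> 0^'+] --> (1 : R).

End FiniteGraphs.

(* Main.v *)
(* A uniform d-regular graph is a uniform perfect matching of half-edges
   conditioned on being simple. The matchings carrying a coloring f with local
   statistics close to mu are counted by exp(n Sigma_r(mu)), up to
   subexponential factors, and the pairs of such colorings by
   exp(n Sigma_r(nu)), where nu ranges over the couplings of mu with itself. By
   a compactness argument the hypothesis bounds the latter exponent by twice
   the former, so the second moment method yields such a coloring with
   probability at least exp(-o(n)). Changing a few matched pairs changes the
   local statistics of f little, and by concentration every set of matchings of
   probability exp(-o(n)) has almost all matchings within distance o(n) of it.
   Hence almost all matchings carry such a coloring, with an exponentially
   small exceptional probability, whereas simplicity has probability at least
   1/poly(n). Most neighborhoods are trees, around which the random labeling of
   a vertex follows the law of the randomly relabeled universal cover. *)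
From HB Require Import structures.
Require Import Defs.
From mathcomp Require Import all_boot all_order all_algebra all_fingroup finmap.
From mathcomp Require Import all_classical all_reals all_analysis measurable_realfun.
From mathcomp Require Import ring lra zify.

Set Implicit Arguments.
Unset Strict Implicit.
Unset Printing Implicit Defensive.

Import Order.TTheory GRing.Theory Num.Theory.
Import numFieldNormedType.Exports.
Local Open Scope ring_scope.

(** * Typical sequences and concentration of matchings *)

(** The hypothesis concerns exact couplings of infinite processes at the levels [r k], the second
    moment approximate couplings on finite multigraphs at one level. Monotonicity bridges the two:
    [sig P r], the annealed entropy of level [r.+1], is nonincreasing in [r], so bad finite
    couplings at levels tending to infinity have a limit that is bad at a fixed level. The
    hypothesis for the diagonal coupling gives [0 <= sig], hence an infimum over the levels to
    compare with. Laws are families on finite stars ([inv_family]). The statistics of a colored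
    matching are taken in the universal cover and averaged over relabelings, so they form such a
    family in spite of loops and short cycles. Simplicity is only shown to be polynomially likely,
    so every exceptional set must be exponentially small, also that of the matchings with many short
    cycles. That bound comes from the same concentration theorem for independent uniform colors from
    a large palette, where the entropy condition is automatic: a repeated vertex repeats its color,
    but stars with a repeated color are rare. *)

Section Chernoff.
Variable R : realType.
Implicit Types (A I : finType).

Definition is_pmf A (q : A -> R) : Prop := (forall a, 0 <= q a) /\ \sum_a q a = 1.

Definition hent A (p : A -> R) : R := - \sum_a p a * ln (p a).

(** Multiply by [1 - x > 0] and use [expR (- x) >= 1 - x]; the remaining slack is
    [x ^+ 2 * (1 - 2 * x)]. *)
Lemma expR_le_quadratic (x : R) : x <= 2^-1 -> expR x <= 1 + x + 2 * x ^+ 2.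
Proof.
move=> x2; have x1 : 0 < 1 - x by lra.
have h : expR x * (1 - x) <= 1.
  rewrite -[leRHS](expRxMexpNx_1 x) ler_pM2l ?expR_gt0//.
  exact: (expR_ge1Dx (- x)).
rewrite -(ler_pM2r x1); apply: (le_trans h).
rewrite -subr_ge0 (_ : _ - 1 = x ^+ 2 * (1 - 2 * x)); last by ring.
by rewrite mulr_ge0 ?sqr_ge0//; lra.
Qed.

Lemma mgf_le A (q g : A -> R) (c l : R) : is_pmf q -> \sum_a q a * g a = 0 ->
  (forall a, `|g a| <= c) -> `|l| * c <= 2^-1 ->
  \sum_a q a * expR (l * g a) <= expR (2 * (l * c) ^+ 2).
Proof.
move=> [q0 q1] qg gc lc.
have term a : expR (l * g a) <= 1 + l * g a + 2 * (l * c) ^+ 2.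
  have lg : `|l * g a| <= `|l| * c by rewrite normrM ler_wpM2l.
  apply: (le_trans (expR_le_quadratic _)).
    by apply: le_trans lc; apply: le_trans lg; exact: ler_norm.
  rewrite lerD2l ler_pM2l ?ltr0n// -real_normK ?num_real// exprMn.
  rewrite -[l ^+ 2]real_normK ?num_real// -exprMn.
  by rewrite lerXn2r ?nnegrE// (le_trans _ lg).
apply: (@le_trans _ _ (1 + 2 * (l * c) ^+ 2)); last exact: expR_ge1Dx.
apply: (@le_trans _ _ (\sum_a q a * (1 + l * g a + 2 * (l * c) ^+ 2))).
  by apply: ler_sum => a _; rewrite ler_wpM2l.
rewrite (eq_bigr (fun a => q a * (1 + 2 * (l * c) ^+ 2) + l * (q a * g a))); last first.
  by move=> a _; ring.
by rewrite big_split /= -mulr_suml q1 mul1r -mulr_sumr qg mulr0 addr0.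
Qed.

Lemma sum_prod_iid A I (w : A -> R) :
  \sum_(s : {ffun I -> A}) \prod_i w (s i) = (\sum_a w a) ^+ #|I|.
Proof. by rewrite -(bigA_distr_bigA (fun _ : I => w)) prodr_const. Qed.

Lemma pmf_iid A I (q : A -> R) : is_pmf q -> is_pmf (fun s : {ffun I -> A} => \prod_i q (s i)).
Proof.
move=> [q0 q1]; split; first by move=> s; exact: prodr_ge0.
by rewrite sum_prod_iid q1 expr1n.
Qed.

Lemma chernoff A I (q g : A -> R) (t : R) : is_pmf q -> \sum_a q a * g a = 0 ->
  (forall a, `|g a| <= 1) -> 0 <= t <= 1 ->
  \sum_(s : {ffun I -> A} | t * #|I|%:R <= \sum_i g (s i)) \prod_i q (s i)
    <= expR (- (t ^+ 2 / 8 * #|I|%:R)).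
Proof.
move=> qp qg g1 /andP[t0 t1]; have [q0 q1] := qp.
(* [t / 4] minimizes the exponent [2 * l ^+ 2 - l * t], with value [- t ^+ 2 / 8]. *)
set l := t / 4; set N : R := #|I|%:R.
have l0 : 0 <= l by rewrite /l; lra.
apply: (@le_trans _ _ (\sum_(s : {ffun I -> A})
    expR (- (l * (t * N))) * \prod_i (q (s i) * expR (l * g (s i))))).
  rewrite big_mkcond; apply: ler_sum => s _; case: ifP => [ts|_]; last first.
    by rewrite mulr_ge0 ?expR_ge0// prodr_ge0// => i _; rewrite mulr_ge0 ?expR_ge0.
  rewrite big_split /= -expR_sum -mulr_sumr mulrCA -expRD.
  rewrite -[leLHS]mulr1 ler_wpM2l ?prodr_ge0// -expR0 ler_expR addrC subr_ge0.
  by rewrite ler_wpM2l.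
rewrite -mulr_sumr (sum_prod_iid _ (fun a => q a * expR (l * g a))).
apply: (@le_trans _ _ (expR (- (l * (t * N))) * expR (2 * (l * 1) ^+ 2) ^+ #|I|)).
  rewrite ler_wpM2l ?expR_ge0// lerXn2r ?nnegrE ?expR_ge0 ?sumr_ge0//.
    by move=> a _; rewrite mulr_ge0 ?expR_ge0.
  by apply: mgf_le => //; rewrite mulr1 ger0_norm// /l; lra.
rewrite -expRM_natl -expRD ler_expR -/N /l.
by apply/eqP/eqP; rewrite le_eqVlt; apply/orP; left; apply/eqP; field.
Qed.

Lemma sum_indicator I (P : pred I) : \sum_i (P i)%:R = #|[set i | P i]|%:R :> R.
Proof.
rewrite -natr_sum -sum1_card [in RHS]big_mkcond; congr (_%:R).
by apply: eq_bigr => i _; rewrite inE; case: (P i).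
Qed.

Definition cnt I A (s : I -> A) (a : A) : nat := #|[set i | s i == a]|.

Lemma sum_cnt I A (s : I -> A) (F : A -> R) :
  \sum_i F (s i) = \sum_a (cnt s a)%:R * F a.
Proof.
rewrite (partition_big s predT)//=; apply: eq_bigr => a _.
rewrite (eq_bigr (fun=> F a)) => [|i /eqP->//].
rewrite sumr_const mulr_natl; congr (_ *+ _); apply: eq_card => i.
by rewrite inE.
Qed.

Lemma sum_cnt_card I A (s : I -> A) : \sum_a (cnt s a)%:R = #|I|%:R :> R.
Proof.
rewrite -(eq_bigr _ (fun a _ => mulr1 _)) -(sum_cnt s (fun=> 1)).
by rewrite sumr_const.
Qed.

(** The error is relative to the expected count. So a letter of probability 0 never occurs
    ([typ_supp]), and nonnegative linear statistics inherit the same [e] ([typ_claim]). *)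
Definition typ I A (q : A -> R) (e : R) (s : I -> A) : bool :=
  [forall a, `|(cnt s a)%:R - #|I|%:R * q a| <= e * (#|I|%:R * q a)].

Lemma pmf_le1 A (q : A -> R) a : is_pmf q -> q a <= 1.
Proof.
by move=> [q0 <-]; rewrite (bigD1 a)//= lerDl sumr_ge0.
Qed.

Lemma atyp_letter A I (q : A -> R) (e : R) a : is_pmf q -> 0 < e <= 1 ->
  \sum_(s : {ffun I -> A} | ~~ (`|(cnt s a)%:R - #|I|%:R * q a| <= e * (#|I|%:R * q a)))
    \prod_i q (s i) <= 2 * expR (- ((e * q a) ^+ 2 / 8 * #|I|%:R)).
Proof.
move=> qp /andP[e0 e1]; have [q0 q1] := qp.
have qa1 := pmf_le1 a qp.
pose g (b : A) : R := (b == a)%:R - q a.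
set t := e * q a; set N : R := #|I|%:R.
have t01 : 0 <= t <= 1 by rewrite /t; apply/andP; split; have := q0 a; nra.
have g1 b : `|g b| <= 1.
  by rewrite /g ler_norml; have := q0 a; case: (b == a) => /=; lra.
have qg : \sum_b q b * g b = 0.
  under eq_bigr do rewrite /g mulrBr.
  rewrite big_split /= sumrN -mulr_suml q1 mul1r (bigD1 a)//= eqxx mulr1 big1 ?addr0 ?subrr//.
  by move=> b /negbTE->; rewrite mulr0.
have sumg (s : {ffun I -> A}) : \sum_i g (s i) = (cnt s a)%:R - N * q a.
  rewrite big_split /= sumrN sumr_const mulr_natl; congr (_ - _).
  exact: sum_indicator.
have h1 := chernoff I qp qg g1 t01.
have g1' b : `|- g b| <= 1 by rewrite normrN.
have qg' : \sum_b q b * - g b = 0.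
  by under eq_bigr do rewrite mulrN; rewrite sumrN qg oppr0.
have h2 := chernoff I qp qg' g1' t01.
rewrite mulr_natl mulr2n; apply: le_trans (lerD h1 h2).
rewrite big_mkcond [X in _ <= X + _]big_mkcond [X in _ <= _ + X]big_mkcond -big_split /=.
apply: ler_sum => s _; rewrite sumrN !sumg -/N /t.
have w0 : 0 <= \prod_i q (s i) by apply: prodr_ge0.
case: ifP => [dev|_]; last by case: ifP; case: ifP => _ _; lra.
case: ifP => [_|/negbT]; first by case: ifP => _; lra.
rewrite -ltNge => lt1; case: ifP => [_|/negbT]; first by lra.
rewrite -ltNge => lt2; exfalso; move/negP: dev; apply.
by rewrite ler_norml (_ : e * (N * q a) = e * q a * N); [lra|ring].
Qed.

Lemma expR_natr_small (k eps : R) : 0 < k -> 0 < eps ->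
  exists N0 : nat, forall n, (N0 <= n)%N -> expR (- (k * n%:R)) <= eps.
Proof.
move=> k0 e0; exists (Num.bound (`|ln eps| / k)).+1 => n Nn.
rewrite -[leRHS](lnK e0) ler_expR lerNl.
apply: (@le_trans _ _ `|ln eps|); first by rewrite -normrN ler_norm.
rewrite -ler_pdivrMl// mulrC; apply: (@le_trans _ _ (Num.bound (`|ln eps| / k))%:R).
  by apply/ltW/archi_boundP; rewrite divr_ge0// ltW.
by rewrite ler_nat ltnW.
Qed.

Lemma prob_typ A (q : A -> R) (e : R) : is_pmf q -> 0 < e <= 1 ->
  exists N0 : nat, forall I, (N0 <= #|I|)%N ->
    2^-1 <= \sum_(s : {ffun I -> A} | typ q e s) \prod_i q (s i).
Proof.
move=> qp e01; have [q0 q1] := qp.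
pose dev I (a : A) := \sum_(s : {ffun I -> A} |
  ~~ (`|(cnt s a)%:R - #|I|%:R * q a| <= e * (#|I|%:R * q a))) \prod_i q (s i).
have A0 : (0 < #|A|)%N.
  apply/card_gt0P; apply: contrapT => nA; move: q1; rewrite big1.
    by move=> /eqP; rewrite eq_sym oner_eq0.
  by move=> a _; exfalso; apply: nA; exists a.
have A0' : 0 < (#|A|%:R : R) by rewrite ltr0n.
have [N0 N0P] : exists N0 : A -> nat, forall a I, (N0 a <= #|I|)%N ->
    dev I a <= (2 * #|A|%:R)^-1.
  apply: (@fin_all_exists A (fun=> nat) (fun a m => forall I, (m <= #|I|)%N -> dev I a <= (2 * #|A|%:R)^-1)) => a.
  have [qa0|qa0] := eqVneq (q a) 0.
    exists 0%N => I _; rewrite /dev big1 ?invr_ge0 ?mulr_ge0// => s.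
    rewrite qa0 !mulr0 subr0 normr_le0 pnatr_eq0 => /eqP/eqP.
    rewrite -lt0n => /card_gt0P[i]; rewrite inE => /eqP si.
    by rewrite (bigD1 i)//= si qa0 mul0r.
  have qa : 0 < q a by rewrite lt_neqAle eq_sym qa0 q0.
  have k0 : 0 < (e * q a) ^+ 2 / 8.
    by rewrite divr_gt0// exprn_gt0// mulr_gt0//; case/andP: e01.
  have c0 : 0 < (4 * #|A|%:R : R)^-1 by rewrite invr_gt0 mulr_gt0.
  have [N0 N0P] := expR_natr_small k0 c0.
  exists N0 => I NI; apply: (le_trans (atyp_letter I a qp e01)).
  rewrite -ler_pdivlMl//; apply: (le_trans (N0P _ NI)).
  by rewrite le_eqVlt; apply/orP; left; apply/eqP; field; rewrite gt_eqF.
exists (\max_a N0 a) => I NI.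
have tot : \sum_(s : {ffun I -> A}) \prod_i q (s i) = 1 by have [] := pmf_iid I qp.
rewrite (bigID (fun s : {ffun I -> A} => typ q e s)) /= in tot.
suff : \sum_(s : {ffun I -> A} | ~~ typ q e s) \prod_i q (s i) <= 2^-1.
  by move: tot; lra.
apply: (@le_trans _ _ (\sum_a dev I a)); last first.
  apply: (@le_trans _ _ (\sum_(a : A) (2 * #|A|%:R)^-1)).
    apply: ler_sum => a _; apply: N0P; apply: leq_trans NI.
    exact: (leq_bigmax (F := N0)).
  rewrite sumr_const -[leLHS]mulr_natr invfM -mulrA mulVf ?mulr1// gt_eqF//.
rewrite /dev; under [leRHS]eq_bigr do rewrite big_mkcond.
rewrite exchange_big /= big_mkcond; apply: ler_sum => s _.
case: ifP => [/forallPn[a na]|_].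
  rewrite (bigD1 a)//= na lerDl; apply: sumr_ge0 => b _; case: ifP => // _.
  exact: prodr_ge0.
by apply: sumr_ge0 => b _; case: ifP => // _; exact: prodr_ge0.
Qed.

Lemma prod_weight I A (q : A -> R) (s : I -> A) : (forall i, 0 < q (s i)) ->
  \prod_i q (s i) = expR (\sum_a (cnt s a)%:R * ln (q a)).
Proof.
move=> q0; rewrite -(sum_cnt s (fun a => ln (q a))) expR_sum.
by apply: eq_bigr => i _; rewrite lnK// posrE.
Qed.

Lemma typ_supp I A (q : A -> R) (e : R) (s : I -> A) i : is_pmf q ->
  typ q e s -> 0 < q (s i).
Proof.
move=> [q0 _] /forallP/(_ (s i)); rewrite lt_neqAle q0 andbT eq_sym.
apply: contraTneq => ->; rewrite !mulr0 subr0 normr_le0 pnatr_eq0 -lt0n.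
by apply/card_gt0P; exists i; rewrite inE.
Qed.

Lemma hent_ge0 A (q : A -> R) : is_pmf q -> 0 <= hent q.
Proof.
move=> qp; rewrite /hent -sumrN; apply: sumr_ge0 => a _.
by rewrite -mulrN mulr_ge0 ?oppr_ge0 ?ln_le0 ?pmf_le1//; case: qp.
Qed.

Lemma typ_weight I A (q : A -> R) (e : R) (s : I -> A) : is_pmf q -> typ q e s ->
  expR (- ((1 + e) * #|I|%:R * hent q)) <= \prod_i q (s i)
    <= expR (- ((1 - e) * #|I|%:R * hent q)).
Proof.
move=> qp ts; rewrite prod_weight => [|i]; last exact: typ_supp ts.
rewrite !ler_expR.
have q1 a : ln (q a) <= 0 by rewrite ln_le0 ?pmf_le1.
have ->: - ((1 + e) * #|I|%:R * hent q) = \sum_a (#|I|%:R * q a + e * (#|I|%:R * q a)) * ln (q a).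
  rewrite /hent !mulrN opprK mulr_sumr; apply: eq_bigr => a _; ring.
have ->: - ((1 - e) * #|I|%:R * hent q) = \sum_a (#|I|%:R * q a - e * (#|I|%:R * q a)) * ln (q a).
  rewrite /hent !mulrN opprK mulr_sumr; apply: eq_bigr => a _; ring.
move/forallP in ts.
apply/andP; split; apply: ler_sum => a _; rewrite ler_wnM2r//.
  by have := ts a; rewrite ler_norml; lra.
by have := ts a; rewrite ler_norml; lra.
Qed.

Lemma card_typ_le I A (q : A -> R) (e : R) : is_pmf q ->
  #|[set s : {ffun I -> A} | typ q e s]|%:R <= expR ((1 + e) * #|I|%:R * hent q).
Proof.
move=> qp; set c := (1 + e) * _ * _.
suff : #|[set s : {ffun I -> A} | typ q e s]|%:R * expR (- c) <= 1.
  by rewrite expRN -ler_pdivlMr ?invr_gt0 ?expR_gt0// invrK mul1r.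
have [_ tot] := pmf_iid I qp.
rewrite -[leRHS]tot -sum_indicator mulr_suml; apply: ler_sum => s _.
case: (boolP (typ q e s)) => [ts|_]; last by rewrite mul0r prodr_ge0//; case: qp.
by rewrite mul1r; have /andP[] := typ_weight qp ts.
Qed.

Lemma card_typ_ge A (q : A -> R) (e : R) : is_pmf q -> 0 < e <= 1 ->
  exists N0 : nat, forall I, (N0 <= #|I|)%N ->
    2^-1 * expR ((1 - e) * #|I|%:R * hent q) <= #|[set s : {ffun I -> A} | typ q e s]|%:R.
Proof.
move=> qp e01; have [N0 N0P] := prob_typ qp e01; exists N0 => I /N0P h.
set c := (1 - e) * _ * _.
rewrite -ler_pdivlMr ?expR_gt0// -expRN; apply: (le_trans h).
rewrite -sum_indicator mulr_suml big_mkcond; apply: ler_sum => s _.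
case: ifP => [ts|_]; last by rewrite mul0r.
by rewrite mul1r; have /andP[] := typ_weight qp ts.
Qed.

(** All sequences of the class have the same weight under the product of [q], and the weights sum to
    at most 1. [q] need not be the empirical law: [sum_patterns] takes a symmetrized one. *)
Lemma card_class_le I A (q : A -> R) (c : A -> nat) : is_pmf q ->
  (forall a, (0 < c a)%N -> 0 < q a) ->
  #|[set s : {ffun I -> A} | [forall a, cnt s a == c a]]|%:R
    <= expR (- \sum_a (c a)%:R * ln (q a)).
Proof.
move=> qp cq; set S := \sum_a _.
suff : #|[set s : {ffun I -> A} | [forall a, cnt s a == c a]]|%:R * expR S <= 1.
  by rewrite expRN -ler_pdivlMr ?expR_gt0// mul1r.
have [_ tot] := pmf_iid I qp.
rewrite -[leRHS]tot -sum_indicator mulr_suml; apply: ler_sum => s _.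
case: forallP => [ts|_]; last by rewrite mul0r prodr_ge0//; case: qp.
rewrite mul1r prod_weight => [|i].
  by rewrite ler_expR; apply: ler_sum => a _; rewrite (eqP (ts a)).
apply: cq; rewrite -(eqP (ts (s i))); apply/card_gt0P; exists i.
by rewrite inE.
Qed.

(** Give weight 1 to an agreement with [s0] and [x <= 1] to a disagreement: with [n = #|I|], a point
    of the ball weighs at least [x ^ (eta * n)], and the total weight is at most
    [(1 + #|A| * x) ^ n]. *)
Lemma hamming_ball A (delta : R) : 0 < delta ->
  exists2 eta : R, 0 < eta & forall I (s0 : {ffun I -> A}),
    #|[set s : {ffun I -> A} | #|[set i | s i != s0 i]|%:R <= eta * #|I|%:R]|%:R
      <= expR (delta * #|I|%:R).
Proof.
(* [x] makes [x * #|A| <= delta / 2]; the [eta] below makes [- eta * ln x <= delta / 2]. *)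
move=> d0; pose x : R := (1 + 2 * #|A|%:R / delta)^-1.
have y0 : 0 <= 2 * #|A|%:R / delta by rewrite divr_ge0 ?(ltW d0)// mulr_ge0.
have x0 : 0 < x by rewrite invr_gt0; lra.
have x1 : x <= 1 by rewrite invf_le1; lra.
have lx : 0 <= - ln x by rewrite oppr_ge0 ln_le0.
have xA : x * #|A|%:R <= delta / 2.
  rewrite /x mulrC ler_pdivrMr; last by lra.
  rewrite mulrDr mulr1 (_ : _ * (2 * _ / _) = #|A|%:R); last by field; rewrite gt_eqF.
  by rewrite lerDr; lra.
exists (delta / 2 / (1 - ln x)) => [|I s0]; first by rewrite !divr_gt0//; lra.
set k := _ * #|I|%:R; set S := finset _.
have tot : \sum_(s : {ffun I -> A}) \prod_i (if s i == s0 i then 1 else x) =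
    (1 + (#|A|%:R - 1) * x) ^+ #|I|.
  rewrite -(bigA_distr_bigA (fun i a => if a == s0 i then 1 else x)).
  rewrite (eq_bigr (fun=> 1 + (#|A|%:R - 1) * x)) ?prodr_const// => i _.
  rewrite (bigD1 (s0 i))//= eqxx; congr (_ + _).
  rewrite (eq_bigr (fun=> x)) => [|a /negbTE->//].
  rewrite sumr_const -[LHS]mulr_natl; congr (_ * _).
  have -> : #|A| = #|[pred a | a != s0 i]|.+1.
    by rewrite (cardD1 (s0 i) A) inE add1n; congr _.+1; apply: eq_card => a; rewrite !inE andbT.
  by rewrite -natr1 addrK.
have sx s : s \in S -> expR (k * ln x) <= \prod_i (if s i == s0 i then 1 else x).
  rewrite inE => sk.
  rewrite (bigID (fun i => s i == s0 i)) /= big1 ?mul1r => [|i ->//].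
  rewrite (eq_bigr (fun=> x)) => [|i /negbTE->//].
  rewrite prodr_const -[X in _ <= X ^+ _]lnK// -expRM_natl ler_expR.
  rewrite ler_wnM2r ?ln_le0//; apply: le_trans sk; rewrite ler_nat.
  by rewrite cardsE.
have h : #|S|%:R * expR (k * ln x) <= (1 + (#|A|%:R - 1) * x) ^+ #|I|.
  rewrite -tot mulr_natl -sumr_const big_mkcond; apply: ler_sum => s _.
  case: ifP => [/sx//|_]; apply: prodr_ge0 => i _; case: ifP => // _; exact: ltW.
have h2 : (1 + (#|A|%:R - 1) * x) ^+ #|I| <= expR (delta / 2 * #|I|%:R).
  rewrite [X in expR X]mulrC expRM_natl.
  have [->|I0] := posnP #|I|; first by rewrite !expr0.
  have A0 : (1 : R) <= #|A|%:R.
    rewrite ler1n; have /card_gt0P[i _] := I0.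
    by apply/card_gt0P; exists (s0 i).
  have z0 : 0 <= (#|A|%:R - 1) * x by rewrite mulr_ge0 ?subr_ge0// ltW.
  rewrite lerXn2r ?nnegrE ?expR_ge0//; first by lra.
  apply: le_trans (expR_ge1Dx _); rewrite lerD2l mulrBl mul1r; lra.
have := le_trans h h2; rewrite -ler_pdivlMr ?expR_gt0// -expRN -expRD.
move=> h3; apply: (le_trans h3); rewrite ler_expR.
have -> : delta * #|I|%:R = delta / 2 * #|I|%:R + delta / 2 * #|I|%:R by field.
have lx1 : (1 - ln x)^-1 * - ln x <= 1 by rewrite mulrC ler_pdivrMr; lra.
rewrite lerD2l (_ : - (k * ln x) = delta / 2 * #|I|%:R * ((1 - ln x)^-1 * - ln x)).
  by rewrite -[leRHS]mulr1 ler_wpM2l ?mulr_ge0 ?divr_ge0 ?(ltW d0).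
by rewrite /k; ring.
Qed.

(** Take [g] with the most agreements. If a position [h] of color [a] is wrong, no position of
    another color holds an [a], since swapping it with [h] would gain an agreement. So all the [a]
    of [t] are well placed, and at most [cnt u a - cnt t a] positions of color [a] are wrong. *)
Lemma rearrange (H A : finType) (t u : H -> A) : exists g : {perm H},
  (#|[set h | t (g h) != u h]| <= \sum_a (cnt u a - cnt t a))%N.
Proof.
pose agree (g : {perm H}) := #|[set h | t (g h) == u h]|.
have [g _ gmax] : exists2 g, true & forall g', (agree g' <= agree g)%N.
  by case: (@arg_maxnP _ 1%g predT agree isT) => g _ gm; exists g => // g'; exact: gm.
exists g.
have disj a : (#|[set h | (u h == a) && (t (g h) != u h)]| <= cnt u a - cnt t a)%N.
  have [->|/set0Pn[h]] := eqVneq [set h | (u h == a) && (t (g h) != u h)] finset.set0.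
    by rewrite cards0.
  rewrite inE => /andP[/eqP ua tu].
  have sub : forall h', t (g h') = a -> u h' = a.
    move=> h' th'; apply/eqP; apply: contraT => uh'.
    have := gmax (tperm h h' * g)%g; rewrite leqNgt => /negP; case.
    apply: proper_card; apply/properP; split.
      apply/fintype.subsetP => x; rewrite !inE permM => /eqP tx.
      case: tpermP => [xh|xh'|_ _]; last by rewrite tx.
        by move: tu; rewrite -xh tx eqxx.
      by move: uh'; rewrite -xh' -tx xh' th' eqxx.
    by exists h; rewrite !inE // permM tpermL th' ua.
  have -> : cnt t a = #|[set h' | (u h' == a) && (t (g h') == u h')]|.
    rewrite /cnt -(card_preimset _ (@perm_inj _ g)); apply: eq_card => x.
    rewrite !inE; apply/idP/andP => [/eqP tx|[/eqP <- //]].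
    by rewrite (sub _ tx) tx eqxx.
  rewrite leq_subRL; last first.
    by apply: subset_leq_card; apply/fintype.subsetP => x; rewrite !inE => /andP[].
  rewrite -cardsUI (_ : _ :&: _ = finset.set0) ?cards0 ?addn0.
    by apply: subset_leq_card; apply/fintype.subsetP => x; rewrite !inE => /orP[] /andP[].
  by apply/setP => x; rewrite !inE; case: (t (g x) == u x); rewrite ?andbF.
rewrite -sum1_card (partition_big u predT)//=; apply: leq_sum => a _.
apply: leq_trans (disj a); rewrite -sum1_card; apply: eq_leq.
by apply: eq_bigl => h; rewrite !inE andbC.
Qed.

Lemma ln_fact_le (k : nat) : ln (k`!%:R : R) <= k.+1%:R * ln k.+1%:R - k%:R.
Proof.
elim: k => [|k IH]; first by rewrite fact0 !ln1 mulr0 subr0.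
have k0 : 0 < (k.+1%:R : R) by [].
rewrite factS natrM lnM ?posrE ?ltr0n ?fact_gt0//.
suff : (1 : R) <= k.+2%:R * (ln k.+2%:R - ln k.+1%:R).
  move: IH; rewrite -(natr1 k.+1) -(natr1 k); set a := ln _; set b := ln (_ + 1 : R).
  move: (ln (k%:R + 1 + 1)) => c; nra.
have : ln (k.+1%:R / k.+2%:R : R) <= k.+1%:R / k.+2%:R - 1.
  rewrite -[X in ln X](subrK 1) addrC; apply: le_ln1Dx.
  by rewrite ltrBrDr addNr divr_gt0.
rewrite ln_div ?posrE// -(ler_pM2l (_ : 0 < k.+2%:R)) ?ltr0n//.
rewrite [X in _ <= X -> _]mulrBr mulr1 mulrCA divff ?pnatr_eq0// mulr1.
rewrite -[X in _ <= _ - X](natr1 k.+1); lra.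
Qed.

Lemma ln_fact_ge (k : nat) : k%:R * ln k%:R - k%:R <= ln (k`!%:R : R).
Proof.
elim: k => [|k IH]; first by rewrite fact0 ln1 mul0r subr0.
rewrite factS natrM lnM ?posrE ?ltr0n ?fact_gt0//.
case: k IH => [|k] IH; first by rewrite ?ln1 ?fact0 ?ln1; lra.
suff : k.+1%:R * (ln (k.+2%:R : R) - ln k.+1%:R) <= 1.
  move: IH; rewrite -!(natr1 k.+1); move: (ln (k.+1)`!%:R) => f.
  set b := ln (_ + 1); set a := ln _; lra.
rewrite -ln_div ?posrE// (_ : k.+2%:R / k.+1%:R = 1 + k.+1%:R^-1); last first.
  by rewrite -(natr1 k.+1) mulrDl divff ?pnatr_eq0// mul1r.
rewrite -[leRHS](mulfV (_ : k.+1%:R != 0)) ?pnatr_eq0// ler_wpM2l//.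
by apply: le_ln1Dx; apply: (@lt_trans _ _ 0); rewrite ?ltrN10 ?invr_gt0.
Qed.

(** Reveals the value at [x]. This is the induction step of both the count of color-preserving
    permutations and the exponential moment [perm_mgf]. *)
Lemma sum_perm_on_setU1 (T : finType) (x : T) (S : {set T}) (F : {perm T} -> R) :
  x \in S -> \sum_(p | perm_on S p) F p =
    \sum_(y in S) \sum_(p | perm_on (S :\ x) p) F (p * tperm x y)%g.
Proof.
move=> xS; rewrite (partition_big (fun p : {perm T} => p x) (mem S)) /=; last first.
  by move=> p pS; rewrite perm_closed.
apply: eq_bigr => y yS.
rewrite (reindex_onto (fun p => (p * tperm x y)%g) (fun p => (p * tperm x y)%g)); last first.
  by move=> p _; rewrite -mulgA tperm2 mulg1.
apply: eq_bigl => p; rewrite -mulgA tperm2 mulg1 eqxx andbT.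
have txy : perm_on S (tperm x y).
  by apply/fintype.subsetP => z; rewrite inE; case: tpermP => [->|->|]; rewrite ?xS ?yS ?eqxx.
apply/andP/idP => [[pS /eqP pxy]|pS].
  have px : p x = x by move: pxy; rewrite permM => /(canRL (tpermK _ _)); rewrite tpermR.
  apply/fintype.subsetP => z pz; rewrite !inE; apply/andP; split.
    by apply: contraTneq pz => ->; rewrite inE px eqxx.
  have pS' : perm_on S p.
    by rewrite -[p]mulg1 -(tperm2 x y) mulgA; exact: perm_onM.
  by move/fintype.subsetP: pS'; apply; exact: pz.
have px : p x = x by apply: (out_perm pS); rewrite !inE eqxx.
split; last by rewrite permM px tpermL eqxx.
apply: perm_onM => //; apply: fintype.subset_trans pS _.
by apply/fintype.subsetP => z; rewrite !inE => /andP[].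
Qed.

Lemma card_perm_colored (T A : finType) (t : T -> A) (S : {set T}) :
  (#|[set p : {perm T} | perm_on S p && [forall x, t (p x) == t x]]|
    <= \prod_a (#|[set x in S | t x == a]|)`!)%N.
Proof.
have [n] := ubnP #|S|; elim: n S => // n IH S; rewrite ltnS => Sn.
have [->|/set0Pn[x xS]] := eqVneq S finset.set0.
  apply: (@leq_trans 1); last by apply: prodn_gt0 => a; exact: fact_gt0.
  rewrite -(cards1 (1%g : {perm T})); apply: subset_leq_card.
  apply/fintype.subsetP => p; rewrite !inE => /andP[p1 _].
  by apply/eqP/permP => z; rewrite perm1; apply: (out_perm p1); rewrite inE.
rewrite -(ler_nat R) -sum_indicator.
rewrite (bigID (perm_on S)) /= [X in _ + X]big1 ?addr0; last by move=> p /negbTE->.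
rewrite (sum_perm_on_setU1 _ xS).
have bnd y : y \in S -> t y != t x ->
  \sum_(p | perm_on (S :\ x) p) (perm_on S (p * tperm x y)%g &&
     [forall z, t ((p * tperm x y)%g z) == t z])%:R = 0 :> R.
  move=> yS tyx; apply: big1 => p pS.
  rewrite [X in _ && X](_ : _ = false) ?andbF//; apply/negP => /forallP/(_ x).
  rewrite permM (out_perm pS) ?inE ?eqxx// tpermL; exact/negP.
rewrite (bigID (fun y => t y == t x)) /= [X in _ + X]big1 ?addr0; last first.
  by move=> y /andP[yS]; exact: bnd.
have Sx : (#|S :\ x| < n)%N by rewrite (cardsD1 x S) xS in Sn.
have := IH _ Sx; rewrite -(ler_nat R) -sum_indicator => IHx.
set K := \sum_(_ | _) _ in IHx.
apply: (@le_trans _ _ (\sum_(y | (y \in S) && (t y == t x)) K)).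
  apply: ler_sum => y /andP[yS /eqP tyx].
  rewrite /K big_mkcond; apply: ler_sum => p _; case: ifP => [pS|_]; last by [].
  rewrite /= ler_nat; case: forallP => [h|_]; rewrite ?andbF//.
  rewrite [X in (_ <= nat_of_bool X)%N](_ : _ = true) ?leq_b1//.
  apply/forallP => z; have /eqP := h z; rewrite permM => <-.
  by case: tpermP => [->|->|]//; rewrite tyx.
rewrite sumr_const -[leLHS]mulr_natl.
have -> : (\prod_a (#|[set z in S | t z == a]|)`!)%N =
    (#|[set z in S | t z == t x]| * \prod_a (#|[set z in S :\ x | t z == a]|)`!)%N.
  rewrite (bigD1 (t x))//= [in RHS](bigD1 (t x))//= mulnA; congr (_ * _)%N.
    rewrite (cardsD1 x [set z in S | t z == t x]) inE xS eqxx /= add1n factS; congr (_ * _`!)%N.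
    by apply: eq_card => z; rewrite !inE andbA.
  apply: eq_bigr => a atx; congr (_`!); apply: eq_card => z; rewrite !inE.
  by case: (eqVneq z x) => [->|]//=; rewrite eq_sym (negbTE atx) andbF.
rewrite natrM ler_pM//; first by rewrite /K sumr_ge0.
by rewrite ler_nat; apply: subset_leq_card; apply/fintype.subsetP => y; rewrite !inE.
Qed.

(** Permutations act transitively on the class by [rearrange], with stabilizers of order at most the
    product of the factorials of the counts; the Stirling bounds then cost a polynomial factor. *)
Lemma class_size_ge (T A : finType) (t : T -> A) :
  expR (- (\sum_a (cnt t a)%:R * ln ((cnt t a)%:R / #|T|%:R : R)) - #|A|%:R * (1 + ln #|T|.+1%:R))
  <= #|[set u : {ffun T -> A} | [forall a, cnt u a == cnt t a]]|%:R.
Proof.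
set N := #|T|; set Cl := finset _.
have h1 : (N`! <= #|Cl| * \prod_a (cnt t a)`!)%N.
  rewrite -[N]cardsT -card_perm -sum_nat_const.
  rewrite -sum1_card (partition_big (fun g : {perm T} => [ffun x => t (g x)]) (mem Cl)) /=.
    apply: leq_sum => u; rewrite inE => /forallP uC.
    have [g0] := rearrange t u.
    rewrite big1 => [|a _]; last by rewrite (eqP (uC a)) subnn.
    rewrite leqn0 cards_eq0 => /eqP/setP g0P.
    have tg0 x : t (g0 x) = u x by have := g0P x; rewrite !inE => /negbFE/eqP.
    apply: leq_trans (leq_trans (card_perm_colored t [set: T]) _).
      rewrite sum1dep_card -[leqLHS](card_imset _ (mulgI g0^-1)%g).
      apply: subset_leq_card; apply/fintype.subsetP => _ /imsetP[g + ->].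
      rewrite !inE => /andP[_ /eqP gu]; apply/andP; split.
        by apply/fintype.subsetP => z _; rewrite inE.
      apply/forallP => x; move/ffunP: gu => /(_ (g0^-1 x)%g).
      by rewrite permM ffunE => ->; rewrite -tg0 permKV.
    apply: leq_prod => a _; rewrite leq_eqVlt; apply/orP; left; apply/eqP; congr (_`!).
    by apply: eq_card => x; rewrite !inE.
  move=> g _; rewrite inE; apply/forallP => a; apply/eqP.
  rewrite /cnt -(card_preimset [set i | t i == a] (@perm_inj _ g)).
  by apply: eq_card => x; rewrite !inE ffunE.
have F0 a : 0 < ((cnt t a)`!%:R : R) by rewrite ltr0n fact_gt0.
have Cl0 : 0 < (#|Cl|%:R : R).
  rewrite ltr0n; apply/card_gt0P; exists (finfun t); rewrite inE.
  by apply/forallP => a; apply/eqP; apply: eq_card => x; rewrite !inE ffunE.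
rewrite -[leRHS]lnK ?posrE// ler_expR.
have h2 : ln (N`!%:R : R) <= ln #|Cl|%:R + \sum_a ln (cnt t a)`!%:R.
  have -> : \sum_a ln (cnt t a)`!%:R = ln (\prod_a (cnt t a)`!%:R) :> R.
    rewrite -[RHS]expRK; rewrite -[LHS]expRK; congr ln; congr expR.
    rewrite -[RHS](expRK) lnK ?posrE ?prodr_gt0// -[LHS]expRK expR_sum; congr ln.
    by apply: eq_bigr => a _; rewrite lnK ?posrE.
  have N0 : 0 < (N`!%:R : R) by rewrite ltr0n fact_gt0.
  have P0 : 0 < \prod_a ((cnt t a)`!%:R : R) by apply: prodr_gt0.
  rewrite -lnM ?posrE// ler_ln ?posrE ?mulr_gt0//.
  by rewrite -natr_prod -natrM ler_nat.
have h3 a : ln ((cnt t a)`!%:R : R) <= (cnt t a)%:R * ln (cnt t a)%:R - (cnt t a)%:R + (1 + ln N.+1%:R).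
  apply: (le_trans (ln_fact_le _)).
  have cN : (cnt t a <= N)%N by rewrite max_card.
  move: (cnt t a) cN => k kN.
  have l1 : ln (k.+1%:R : R) <= ln N.+1%:R by rewrite ler_ln ?posrE// ler_nat ltnS.
  have l2 : k%:R * (ln (k.+1%:R : R) - ln k%:R) <= 1.
    case: k {kN l1} => [|k]; first by rewrite mul0r.
    rewrite -ln_div ?posrE// (_ : k.+2%:R / k.+1%:R = 1 + k.+1%:R^-1); last first.
      by rewrite -(natr1 k.+1) mulrDl divff ?pnatr_eq0// mul1r.
    rewrite -[leRHS](mulfV (_ : k.+1%:R != 0)) ?pnatr_eq0// ler_wpM2l//.
    by apply: le_ln1Dx; apply: (@lt_trans _ _ 0); rewrite ?ltrN10 ?invr_gt0.
  move: l1 l2; rewrite -(natr1 k); set b := ln (k%:R + 1); set c := ln k%:R; lra.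
have h4 : \sum_a ln ((cnt t a)`!%:R : R) <= \sum_a (cnt t a)%:R * ln (cnt t a)%:R - N%:R
    + #|A|%:R * (1 + ln N.+1%:R).
  apply: (le_trans (ler_sum _ (fun a _ => h3 a))).
  rewrite big_split /= sumr_const -[_ *+ #|A|]mulr_natl lerD2r.
  by rewrite sumrB (sum_cnt_card t).
have h5 := ln_fact_ge N.
have -> : \sum_a (cnt t a)%:R * ln ((cnt t a)%:R / N%:R) =
    \sum_a (cnt t a)%:R * ln (cnt t a)%:R - N%:R * ln N%:R :> R.
  rewrite -[N%:R in X in _ - X](sum_cnt_card t) mulr_suml -sumrB; apply: eq_bigr => a _.
  have [->|c0] := posnP (cnt t a); first by rewrite !mul0r subrr.
  by rewrite -mulrBr (sum_cnt_card t) ln_div ?posrE ?ltr0n// (leq_trans c0)// max_card.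
move: h2 h4 h5; set x1 := ln _; set x2 := ln _; lra.
Qed.

(** Azuma's inequality by induction on [S]: given that [x] is sent to [y], the conditional means
    [m y] differ pairwise by at most [2 * c], because [Fy y] and [Fy y'] differ by two
    transpositions, and [mgf_le] applies to a uniform [y]. *)
Lemma perm_mgf (T : finType) (F : {perm T} -> R) (c l : R) (S : {set T}) :
  (forall p x y, `|F (tperm x y * p)%g - F p| <= c) -> `|l| * (2 * c) <= 2^-1 ->
  \sum_(p | perm_on S p)
      expR (l * (F p - (\sum_(p' | perm_on S p') F p') / (#|S|)`!%:R))
    <= (#|S|)`!%:R * expR (2 * (l * (2 * c)) ^+ 2 * #|S|%:R).
Proof.
move=> Fc lc; have [n] := ubnP #|S|; elim: n S F Fc => // n IH S F Fc; rewrite ltnS => Sn.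
have [->|/set0Pn[x xS]] := eqVneq S finset.set0.
  rewrite cards0 fact0 mulr0 expR0 divr1 mul1r.
  have one (G : {perm T} -> R) : \sum_(p | perm_on finset.set0 p) G p = G 1%g.
    rewrite (bigD1 1%g) ?perm_on1//= big1 ?addr0// => p /andP[p1 /eqP[]].
    by apply/permP => z; rewrite perm1; apply: (out_perm p1); rewrite inE.
  by rewrite !one subrr mulr0 expR0.
set Fy := fun y p => F (p * tperm x y)%g.
have Fyc y p x' y' : `|Fy y (tperm x' y' * p)%g - Fy y p| <= c by rewrite /Fy -mulgA.
have Sx : #|S| = #|S :\ x|.+1 by rewrite (cardsD1 x S) xS.
have Sxn : (#|S :\ x| < n)%N by rewrite -Sx.
set k := #|S :\ x| in Sx Sxn.
pose m y := (\sum_(p | perm_on (S :\ x) p) Fy y p) / k`!%:R.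
set mm := (\sum_(p' | perm_on S p') F p') / (#|S|)`!%:R.
have S0 : 0 < (#|S|%:R : R) by rewrite Sx.
have mmE : mm = (\sum_(y in S) m y) / #|S|%:R.
  rewrite /mm (sum_perm_on_setU1 _ xS) Sx factS natrM invfM mulrA mulrAC; congr (_ / _).
  by rewrite mulr_suml.
have card_k : \sum_(p : {perm T} | perm_on (S :\ x) p) 1 = k`!%:R :> R.
  by rewrite sumr_const; congr (_ *+ _); rewrite -card_perm; apply: eq_card.
have k0 : 0 < (k`!%:R : R) by rewrite ltr0n fact_gt0.
have mc y y' : `|m y - m y'| <= 2 * c.
  rewrite /m -mulrBl normrM [X in _ * X]gtr0_norm ?invr_gt0// ler_pdivrMr//.
  rewrite -sumrB; apply: (le_trans (ler_norm_sum _ _ _)).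
  rewrite -card_k mulr_sumr; apply: ler_sum => p _; rewrite mulr1 /Fy.
  (* The hypothesis on [F] concerns transpositions of arguments; here one of values is needed, which
     is a conjugate. *)
  have rc p' a b : `|F (p' * tperm a b)%g - F p'| <= c.
    have -> : (p' * tperm a b)%g = (tperm ((p'^-1)%g a) ((p'^-1)%g b) * p')%g.
      by rewrite -tpermJ conjgE invgK -!mulgA mulVg mulg1.
    exact: Fc.
  rewrite -(subrKA (F p)) mulr_natl mulr2n; apply: (le_trans (ler_normD _ _)).
  by rewrite lerD// distrC.
have mmc y : `|m y - mm| <= 2 * c.
  rewrite mmE -[m y](mulfK (lt0r_neq0 S0)) -mulrBl normrM [X in _ * X]gtr0_norm ?invr_gt0//.
  rewrite ler_pdivrMr// mulr_natr -sumr_const -sumrB.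
  apply: (le_trans (ler_norm_sum _ _ _)).
  by rewrite mulr_natr -sumr_const; apply: ler_sum.
rewrite (sum_perm_on_setU1 _ xS).
have step y : \sum_(p | perm_on (S :\ x) p) expR (l * (Fy y p - mm)) <=
   expR (l * (m y - mm)) * (k`!%:R * expR (2 * (l * (2 * c)) ^+ 2 * k%:R)).
  apply: le_trans (ler_wpM2l (expR_ge0 _) (IH _ _ (Fyc y) Sxn)).
  rewrite mulr_sumr; apply: ler_sum => p _; rewrite -expRD ler_expR -mulrDr.
  by rewrite le_eqVlt -/k -/(m y) [in X in _ || X]addrC; apply/orP; left; apply/eqP; ring.
apply: (le_trans (ler_sum _ (fun y _ => step y))).
rewrite -mulr_suml.
pose q y : R := (y \in S)%:R / #|S|%:R.
pose g y := if y \in S then m y - mm else 0.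
have qp : is_pmf q.
  split=> [y|]; first by rewrite divr_ge0.
  by rewrite -mulr_suml sum_indicator cardsE divff ?gt_eqF.
have qg : \sum_y q y * g y = 0.
  rewrite (bigID (mem S)) /= [X in _ + X]big1 ?addr0; last first.
    by move=> y /negbTE yS; rewrite /g yS mulr0.
  rewrite (eq_bigr (fun y => (m y - mm) / #|S|%:R)); last first.
    by move=> y yS; rewrite /q /g yS mul1r mulrC.
  rewrite -mulr_suml sumrB sumr_const mmE -[X in _ - X]mulr_natr mulfVK ?subrr ?mul0r//.
  by rewrite gt_eqF.
have gc y : `|g y| <= 2 * c.
  rewrite /g; case: ifP => _ //; rewrite normr0 (le_trans _ (mmc x))//.
have := mgf_le qp qg gc lc.
rewrite (bigID (mem S)) /= [X in _ + X]big1 ?addr0; last first.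
  by move=> y /negbTE yS; rewrite /q yS !mul0r.
rewrite (eq_bigr (fun y => expR (l * (m y - mm)) / #|S|%:R)); last first.
  by move=> y yS; rewrite /q /g yS mul1r mulrC.
rewrite -mulr_suml ler_pdivrMr// => h.
apply: (le_trans (ler_wpM2r _ h)); first by rewrite mulr_ge0 ?expR_ge0.
set e := 2 * _ ^+ 2; rewrite Sx factS natrM (_ : e * k.+1%:R = e * k%:R + e).
  by rewrite expRD le_eqVlt; apply/orP; left; apply/eqP; ring.
by rewrite -(natr1 k); ring.
Qed.

Lemma perm_upper_tail (T : finType) (F : {perm T} -> R) (c l s : R) :
  (forall p x y, `|F (tperm x y * p)%g - F p| <= c) -> 0 <= l -> l * (2 * c) <= 2^-1 ->
  #|[set p | s <= F p - (\sum_p' F p') / (#|T|)`!%:R]|%:R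
    <= (#|T|)`!%:R * expR (8 * (l * c) ^+ 2 * #|T|%:R - l * s).
Proof.
move=> Fc l0 lc.
have onT (p : {perm T}) : perm_on [set: T] p.
  by apply/fintype.subsetP => z _; rewrite inE.
have /= := @perm_mgf T F c l [set: T] Fc; rewrite ger0_norm// => /(_ lc).
have -> : \sum_(p | perm_on [set: T] p) F p = \sum_p F p by apply: eq_bigl.
rewrite (eq_bigl _ _ onT) cardsT => h.
rewrite expRD mulrA expRN ler_pdivlMr ?expR_gt0//.
have -> : 8 * (l * c) ^+ 2 * #|T|%:R = 2 * (l * (2 * c)) ^+ 2 * #|T|%:R by ring.
apply: le_trans h; rewrite -sum_indicator mulr_suml; apply: ler_sum => p _.
case: (boolP (s <= _)) => [sp|_]; last by rewrite mul0r expR_ge0.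
by rewrite mul1r ler_expR ler_wpM2l.
Qed.

(** If the mean of [F] exceeded [t * #|T| / 2], the lower tail would make [F <= 0] rarer than
    assumed. Hence the mean is at most that, and the upper tail bounds [F >= t * #|T|]. *)
Lemma perm_blowup (T : finType) (F : {perm T} -> R) (c t : R) :
  (forall p x y, `|F (tperm x y * p)%g - F p| <= c) -> 0 < c -> 0 < t <= 8 * c ->
  (#|T|)`!%:R * expR (- (t ^+ 2 / (128 * c ^+ 2) * #|T|%:R)) < #|[set p | F p <= 0]|%:R ->
  #|[set p | t * #|T|%:R <= F p]|%:R
    <= (#|T|)`!%:R * expR (- (t ^+ 2 / (128 * c ^+ 2) * #|T|%:R)).
Proof.
move=> Fc c0 /andP[t0 t8] big.
set m := (\sum_p' F p') / (#|T|)`!%:R; set N : R := #|T|%:R.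
(* The minimizer of [8 * (l * c) ^+ 2 * N - l * (t * N / 2)]. *)
pose l := t / (32 * c ^+ 2).
have l0 : 0 < l by rewrite divr_gt0 ?mulr_gt0 ?exprn_gt0.
have lc : l * (2 * c) <= 2^-1.
  rewrite (_ : l * (2 * c) = t / (16 * c)); last by rewrite /l; field; rewrite gt_eqF.
  by rewrite ler_pdivrMr ?mulr_gt0//; lra.
have expE : 8 * (l * c) ^+ 2 * N - l * (t * N / 2) = - (t ^+ 2 / (128 * c ^+ 2) * N).
  by rewrite /l; field; rewrite gt_eqF.
have mle : m <= t * N / 2.
  rewrite leNgt; apply/negP => mt.
  have Fc' p x y : `|- F (tperm x y * p)%g - - F p| <= c.
    by rewrite -opprD normrN.
  have := perm_upper_tail (t * N / 2) Fc' (ltW l0) lc.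
  rewrite expE; apply/negP; rewrite -ltNge; apply: (lt_le_trans big).
  rewrite ler_nat; apply: subset_leq_card; apply/fintype.subsetP => p; rewrite !inE.
  rewrite sumrN mulNr opprK -/m => Fp; lra.
have := perm_upper_tail (t * N / 2) Fc (ltW l0) lc.
rewrite expE; apply: le_trans; rewrite ler_nat; apply: subset_leq_card.
by apply/fintype.subsetP => p; rewrite !inE -/m -/N => Fp; lra.
Qed.

End Chernoff.

(** * Balls of the tree and local laws of colorings *)

Section Branches.
Variables (R : realType) (D : nat).
Implicit Types M N : finType.

(* [br M r] is the set of colorings of depth [r] of the branch hanging from one
   end of an edge, [star M r] that of colorings of the ball of radius [r.+1],
   where [d = D.+1]; a half-edge is a pair of a vertex and a direction. *)
Fixpoint br M (r : nat) : finType :=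
  if r is r'.+1 then (M * {ffun 'I_D -> br M r'})%type else M.

Definition star M (r : nat) : finType := (M * {ffun 'I_D.+1 -> br M r})%type.

(** For [k > r] the missing levels are filled with copies of the leaf colors, a junk value:
    truncation is meant for [k <= r]. *)
Fixpoint trunc M (k r : nat) {struct k} : br M r -> br M k :=
  match k, r return br M r -> br M k with
  | 0, 0 => id
  | 0, r'.+1 => fun x => x.1
  | k'.+1, 0 => fun x => (x, [ffun=> @trunc M k' 0 x])
  | k'.+1, r'.+1 => fun x => (x.1, [ffun i => @trunc M k' r' (x.2 i)])
  end.

Definition strunc M r (x : star M r.+1) : star M r :=
  (x.1, [ffun i => trunc r (x.2 i)]).

Lemma trunc_trunc M k r s (x : br M s) : (k <= r <= s)%N ->
  trunc k (trunc r x) = trunc k x.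
Proof.
elim: k r s x => [|k IH] [|r] [|s] x //= /andP[kr rs] //.
by congr pair; apply/ffunP => i; rewrite !ffunE IH// -ltnS kr.
Qed.

Lemma trunc_id M r (x : br M r) : trunc r x = x.
Proof.
elim: r x => [|r IH] //= [m y] /=; congr pair.
by apply/ffunP => i; rewrite ffunE IH.
Qed.

(* The branch of the root of [x] seen through direction [i]. *)
Definition own M r (i : 'I_D.+1) : star M r -> br M r :=
  match r return star M r -> br M r with
  | 0 => fun x => x.1
  | r'.+1 => fun x => (x.1, [ffun k => trunc r' (x.2 (lift i k))])
  end.

(* The automorphisms of a rooted branch. *)
Fixpoint bg (r : nat) : finType :=
  if r is r'.+1 then ('S_D * {ffun 'I_D -> bg r'})%type else unit.

Fixpoint act M r : bg r -> br M r -> br M r :=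
  match r return bg r -> br M r -> br M r with
  | 0 => fun _ x => x
  | r'.+1 => fun g x => (x.1, [ffun k => @act M r' (g.2 k) (x.2 (g.1 k))])
  end.

(** Automorphisms of [n] branches at a common vertex, [n] being [D] inside a branch and [D.+1] at
    the root of a star. *)
Definition ng n r : finType := ('S_n * {ffun 'I_n -> bg r})%type.

Definition nact M n r (g : ng n r) (z : {ffun 'I_n -> br M r}) : {ffun 'I_n -> br M r} :=
  [ffun k => act (g.2 k) (z (g.1 k))].

Definition sact M r (g : ng D.+1 r) (x : star M r) : star M r := (x.1, nact g x.2).

Fixpoint bmul r : bg r -> bg r -> bg r :=
  match r return bg r -> bg r -> bg r with
  | 0 => fun _ _ => tt
  | r'.+1 => fun h g => ((h.1 * g.1)%g, [ffun k => @bmul r' (h.2 k) (g.2 (h.1 k))])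
  end.

Fixpoint binv r : bg r -> bg r :=
  match r return bg r -> bg r with
  | 0 => fun _ => tt
  | r'.+1 => fun g => ((g.1^-1)%g, [ffun k => @binv r' (g.2 ((g.1^-1)%g k))])
  end.

Fixpoint bone r : bg r :=
  match r return bg r with 0 => tt | r'.+1 => (1%g, [ffun=> bone r']) end.

Lemma act_mul M r h g (x : br M r) : act (bmul h g) x = act h (act g x).
Proof.
elim: r h g x => //= r IH h g x; congr pair; apply/ffunP => k.
by rewrite !ffunE IH permM.
Qed.

Lemma act_one M r (x : br M r) : act (bone r) x = x.
Proof.
elim: r x => //= r IH [m y]; congr pair; apply/ffunP => k.
by rewrite !ffunE perm1 IH.
Qed.

Lemma act_invK M r (g : bg r) : cancel (@act M r g) (act (binv g)).
Proof.
elim: r g => //= r IH g [m y]; congr pair; apply/ffunP => k.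
by rewrite !ffunE permKV IH.
Qed.

Definition nginv n r (g : ng n r) : ng n r :=
  ((g.1^-1)%g, [ffun k => binv (g.2 ((g.1^-1)%g k))]).

Lemma nact_invK M n r (g : ng n r) : cancel (@nact M n r g) (nact (nginv g)).
Proof. by move=> z; apply/ffunP => k; rewrite /nact !ffunE permKV act_invK. Qed.

Lemma sact_invK M r (g : ng D.+1 r) : cancel (@sact M r g) (sact (nginv g)).
Proof. by move=> [m y]; rewrite /sact /= nact_invK. Qed.

Lemma sact_inj M r (g : ng D.+1 r) : injective (@sact M r g).
Proof. exact: can_inj (@sact_invK _ _ g). Qed.

Definition orb M r (z : br M r) : {set br M r} := [set act g z | g : bg r].

Lemma orb_refl M r (z : br M r) : z \in orb z.
Proof. by apply/imsetP; exists (bone r); rewrite ?act_one. Qed.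

Lemma orb_act M r g (z : br M r) : orb (act g z) = orb z.
Proof.
apply/setP => x; apply/imsetP/imsetP => -[h _ ->].
  by exists (bmul h g); rewrite // act_mul.
by exists (bmul h (binv g)); rewrite // act_mul act_invK.
Qed.

Lemma orb_eqP M r (x z : br M r) : reflect (orb x = orb z) (x \in orb z).
Proof.
apply: (iffP idP) => [/imsetP[g _ ->]|<-]; [exact: orb_act|exact: orb_refl].
Qed.

(** Law of [z] after a uniform automorphism; [norb] and [SB] are the analogues for the branches at a
    vertex and for a star. They describe the random labeling of a neighborhood that is a tree. *)
Definition Borb M r (z x : br M r) : R := (\sum_(g : bg r) (act g z == x)%:R) / #|bg r|%:R.

Definition norb M n r (z x : {ffun 'I_n -> br M r}) : R :=
  (\sum_(g : ng n r) (nact g z == x)%:R) / #|ng n r|%:R.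

Definition SB M r (z x : star M r) : R :=
  (\sum_(g : ng D.+1 r) (sact g z == x)%:R) / #|ng D.+1 r|%:R.

Lemma card_bg_gt0 r : (0 < #|bg r|)%N.
Proof. by apply/card_gt0P; exists (bone r). Qed.

Lemma card_ng_gt0 n r : (0 < #|ng n r|)%N.
Proof. by apply/card_gt0P; exists (1%g, [ffun=> bone r]). Qed.

Lemma prod_indicator (I : finType) (P : pred I) :
  \prod_i (P i)%:R = [forall i, P i]%:R :> R.
Proof.
case: forallP => [h|/forallP/forallPn[i /negbTE h]].
  by rewrite big1// => i _; rewrite h.
by rewrite (bigD1 i)//= h mul0r.
Qed.

Lemma norbE M n r (z x : {ffun 'I_n -> br M r}) :
  norb z x = (\sum_(s : 'S_n) \prod_k Borb (z (s k)) (x k)) / n`!%:R.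
Proof.
rewrite /norb card_prod card_ffun card_ord natrM natrX -card_Sn invfM mulrA.
rewrite -(pair_bigA _ (fun (s : 'S_n) (g : {ffun 'I_n -> bg r}) => (nact (s, g) z == x)%:R)) /=.
rewrite mulrAC; congr (_ / _); rewrite !mulr_suml; apply: eq_bigr => s _.
rewrite /Borb big_split /= prodr_const card_ord exprVn; congr (_ / _).
rewrite (bigA_distr_bigA (fun k g => (act g (z (s k)) == x k)%:R)) /=.
apply: eq_bigr => g _; rewrite prod_indicator; congr (nat_of_bool _)%:R.
apply/eqP/forallP => [/ffunP h k|h]; first by rewrite -h ffunE.
by apply/ffunP => k; rewrite ffunE (eqP (h k)).
Qed.

Lemma BorbS M r (z x : br M r.+1) : Borb z x = (z.1 == x.1)%:R * norb z.2 x.2.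
Proof.
rewrite /Borb /norb mulrA; congr (_ / _).
rewrite mulr_sumr; apply: eq_bigr => g _.
by rewrite -natrM mulnb; case: x => m y /=.
Qed.

Lemma SBE M r (z x : star M r) : SB z x = (z.1 == x.1)%:R * norb z.2 x.2.
Proof.
rewrite /SB /norb mulrA; congr (_ / _).
rewrite mulr_sumr; apply: eq_bigr => g _.
by rewrite -natrM mulnb; case: x => m y /=.
Qed.

Lemma Borb0 M (z x : br M 0) : Borb z x = (z == x)%:R.
Proof. by rewrite /Borb (eq_bigr (fun=> (z == x)%:R))// sumr_const card_unit divr1. Qed.

Lemma avg_eq_pmf (G T : finType) (a : G -> T) : (0 < #|G|)%N ->
  is_pmf (fun x => (\sum_g (a g == x)%:R) / #|G|%:R : R).
Proof.
move=> G0; split=> [x|]; first by rewrite divr_ge0 ?sumr_ge0.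
rewrite -mulr_suml exchange_big /= (eq_bigr (fun=> 1)) => [|g _].
  by rewrite sumr_const divff// pnatr_eq0 -lt0n.
by rewrite (bigD1 (a g))//= eqxx big1 ?addr0// => x /negbTE; rewrite eq_sym => ->.
Qed.

Lemma Borb_pmf M r (z : br M r) : is_pmf (Borb z).
Proof. exact: avg_eq_pmf (card_bg_gt0 r). Qed.

Lemma norb_pmf M n r (z : {ffun 'I_n -> br M r}) : is_pmf (norb z).
Proof. exact: avg_eq_pmf (card_ng_gt0 n r). Qed.

Lemma SB_pmf M r (z : star M r) : is_pmf (SB z).
Proof. exact: avg_eq_pmf (card_ng_gt0 _ r). Qed.

Lemma norb_act_of M n r (g : ng n r) (z x : {ffun 'I_n -> br M r}) :
  (forall h (a b : br M r), Borb a (act h b) = Borb a b) ->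
  norb z (nact g x) = norb z x.
Proof.
move=> IH; rewrite !norbE; congr (_ / _).
rewrite [RHS](reindex_inj (mulgI (g.1^-1)%g)) /=; apply: eq_bigr => s _.
rewrite [RHS](reindex_inj (@perm_inj _ g.1)) /=; apply: eq_bigr => k _.
by rewrite ffunE IH permM permK.
Qed.

Lemma Borb_act M r (g : bg r) (z x : br M r) : Borb z (act g x) = Borb z x.
Proof.
elim: r g z x => [|r IH] g z x //; rewrite !BorbS /=; congr (_ * _).
exact: (norb_act_of (g : ng D r) _ _ IH).
Qed.

Lemma SB_act M r (g : ng D.+1 r) (z x : star M r) : SB z (sact g x) = SB z x.
Proof. by rewrite !SBE /=; congr (_ * _); apply: norb_act_of; exact: Borb_act. Qed.

Lemma BorbE M r (z x : br M r) : Borb z x = (x \in orb z)%:R / #|orb z|%:R.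
Proof.
have supp y : y \notin orb z -> Borb z y = 0.
  move=> yz; rewrite /Borb big1 ?mul0r// => g _; case: eqP => // gz.
  by move: yz; rewrite -gz -(orb_act g z) orb_refl.
have cst y : y \in orb z -> Borb z y = Borb z z.
  by move=> /imsetP[g _ ->]; rewrite Borb_act.
have [_] := Borb_pmf z; rewrite (bigID (mem (orb z))) /= [X in _ + X]big1 ?addr0//.
rewrite (eq_bigr _ cst) sumr_const -[_ *+ _]mulr_natr => zz.
have n0 : #|orb z|%:R != 0 :> R.
  by rewrite pnatr_eq0 -lt0n; apply/card_gt0P; exists z; exact: orb_refl.
case: (boolP (x \in orb z)) => [/cst->|/supp->]; last by rewrite mul0r.
by apply: (mulIf n0); rewrite zz mul1r mulVf.
Qed.

Lemma norb_push M N n r r' (phi : br M r -> br N r') :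
  (forall z y, \sum_x (phi x == y)%:R * Borb z x = Borb (phi z) y) ->
  forall (z : {ffun 'I_n -> br M r}) y,
  \sum_(x : {ffun 'I_n -> br M r}) ([ffun k => phi (x k)] == y)%:R * norb z x = norb [ffun k => phi (z k)] y.
Proof.
move=> h z y; rewrite norbE.
under eq_bigr do rewrite norbE mulrA.
rewrite -mulr_suml; congr (_ / _).
under eq_bigr do rewrite mulr_sumr.
rewrite exchange_big /=; apply: eq_bigr => s _.
under [RHS]eq_bigr do rewrite ffunE -h.
rewrite (bigA_distr_bigA (fun k x => (phi x == y k)%:R * Borb (z (s k)) x)) /=.
apply: eq_bigr => x _; rewrite [RHS]big_split /=; congr (_ * _).
transitivity ([forall k, phi (x k) == y k]%:R : R); last exact/esym/prod_indicator.
congr (nat_of_bool _)%:R; apply/eqP/forallP => [/ffunP e k|e]; first by rewrite -e ffunE.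
by apply/ffunP => k; rewrite ffunE (eqP (e k)).
Qed.

Lemma sum_node_push M (A B : finType) (m : M) (phi : A -> B) (w : A -> R) (n : M) (y : B) :
  \sum_(x : M * A) ((x.1, phi x.2) == (n, y))%:R * ((m == x.1)%:R * w x.2)
  = (m == n)%:R * \sum_a (phi a == y)%:R * w a.
Proof.
rewrite -(pair_bigA _ (fun i a => ((i, phi a) == (n, y))%:R * ((m == i)%:R * w a))) /=.
rewrite (bigD1 n)//= [X in _ + X]big1 ?addr0 => [|i /negbTE ni]; last first.
  by apply: big1 => a _; rewrite xpair_eqE ni mul0r.
rewrite mulr_sumr; apply: eq_bigr => a _.
by rewrite xpair_eqE eqxx mulrCA.
Qed.

Lemma Borb_trunc M r (z : br M r.+1) y :
  \sum_x (trunc r x == y)%:R * Borb z x = Borb (trunc r z) y.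
Proof.
elim: r z y => [|r IH] z y.
  rewrite Borb0 /= -[in RHS](mulr1 (_ == _)%:R); have [_ h1] := @norb_pmf M D 0 z.2.
  rewrite -[X in _ = _ * X]h1.
  under eq_bigr do rewrite BorbS.
  rewrite -(pair_bigA _ (fun i (a : {ffun 'I_D -> M}) => (i == y)%:R * ((z.1 == i)%:R * norb (r := 0) z.2 a))) /=.
  rewrite (bigD1 y)//= [X in _ + X]big1 ?addr0 => [|i /negbTE->]; last first.
    by apply: big1 => a _; rewrite mul0r.
  by under eq_bigr do rewrite eqxx mul1r; rewrite -mulr_sumr.
rewrite [RHS]BorbS; under eq_bigr do rewrite BorbS.
case: y => n y; rewrite (sum_node_push z.1 (fun x : {ffun _ -> _} => [ffun k => trunc r (x k)]) (@norb M D r.+1 z.2)).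
by congr (_ * _); rewrite (norb_push IH).
Qed.

Lemma SB_trunc M r (z : star M r.+1) y :
  \sum_x (strunc x == y)%:R * SB z x = SB (strunc z) y.
Proof.
rewrite [RHS]SBE; under eq_bigr do rewrite SBE.
case: y => n y; rewrite (sum_node_push z.1 (fun x : {ffun _ -> _} => [ffun k => trunc r (x k)]) (norb z.2)).
by congr (_ * _); rewrite (norb_push (@Borb_trunc M r)).
Qed.

Lemma sum_lift_perm (n : nat) (G : 'I_n.+1 -> {ffun 'I_n -> 'I_n.+1} -> R) :
  \sum_(s : 'S_n.+1) G (s ord0) [ffun k => s (lift ord0 k)] =
  \sum_(i : 'I_n.+1) \sum_(t : 'S_n) G i [ffun k => lift i (t k)].
Proof.
rewrite (partition_big (fun s : 'S_n.+1 => s ord0) predT)//=; apply: eq_bigr => i _.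
rewrite (reindex (lift_perm ord0 i)) /=; last first.
  (* [ulsf s] is what [s] induces from the points other than [ord0] to the values other than
     [s ord0]. *)
  pose ulsf (s : 'S_n.+1) k := odflt k (unlift (s ord0) (s (lift ord0 k))).
  have ulsfK (s : 'S_n.+1) k : lift (s ord0) (ulsf s k) = s (lift ord0 k).
    rewrite /ulsf; have := neq_lift ord0 k.
    by rewrite -(can_eq (permK s)) => /unlift_some[] ? ? ->.
  have inj_ulsf s : injective (ulsf s).
    move=> x y /(congr1 (lift (s ord0))); rewrite !ulsfK => /perm_inj.
    exact: lift_inj.
  exists (fun s => perm (inj_ulsf s)) => [t _|s].
    apply/permP => k; rewrite permE; apply: (@lift_inj _ i).
    by rewrite -{1}(lift_perm_id ord0 i t) ulsfK lift_perm_lift.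
  rewrite inE => /eqP si; apply/permP => k.
  case: (unliftP ord0 k) => [j ->|->]; last by rewrite lift_perm_id si.
  by rewrite lift_perm_lift permE -si ulsfK.
apply: eq_big => [t|t _]; first by rewrite lift_perm_id eqxx.
rewrite lift_perm_id; congr G; apply/ffunP => k.
by rewrite !ffunE lift_perm_lift.
Qed.

(** Condition on the branch [i] that the random permutation puts in direction [ord0]: the others are
    then permuted uniformly. [phi] stands for the truncation in [own], or for a constant at depth
    0. *)
Lemma norb_edge M r (z : {ffun 'I_D.+1 -> br M r}) (A : finType) (phi : br M r -> A)
    (a : {ffun 'I_D -> A}) (b : br M r) :
  \sum_(x : {ffun 'I_D.+1 -> br M r}) (x ord0 == b)%:R *
      [forall k, phi (x (lift ord0 k)) == a k]%:R * norb z x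
  = (\sum_(i : 'I_D.+1) Borb (z i) b *
      ((\sum_(t : 'S_D) \prod_k \sum_(c : br M r) (phi c == a k)%:R * Borb (z (lift i (t k))) c)
         / D`!%:R)) / D.+1%:R.
Proof.
under eq_bigr do rewrite norbE mulrA.
rewrite -mulr_suml factS natrM invfM [in LHS]mulrA mulrAC; congr (_ / _).
under eq_bigr do rewrite mulr_sumr.
rewrite exchange_big /=.
under [RHS]eq_bigr do rewrite mulrA.
rewrite -mulr_suml; congr (_ / _).
under [RHS]eq_bigr do rewrite mulr_sumr.
pose G i (s : {ffun 'I_D -> 'I_D.+1}) : R := Borb (z i) b *
  \prod_k \sum_(c : br M r) (phi c == a k)%:R * Borb (z (s k)) c.
transitivity (\sum_(s : 'S_D.+1) G (s ord0) [ffun k => s (lift ord0 k)]); last first.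
  rewrite sum_lift_perm; apply: eq_bigr => i _; apply: eq_bigr => t _; rewrite /G.
  by congr (_ * _); apply: eq_bigr => k _; rewrite ffunE.
apply: eq_bigr => s _.
pose F (j : 'I_D.+1) (c : br M r) : R :=
  (if unlift ord0 j is Some k then phi c == a k else c == b)%:R * Borb (z (s j)) c.
transitivity (\prod_j \sum_c F j c); last first.
  rewrite big_ord_recl /G /F unlift_none; congr (_ * _).
    rewrite (bigD1 b)//= eqxx mul1r big1 ?addr0// => c /negbTE->.
    by rewrite mul0r.
  by apply: eq_bigr => k _; rewrite liftK ffunE.
rewrite bigA_distr_bigA /=; apply: eq_bigr => x _.
rewrite /F [RHS]big_split /=; congr (_ * _).
by rewrite [RHS]big_ord_recl unlift_none -prod_indicator; congr (_ * _); apply: eq_bigr => k _; rewrite liftK.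
Qed.

(** The relabeling shows a uniform direction [i] of [z] as [ord0] and randomizes both sides of that
    edge independently. This makes the edge law of a matching a sum over half-edges ([edge_Plab]),
    symmetric because matched half-edges see the same edge from its two ends. *)
Lemma SB_edge M r (z : star M r) a b :
  \sum_x ((own ord0 x == a) && (x.2 ord0 == b))%:R * SB z x =
  (\sum_i Borb (own i z) a * Borb (z.2 i) b) / D.+1%:R.
Proof.
case: r z a b => [|r] z a b.
  have e : forall x : star M 0, ((own ord0 x == a) && (x.2 ord0 == b))%:R * SB z x =
    (z.1 == a)%:R * ((x.1 == a)%:R * ((x.2 ord0 == b)%:R *
       [forall k : 'I_D, (fun=> tt) (x.2 (lift ord0 k)) == [ffun=> tt] k]%:R * norb (r := 0) z.2 x.2)).
    move=> [m x] /=; rewrite SBE /= [X in nat_of_bool X]//; rewrite (_ : [forall _, _] = true); last first.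
      by apply/forallP => k.
    rewrite mulr1 -mulnb natrM; case: (eqVneq m a) => [->|]; rewrite ?mul0r ?mulr0// !mul1r.
    by rewrite mulrCA.
  under eq_bigr do rewrite e.
  rewrite -mulr_sumr -(pair_bigA _ (fun m (x : {ffun 'I_D.+1 -> M}) => (m == a)%:R * ((x ord0 == b)%:R *
       [forall k : 'I_D, (fun=> tt) (x (lift ord0 k)) == [ffun=> tt] k]%:R * norb (r := 0) z.2 x))) /=.
  rewrite (bigD1 a)//= [X in _ + X]big1 ?addr0 => [|m /negbTE ma]; last first.
    by apply: big1 => x _; rewrite ma mul0r.
  under eq_bigr do rewrite eqxx mul1r.
  rewrite (norb_edge (r := 0) z.2 (fun=> tt) [ffun=> tt] b) mulrA; congr (_ / _).
  rewrite mulr_sumr; apply: eq_bigr => i _.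
  rewrite (eq_bigr (fun=> 1)) => [|t _].
    rewrite sumr_const card_Sn divff ?mulr1 ?pnatr_eq0 -?lt0n ?fact_gt0//.
    by rewrite (Borb0 (own i z)).
  rewrite big1// => k _; under eq_bigr do rewrite ffunE mul1r.
  by have [_] := @Borb_pmf M 0 (z.2 (lift i (t k))).
have e : forall x : star M r.+1, ((own ord0 x == a) && (x.2 ord0 == b))%:R * SB z x =
    (z.1 == a.1)%:R * ((x.1 == a.1)%:R * ((x.2 ord0 == b)%:R *
       [forall k : 'I_D, trunc r (x.2 (lift ord0 k)) == a.2 k]%:R * norb z.2 x.2)).
  move=> [m x] /=; rewrite SBE /= (_ : [forall _, _] = ([ffun k => trunc r (x (lift ord0 k))] == a.2)); last first.
    apply/forallP/eqP => [h|<-] => [|k]; last by rewrite ffunE.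
    by apply/ffunP => k; rewrite ffunE (eqP (h k)).
  case: a => a1 a2 /=; rewrite xpair_eqE -!mulnb !natrM.
  case: (eqVneq m a1) => [->|]; rewrite ?mul0r ?mulr0// !mul1r.
  by rewrite -!mulrA; ring.
under eq_bigr do rewrite e.
rewrite -mulr_sumr -(pair_bigA _ (fun m (x : {ffun 'I_D.+1 -> br M r.+1}) => (m == a.1)%:R * ((x ord0 == b)%:R *
       [forall k : 'I_D, trunc r (x (lift ord0 k)) == a.2 k]%:R * norb z.2 x))) /=.
rewrite (bigD1 a.1)//= [X in _ + X]big1 ?addr0 => [|m /negbTE ma]; last first.
  by apply: big1 => x _; rewrite ma mul0r.
under eq_bigr do rewrite eqxx mul1r.
rewrite (norb_edge z.2 (@trunc M r r.+1) a.2 b) mulrA; congr (_ / _).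
rewrite mulr_sumr; apply: eq_bigr => i _; rewrite (BorbS (own i z)) /= -mulrA; congr (_ * _).
rewrite mulrC; congr (_ * _).
rewrite norbE; congr (_ / _); apply: eq_bigr => t _; apply: eq_bigr => k _.
by rewrite Borb_trunc ffunE.
Qed.

Section Unfolding.
Variables (M V : finType).
Implicit Types (p : V * 'I_D.+1 -> V * 'I_D.+1) (f : V -> M).

(* The coloring [f] lifted to the universal cover of the multigraph in which the
   half-edge [h] is matched with [p h]. *)
Fixpoint unf p f r (h : V * 'I_D.+1) : br M r :=
  match r return br M r with
  | 0 => f h.1
  | r'.+1 => (f h.1, [ffun k => unf p f r' (p (h.1, lift h.2 k))])
  end.

Definition sunf p f r (v : V) : star M r := (f v, [ffun i => unf p f r (p (v, i))]).

Lemma trunc_unf p f k r h : (k <= r)%N -> trunc k (unf p f r h) = unf p f k h.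
Proof.
elim: k r h => [|k IH] [|r] h //= kr; congr pair; apply/ffunP => i.
by rewrite !ffunE IH.
Qed.

Lemma own_sunf p f r i v : own i (sunf p f r v) = unf p f r (v, i).
Proof.
case: r => [|r] //=; congr pair; apply/ffunP => k.
by rewrite !ffunE; exact: trunc_unf (leqnSn r).
Qed.

Lemma strunc_sunf p f r v : strunc (sunf p f r.+1 v) = sunf p f r v.
Proof.
congr pair; apply/ffunP => k; rewrite !ffunE; exact: trunc_unf (leqnSn r).
Qed.

(** Local statistics of [f]: the cover seen from a uniform vertex, under a random relabeling that
    removes the dependence on the numbering of the half-edges at each vertex. *)
Definition Plab p f r (x : star M r) : R := (\sum_v SB (sunf p f r v) x) / #|V|%:R.

Definition edge (P : forall r, star M r -> R) r (ab : br M r * br M r) : R :=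
  \sum_x ((own ord0 x == ab.1) && (x.2 ord0 == ab.2))%:R * P r x.

(* The finite-dimensional laws of an invariant process: consistent, invariant
   under rotations of the root and under the reversal of an edge. *)
Definition inv_family (P : forall r, star M r -> R) : Prop :=
  [/\ forall r, is_pmf (P r),
      forall r y, \sum_x (strunc x == y)%:R * P r.+1 x = P r y,
      forall r g x, P r (sact g x) = P r x &
      forall r (a b : br M r), edge P (a, b) = edge P (b, a)].

Lemma edge_Plab p f r a b : edge (Plab p f) (a, b) =
  (\sum_h Borb (unf p f r h) a * Borb (unf p f r (p h)) b) / #|{: V * 'I_D.+1}|%:R.
Proof.
rewrite /edge /Plab; under eq_bigr do rewrite mulrA mulr_sumr.
rewrite -mulr_suml exchange_big /=; under eq_bigr do rewrite SB_edge.
rewrite -mulr_suml -mulrA -invfM -natrM card_prod card_ord mulnC; congr (_ / _).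
rewrite pair_big /=; apply: eq_bigr => -[v i] _ /=.
by rewrite own_sunf ffunE.
Qed.

Lemma Plab_inv p f : (0 < #|V|)%N -> involutive p -> inv_family (Plab p f).
Proof.
move=> V0 pK; have V0' : #|V|%:R != 0 :> R by rewrite pnatr_eq0 -lt0n.
split.
- move=> r; split=> [x|].
    by rewrite divr_ge0// sumr_ge0// => v _; have [] := SB_pmf (sunf p f r v).
  rewrite -mulr_suml exchange_big /= (eq_bigr (fun=> 1)) ?sumr_const ?divff//.
  by move=> v _; have [] := SB_pmf (sunf p f r v).
- move=> r y; rewrite /Plab; under eq_bigr do rewrite mulrA mulr_sumr.
  rewrite -mulr_suml exchange_big /=; congr (_ / _).
  by apply: eq_bigr => v _; rewrite SB_trunc strunc_sunf.
- by move=> r g x; congr (_ / _); apply: eq_bigr => v _; rewrite SB_act.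
- move=> r a b; rewrite !edge_Plab; congr (_ / _).
  rewrite (reindex_inj (inv_inj pK)) /=; apply: eq_bigr => h _.
  by rewrite pK mulrC.
Qed.

Fixpoint defect_const k : nat := if k is k'.+1 then (D.+1 * (1 + defect_const k'))%N else 0.

(* A claimed star [t v] at each vertex is correct wherever the claims of matched
   half-edges agree, except near the few half-edges where they do not. *)
Lemma defect p r (t : V -> star M r) (Df : {set V * 'I_D.+1}) : involutive p ->
  (forall h, h \notin Df -> (t h.1).2 h.2 = own (p h).2 (t (p h).1)) ->
  (#|[set v | sunf p (fun v => (t v).1) r v != t v]| <= (1 + defect_const r) * #|Df|)%N.
Proof.
move=> pK tD; set f := fun v => (t v).1.
have near (B : {set V * 'I_D.+1}) : (#|[set h.1 | h in Df :|: p @^-1: B]| <= #|Df| + #|B|)%N.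
  apply: leq_trans (leq_imset_card _ _) _; rewrite -(card_preimset B (inv_inj pK)).
  by rewrite cardsU leq_subr.
have nearP (B : {set V * 'I_D.+1}) v i : v \notin [set h.1 | h in Df :|: p @^-1: B] ->
    (v, i) \notin Df /\ p (v, i) \notin B.
  move=> vB; split; apply: contra vB => h; apply/imsetP; exists (v, i) => //.
    by rewrite inE h.
  by rewrite !inE h orbT.
(* The half-edges whose branch of depth [k] is not the claimed one. A half-edge can be bad at depth
   [k.+1] only if its vertex carries a half-edge that lies in [Df] or is matched into [bad k]; hence
   the recursion of [defect_const]. *)
pose bad k := [set h | unf p f k h != trunc k (own h.2 (t h.1))].
have badE k h : h \notin bad k -> unf p f k h = trunc k (own h.2 (t h.1)).
  by rewrite inE negbK => /eqP.
have badk k : (k <= r)%N -> (#|bad k| <= defect_const k * #|Df|)%N.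
  elim: k => [_|k IH kr].
    rewrite mul0n leqn0 cards_eq0; apply/eqP/setP => h; rewrite !inE; apply/negbTE.
    by rewrite negbK; apply/eqP; case: (r) t @f {tD bad badE} => [|r'] t.
  have sub : bad k.+1 \subset finset.setX [set h.1 | h in Df :|: p @^-1: bad k] [set: 'I_D.+1].
    apply/fintype.subsetP => -[v i]; rewrite !inE andbT; apply: contraR => vB.
    case: (r) t tD @f kr bad badE vB {IH} => // r' t tD f kr bad badE vB.
    apply/eqP => /=; congr pair; apply/ffunP => j; rewrite !ffunE.
    have [vD vb] := nearP (bad k) v (lift i j) vB.
    by rewrite (badE _ _ vb) -(tD _ vD) trunc_trunc// -ltnS kr /=.
  apply: leq_trans (subset_leq_card sub) _; rewrite cardsX cardsT card_ord mulnC.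
  rewrite /= -mulnA leq_mul2l /=; apply: leq_trans (near _) _.
  by rewrite mulnDl mul1n leq_add2l IH// ltnW.
apply: (@leq_trans #|[set h.1 | h in Df :|: p @^-1: bad r]|).
  apply: subset_leq_card; apply/fintype.subsetP => v; rewrite inE; apply: contraR => vB.
  apply/eqP; rewrite [RHS]surjective_pairing; congr pair; apply/ffunP => i; rewrite ffunE.
  have [vD vb] := nearP (bad r) v i vB.
  by rewrite (badE _ _ vb) trunc_id -(tD _ vD).
apply: leq_trans (near _) _; by rewrite mulnDl mul1n leq_add2l badk.
Qed.

End Unfolding.

End Branches.

(** * Random matchings *)

Section Matchings.
Variable R : realType.
Implicit Types (H A : finType).

Fact matchings_key : unit. Proof. exact: tt. Qed.

(** Locked, so that rewriting with [inE] leaves membership in [matchings] folded. *)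
Definition matchings H : {set {perm H}} :=
  locked_with matchings_key [set p : {perm H} | [forall h, (p (p h) == h) && (p h != h)]].

Lemma matchingsP H (p : {perm H}) :
  reflect (involutive p /\ forall h, p h != h) (p \in matchings H).
Proof.
rewrite /matchings locked_withE inE; apply: (iffP forallP) => [h|[h1 h2] x].
  by split=> x; have /andP[/eqP] := h x.
by rewrite h1 eqxx h2.
Qed.

Lemma matchings_conj H (p g : {perm H}) : p \in matchings H -> (p ^ g)%g \in matchings H.
Proof.
move=> /matchingsP[pK pn]; apply/matchingsP; rewrite conjgE; split=> h.
  by rewrite !permM permK pK permKV.
rewrite !permM; apply: contra (pn ((g^-1)%g h)) => /eqP e.
by apply/eqP/(@perm_inj _ g); rewrite e permKV.
Qed.

Lemma conj_tperm_diff H (p : {perm H}) x y : p \in matchings H ->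
  (#|[set h | (p ^ tperm x y)%g h != p h]| <= 4)%N.
Proof.
move=> /matchingsP[pK pn].
apply: (@leq_trans #|[set x; y; p x; p y]|); last first.
  rewrite -finset.setUA -[4%N]/(2 + 2)%N; apply: leq_trans (leq_card_setU _ _) _.
  by rewrite leq_add// cards2; case: eqP.
apply: subset_leq_card; apply/fintype.subsetP => h; rewrite !inE conjgE !permM tpermV.
apply: contraR; rewrite !negb_or -!andbA => /and4P[hx hy hpx hpy].
rewrite (tpermD (z := h)) 1?eq_sym// tpermD 1?eq_sym//.
  by apply: contra hpx => /eqP<-; rewrite pK.
by apply: contra hpy => /eqP<-; rewrite pK.
Qed.

(** A [g] for which [p ^ g] agrees most often with [q] leaves no disagreement: if [r = p ^ g]
    differs from [q] at [h], conjugating by the transposition of [r h] and [q h] repairs [h] and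
    spoils nothing. *)
Lemma matchings_trans H (p q : {perm H}) : p \in matchings H -> q \in matchings H ->
  exists g, q = (p ^ g)%g.
Proof.
move=> pM qM; pose agree (g : {perm H}) := #|[set h | (p ^ g)%g h == q h]|.
have [g _ gmax] : exists2 g, true & forall g', (agree g' <= agree g)%N.
  by case: (@arg_maxnP _ 1%g predT agree isT) => g _ gm; exists g => // g'; exact: gm.
exists g; apply/permP => h; apply/esym/eqP; apply: contraT => dh.
have /matchingsP[qK qn] := qM; have /matchingsP[rK rn] := matchings_conj g pM.
move: rK rn dh gmax; rewrite /agree; move: (p ^ g)%g (conjgM p g) => r rE rK rn dh gmax.
have := gmax (g * tperm (r h) (q h))%g; rewrite rE leqNgt => /negP; case.
apply: proper_card; apply/properP; split.
  apply/fintype.subsetP => z; rewrite !inE => /eqP rz; rewrite conjgE !permM tpermV.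
  have zh : z != h by apply: contra dh => /eqP<-; rewrite rz.
  have zr : z != r h.
    by apply: contra dh => /eqP zr; rewrite -(can_eq qK) qK -zr -rz zr rK.
  have zq : z != q h.
    by apply: contra dh => /eqP zq; rewrite -(can_eq rK) rK -zq rz zq qK.
  rewrite (tpermD (z := z)) 1?eq_sym// tpermD ?rz// eq_sym.
    by apply: contra zh => /eqP e; apply/eqP/(can_inj rK); rewrite rz.
  by apply: contra zh => /eqP e; apply/eqP/(can_inj qK).
exists h; rewrite !inE// conjgE !permM tpermV (tpermD (z := h)) ?tpermL//.
Qed.

Lemma card_conj_fiber H (p q : {perm H}) : p \in matchings H -> q \in matchings H ->
  #|[set g | (p ^ g)%g == q]| = #|[set g | (p ^ g)%g == p]|.
Proof.
move=> pM qM; have [g0 qE] := matchings_trans pM qM.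
rewrite -[RHS](card_imset _ (mulIg g0)); apply: eq_card => g.
apply/idP/imsetP => [|[h + ->]]; rewrite !inE => /eqP.
  move=> pg; exists (g * g0^-1)%g; last by rewrite mulgKV.
  by rewrite inE conjgM pg qE conjgK.
by move=> ph; rewrite conjgM ph qE.
Qed.

(** A fixed matching conjugated by a uniform permutation is a uniform matching; this carries
    concentration from the symmetric group over to matchings. *)
Lemma card_conj_preim H (p : {perm H}) (S : {set {perm H}}) : p \in matchings H ->
  S \subset matchings H ->
  (#|[set g | (p ^ g)%g \in S]| * #|matchings H| = #|S| * (#|H|)`!)%N.
Proof.
move=> pM SM; set k := #|[set g | (p ^ g)%g == p]|.
have cnt (T : {set {perm H}}) : T \subset matchings H -> #|[set g | (p ^ g)%g \in T]| = (#|T| * k)%N.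
  move=> /fintype.subsetP TM; rewrite -sum1_card (partition_big (fun g => (p ^ g)%g) (mem T)) /=.
    rewrite -sum_nat_const; apply: eq_bigr => q qT; rewrite /k -(card_conj_fiber pM (TM _ qT)).
    rewrite -sum1_card; apply: eq_bigl => g; rewrite !inE.
    by case: eqP => [->|]; rewrite ?qT ?andbF.
  by move=> g; rewrite inE.
rewrite (cnt _ SM) -mulnA (mulnC k) -(cnt _ (fintype.subxx _)); congr (_ * _)%N.
have -> : [set g | (p ^ g)%g \in matchings H] = [set: {perm H}].
  by apply/setP => g; rewrite !inE matchings_conj.
rewrite -(cardsT H) -card_perm; apply: eq_card => g.
by rewrite inE; apply/esym/fintype.subsetP => z; rewrite inE.
Qed.

Definition hamm H (p q : {perm H}) : nat := #|[set h | p h != q h]|.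

Lemma hamm_triangle H (p q r : {perm H}) : (hamm p r <= hamm p q + hamm q r)%N.
Proof.
apply: leq_trans (leq_card_setU _ _); apply: subset_leq_card.
apply/fintype.subsetP => h; rewrite !inE -negb_and; apply: contra.
by move=> /andP[/eqP-> /eqP->].
Qed.

(** [perm_blowup] for the distance from [p0 ^ g] to [S], which a transposition changes by at most 4;
    hence [2048 = 128 * 4 ^ 2]. *)
Lemma blowup H (S : {set {perm H}}) (t : R) : 0 < t <= 1 -> S \subset matchings H ->
  #|matchings H|%:R * expR (- (t ^+ 2 / 2048 * #|H|%:R)) < #|S|%:R ->
  #|[set p in matchings H | [forall q in S, t * #|H|%:R <= (hamm p q)%:R]]|%:R
    <= #|matchings H|%:R * expR (- (t ^+ 2 / 2048 * #|H|%:R)).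
Proof.
move=> /andP[t0 t1] SM Sbig.
have S0 : (0 < #|S|)%N.
  by rewrite -(ltr_nat R); apply: le_lt_trans Sbig; rewrite mulr_ge0 ?expR_ge0.
have [p0 p0S] : exists p, p \in S by apply/card_gt0P.
have p0M : p0 \in matchings H by move/fintype.subsetP: SM; exact.
have M0 : 0 < (#|matchings H|%:R : R) by rewrite ltr0n; apply/card_gt0P; exists p0.
have H0 : 0 < ((#|H|)`!%:R : R) by rewrite ltr0n fact_gt0.
pose dS p : nat := hamm p [arg min_(q < p0 in S) hamm p q].
have dSP p : (exists2 q, q \in S & dS p = hamm p q) /\ forall q, q \in S -> (dS p <= hamm p q)%N.
  rewrite /dS; case: arg_minnP => // q qS qmin; split; first by exists q.
  by move=> q'; exact: qmin.
pose F (g : {perm H}) : R := (dS (p0 ^ g)%g)%:R.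
have dS4 p x y : p \in matchings H -> (dS (p ^ tperm x y)%g <= dS p + 4)%N.
  move=> pM; have [[q qS ->] _] := dSP p; have [_ h] := dSP (p ^ tperm x y)%g.
  apply: leq_trans (h _ qS) _; apply: leq_trans (hamm_triangle _ p _) _.
  by rewrite addnC leq_add2l conj_tperm_diff.
have Fc g x y : `|F (tperm x y * g)%g - F g| <= 4.
  have e : (p0 ^ (tperm x y * g) = (p0 ^ g) ^ tperm (g x) (g y))%g.
    by rewrite -tpermJ -conjgM conjgE mulKVg.
  have gM := matchings_conj g p0M.
  have e' : (p0 ^ g = (p0 ^ (tperm x y * g)) ^ tperm (g x) (g y))%g.
    by rewrite e -conjgM tperm2 conjg1.
  rewrite /F ler_norml; apply/andP; split.
    rewrite lerBrDr addrC -lerBrDr opprK -natrD ler_nat {1}e'.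
    exact/dS4/matchings_conj.
  by rewrite lerBlDr addrC -natrD ler_nat e dS4.
have key (T : {set {perm H}}) : T \subset matchings H ->
    #|T|%:R = #|[set g | (p0 ^ g)%g \in T]|%:R / (#|H|)`!%:R * #|matchings H|%:R :> R.
  move=> TM; have := card_conj_preim p0M TM => /(congr1 (fun n => n%:R : R)).
  rewrite !natrM mulrAC => ->; rewrite mulfK// lt0r_neq0//.
set e := t ^+ 2 / 2048 * #|H|%:R in Sbig *.
have eE : t ^+ 2 / (128 * 4 ^+ 2) * #|H|%:R = e.
  by rewrite /e; congr (_ / _ * _); rewrite expr2 -!natrM.
have c40 : 0 < (4 : R) by [].
have t8 : 0 < t <= 8 * 4 by rewrite t0 (le_trans t1)// -natrM ler1n.
have := @perm_blowup R H F 4 t Fc c40 t8; rewrite eE.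
have Sb : (#|H|)`!%:R * expR (- e) < #|[set g | F g <= 0]|%:R.
  have : #|S|%:R <= #|[set g | F g <= 0]|%:R / (#|H|)`!%:R * #|matchings H|%:R :> R.
    rewrite (key _ SM) ler_pM2r// ler_pM2r ?invr_gt0// ler_nat; apply: subset_leq_card.
    apply/fintype.subsetP => g; rewrite !inE => gS.
    have [_ /(_ _ gS)] := dSP (p0 ^ g)%g; rewrite /F /hamm (_ : [set _ | _] = finset.set0).
      by rewrite cards0 leqn0 => /eqP->.
    by apply/setP => h; rewrite !inE eqxx.
  move=> /(lt_le_trans Sbig); rewrite mulrC ltr_pM2r//.
  by rewrite ltr_pdivlMr// mulrC.
move=> /(_ Sb) h; set T := [set p in _ | _].
have TM : T \subset matchings H by apply/fintype.subsetP => p; rewrite inE => /andP[].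
rewrite (key _ TM).
rewrite mulrC ler_pM2l// ler_pdivrMr// mulrC; apply: le_trans h.
rewrite ler_nat; apply: subset_leq_card; apply/fintype.subsetP => g; rewrite !inE.
move=> /andP[_ /forallP h]; rewrite /F.
have [[q qS ->] _] := dSP (p0 ^ g)%g; have := h q; by rewrite qS.
Qed.

Variable A : finType.
Variable sw : A -> A.
Hypothesis swK : involutive sw.

Definition consistent H (p : {perm H}) (u : H -> A) : bool :=
  [forall h, u (p h) == sw (u h)].

(** One half-edge of each matched pair, chosen by enumeration order. A consistent labeling is
    determined by its restriction to it, which is why entropies come with the factor [#|H| / 2]. *)
Definition half H (p : {perm H}) : finType := {h : H | (enum_rank h < enum_rank (p h))%N}.

Definition freq H (u : H -> A) (a : A) : R := (cnt u a)%:R / #|H|%:R.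

Section Orientation.
Variables (H : finType) (p : {perm H}).
Hypothesis pM : p \in matchings H.

Let first h := (enum_rank h < enum_rank (p h))%N.

Let firstN h : first (p h) = ~~ first h.
Proof.
have /matchingsP[pK pn] := pM; rewrite /first pK -leqNgt [RHS]leq_eqVlt.
case: (eqVneq (enum_rank (p h) : nat) (enum_rank h)) => [/val_inj/enum_rank_inj e|//].
by have := pn h; rewrite e eqxx.
Qed.

Let I : finType := half p.

Lemma card_orientation : (#|I|.*2 = #|H|)%N.
Proof.
have -> : #|I| = #|[set h | first h]|.
  by rewrite card_sig cardsE; apply: eq_card.
rewrite -addnn -(cardsC [set h | first h]); congr (_ + _)%N.
rewrite -(card_preimset _ (@perm_inj _ p)); apply: eq_card => h.
by rewrite !inE firstN.
Qed.

Lemma sum_orientation (g : H -> R) : (forall h, g (p h) = g h) ->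
  \sum_h g h = 2 * \sum_(i : I) g (val i).
Proof.
have /matchingsP[pK pn] := pM.
move=> gp; have e : \sum_(i : I) g (val i) = \sum_(h | first h) g h.
  rewrite [RHS](reindex_omap (val : I -> H) insub) /=; last by move=> h fh; rewrite insubT.
  by apply: eq_bigl => i; rewrite valK eqxx andbT; apply/esym; exact: (valP i).
rewrite e (bigID first) /= mulr_natl mulr2n; congr (_ + _).
rewrite (reindex_inj (inv_inj pK)) /=; apply: eq_big => [h|h _]; last by rewrite gp.
by rewrite firstN negbK.
Qed.

(** Restricted to [half p], the labelings counted remain distinct, and each weighs
    [expR (- (#|H| / 2 * hent q))] under the product of [q]; the consistency of [u0] makes
    [q = freq u0] invariant under [sw]. *)
Lemma card_consistent_class_le (u0 : H -> A) : consistent p u0 ->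
  #|[set u : {ffun H -> A} | [forall a, cnt u a == cnt u0 a] && consistent p u]|%:R
    <= expR (#|H|%:R / 2 * hent (freq u0)).
Proof.
set q := freq u0; move=> cons0; have /forallP cu0 := cons0; set S := finset _.
have [H0|H0] := eqVneq #|H| 0%N.
  rewrite H0 !mul0r expR0 (_ : 1 = 1%:R)// ler_nat.
  apply: leq_trans (max_card _) _; by rewrite card_ffun H0 expn0.
have Hp : 0 < (#|H|%:R : R) by rewrite ltr0n lt0n.
have qp : is_pmf q.
  split=> [a|]; first by rewrite divr_ge0.
  by rewrite -mulr_suml (sum_cnt_card R u0) divff// lt0r_neq0.
pose rs (u : {ffun H -> A}) : {ffun I -> A} := [ffun i => u (val i)].
have rs_inj : {in S &, injective rs}.
  move=> u u'; rewrite !inE => /andP[_ /forallP cu] /andP[_ /forallP cu'] /ffunP e.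
  have e1 h : first h -> u h = u' h.
    by move=> fh; have := e (exist _ h fh); rewrite !ffunE.
  apply/ffunP => h; have [/e1//|nf] := boolP (first h).
  have /matchingsP[pK _] := pM.
  apply: (can_inj swK); rewrite -(eqP (cu h)) -(eqP (cu' h)).
  by apply: e1; rewrite firstN.
have wS u : u \in S -> \prod_i q (rs u i) = expR (- (#|H|%:R / 2 * hent q)).
  rewrite inE => /andP[/forallP cl /forallP cu].
  have qpos h : 0 < q (u h).
    rewrite divr_gt0// ltr0n -(eqP (cl (u h))); apply/card_gt0P; exists h.
    by rewrite inE.
  have qsw a : q (sw a) = q a.
    congr (_%:R / _); rewrite /cnt -(card_preimset _ (@perm_inj _ p)); apply: eq_card => h.
    by rewrite !inE (eqP (cu0 h)) (can_eq swK).
  rewrite (eq_bigr (fun i => expR (ln (q (u (val i)))))); last first.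
    by move=> i _; rewrite ffunE lnK// posrE.
  rewrite -expR_sum; congr expR.
  have := sum_orientation (g := fun h => ln (q (u h))).
  rewrite (sum_cnt u (fun a => ln (q a))) => e.
  have -> : hent q = - (\sum_a (cnt u a)%:R * ln (q a)) / #|H|%:R.
    rewrite /hent mulNr; congr (- _); rewrite mulr_suml; apply: eq_bigr => a _.
    by rewrite {1}/q /freq -(eqP (cl a)) mulrAC.
  rewrite e => [|h]; last by rewrite (eqP (cu h)) qsw.
  by field; rewrite lt0r_neq0.
rewrite -[leRHS]mul1r -ler_pdivrMr ?expR_gt0// -expRN.
have [_ tot] := pmf_iid I qp; rewrite -[leRHS]tot [leLHS]mulr_natl -sumr_const.
rewrite -(eq_bigr _ wS) -(big_imset (fun s : {ffun I -> A} => \prod_i q (s i)) rs_inj) /=.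
rewrite [leRHS](bigID (mem (rs @: S))) /= lerDl; apply: sumr_ge0 => s _.
by apply: prodr_ge0 => i _; case: qp.
Qed.

(** A labeling of the representatives extends consistently by [sw]. The counts of [a] and [sw a] add
    up, and the relative error survives because [q] is invariant under [sw]. *)
Lemma card_consistent_typ_ge (q : A -> R) (e : R) :
  (forall a, q (sw a) = q a) ->
  (#|[set s : {ffun I -> A} | typ q e s]| <=
   #|[set u : {ffun H -> A} | typ q e u && consistent p u]|)%N.
Proof.
move=> qsw; have /matchingsP[pK pn] := pM.
have fr h : first (if first h then h else p h).
  by case: ifP => // /negbT; rewrite firstN.
pose ext (s : {ffun I -> A}) : {ffun H -> A} :=
  [ffun h => let a := s (exist (fun x : H => is_true (first x)) _ (fr h)) in if first h then a else sw a].
have ext1 s (i : I) : ext s (val i) = s i.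
  have fi : first (val i) by exact: (valP i).
  have e' : exist (fun x : H => is_true (first x)) _ (fr (val i)) = i.
    by apply: val_inj; rewrite /= fi.
  by rewrite ffunE /= e' fi.
have ext2 s (i : I) : ext s (p (val i)) = sw (s i).
  have nf : first (p (val i)) = false by rewrite firstN; apply/negbF; exact: (valP i).
  have e' : exist (fun x : H => is_true (first x)) _ (fr (p (val i))) = i.
    by apply: val_inj; rewrite /= nf pK.
  by rewrite ffunE /= e' nf.
have split h : (exists i : I, h = val i) \/ (exists i : I, h = p (val i)).
  have [fh|nfh] := boolP (first h); first by left; exists (exist _ h fh).
  have fph : first (p h) by rewrite firstN.
  by right; exists (exist _ (p h) fph); rewrite /= pK.
have ext_inj : injective ext.
  by move=> s s' /ffunP e'; apply/ffunP => i; have := e' (val i); rewrite !ext1.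
rewrite -(card_imset _ ext_inj); apply: subset_leq_card.
apply/fintype.subsetP => _ /imsetP[s + ->]; rewrite !inE => /forallP ts.
have cntE a : (cnt (ext s) a = cnt s a + cnt s (sw a))%N.
  have -> : cnt (ext s) a = #|(val @: [set i | s i == a]) :|: ((p \o val) @: [set i | s i == sw a])|.
    apply: eq_card => h; rewrite !inE; apply/idP/orP => [/eqP eh|[] /imsetP[i + ->]].
    - case: (split h) => -[i hi]; [left|right]; apply/imsetP; exists i => //.
        by rewrite inE -eh hi ext1.
      by rewrite inE -eh hi ext2 swK.
    - by rewrite inE ext1.
    - by rewrite inE ext2 => /eqP->; rewrite swK.
  rewrite cardsU disjoint_setI0 ?cards0 ?subn0; last first.
    rewrite -setI_eq0; apply/eqP/setP => h; rewrite !inE; apply/negbTE/negP => /andP[].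
    move=> /imsetP[i _ ->] /imsetP[j _ ij]; have fi : first (val i) := valP i.
    have fj : first (val j) := valP j.
    by move: fi; rewrite ij /= firstN fj.
  have vi : injective (val : I -> H) by exact: val_inj.
  have pvi : injective (p \o (val : I -> H)) by move=> i j /perm_inj/val_inj.
  by rewrite (card_imset _ vi) (card_imset _ pvi).
apply/andP; split; last first.
  apply/forallP => h; case: (split h) => -[i ->]; first by rewrite ext1 ext2.
  by rewrite pK ext1 ext2 swK.
have HI : #|H|%:R = 2 * #|I|%:R :> R by rewrite -card_orientation -muln2 natrM mulrC.
apply/forallP => a; have := ts a; have := ts (sw a); rewrite qsw => h1 h2.
rewrite cntE natrD HI (_ : _ - _ = ((cnt s a)%:R - #|I|%:R * q a) + ((cnt s (sw a))%:R - #|I|%:R * q a)); last by ring.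
apply: (le_trans (ler_normD _ _)); apply: le_trans (lerD h2 h1) _.
by rewrite le_eqVlt; apply/orP; left; apply/eqP; ring.
Qed.

End Orientation.

(** Double counting of matchings against the class [C] of [u0]: by conjugation every labeling in [C]
    is consistent with equally many matchings, a matching is consistent with at most
    [expR (#|H| / 2 * hent q)] of them, and [C] has about [expR (#|H| * hent q)] elements. *)
Lemma card_consistent_le H (u0 : H -> A) :
  #|[set p in matchings H | consistent p u0]|%:R <=
   #|matchings H|%:R * expR (- (#|H|%:R / 2 * hent (freq u0)) + #|A|%:R * (1 + ln #|H|.+1%:R)).
Proof.
set q := freq u0; set C := [set u : {ffun H -> A} | [forall a, cnt u a == cnt u0 a]].
have Cge := class_size_ge R u0; rewrite -/C in Cge.
set m := #|[set p in matchings H | consistent p u0]|.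
have mE u : u \in C -> #|[set p in matchings H | consistent p u]| = m.
  rewrite inE => /forallP cu; have [g] := rearrange u0 u.
  rewrite big1 => [|a _]; last by rewrite (eqP (cu a)) subnn.
  rewrite leqn0 cards_eq0 => /eqP/setP gP.
  have ug x : u0 (g x) = u x by have := gP x; rewrite !inE => /negbFE/eqP.
  rewrite /m -(card_imset _ (@conjg_inj _ g)); apply: eq_card => p.
  apply/imsetP/idP => [[p' + ->]|].
    rewrite inE => /andP[pM' /forallP cp]; rewrite inE matchings_conj//=.
    by apply/forallP => h; rewrite conjgE !permM ug (eqP (cp _)) -ug permKV.
  rewrite inE => /andP[pM' /forallP cp]; exists (p ^ g^-1)%g; last by rewrite conjgKV.
  rewrite inE matchings_conj//=; apply/forallP => h; rewrite conjgE invgK !permM -!ug permKV.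
  by rewrite (eqP (cp _)).
have dbl : (#|C| * m = \sum_(p in matchings H) #|[set u : {ffun H -> A} | [forall a, cnt u a == cnt u0 a] && consistent p u]|)%N.
  rewrite -sum_nat_const -(eq_bigr _ mE).
  under eq_bigr do rewrite -sum1_card big_mkcond.
  rewrite exchange_big /= (bigID (mem (matchings H))) /= [X in (_ + X)%N]big1 ?addn0.
    apply: eq_bigr => p pM; rewrite -sum1_card [RHS]big_mkcond [LHS]big_mkcond; apply: eq_bigr => u _.
    by rewrite !inE pM /=; case: [forall a, _].
  by move=> p npM; apply: big1 => u _; rewrite inE (negbTE npM).
have C0 : 0 < (#|C|%:R : R) by apply: lt_le_trans Cge; rewrite expR_gt0.
have h1 : #|C|%:R * m%:R <= #|matchings H|%:R * expR (#|H|%:R / 2 * hent q).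
  rewrite -natrM dbl natr_sum mulr_natl -sumr_const; apply: ler_sum => p pM.
  set S := finset _; have [->|/set0Pn[u]] := eqVneq S finset.set0.
    by rewrite cards0 expR_ge0.
  rewrite inE => /andP[/forallP cu up]; have := card_consistent_class_le pM up.
  have -> : freq u = q by apply/funext => a; rewrite /q /freq (eqP (cu a)).
  rewrite (_ : [set _ | _] = S)//; apply/setP => u'; rewrite !inE; congr (_ && _).
  by apply: eq_forallb => a; rewrite (eqP (cu a)).
have qE : - (\sum_a (cnt u0 a)%:R * ln ((cnt u0 a)%:R / #|H|%:R)) = #|H|%:R * hent q.
  rewrite /hent mulrN mulr_sumr; congr (- _); apply: eq_bigr => a _.
  have [H0|H0] := eqVneq #|H| 0%N; last by rewrite /q /freq; field; rewrite pnatr_eq0.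
  rewrite /q /freq H0 (_ : cnt u0 a = 0%N) ?mul0r ?mulr0//.
  by apply/eqP; rewrite -leqn0 -H0 max_card.
rewrite qE in Cge; set k := #|A|%:R * _ in Cge *.
rewrite -(ler_pM2l C0); apply: (le_trans h1).
rewrite mulrCA ler_wpM2l//; apply: le_trans (ler_wpM2r (expR_ge0 _) Cge).
by rewrite -expRD ler_expR le_eqVlt; apply/orP; left; apply/eqP; field.
Qed.

Definition dfc H (p : {perm H}) (u : H -> A) : {set H} := [set h | u (p h) != sw (u h)].

(** Exact consistency may be impossible for the given [u0], so defects are allowed. A typical [u]
    differs from a rearrangement of [u0] at no more than [2 * e * #|H|] positions, and conjugation
    turns a matching consistent with [u] into one with at most twice as many defects for [u0]. It
    remains to double count the consistent pairs with typical [u]. *)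
Lemma card_few_defects_ge (q : A -> R) (e : R) : is_pmf q -> (forall a, q (sw a) = q a) ->
  0 < e <= 1 -> exists N0 : nat, forall H (u0 : H -> A), (N0 <= #|H|)%N -> typ q e u0 ->
  #|matchings H|%:R * (2^-1 * expR (- ((1 + 3 * e) * (#|H|%:R / 2) * hent q)))
    <= #|[set p in matchings H | #|dfc p u0|%:R <= 4 * e * #|H|%:R]|%:R.
Proof.
move=> qp qsw e01; have [N0 N0P] := card_typ_ge qp e01.
exists N0.*2 => H u0 HN tu0.
set K := #|[set p in matchings H | _]|.
have e0 : 0 < e by case/andP: e01.
have each u : typ q e u -> (#|[set p in matchings H | consistent p u]| <= K)%N.
  move=> tu; have [g gP] := rearrange u0 u.
  have gd : #|[set h | u0 (g h) != u h]|%:R <= 2 * e * #|H|%:R.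
    apply: (@le_trans _ _ (\sum_a (cnt u a - cnt u0 a)%N%:R)).
      by rewrite -natr_sum ler_nat.
    apply: (@le_trans _ _ (\sum_a 2 * e * (#|H|%:R * q a))); last first.
      by rewrite -mulr_sumr -mulr_sumr; have [_ ->] := qp; rewrite mulr1.
    apply: ler_sum => a _.
    have := forallP tu a; have := forallP tu0 a; rewrite !ler_norml => h1 h2.
    have q0 : 0 <= e * (#|H|%:R * q a) by rewrite mulr_ge0 ?(ltW e0)// mulr_ge0//; case: qp.
    have [le|lt] := leqP (cnt u0 a) (cnt u a); first by rewrite natrB//; lra.
    by rewrite (eqP (ltnW lt)); rewrite -mulrA; lra.
  rewrite -(card_imset _ (@conjg_inj _ g)); apply: subset_leq_card.
  apply/fintype.subsetP => _ /imsetP[p + ->]; rewrite inE => /andP[pM /forallP cp].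
  rewrite inE matchings_conj//=; set S := [set h | _] in gd.
  have sub : dfc (p ^ g)%g u0 \subset g @: (S :|: p @^-1: S).
    apply/fintype.subsetP => h; rewrite inE => hd; apply/imsetP; exists (g^-1 h)%g; last by rewrite permKV.
    rewrite !inE; apply: contraR hd; rewrite negb_or !negbK => /andP[/eqP h1 /eqP h2].
    by rewrite conjgE !permM h2 (eqP (cp _)) -h1 permKV.
  apply: (@le_trans _ _ (#|S| + #|S|)%:R).
    rewrite ler_nat; apply: leq_trans (subset_leq_card sub) _.
    apply: leq_trans (leq_imset_card _ _) _.
    by rewrite -{2}(card_preimset S (@perm_inj _ p)) cardsU leq_subr.
  by rewrite natrD; lra.
have dbl : (#|matchings H|%:R * (2^-1 * expR ((1 - e) * (#|H|%:R / 2) * hent q)) : R)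
    <= #|[set u : {ffun H -> A} | typ q e u]|%:R * K%:R.
  apply: (@le_trans _ _ (\sum_(p in matchings H) #|[set u : {ffun H -> A} | typ q e u && consistent p u]|)%:R).
    rewrite natr_sum mulr_natl -sumr_const; apply: ler_sum => p pM.
    have HI := card_orientation pM.
    have := N0P (half p); rewrite -leq_double HI => /(_ HN) h.
    apply: (@le_trans _ _ #|[set s : {ffun half p -> A} | typ q e s]|%:R); last first.
      by rewrite ler_nat; exact: card_consistent_typ_ge.
    rewrite (_ : #|H|%:R / 2 = #|half p|%:R)//.
    by rewrite -HI -muln2 natrM mulfK.
  rewrite -natrM ler_nat -sum_nat_const.
  apply: (@leq_trans (\sum_(u in [set u : {ffun H -> A} | typ q e u]) #|[set p in matchings H | consistent p u]|)); last first.
    by apply: leq_sum => u; rewrite inE; exact: each.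
  apply: eq_leq.
  under eq_bigr do rewrite -sum1_card big_mkcond.
  under [RHS]eq_bigr do rewrite -sum1_card big_mkcond.
  rewrite exchange_big /= [RHS]big_mkcond; apply: eq_bigr => u _.
  rewrite [in RHS]inE; case tu: (typ q e u) => /=; last first.
    by apply: big1 => p _; rewrite inE tu.
  rewrite [LHS]big_mkcond; apply: eq_bigr => p _.
  by rewrite !inE tu; case: (p \in matchings H).
have tle := card_typ_le H e qp.
have := le_trans dbl (ler_wpM2r (ler0n R K) tle).
rewrite [X in _ <= X -> _]mulrC -ler_pdivrMr ?expR_gt0// -expRN.
apply: le_trans; rewrite -!mulrA ler_wpM2l// ler_wpM2l ?invr_ge0// -expRD ler_expR.
by rewrite le_eqVlt; apply/orP; left; apply/eqP; field.
Qed.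

End Matchings.

(** * Second moment method *)

Section Counting.
Variables (R : realType) (D : nat).
Implicit Types (M N : finType).

Lemma log_small (K delta : R) (c : nat) : 0 < delta ->
  exists n0 : nat, forall n : nat, (n0 <= n)%N -> K * (1 + ln (c * n).+1%:R) <= delta * n%:R.
Proof.
move=> d0; wlog K0 : K / 0 < K.
  move=> h; have [K0|K0] := ltP 0 K; first exact: h.
  have [n0 hn] := h 1 ltr01; exists n0 => n /hn h1; apply: le_trans h1.
  by rewrite ler_wpM2r ?addr_ge0 ?ln_ge0 ?ler1n// (le_trans K0).
pose e := delta / (2 * K); have e0 : 0 < e by rewrite divr_gt0 ?mulr_gt0.
pose m := Num.max (2 * c%:R / e ^+ 2) (2 * K / delta).
exists (Num.bound `|m|) => n hn.
have mn : m <= n%:R.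
  apply: (le_trans (ler_norm _)); apply: (@le_trans _ _ (Num.bound `|m|)%:R); last by rewrite ler_nat.
  by apply/ltW/archi_boundP.
have [m1 m2] : 2 * c%:R / e ^+ 2 <= n%:R /\ 2 * K / delta <= n%:R.
  by move: mn; rewrite /m ge_max => /andP[].
have l : ln (c * n).+1%:R <= e * n%:R.
  rewrite -[leRHS]expRK ler_ln ?posrE ?expR_gt0//.
  apply: (@le_trans _ _ (1 + (e * n%:R) ^+ 2 / 2)).
    rewrite -natr1 addrC lerD2l natrM exprMn expr2 [n%:R ^+ 2]expr2.
    move: m1; rewrite ler_pdivrMr ?exprn_gt0// expr2 => /(ler_wpM2r (ler0n R n)); lra.
  exact: (expR_ge1Dxn 1 (mulr_ge0 (ltW e0) (ler0n R n))).
apply: (@le_trans _ _ (K + K * (e * n%:R))).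
  by rewrite mulrDr mulr1 lerD2l ler_wpM2l// ltW.
have -> : K * (e * n%:R) = delta / 2 * n%:R by rewrite /e; field; rewrite lt0r_neq0.
move: m2; rewrite ler_pdivrMr//; lra.
Qed.

(** Chain rule: [c x] is the reciprocal of the conditional probability of [x] given [T x]. *)
Lemma hent_push (X A : finType) (P : X -> R) (Q : A -> R) (T : X -> A) (c : X -> R) :
  is_pmf P -> (forall a, \sum_(x | T x == a) P x = Q a) -> (forall x, 0 < c x) ->
  (forall x, P x * c x = Q (T x)) -> hent P = hent Q + \sum_x P x * ln (c x).
Proof.
move=> [P0 P1] PQ c0 Pc.
have -> : hent Q = - \sum_x P x * ln (Q (T x)).
  rewrite /hent; congr (- _); rewrite [RHS](partition_big T predT)//=.
  apply: eq_bigr => a _; rewrite -PQ mulr_suml; apply: eq_bigr => x /eqP Tx.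
  by rewrite Tx PQ.
rewrite -sumrN -big_split /= /hent -sumrN; apply: eq_bigr => x _.
have [->|Px] := eqVneq (P x) 0; first by rewrite !mul0r oppr0 addr0.
have Pp : 0 < P x by rewrite lt_neqAle eq_sym Px P0.
by rewrite -Pc lnM ?posrE// mulrDr opprD subrK.
Qed.

Lemma trunc_act M k r (g : bg D r) : exists h, forall x : br D M r, (k <= r)%N ->
  trunc k (act g x) = act h (trunc k x).
Proof.
elim: k r g => [|k IH] r g; first by exists tt; case: r g.
case: r g => [|r] g; first by exists (bone D k.+1).
have [h hP] := fin_all_exists (fun i => IH r (g.2 i)).
exists (g.1, [ffun i => h i]) => -[m y] kr /=; congr pair; apply/ffunP => i.
by rewrite !ffunE hP.
Qed.

Lemma perm_lift n (s : 'S_n.+1) (i : 'I_n.+1) :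
  exists t : 'S_n, forall k, s (lift i k) = lift (s i) (t k).
Proof.
have f k : exists j, s (lift i k) = lift (s i) j.
  have := neq_lift i k; rewrite -(inj_eq (@perm_inj _ s)) => /unlift_some[j -> _].
  by exists j.
have [t tP] := fin_all_exists f.
have ti : injective t.
  by move=> k l e; apply: (@lift_inj _ i); apply: (@perm_inj _ s); rewrite !tP e.
by exists (perm ti) => k; rewrite permE.
Qed.

Lemma own_act M r (i : 'I_D.+1) (g : ng D D.+1 r) (z : star D M r) :
  exists h, own i (sact g z) = act h (own (g.1 i) z).
Proof.
case: r g z => [|r] g z; first by exists tt.
have [t tP] := perm_lift g.1 i.
have [h hP] := fin_all_exists (fun k => trunc_act M r (g.2 (lift i k))).
exists (t, [ffun k => h k]) => /=; congr pair; apply/ffunP => k.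
by rewrite !ffunE hP// tP.
Qed.

Lemma trunc0_act M r (g : bg D r) (x : br D M r) : trunc 0 (act g x) = trunc 0 x.
Proof. by case: r g x. Qed.

Lemma trunc0_own M r i (x : star D M r) : trunc 0 (own i x) = x.1.
Proof. by case: r x. Qed.

(** * Types of branches and patterns of vertices *)

Section Types.
Variables (M : finType) (r : nat).

(** Only orbits of branches are counted: the entropy inside the orbits cancels between the star and
    the edge term of [sig] ([sig_Plab]). *)
Definition ctype : finType := {set br D M r}.
(** For each direction the orbits on both sides of the edge, so that matched half-edges carry
    swapped pairs. *)
Definition pat : finType := {ffun 'I_D.+1 -> ctype * ctype}.

Definition patx (x : star D M r) : pat := [ffun i => (orb (own i x), orb (x.2 i))].

Definition patp (s : 'S_D.+1) (a : pat) : pat := [ffun i => a (s i)].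

Lemma patx_act g x : patx (sact g x) = patp g.1 (patx x).
Proof.
apply/ffunP => i; rewrite !ffunE /=; have [h ->] := own_act i g x.
by rewrite !orb_act.
Qed.

Lemma orb_gt0 (z : br D M r) : 0 < (#|orb z|%:R : R).
Proof. by rewrite ltr0n; apply/card_gt0P; exists z; exact: orb_refl. Qed.

Lemma Borb_orb (z x : br D M r) : Borb R z x * #|orb x|%:R = (orb x == orb z)%:R.
Proof.
rewrite BorbE; case: (orb_eqP x z) => [e|/eqP ne]; last by rewrite (negbTE ne) !mul0r.
by rewrite e eqxx mul1r mulVf// lt0r_neq0// orb_gt0.
Qed.

Lemma SB_pat (z x : star D M r) : SB R z x * \prod_i #|orb (x.2 i)|%:R =
  (\sum_(s : 'S_D.+1) (patp s (patx z) == patx x)%:R) / (D.+1)`!%:R.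
Proof.
rewrite SBE norbE mulrA mulrAC; congr (_ / _); rewrite -mulrA mulr_suml mulr_sumr.
apply: eq_bigr => s _; rewrite -big_split /=.
under eq_bigr do rewrite Borb_orb.
rewrite prod_indicator -natrM mulnb; congr (nat_of_bool _)%:R.
apply/andP/eqP => [[/eqP zx /forallP h]|/ffunP h].
  have [g gP] : exists g : 'I_D.+1 -> bg D r, forall i, x.2 i = act (g i) (z.2 (s i)).
    apply: (@fin_all_exists _ (fun=> bg D r) (fun i g => x.2 i = act g (z.2 (s i)))) => i.
    have /eqP/orb_eqP/imsetP[g _ ->] := h i.
    by exists g.
  have -> : x = sact (s, [ffun i => g i]) z.
    by rewrite [x]surjective_pairing /sact zx; congr pair; apply/ffunP => i; rewrite !ffunE gP.
  by rewrite patx_act.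
split; last by apply/forallP => i; have := h i; rewrite !ffunE => -[_ ->].
(* The root color is not recorded in a pattern, but an [own] orbit determines it. *)
have := h ord0; rewrite !ffunE => -[/esym/orb_eqP/imsetP[g _] e _].
by rewrite -(trunc0_own ord0 x) e trunc0_act trunc0_own.
Qed.

Definition Hb (x : br D M r) : R := ln #|orb x|%:R.

Lemma Borb_Hb z : \sum_x Borb R z x * Hb x = Hb z.
Proof.
rewrite (eq_bigr (fun x => Borb R z x * Hb z)) => [|x _].
  by rewrite -mulr_suml; have [_ ->] := Borb_pmf R z; rewrite mul1r.
rewrite BorbE; case: (orb_eqP x z) => [e|_]; last by rewrite !mul0r.
by rewrite /Hb e.
Qed.

Lemma SB_Hb (z : star D M r) : \sum_x SB R z x * \sum_i Hb (x.2 i) = \sum_i Hb (z.2 i).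
Proof.
rewrite /SB; under eq_bigr do rewrite mulrAC mulr_suml.
rewrite -mulr_suml exchange_big /= (eq_bigr (fun=> \sum_i Hb (z.2 i))) => [|g _].
  by rewrite sumr_const -[X in X / _]mulr_natr mulfK// pnatr_eq0 -lt0n card_ng_gt0.
rewrite (bigD1 (sact g z))//= eqxx mul1r [X in _ + X]big1 ?addr0 => [|x /negbTE]; last first.
  by rewrite eq_sym => ->; rewrite mul0r.
rewrite [RHS](reindex_inj (@perm_inj _ g.1)) /=.
by apply: eq_bigr => i _; rewrite ffunE /Hb orb_act.
Qed.

Section Config.
Variables (V : finType) (p : V * 'I_D.+1 -> V * 'I_D.+1) (f : V -> M).
Hypothesis V0 : (0 < #|V|)%N.
Hypothesis pK : involutive p.
Let n : R := #|V|%:R.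

Definition cpat (v : V) : pat := [ffun i => (orb (unf p f r (v, i)), orb (unf p f r (p (v, i))))].

Lemma patx_sunf v : patx (sunf p f r v) = cpat v.
Proof. by apply/ffunP => i; rewrite !ffunE own_sunf. Qed.

(** Empirical law of the patterns, symmetrized over the order of the directions. *)
Definition pbar (T : V -> pat) (a : pat) : R :=
  (\sum_v (\sum_(s : 'S_D.+1) (patp s (T v) == a)%:R) / (D.+1)`!%:R) / n.

Definition cth (T : V -> pat) (h : V * 'I_D.+1) : ctype * ctype := T h.1 h.2.

Let n0 : n != 0. Proof. by rewrite pnatr_eq0 -lt0n. Qed.

(* [sig P r] is the annealed entropy of level [r.+1]. *)
Definition sig (P : forall r, star D M r -> R) (r : nat) : R :=
  hent (P r) - D.+1%:R / 2 * hent (edge P (r := r)).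

Lemma sum_Plab_patx a : \sum_(x | patx x == a) Plab R p f x = pbar cpat a.
Proof.
rewrite /Plab -mulr_suml; congr (_ / _); rewrite exchange_big /=; apply: eq_bigr => v _.
rewrite big_mkcond /= (eq_bigr (fun x => (\sum_g (sact g (sunf p f r v) == x)%:R *
   (patx x == a)%:R) / #|ng D D.+1 r|%:R)) => [|x _]; last first.
  by rewrite /SB; case: ifP => _; [under [in RHS]eq_bigr do rewrite mulr1
    |rewrite big1 ?mul0r// => g _; rewrite mulr0].
rewrite -mulr_suml exchange_big /=.
rewrite (eq_bigr (fun g : ng D D.+1 r => (patp g.1 (cpat v) == a)%:R)) => [|g _]; last first.
  rewrite (bigD1 (sact g (sunf p f r v)))//= eqxx mul1r big1 ?addr0 => [|x /negbTE]; last first.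
    by rewrite eq_sym => ->; rewrite mul0r.
  by rewrite patx_act patx_sunf.
rewrite -(pair_bigA _ (fun (s : 'S_D.+1) (g : {ffun 'I_D.+1 -> bg D r}) => (patp s (cpat v) == a)%:R)) /=.
under eq_bigr do rewrite sumr_const -[_ *+ #|_|]mulr_natr.
rewrite -mulr_suml card_prod natrM card_Sn -mulrA; congr (_ * _).
rewrite invfM mulrCA mulfV ?mulr1// pnatr_eq0 -lt0n.
by apply/card_gt0P; exists [ffun=> bone D r].
Qed.

Lemma Plab_patx x : Plab R p f x * \prod_i #|orb (x.2 i)|%:R = pbar cpat (patx x).
Proof.
rewrite /Plab mulrAC; congr (_ / _); rewrite mulr_suml; apply: eq_bigr => v _.
by rewrite SB_pat patx_sunf.
Qed.

(** Given its pattern, a star is uniform over the orbits of its [D.+1] outer branches; given its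
    types, an edge is uniform over the orbits at both ends. With [G] the sum of the log orbit sizes
    over all half-edges, the entropies exceed those of patterns and types by [G / n] and
    [2 * G / (n * D.+1)], which cancel in [sig]. *)
Lemma sig_Plab : sig (Plab R p f) r =
  hent (pbar cpat) - D.+1%:R / 2 * hent (freq R (cth cpat)).
Proof.
have [pm _ _ _] := Plab_inv R f V0 pK.
have e1 : hent (Plab R p f (r := r)) = hent (pbar cpat) +
    \sum_(x : star D M r) Plab R p f x * ln (\prod_i #|orb (x.2 i)|%:R).
  apply: (hent_push (pm r) sum_Plab_patx) => x; last exact: Plab_patx.
  by apply: prodr_gt0 => i _; exact: orb_gt0.
have H0 : #|{: V * 'I_D.+1}|%:R != 0 :> R.
  by rewrite card_prod card_ord natrM mulf_neq0// pnatr_eq0.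
set E := edge (Plab R p f) (r := r).
have EE ab : E ab = (\sum_h Borb R (unf p f r h) ab.1 * Borb R (unf p f r (p h)) ab.2)
   / #|{: V * 'I_D.+1}|%:R by case: ab => a b; rewrite /E edge_Plab.
have Epmf : is_pmf E.
  split=> [ab|].
    rewrite EE divr_ge0// sumr_ge0// => h _.
    by rewrite mulr_ge0//; have [] := Borb_pmf R (unf p f r h) => // _ _; have [] := Borb_pmf R (unf p f r (p h)).
  under eq_bigr do rewrite EE; rewrite -mulr_suml exchange_big /= (eq_bigr (fun=> 1)).
    by rewrite sumr_const divff.
  move=> h _; rewrite -(pair_bigA _ (fun a b => Borb R (unf p f r h) a * Borb R (unf p f r (p h)) b)) /=.
  under eq_bigr do rewrite -mulr_sumr.
  have [_ ->] := Borb_pmf R (unf p f r (p h)); under eq_bigr do rewrite mulr1.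
  by have [_ ->] := Borb_pmf R (unf p f r h).
pose T (ab : br D M r * br D M r) := (orb ab.1, orb ab.2).
have thE h : cth cpat h = (orb (unf p f r h), orb (unf p f r (p h))).
  by case: h => v i; rewrite /cth /= ffunE.
have Ec ab : E ab * (#|orb ab.1|%:R * #|orb ab.2|%:R) = freq R (cth cpat) (T ab).
  rewrite EE mulrAC /freq; congr (_ / _); rewrite mulr_suml /cnt -sum_indicator.
  apply: eq_bigr => h _; rewrite mulrACA !Borb_orb -natrM mulnb; congr (nat_of_bool _)%:R.
  by rewrite thE /T xpair_eqE eq_sym; congr (_ && _); rewrite eq_sym.
have EQ c : \sum_(ab | T ab == c) E ab = freq R (cth cpat) c.
  rewrite /freq; under eq_bigr do rewrite EE; rewrite -mulr_suml; congr (_ / _).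
  rewrite exchange_big /= /cnt -sum_indicator; apply: eq_bigr => h _.
  rewrite thE; case: eqP => [<-|ne].
    transitivity (\sum_ab Borb R (unf p f r h) ab.1 * Borb R (unf p f r (p h)) ab.2).
      rewrite [RHS](bigID (fun ab => T ab == (orb (unf p f r h), orb (unf p f r (p h))))) /=.
      rewrite [X in _ + X]big1 ?addr0// => -[a b] /=; rewrite xpair_eqE negb_and.
      rewrite !BorbE /=; case: (orb_eqP a (unf p f r h)) => [->|]; last by rewrite !mul0r.
      rewrite eqxx /=; case: (orb_eqP b (unf p f r (p h))) => [->|]; last by rewrite !mul0r mulr0.
      by rewrite eqxx.
    rewrite -(pair_bigA _ (fun a b => Borb R (unf p f r h) a * Borb R (unf p f r (p h)) b)) /=.
    under eq_bigr do rewrite -mulr_sumr.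
    have [_ ->] := Borb_pmf R (unf p f r (p h)); under eq_bigr do rewrite mulr1.
    by have [_ ->] := Borb_pmf R (unf p f r h).
  apply: big1 => -[a b] /=; rewrite /T /= => /eqP Tc.
  rewrite !BorbE; case: (orb_eqP a (unf p f r h)) => [ea|]; last by rewrite !mul0r.
  case: (orb_eqP b (unf p f r (p h))) => [eb|]; last by rewrite !mul0r mulr0.
  by exfalso; apply: ne; rewrite -Tc ea eb.
have := hent_push (T := T) (c := fun ab => #|orb ab.1|%:R * #|orb ab.2|%:R) Epmf EQ.
move=> /(_ (fun ab => mulr_gt0 (orb_gt0 _) (orb_gt0 _)) Ec) eE.
rewrite /sig e1 eE; set A := \sum_x _; set B := \sum_x _.
suff : A = D.+1%:R / 2 * B by move->; ring.
pose G := \sum_h Hb (unf p f r h).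
have GP : \sum_h Hb (unf p f r (p h)) = G.
  by rewrite /G [RHS](reindex_inj (inv_inj pK)).
have -> : A = G / n.
  rewrite /A (eq_bigr (fun x => (\sum_v SB R (sunf p f r v) x * \sum_i Hb (x.2 i)) / n)) => [|x _]; last first.
    rewrite /Plab mulrAC; congr (_ / _); rewrite mulr_suml; apply: eq_bigr => v _; congr (_ * _).
    rewrite -[LHS]expRK -[RHS]expRK; congr ln.
    rewrite expR_sum lnK ?posrE ?prodr_gt0//; last by move=> i _; exact: orb_gt0.
    by apply: eq_bigr => i _; rewrite /Hb lnK// posrE orb_gt0.
  rewrite -mulr_suml exchange_big /=; congr (_ / _); rewrite -GP.
  rewrite (eq_bigr (fun v => \sum_i Hb (unf p f r (p (v, i))))) => [|v _].
    by rewrite pair_bigA /=; apply: eq_bigr => -[].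
  by rewrite SB_Hb; apply: eq_bigr => i _; rewrite ffunE.
have -> : B = 2 * G / #|{: V * 'I_D.+1}|%:R.
  rewrite /B (eq_bigr (fun ab => (\sum_h Borb R (unf p f r h) ab.1 * Borb R (unf p f r (p h)) ab.2
     * (Hb ab.1 + Hb ab.2)) / #|{: V * 'I_D.+1}|%:R)) => [|ab _]; last first.
    rewrite EE mulrAC; congr (_ / _); rewrite mulr_suml; apply: eq_bigr => h _; congr (_ * _).
    by rewrite lnM ?posrE ?orb_gt0.
  rewrite -mulr_suml exchange_big /=; congr (_ / _); rewrite mulr_natl mulr2n -{2}GP -big_split /=.
  apply: eq_bigr => h _; rewrite -(pair_bigA _ (fun a b => Borb R (unf p f r h) a * Borb R (unf p f r (p h)) b * (Hb a + Hb b))) /=.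
  transitivity (\sum_a (Borb R (unf p f r h) a * Hb a + Borb R (unf p f r h) a * Hb (unf p f r (p h)))).
    apply: eq_bigr => a _; rewrite -(Borb_Hb (unf p f r (p h))).
    have [_ e2] := Borb_pmf R (unf p f r (p h)); rewrite -[X in X + _]mulr1 -e2 !mulr_sumr -big_split /=.
    by apply: eq_bigr => b _; ring.
  rewrite big_split /= Borb_Hb -mulr_suml; have [_ ->] := Borb_pmf R (unf p f r h).
  by rewrite mul1r.
have dd : (D.+1%:R : R) != 0 by rewrite pnatr_eq0.
rewrite card_prod card_ord natrM -/n; move: (D.+1%:R : R) dd => d' dd; field.
by rewrite n0 dd.
Qed.

End Config.

Section Upper.
Variable V : finType.
Hypothesis V0 : (0 < #|V|)%N.
Let n : R := #|V|%:R.
Let n0 : n != 0. Proof. by rewrite pnatr_eq0 -lt0n. Qed.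
Implicit Type T : V -> pat.

Lemma pbarE T a : pbar T a =
  (\sum_b (cnt T b)%:R * ((\sum_(s : 'S_D.+1) (patp s b == a)%:R) / (D.+1)`!%:R)) / n.
Proof.
by rewrite /pbar (sum_cnt T (fun b => (\sum_(s : 'S_D.+1) (patp s b == a)%:R) / (D.+1)`!%:R)).
Qed.

Lemma factD : (D.+1)`!%:R != 0 :> R. Proof. by rewrite pnatr_eq0 -lt0n fact_gt0. Qed.

Lemma pbar_pmf T : is_pmf (pbar T).
Proof.
split=> [a|].
  by rewrite divr_ge0// sumr_ge0// => v _; rewrite divr_ge0// sumr_ge0.
rewrite -mulr_suml exchange_big /= (eq_bigr (fun=> 1)) ?sumr_const ?divff// => v _.
rewrite -mulr_suml exchange_big /= (eq_bigr (fun=> 1)) ?sumr_const ?card_Sn ?divff ?factD// => s _.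
by rewrite (bigD1 (patp s (T v)))//= eqxx big1 ?addr0// => a /negbTE; rewrite eq_sym => ->.
Qed.

Lemma patp_mul s t a : patp s (patp t a) = patp (s * t)%g a.
Proof. by apply/ffunP => i; rewrite !ffunE permM. Qed.

Lemma pbar_patp T s a : pbar T (patp s a) = pbar T a.
Proof.
rewrite /pbar; congr (_ / _); apply: eq_bigr => v _; congr (_ / _).
rewrite (reindex_inj (mulgI s)) /=; apply: eq_bigr => t _.
rewrite -patp_mul; congr (nat_of_bool _)%:R; apply/eqP/eqP => [|->//].
move=> /(congr1 (patp s^-1)); rewrite !patp_mul mulVg.
have p1 b : patp 1 b = b by apply/ffunP => i; rewrite ffunE perm1.
by rewrite mul1g !p1.
Qed.

(** Symmetrization does not affect the sum, since [pbar T] is invariant under [patp]. *)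
Lemma hent_pbar T : \sum_b (cnt T b)%:R * ln (pbar T b) = - (n * hent (pbar T)).
Proof.
rewrite /hent mulrN opprK mulr_sumr.
rewrite [RHS](eq_bigr (fun a => \sum_v (\sum_(s : 'S_D.+1) (patp s (T v) == a)%:R * ln (pbar T a)) / (D.+1)`!%:R)); last first.
  move=> a _; rewrite {1}/pbar -/n mulrA mulrCA mulfV// mulr1 mulr_suml.
  by apply: eq_bigr => v _; rewrite mulrAC mulr_suml.
rewrite exchange_big /= -(sum_cnt T (fun b => ln (pbar T b))); apply: eq_bigr => v _.
rewrite -mulr_suml exchange_big /= (eq_bigr (fun=> ln (pbar T (T v)))) => [|s _].
  by rewrite sumr_const card_Sn -[X in X / _]mulr_natr mulfK// factD.
rewrite (bigD1 (patp s (T v)))//= eqxx mul1r pbar_patp [X in _ + X]big1 ?addr0// => a /negbTE.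
by rewrite eq_sym => ->; rewrite mul0r.
Qed.

(** Each class of equal counts contributes at most 1, by [card_class_le] with the law [pbar], and
    there are at most [#|V|.+1 ^ #|pat|] classes. *)
Lemma sum_patterns : \sum_(T : {ffun V -> pat}) expR (- (n * hent (pbar T)))
  <= (#|V|.+1)%:R ^+ #|pat|.
Proof.
pose kap (T : {ffun V -> pat}) : {ffun pat -> 'I_#|V|.+1} :=
  [ffun a => inord (cnt T a)].
have kapE (T : {ffun V -> pat}) a : kap T a = cnt T a :> nat.
  by rewrite ffunE inordK// ltnS max_card.
have e : (#|V|.+1 ^ #|pat|)%N = #|{ffun pat -> 'I_#|V|.+1}| by rewrite [RHS]card_ffun card_ord.
rewrite -natrX e -[X in _ <= X%:R]sum1_card natr_sum (partition_big kap predT)//.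
apply: ler_sum => k _; rewrite [leLHS](eq_bigl (fun T : {ffun V -> pat} => kap T == k))//.
have [/existsP[T0 /eqP T0k]|/existsPn nk] := boolP [exists T, kap T == k]; last first.
  by rewrite big_pred0// => T; apply/negbTE; exact: nk.
have cE (T : {ffun V -> pat}) : (kap T == k) = [forall a, cnt T a == cnt T0 a].
  rewrite -T0k; apply/eqP/forallP => [e' a|e']; first by rewrite -!kapE e'.
  by apply/ffunP => a; rewrite !ffunE (eqP (e' a)).
have pE (T : {ffun V -> pat}) : kap T == k -> pbar T = pbar T0.
  rewrite cE => /forallP e'; apply/funext => a; rewrite !pbarE; congr (_ / _).
  by apply: eq_bigr => b _; rewrite (eqP (e' b)).
rewrite (eq_bigr (fun=> expR (- (n * hent (pbar T0))))) => [|T /pE->//].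
rewrite sumr_const -[leLHS]mulr_natl.
have := @card_class_le R V pat (pbar T0) (cnt T0) (pbar_pmf T0).
rewrite hent_pbar opprK => /(_ _) h0.
have h : #|[set s : {ffun V -> pat} | [forall a, cnt s a == cnt T0 a]]|%:R <= expR (n * hent (pbar T0)).
  apply: h0 => a /card_gt0P[v]; rewrite inE => /eqP va.
  rewrite lt_neqAle eq_sym; have [p0 _] := pbar_pmf T0; rewrite p0 andbT.
  rewrite /pbar mulf_neq0 ?invr_eq0// psumr_neq0; last first.
    by move=> w _; rewrite divr_ge0// sumr_ge0.
  apply/hasP; exists v; rewrite ?mem_index_enum//= divr_gt0//.
  rewrite lt_neqAle eq_sym psumr_neq0// sumr_ge0 ?andbT//.
  apply/hasP; exists 1%g; rewrite ?mem_index_enum//= (_ : patp 1 (T0 v) = a) ?eqxx ?ltr01//.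
  by apply/ffunP => i; rewrite ffunE perm1 va.
rewrite expRN ler_pdivrMr ?expR_gt0// mul1r; apply: le_trans h.
rewrite ler_nat; apply: eq_leq; rewrite cardsE; apply: eq_card => T.
exact: (cE T).
Qed.

Lemma unf_color (p : V * 'I_D.+1 -> V * 'I_D.+1) (f f' : V -> M) h h' :
  orb (unf p f r h) = orb (unf p f' r h') -> f h.1 = f' h'.1.
Proof.
move=> /orb_eqP/imsetP[g _] /(congr1 (@trunc D M 0 r)); rewrite trunc0_act !trunc_unf//= => ->.
Qed.

(** A coloring is determined by its patterns [T], and [p] is consistent with the resulting types of
    half-edges. By [sig_Plab] these types have [D.+1 / 2 * hent >= hent (pbar T) - s], so
    [card_consistent_le] leaves [expR (n * s - n * hent (pbar T))], which [sum_patterns] sums over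
    [T]. *)
Lemma count_upper (s : R) (S : {set {perm (V * 'I_D.+1)} * {ffun V -> M}}) :
  (forall pF, pF \in S -> pF.1 \in matchings (V * 'I_D.+1)%type /\ sig (Plab R pF.1 pF.2) r <= s) ->
  #|S|%:R <= #|matchings (V * 'I_D.+1)%type|%:R *
    expR (n * s + #|{: ctype * ctype}|%:R * (1 + ln #|{: V * 'I_D.+1}|.+1%:R)
       + #|pat|%:R * ln #|V|.+1%:R).
Proof.
move=> SP; set H : finType := (V * 'I_D.+1)%type.
set K := #|{: ctype * ctype}|%:R * _.
pose sw (c : ctype * ctype) := (c.2, c.1).
have swK : involutive sw by case.
pose G (pF : {perm H} * {ffun V -> M}) : {perm H} * {ffun V -> pat} := (pF.1, finfun (cpat pF.1 pF.2)).
have Ginj : injective G.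
  move=> [p F] [p' F'] [<- /ffunP e]; congr pair; apply/ffunP => v.
  have := e v; rewrite !ffunE => /ffunP/(_ ord0); rewrite !ffunE => -[/unf_color + _]; exact.
have GE p (F : {ffun V -> M}) : (finfun (cpat p F) : V -> pat) = cpat p F.
  by apply/funext => v; rewrite ffunE.
have cons (p : {perm H}) (F : {ffun V -> M}) : involutive p -> consistent sw p (cth (cpat p F)).
  by move=> pK; apply/forallP => -[v i]; rewrite /cth !ffunE /sw /= -surjective_pairing pK.
pose Im := [set T : {ffun V -> pat} | [exists pF in S, (G pF).2 == T]].
have h1 : (#|S| <= \sum_(T in Im) #|[set p in matchings H | consistent sw p (cth T)]|)%N.
  rewrite -(card_imset _ Ginj).
  pose X := [set pT : {perm H} * {ffun V -> pat} | (pT.2 \in Im) && ((pT.1 \in matchings H) && consistent sw pT.1 (cth pT.2))].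
  apply: (@leq_trans #|X|).
    apply: subset_leq_card; apply/fintype.subsetP => _ /imsetP[[p F] pFS ->].
    have [/= pM _] := SP _ pFS; have [pK _] := matchingsP _ pM.
    rewrite inE; apply/andP; split; last by rewrite /= pM GE cons.
    by rewrite inE; apply/existsP; exists (p, F); rewrite pFS eqxx.
  rewrite -sum1_card big_mkcond /= (eq_bigr (fun pT => if (pT.1, pT.2) \in X then 1%N else 0%N)) => [|[]//].
  rewrite -(pair_bigA _ (fun p (T : {ffun V -> pat}) => if (p, T) \in X then 1%N else 0%N)) /=.
  rewrite exchange_big /= [X in (_ <= X)%N]big_mkcond; apply: leq_sum => T _.
  case: (boolP (T \in Im)) => TI.
    rewrite -sum1_card [X in (_ <= X)%N]big_mkcond; apply: leq_sum => p _.
    case: ifP => // pTX; suff -> : p \in [set p0 in matchings H | consistent sw p0 (cth T)] by [].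
    by have : (p, T) \in X by []; rewrite {1}/X inE => /andP[_ pc]; rewrite inE.
  rewrite big1// => p _; case: ifP => //; rewrite inE => /andP[/= TI'].
  by rewrite TI' in TI.
have h2 (T : {ffun V -> pat}) : T \in Im -> #|[set p in matchings H | consistent sw p (cth T)]|%:R <=
    #|matchings H|%:R * (expR (n * s + K) * expR (- (n * hent (pbar T)))).
  rewrite inE => /existsP[[p F] /andP[pFS /eqP <-]].
  have [/= pM] := SP _ pFS; have [pK _] := matchingsP _ pM.
  rewrite sig_Plab// GE => sg; apply: (le_trans (card_consistent_le R swK (cth (cpat p F)))).
  rewrite ler_wpM2l// -expRD ler_expR -/K.
  have -> : #|H|%:R = n * D.+1%:R by rewrite /H card_prod card_ord natrM.
  have := ler_wpM2l (ler0n R #|V|) sg; rewrite -/n; lra.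
apply: (@le_trans _ _ (\sum_(T in Im) #|[set p in matchings H | consistent sw p (cth T)]|)%:R).
  by rewrite ler_nat.
rewrite natr_sum; apply: (le_trans (ler_sum _ h2)).
rewrite -mulr_sumr ler_wpM2l// -mulr_sumr [leRHS]expRD ler_wpM2l ?expR_ge0//.
apply: (@le_trans _ _ (\sum_(T : {ffun V -> pat}) expR (- (n * hent (pbar T))))).
  by rewrite [leRHS](bigID (mem Im)) /= lerDl sumr_ge0// => T _; exact: expR_ge0.
apply: (le_trans sum_patterns); rewrite expRM_natl lnK// posrE//.
Qed.

End Upper.

Section Lower.
Variable P : forall r, star D M r -> R.
Arguments P : clear implicits.
Hypothesis Pinv : inv_family P.

Lemma edge_at i a b :
  \sum_x ((own i x == a) && (x.2 i == b))%:R * P r x = edge P (a, b).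
Proof.
have [_ _ Pact _] := Pinv.
pose g : ng D D.+1 r := (lift_perm ord0 i 1%g, [ffun=> bone D r]).
rewrite /edge [RHS](reindex_inj (@sact_inj D M r g)) /=; apply: eq_bigr => x _.
rewrite Pact; congr (_ * P r x); congr (nat_of_bool _)%:R; congr (_ && _).
  congr (_ == _); case: (r) x @g => [|r'] x g //=; congr pair; apply/ffunP => k.
  by rewrite !ffunE act_one lift_perm_lift perm1.
by rewrite !ffunE act_one lift_perm_id.
Qed.

Lemma inv_SB x : \sum_s P r s * SB R s x = P r x.
Proof.
have [_ _ Pact _] := Pinv.
rewrite /SB; under eq_bigr do rewrite mulrA mulr_sumr.
rewrite -mulr_suml exchange_big /= (eq_bigr (fun=> P r x)) => [|g _].
  by rewrite sumr_const -[X in X / _]mulr_natr mulfK// pnatr_eq0 -lt0n card_ng_gt0.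
under eq_bigr do rewrite -(Pact r g).
transitivity (\sum_y P r y * (y == x)%:R).
  by rewrite [RHS](reindex_inj (@sact_inj D M r g)).
by rewrite (bigD1 x)//= eqxx mulr1 big1 ?addr0// => y /negbTE->; rewrite mulr0.
Qed.

Lemma edge_pmf : is_pmf (edge P (r := r)).
Proof.
have [Pp _ _ _] := Pinv; have [P0 P1] := Pp r.
split=> [ab|]; first by rewrite sumr_ge0// => x _; rewrite mulr_ge0.
rewrite /edge exchange_big /= -[RHS]P1; apply: eq_bigr => x _.
rewrite (bigD1 (own ord0 x, x.2 ord0))//= !eqxx mul1r big1 ?addr0// => -[a b] /=.
by rewrite xpair_eqE [a == _]eq_sym [b == _]eq_sym => /negbTE->; rewrite mul0r.
Qed.

Definition l1 (A : finType) (p q : A -> R) : R := \sum_x `|p x - q x|.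

Section LowerV.
Variable V : finType.
Hypothesis V0 : (0 < #|V|)%N.
Let n : R := #|V|%:R.

Definition claim (t : V -> star D M r) (h : V * 'I_D.+1) := (own h.2 (t h.1), (t h.1).2 h.2).

Lemma typ_claim (e : R) t : typ (P r) e t -> typ (edge P (r := r)) e (claim t).
Proof.
move=> /forallP tt; apply/forallP => -[a b].
pose w (s : star D M r) : R := \sum_(i < D.+1) ((own i s == a) && (s.2 i == b))%:R.
have w0 s : 0 <= w s by rewrite sumr_ge0.
have c1 : (cnt (claim t) (a, b))%:R = \sum_s (cnt t s)%:R * w s.
  rewrite -(sum_cnt t w) /cnt -sum_indicator /w pair_bigA /=.
  by apply: eq_bigr => -[v i] _; rewrite /claim /= xpair_eqE.
have c2 : #|{: V * 'I_D.+1}|%:R * edge P (a, b) = \sum_s n * P r s * w s.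
  rewrite card_prod card_ord natrM -mulrA [D.+1%:R * _]mulr_natl.
  have -> : edge P (a, b) *+ D.+1 = \sum_(i < D.+1) edge P (a, b) by rewrite sumr_const card_ord.
  rewrite mulr_sumr.
  under [RHS]eq_bigr do rewrite mulr_sumr.
  rewrite exchange_big /=; apply: eq_bigr => i _; rewrite -(edge_at i) mulr_sumr.
  by apply: eq_bigr => s _; rewrite -mulrA; congr (_ * _); rewrite mulrC.
rewrite c1 c2 -sumrB mulr_sumr; apply: (le_trans (ler_norm_sum _ _ _)).
apply: ler_sum => s _; rewrite -mulrBl normrM (ger0_norm (w0 s)) mulrA.
by rewrite ler_wpM2r//; have := tt s.
Qed.

Lemma claim_defect p t : involutive p ->
  (#|[set v | sunf p (fun v => (t v).1) r v != t v]| <= (1 + defect_const D r) *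
    #|[set h | claim t (p h) != ((claim t h).2, (claim t h).1)]|)%N.
Proof.
move=> pK; apply: defect => // h; rewrite inE negbK => /eqP.
by rewrite /claim /= => -[].
Qed.

Lemma l1_sunf (s t : V -> star D M r) :
  \sum_x `|\sum_v SB R (s v) x - \sum_v SB R (t v) x| <= 2 * #|[set v | s v != t v]|%:R.
Proof.
apply: (@le_trans _ _ (\sum_x \sum_v `|SB R (s v) x - SB R (t v) x|)).
  by apply: ler_sum => x _; rewrite -sumrB ler_norm_sum.
rewrite exchange_big /= -sum_indicator mulr_sumr; apply: ler_sum => v _.
case: eqVneq => [->|_] /=.
  by rewrite big1 ?mulr0// => x _; rewrite subrr normr0.
rewrite mulr1; have [a0 a1] := SB_pmf R (s v); have [b0 b1] := SB_pmf R (t v).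
apply: (@le_trans _ _ (\sum_x (SB R (s v) x + SB R (t v) x))).
  by apply: ler_sum => x _; apply: (le_trans (ler_normB _ _)); rewrite !ger0_norm.
by rewrite big_split /= a1 b1.
Qed.

(** The relabeled claims average to within [e] of [P], because [P] is its own average over
    relabelings ([inv_SB]); each false claim moves the law by at most [2 / n]. *)
Lemma typ_Plab (e : R) p (t : V -> star D M r) : 0 <= e -> typ (P r) e t ->
  l1 (Plab R p (fun v => (t v).1) (r := r)) (P r) <=
    e + 2 * #|[set v | sunf p (fun v => (t v).1) r v != t v]|%:R / n.
Proof.
move=> e0 /forallP tt; have [Pp _ _ _] := Pinv; have [P0 P1] := Pp r.
have n0 : n != 0 by rewrite pnatr_eq0 -lt0n.
have np : 0 < n by rewrite ltr0n.
apply: (@le_trans _ _ (\sum_x (`|\sum_v SB R (sunf p (fun v => (t v).1) r v) x - \sum_v SB R (t v) x| / n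
   + `|(\sum_v SB R (t v) x) / n - P r x|))).
  apply: ler_sum => x _; rewrite -[X in _ <= _ / X + _](gtr0_norm np) -normf_div mulrBl.
  by apply: le_trans (ler_normD _ _); rewrite addrA subrK.
rewrite big_split /= addrC lerD//; last first.
  by rewrite -mulr_suml ler_wpM2r ?invr_ge0 ?ler0n//; exact: l1_sunf.
rewrite -[leRHS]mulr1 -P1 mulr_sumr; apply: ler_sum => x _.
rewrite (sum_cnt t (fun s => SB R s x)) -{1 2}(inv_SB x) mulr_suml -sumrB mulr_sumr.
apply: (le_trans (ler_norm_sum _ _ _)); apply: ler_sum => s _.
have s0 : 0 <= SB R s x by have [] := SB_pmf R s.
rewrite mulrAC -mulrBl normrM (ger0_norm s0) [leRHS]mulrA ler_wpM2r//.
rewrite -(ler_pM2l np) -[X in X * `|_|](gtr0_norm np) -normrM mulrBr [n * (_ / n)]mulrC mulfVK//.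
by have := tt s; rewrite -/n [n * (e * _)]mulrCA.
Qed.

End LowerV.

(** Choose a typical claim [t] of a star at each vertex, then a matching with few defects against
    the claims: the exponents add up to [sig P r]. By [defect] the claims are true at most vertices.
    So the root colors of [t] have a local law close to [P], and [t] can be recovered from the
    coloring up to a small Hamming ball. *)
Lemma count_lower (eps delta : R) : 0 < eps -> 0 < delta ->
  exists N0 : nat, forall V : finType, (N0 <= #|V|)%N ->
  #|matchings (V * 'I_D.+1)%type|%:R * expR (#|V|%:R * (sig P r - delta)) <=
  #|[set pF : {perm (V * 'I_D.+1)} * {ffun V -> M} | (pF.1 \in matchings (V * 'I_D.+1)%type) &&
      (l1 (Plab R pF.1 pF.2 (r := r)) (P r) <= eps)]|%:R.
Proof.
move=> eps0 delta0; have [Pp _ _ Psym] := Pinv; have qp := edge_pmf.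
pose hP := hent (P r); pose hq := hent (edge P (r := r)).
have hP0 : 0 <= hP by apply: hent_ge0.
have hq0 : 0 <= hq by apply: hent_ge0.
have d4 : 0 < delta / 4 by rewrite divr_gt0.
have [eta eta0 ball] := @hamming_ball R (star D M r) (delta / 4) d4.
pose C : R := (1 + defect_const D r)%:R * (4 * D.+1%:R).
have C0 : 0 < C by rewrite mulr_gt0 ?mulr_gt0 ?ltr0n.
pose B := hP + 3 * (D.+1%:R / 2) * hq.
have B0 : 0 <= B by rewrite addr_ge0// !mulr_ge0.
(* At most [C * e * n] claims are false, to be bounded by [eta * n] for the Hamming ball and by
   [eps / 4 * n] for the local law; [e * B] is the loss in the exponent. *)
pose e := Num.min (Num.min 1 (eps / 2)) (Num.min (Num.min (eta / C) (eps / (4 * C))) (delta / (4 * (B + 1)))).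
have B1 : 0 < B + 1 by rewrite ltr_pwDr.
have e0 : 0 < e by rewrite !lt_min ltr01 !divr_gt0 ?mulr_gt0.
have : e <= e by []. rewrite {2}/e !le_min => /andP[/andP[e1 e2] /andP[/andP[e3 e4] e5]].
have e01 : 0 < e <= 1 by rewrite e0.
have [N1 hN1] := card_typ_ge (Pp r) e01.
have swK2 : involutive (fun a : br D M r * br D M r => (a.2, a.1)) by case.
have qsw : forall a : br D M r * br D M r, edge P (a.2, a.1) = edge P a by case=> a b; rewrite Psym.
have [N2 hN2] := card_few_defects_ge (sw := fun a : br D M r * br D M r => (a.2, a.1)) swK2 qp qsw e01.
have q4 : 0 < 4^-1 :> R by rewrite invr_gt0.
have [N3 hN3] := expR_natr_small d4 q4.
exists (maxn 1 (maxn N1 (maxn N2 N3))) => V; rewrite !geq_max => /and4P[V0 V1 V2 V3].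
set H : finType := (V * 'I_D.+1)%type; pose n : R := #|V|%:R.
have np : 0 < n by rewrite ltr0n.
have HE : #|H|%:R = n * D.+1%:R by rewrite /H card_prod card_ord natrM.
pose good (pF : {perm H} * {ffun V -> M}) := (pF.1 \in matchings H) && (l1 (Plab R pF.1 pF.2 (r := r)) (P r) <= eps).
pose W (pt : {perm H} * {ffun V -> star D M r}) := [&& pt.1 \in matchings H, typ (P r) e pt.2 &
   #|[set h | claim pt.2 (pt.1 h) != ((claim pt.2 h).2, (claim pt.2 h).1)]|%:R <= 4 * e * #|H|%:R].
pose ph (pt : {perm H} * {ffun V -> star D M r}) : {perm H} * {ffun V -> M} := (pt.1, [ffun v => (pt.2 v).1]).
have phE (pt : {perm H} * {ffun V -> star D M r}) : ((ph pt).2 : V -> M) = (fun v => (pt.2 v).1).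
  by apply/funext => v; rewrite ffunE.
have wrong pt : W pt -> #|[set v | sunf pt.1 (fun v => (pt.2 v).1) r v != pt.2 v]|%:R <= C * e * n.
  case: pt => p t /and3P[/= pM _ df]; have [pK _] := matchingsP _ pM.
  apply: (@le_trans _ _ ((1 + defect_const D r)%:R * (4 * e * #|H|%:R))).
    apply: le_trans (ler_wpM2l (ler0n _ _) df); rewrite -natrM ler_nat.
    exact: claim_defect.
  by rewrite HE /C; rewrite le_eqVlt; apply/orP; left; apply/eqP; ring.
have Wgood pt : W pt -> good (ph pt).
  move=> Wpt; have /and3P[pM ty _] := Wpt; rewrite /good pM phE /=.
  apply: (le_trans (typ_Plab V0 pt.1 (ltW e0) ty)).
  have : 2 * #|[set v | sunf pt.1 (fun v => (pt.2 v).1) r v != pt.2 v]|%:R / n <= eps / 2.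
    rewrite ler_pdivrMr//; apply: (@le_trans _ _ (2 * (C * e * n))).
      by rewrite ler_wpM2l// wrong.
    move: e4; rewrite ler_pdivlMr ?mulr_gt0// => e4'; have := ler_wpM2r (ltW np) e4'; lra.
  lra.
have fib pF : good pF -> (#|[set pt | W pt && (ph pt == pF)]|%:R <= expR (delta / 4 * n)).
  move=> _; apply: le_trans (ball V [ffun v => sunf pF.1 pF.2 r v]); rewrite ler_nat.
  rewrite -(card_in_imset (f := snd) (D := [set pt | W pt && (ph pt == pF)])); last first.
    move=> [p t] [p' t']; rewrite !inE => /andP[_ /eqP <-] /andP[_ /eqP[-> _]] /= ->; by [].
  apply: subset_leq_card; apply/fintype.subsetP => y /imsetP[[p t]]; rewrite inE => /andP[Wpt /eqP <-] ->.
  rewrite inE /=; apply: (@le_trans _ _ (C * e * n)).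
    apply: le_trans (wrong _ Wpt); rewrite ler_nat; apply/eq_leq/eq_card => v.
    have := phE (p, t); rewrite /= => phE'; by rewrite !inE ffunE phE' eq_sym.
  by rewrite ler_wpM2r ?(ltW np)// mulrC -ler_pdivlMr.
have tot : #|matchings H|%:R * (4^-1 * expR (n * (sig P r - e * B))) <= #|[set pt | W pt]|%:R.
  have -> : #|[set pt | W pt]|%:R = \sum_(t : {ffun V -> star D M r} | typ (P r) e t)
     #|[set p in matchings H | #|dfc (fun a => (a.2, a.1)) p (claim t)|%:R <= 4 * e * #|H|%:R]|%:R :> R.
    rewrite -sum_indicator (eq_bigr (fun pt => (W (pt.1, pt.2))%:R)) => [|[]//].
    rewrite -(pair_bigA _ (fun p t => (W (p, t))%:R)) /= exchange_big /= [RHS]big_mkcond.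
    apply: eq_bigr => t _; case: ifP => ty.
      by rewrite -sum_indicator; apply: eq_bigr => p _; rewrite /W /= ty.
    by apply: big1 => p _; rewrite /W /= ty andbF.
  have HN : (N2 <= #|H|)%N.
    by apply: (leq_trans V2); rewrite /H card_prod card_ord leq_pmulr.
  apply: (@le_trans _ _ (\sum_(t : {ffun V -> star D M r} | typ (P r) e t)
     #|matchings H|%:R * (2^-1 * expR (- ((1 + 3 * e) * (#|H|%:R / 2) * hq))))); last first.
    apply: ler_sum => t ty; exact: (hN2 H _ HN (typ_claim ty)).
  rewrite sumr_const -[leRHS]mulr_natl [leRHS]mulrCA ler_wpM2l//.
  have := hN1 V V1; rewrite -/n -/hP cardsE => h1.
  apply: (@le_trans _ _ (2^-1 * expR ((1 - e) * n * hP) * (2^-1 * expR (- ((1 + 3 * e) * (#|H|%:R / 2) * hq))))); last first.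
    by rewrite ler_wpM2r// mulr_ge0 ?expR_ge0.
  rewrite mulrACA -expRD HE (_ : 2^-1 * 2^-1 = 4^-1 :> R); last by field.
  by rewrite ler_wpM2l// ler_expR /sig -/hP -/hq /B; rewrite le_eqVlt; apply/orP; left; apply/eqP; field.
have up : #|[set pt | W pt]|%:R <= #|[set pF | good pF]|%:R * expR (delta / 4 * n).
  have -> : #|[set pt | W pt]|%:R = \sum_(pF | good pF) #|[set pt | W pt && (ph pt == pF)]|%:R :> R.
    rewrite -sum1_card natr_sum (partition_big ph good) => [|pt]; last by rewrite inE; exact: Wgood.
    apply: eq_bigr => pF _; rewrite -natr_sum sum1_card; congr (_%:R); apply: eq_card => pt.
    by rewrite !inE -[in LHS]topredE /= inE.
  by apply: (le_trans (ler_sum _ fib)); rewrite sumr_const -[leLHS]mulr_natl ler_wpM2r ?expR_ge0// ler_nat;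
  apply/eq_leq/eq_card => pF; rewrite [RHS]inE.
rewrite -(ler_pM2r (expR_gt0 (delta / 4 * n))); apply: le_trans up; apply: le_trans tot.
rewrite -[leLHS]mulrA ler_wpM2l// -expRD; have h3 := hN3 _ V3.
apply: (@le_trans _ _ (expR (- (delta / 4 * n)) * expR (n * (sig P r - e * B)))); last first.
  by rewrite ler_wpM2r ?expR_ge0.
rewrite -expRD ler_expR.
have eB : e * B <= delta / 4.
  move: e5; rewrite ler_pdivlMr ?mulr_gt0//; nra.
have := mulr_ge0 (ltW np) (ltW delta0); have := ler_wpM2l (ltW np) eB; rewrite -/n; lra.
Qed.

End Lower.
End Types.
End Counting.

(** * The second moment bound and its amplification to almost all matchings *)

Section SecondMoment.
Variables (R : realType) (D : nat) (M : finType).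

Lemma cauchy_schwarz_card (I : finType) (A : {set I}) (X : I -> R) :
  (\sum_(i in A) X i) ^+ 2 <= #|A|%:R * \sum_(i in A) X i ^+ 2.
Proof.
have : 0 <= \sum_(i in A) \sum_(j in A) (X i - X j) ^+ 2.
  by apply: sumr_ge0 => i _; apply: sumr_ge0 => j _; exact: sqr_ge0.
rewrite (_ : \sum_(i in A) _ = 2 * (#|A|%:R * \sum_(i in A) X i ^+ 2) - 2 * (\sum_(i in A) X i) ^+ 2); first lra.
transitivity (\sum_(i in A) (#|A|%:R * X i ^+ 2 + (\sum_(j in A) X j ^+ 2 - 2 * (X i * \sum_(j in A) X j)))).
  apply: eq_bigr => i _; rewrite (eq_bigr (fun j => X i ^+ 2 + (X j ^+ 2 - 2 * X i * X j))) => [|j _]; last ring.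
  by rewrite big_split /= sumrB sumr_const -[_ *+ _]mulr_natl; congr (_ + (_ - _)); rewrite mulrA mulr_sumr.
rewrite big_split /= big_split /= sumrN -!mulr_sumr -mulr_suml sumr_const -[X in _ + (X - _)]mulr_natl; ring.
Qed.

Lemma l1_triangle (A : finType) (p q s : A -> R) : l1 p s <= l1 p q + l1 q s.
Proof.
rewrite /l1 -big_split /=; apply: ler_sum => x _; apply: le_trans (ler_normD _ _).
by rewrite addrA subrK.
Qed.

Lemma l1_strunc (P Q : forall r, star D M r -> R) (k r : nat) :
  inv_family P -> inv_family Q -> (k <= r)%N ->
  l1 (P k) (Q k) <= l1 (P r) (Q r).
Proof.
move=> [_ Pt _ _] [_ Qt _ _] /subnKC<-; elim: (r - k)%N => [|j IH]; first by rewrite addn0.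
apply: (le_trans IH); rewrite addnS; move: (k + j)%N => m {IH}.
apply: (@le_trans _ _ (\sum_y \sum_x (strunc x == y)%:R * `|P m.+1 x - Q m.+1 x|)).
  apply: ler_sum => y _; rewrite -Pt -Qt -sumrB.
  apply: (le_trans (ler_norm_sum _ _ _)); apply: ler_sum => x _.
  by rewrite -mulrBr normrM ger0_norm.
rewrite exchange_big /=; apply: ler_sum => x _; rewrite -mulr_suml.
by rewrite (bigD1 (strunc x))//= eqxx big1 ?addr0 ?mul1r// => y /negbTE; rewrite eq_sym => ->.
Qed.

Variable P : forall r, star D M r -> R.
Arguments P : clear implicits.
Hypothesis Pinv : inv_family P.
(** What the second moment needs of [P]. [coupling_compact] derives it from the hypothesis on
    couplings, [unif_sub] proves it for independent uniform colors. *)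
Hypothesis Psub : forall (delta : R) (R0 : nat), 0 < delta ->
  exists r, (R0 <= r)%N /\ exists2 eps : R, 0 < eps &
  forall (V : finType) (p : V * 'I_D.+1 -> V * 'I_D.+1) (F : V -> M * M),
    (0 < #|V|)%N -> involutive p ->
    l1 (Plab R p (fun v => (F v).1) (r := r)) (P r) <= eps ->
    l1 (Plab R p (fun v => (F v).2) (r := r)) (P r) <= eps ->
    sig (Plab R p F) r <= 2 * sig P r + delta.

(** By the Cauchy-Schwarz inequality: the first moment squared has exponent
    [2 * sig P r - delta / 2] and the second moment [2 * sig P r + delta / 2], which leaves
    [- delta]. *)
Lemma many_matchings (delta eta : R) (R0 : nat) : 0 < delta -> 0 < eta ->
  exists N0 : nat, forall V : finType, (N0 <= #|V|)%N ->
  #|matchings (V * 'I_D.+1)%type|%:R * expR (- (delta * #|V|%:R)) <=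
  #|[set p in matchings (V * 'I_D.+1)%type |
     [exists f : {ffun V -> M}, l1 (Plab R p f (r := R0)) (P R0) <= eta]]|%:R.
Proof.
move=> delta0 eta0; have d4 : 0 < delta / 4 by rewrite divr_gt0.
have [r [rR0 [eps eps0 sub]]] := Psub R0 d4.
pose e := Num.min eps eta; have e0 : 0 < e by rewrite lt_min eps0.
have [ee en] : e <= eps /\ e <= eta by rewrite !ge_min !lexx orbT.
have [N1 hN1] := count_lower r Pinv e0 d4.
pose K : R := (#|{: ctype D (M * M)%type r * ctype D (M * M)%type r}| + #|pat D (M * M)%type r|)%:R.
have [N2 hN2] := log_small K D.+1 d4.
exists (maxn 1 (maxn N1 N2)) => V; rewrite !geq_max => /and3P[V0 V1 V2].
set H : finType := (V * 'I_D.+1)%type; set n : R := #|V|%:R.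
set S := [set _ in _ | _].
pose good (p : {perm H}) := [set f : {ffun V -> M} | l1 (Plab R p f (r := r)) (P r) <= e].
pose S' := [set p in matchings H | (0 < #|good p|)%N].
have SS : S' \subset S.
  apply/fintype.subsetP => p; rewrite !inE => /andP[pM /card_gt0P[f]]; rewrite inE => fe.
  rewrite pM; apply/existsP; exists f; have [pK _] := matchingsP _ pM.
  apply: le_trans en; apply: le_trans fe; apply: l1_strunc => //; exact: Plab_inv.
apply: (@le_trans _ _ #|S'|%:R); last by rewrite ler_nat subset_leq_card.
have [Mat0|Mat0] := posnP #|matchings H|; first by rewrite Mat0 mul0r.
pose mt : R := #|matchings H|%:R; have mt0 : 0 < mt by rewrite ltr0n.
pose X p : R := #|good p|%:R.
have sum1 : mt * expR (n * (sig P r - delta / 4)) <= \sum_(p in S') X p.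
  apply: (le_trans (hN1 V V1)); rewrite -sum_indicator.
  rewrite (eq_bigr (fun pf => ((pf.1 \in matchings H) && (pf.2 \in good pf.1))%:R)) => [|pf _]; last by rewrite inE.
  rewrite -(pair_bigA _ (fun p f => ((p \in matchings H) && (f \in good p))%:R)) /=.
  rewrite [leRHS]big_mkcond; apply: ler_sum => p _.
  have [pS|] := boolP (p \in S').
    by move: pS; rewrite inE => /andP[-> _] /=; rewrite sum_indicator /X cardsE.
  rewrite inE negb_and => /orP[/negbTE->|]; first by rewrite big1.
  rewrite -eqn0Ngt cards_eq0 => /eqP->; rewrite big1// => f _; by rewrite inE andbF.
(* A pair of colorings is one coloring by pairs. Both marginals being close to [P], [sub] bounds its
   [sig] and [count_upper] applies. *)
have sum2 : \sum_(p in S') X p ^+ 2 <= mt * expR (n * (2 * sig P r + delta / 4) + delta / 4 * n).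
  pose S2 := [set pF : {perm H} * {ffun V -> M * M} | [&& pF.1 \in matchings H,
     [ffun v => (pF.2 v).1] \in good pF.1 & [ffun v => (pF.2 v).2] \in good pF.1]].
  apply: (@le_trans _ _ #|S2|%:R).
    rewrite -[leRHS]sum_indicator (eq_bigr (fun pF => ((pF.1, pF.2) \in S2)%:R)) => [|pF _]; last by case: pF => p F; rewrite [in RHS]inE.
    rewrite -(pair_bigA _ (fun p F => ((p, F) \in S2)%:R)) /= [leLHS]big_mkcond.
    apply: ler_sum => p _; case: ifP => [|_]; last by apply: sumr_ge0.
    rewrite inE => /andP[pM _]; rewrite sum_indicator /X -natrX ler_nat expnS expn1 -cardsX.
    pose mk (ff : {ffun V -> M} * {ffun V -> M}) : {ffun V -> M * M} := [ffun v => (ff.1 v, ff.2 v)].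
    have mki : injective mk.
      move=> [f f'] [g g'] /ffunP h; congr pair; apply/ffunP => v; by have := h v; rewrite !ffunE => -[].
    rewrite -(card_imset _ mki); apply: subset_leq_card; apply/fintype.subsetP => F /imsetP[[f f']].
    rewrite finset.in_setX /= => /andP[fg fg'] ->; rewrite inE inE pM /=.
    have -> : [ffun v => (mk (f, f') v).1] = f by apply/ffunP => v; rewrite !ffunE.
    have -> : [ffun v => (mk (f, f') v).2] = f' by apply/ffunP => v; rewrite !ffunE.
    by rewrite fg.
  have cu := @count_upper R D (M * M)%type r V V0 (2 * sig P r + delta / 4) S2.
  apply: le_trans (cu _) _.
    move=> [p F]; rewrite inE => /and3P[/= pM]; rewrite !inE => g1 g2; split => //.
    have [pK _] := matchingsP _ pM; apply: sub => //; apply: le_trans ee.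
      by apply: le_trans g1; rewrite le_eqVlt; apply/orP; left; apply/eqP; congr (l1 (Plab R p _ (r := r)) _); apply/funext => v; rewrite ffunE.
    by apply: le_trans g2; rewrite le_eqVlt; apply/orP; left; apply/eqP; congr (l1 (Plab R p _ (r := r)) _); apply/funext => v; rewrite ffunE.
  rewrite -/mt ler_wpM2l ?(ltW mt0)// ler_expR -addrA lerD2l.
  apply: le_trans (hN2 _ V2); rewrite /K natrD mulrDl lerD//.
    by rewrite [X in ln X.+1%:R](_ : _ = (D.+1 * #|V|)%N)// card_prod card_ord mulnC.
  rewrite ler_wpM2l// -[leLHS]add0r lerD// ler_ln ?posrE ?ltr0n// ler_nat ltnS leq_pmull//.
have sum0 : 0 < mt * expR (n * (sig P r - delta / 4)) by rewrite mulr_gt0 ?expR_gt0.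
have cs := cauchy_schwarz_card S' X.
have h1 : (mt * expR (n * (sig P r - delta / 4))) ^+ 2 <= #|S'|%:R * (mt * expR (n * (2 * sig P r + delta / 4) + delta / 4 * n)).
  apply: le_trans (ler_wpM2l _ sum2) => //; apply: le_trans cs.
  by rewrite ler_pXn2r// nnegrE ?ltW// (lt_le_trans sum0).
have h2 : 0 < mt * expR (n * (2 * sig P r + delta / 4) + delta / 4 * n) by rewrite mulr_gt0 ?expR_gt0.
rewrite -(ler_pM2r h2); apply: le_trans h1; rewrite exprMn -expRM_natl.
rewrite mulrACA -expRD expr2 ler_wpM2l ?mulr_ge0 ?(ltW mt0)// ler_expR; lra.
Qed.

(** [many_matchings] gives a set above the threshold of [blowup], so almost every [p] is within
    distance [t * #|H|] of a matching [q] with a good coloring, and by [defect] the same coloring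
    serves [p]. *)
Lemma almost_all_matchings (eta : R) (R0 : nat) : 0 < eta ->
  exists2 kappa : R, 0 < kappa & exists N0 : nat, forall V : finType, (N0 <= #|V|)%N ->
  #|[set p in matchings (V * 'I_D.+1)%type |
     ~~ [exists f : {ffun V -> M}, l1 (Plab R p f (r := R0)) (P R0) <= eta]]|%:R <=
  #|matchings (V * 'I_D.+1)%type|%:R * expR (- (kappa * #|V|%:R)).
Proof.
move=> eta0; have e2 : 0 < eta / 2 by rewrite divr_gt0.
pose C : R := 2 * ((1 + defect_const D R0)%:R * D.+1%:R).
have C0 : 0 < C by rewrite !mulr_gt0 ?ltr0n.
(* Changing [p] at [t * #|H|] half-edges moves the local law by at most [C * t <= eta / 2]. *)
pose t := Num.min 1 (eta / (2 * C)); have t0 : 0 < t by rewrite lt_min ltr01 divr_gt0 ?mulr_gt0.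
have : t <= t by []. rewrite {2}/t le_min => /andP[t1 t2].
pose kap := t ^+ 2 / 2048 * D.+1%:R.
have k0 : 0 < kap by apply: mulr_gt0; [apply: divr_gt0; [exact: exprn_gt0|rewrite ltr0n]|rewrite ltr0n].
have k2 : 0 < kap / 2 by rewrite divr_gt0.
have [N1 hN1] := many_matchings R0 k2 e2.
exists kap => //; exists (maxn 1 N1) => V; rewrite geq_max => /andP[V0 V1].
set H : finType := (V * 'I_D.+1)%type; set n : R := #|V|%:R.
have np : 0 < n by rewrite ltr0n.
have [Mat0|Mat0] := posnP #|matchings H|.
  rewrite (eqP (_ : #|_| == 0%N)) ?mulr_ge0 ?expR_ge0// cards_eq0; apply/eqP/setP => p.
  by move/eqP: Mat0; rewrite cards_eq0 inE => /eqP->; rewrite !inE.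
have := hN1 V V1; set S := [set _ in _ | _] => h1.
have HE : #|H|%:R = n * D.+1%:R by rewrite /H card_prod card_ord natrM.
have SM : S \subset matchings H by apply/fintype.subsetP => p; rewrite inE => /andP[].
have t01 : 0 < t <= 1 by rewrite t0.
have e1 : t ^+ 2 / 2048 * #|H|%:R = kap * n by rewrite HE /kap; ring.
have := blowup t01 SM; rewrite e1 => bl.
apply: le_trans (bl _); last first.
  apply: lt_le_trans h1; rewrite ltr_pM2l ?ltr0n// ltr_expR ltrN2 ltr_pM2r//.
  by rewrite ltr_pdivrMr// mulr_natr mulr2n ltrDl.
rewrite ler_nat; apply: subset_leq_card; apply/fintype.subsetP => p; rewrite inE => /andP[pM np'].
rewrite inE pM; apply/forallP => q; apply/implyP; rewrite inE => /andP[qM /existsP[f fe]].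
rewrite leNgt; apply: contra np' => hd; apply/existsP; exists f.
have [pK _] := matchingsP _ pM; have [qK _] := matchingsP _ qM.
apply: (le_trans (l1_triangle _ (Plab R q f (r := R0)) _)).
rewrite [eta]splitr lerD//.
have : \sum_x `|\sum_v SB R (sunf p f R0 v) x - \sum_v SB R (sunf q f R0 v) x| <= eta / 2 * n.
  apply: (le_trans (l1_sunf R _ _)).
  have df := @defect D M V p R0 (sunf q f R0) [set h | p h != q h] pK _.
  have {}df : (#|[set v | sunf p f R0 v != sunf q f R0 v]| <= (1 + defect_const D R0) * hamm p q)%N.
    apply: df => h; rewrite inE negbK => /eqP pq.
    by rewrite ffunE own_sunf -!surjective_pairing pq.
  apply: (@le_trans _ _ (2 * ((1 + defect_const D R0)%:R * (hamm p q)%:R))).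
    by rewrite ler_wpM2l// -natrM ler_nat.
  apply: (@le_trans _ _ (C * t * n)).
    rewrite (_ : C * t * n = 2 * ((1 + defect_const D R0)%:R * (t * #|H|%:R))); last by rewrite HE /C; ring.
    by rewrite ler_wpM2l// ler_wpM2l// ltW.
  by rewrite ler_wpM2r ?(ltW np)//; move: t2; rewrite ler_pdivlMr ?mulr_gt0//; lra.
move=> h; rewrite -(ler_pM2r np); apply: le_trans h; rewrite /l1 mulr_suml; apply: ler_sum => x _.
by rewrite -mulrBl normrM normfV (gtr0_norm np) mulfVK// gt_eqF.
Qed.

End SecondMoment.

(** * Monotonicity of the annealed entropy *)

Section Entropy.
Variable R : realType.
Implicit Types X A C I : finType.

Lemma gibbs X (P w : X -> R) : is_pmf P -> (forall x, 0 <= w x) -> \sum_x w x <= 1 ->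
  (forall x, 0 < P x -> 0 < w x) -> hent P <= - \sum_x P x * ln (w x).
Proof.
move=> [P0 P1] w0 w1 Pw; rewrite /hent lerN2 -subr_le0 -sumrB.
apply: (@le_trans _ _ (\sum_x (w x - P x))); last by rewrite sumrB P1 subr_le0.
apply: ler_sum => x _; have [Px|Px] := ltP 0 (P x); last first.
  have -> : P x = 0 by apply/eqP; rewrite eq_le Px P0.
  by rewrite !mul0r subrr subr0.
have wx := Pw _ Px; rewrite -mulrBr -ln_div ?posrE//.
have q0 : 0 < w x / P x by rewrite divr_gt0.
have : ln (w x / P x) <= w x / P x - 1.
  rewrite -[X in ln X](subrK 1) [X in ln X]addrC; apply: le_ln1Dx; lra.
by move=> /(ler_wpM2l (ltW Px)) h; apply: (le_trans h); rewrite mulrBr mulrCA mulfV ?gt_eqF// !mulr1.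
Qed.

Lemma hent_le_card X (P : X -> R) : is_pmf P -> hent P <= ln #|X|%:R.
Proof.
move=> Pp; have [P0 P1] := Pp.
have X0 : (0 < #|X|)%N.
  rewrite lt0n; apply/eqP => X0; have := P1; rewrite big_pred0.
    by move=> /eqP; rewrite eq_sym oner_eq0.
  by move=> x; have := card0_eq X0 x.
have := @gibbs X P (fun=> #|X|%:R^-1) Pp.
rewrite -mulr_suml P1 mul1r lnV ?posrE ?ltr0n// opprK; apply.
- by move=> x; rewrite invr_ge0.
- by rewrite sumr_const -[_ *+ _]mulr_natl mulfV// pnatr_eq0 -lt0n.
- by move=> x _; rewrite invr_gt0 ltr0n.
Qed.

Definition push X A (P : X -> R) (T : X -> A) (a : A) : R := \sum_x (T x == a)%:R * P x.

Lemma push_sum X A (P : X -> R) (T : X -> A) (F : A -> R) :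
  \sum_a push P T a * F a = \sum_x P x * F (T x).
Proof.
rewrite /push; under eq_bigr do rewrite mulr_suml.
rewrite exchange_big /=; apply: eq_bigr => x _.
rewrite (bigD1 (T x))//= eqxx mul1r big1 ?addr0// => a /negbTE; rewrite eq_sym => ->.
by rewrite !mul0r.
Qed.

Lemma push_pmf X A (P : X -> R) (T : X -> A) : is_pmf P -> is_pmf (push P T).
Proof.
move=> [P0 P1]; split=> [a|]; first by apply: sumr_ge0 => x _; rewrite mulr_ge0.
rewrite -P1 (eq_bigr (fun a => push P T a * 1)) => [|a _]; last by rewrite mulr1.
by rewrite push_sum; apply: eq_bigr => x _; rewrite mulr1.
Qed.

Lemma push_push X A C (P : X -> R) (T : X -> A) (c : A -> C) y :
  push (push P T) c y = push P (c \o T) y.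
Proof.
rewrite /push (eq_bigr (fun a => push P T a * (c a == y)%:R)) => [|a _]; last by rewrite mulrC.
by rewrite push_sum; apply: eq_bigr => x _; rewrite mulrC.
Qed.

Lemma ln_prod I (F : I -> R) : (forall i, 0 < F i) -> ln (\prod_i F i) = \sum_i ln (F i).
Proof.
move=> F0; rewrite -[RHS]expRK expR_sum; congr ln; apply: eq_bigr => i _.
by rewrite lnK ?posrE.
Qed.

(* Gibbs' inequality against the weight which makes the [T i] conditionally
   independent given [T0]. *)
Lemma hent_glue X A C I (P : X -> R) (T0 : X -> C) (T : I -> X -> A) (c : I -> A -> C) :
  is_pmf P -> (0 < #|I|)%N -> (forall i x, c i (T i x) = T0 x) ->
  (forall x y, (forall i, T i x = T i y) -> x = y) ->
  hent P <= \sum_i hent (push P (T i)) - (#|I|%:R - 1) * hent (push P T0).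
Proof.
move=> Pp I0 cT Tinj; have [P0 P1] := Pp.
set p0 := push P T0; pose p i := push P (T i).
have p0_ge0 y : 0 <= p0 y by have [] := push_pmf T0 Pp.
have p_ge0 i a : 0 <= p i a by exact: (proj1 (push_pmf (T i) Pp) a).
pose k := #|I|.-1; have Ik : #|I| = k.+1 by rewrite prednK.
pose w x := \prod_i p i (T i x) / p0 (T0 x) ^+ k.
have pos (B : finType) (S : X -> B) x : 0 < P x -> 0 < push P S (S x).
  move=> Px; apply: (lt_le_trans Px); rewrite /push (bigD1 x)//= eqxx mul1r lerDl.
  by apply: sumr_ge0 => y _; rewrite mulr_ge0.
have w0 x : 0 <= w x by rewrite divr_ge0 ?exprn_ge0// prodr_ge0.
have w1 : \sum_x w x <= 1.
  have [_ <-] := push_pmf T0 Pp; rewrite (partition_big T0 predT)//=.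
  apply: ler_sum => y _.
  rewrite (eq_bigr (fun x => \prod_i p i (T i x) / p0 y ^+ k)); last by move=> x /eqP <-.
  rewrite -mulr_suml.
  have h : \sum_(x | T0 x == y) \prod_i p i (T i x) <= p0 y ^+ k.+1.
    have e i : \sum_a (c i a == y)%:R * p i a = p0 y.
      rewrite -[LHS]/(push (p i) (c i) y) push_push /p0 /push; apply: eq_bigr => x _.
      by rewrite /= cT.
    rewrite -Ik -prodr_const -(eq_bigr _ (fun i _ => e i)) bigA_distr_bigA /=.
    pose g x : {ffun I -> A} := [ffun i => T i x].
    have gi : injective g.
      by move=> x x' /ffunP gx; apply: Tinj => i; have := gx i; rewrite !ffunE.
    apply: (@le_trans _ _ (\sum_(h in g @: [set x | T0 x == y]) \prod_i ((c i (h i) == y)%:R * p i (h i)))).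
      rewrite big_imset /=; last by move=> ? ? _ _; exact: gi.
      rewrite [leRHS](eq_bigl (fun x => T0 x == y)) => [|x]; last by rewrite inE.
      apply: ler_sum => x xy; rewrite le_eqVlt; apply/orP; left; apply/eqP.
      by apply: eq_bigr => i _; rewrite ffunE cT xy mul1r.
    rewrite [leRHS](bigID (mem (g @: [set x | T0 x == y]))) /= lerDl.
    by apply: sumr_ge0 => h _; apply: prodr_ge0 => i _; rewrite mulr_ge0.
  apply: (@le_trans _ _ (p0 y ^+ k.+1 / p0 y ^+ k)).
    by rewrite ler_wpM2r// invr_ge0 exprn_ge0.
  have [->|ne] := eqVneq (p0 y) 0; first by rewrite exprS !mul0r.
  by rewrite exprS mulfK// expf_neq0.
have wp x : 0 < P x -> 0 < w x.
  move=> Px; rewrite divr_gt0 ?exprn_gt0 ?pos//.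
  by apply: prodr_gt0 => i _; rewrite pos.
apply: (le_trans (gibbs Pp w0 w1 wp)).
have -> : \sum_x P x * ln (w x) =
    \sum_x ((\sum_i P x * ln (p i (T i x))) - k%:R * (P x * ln (p0 (T0 x)))).
  apply: eq_bigr => x _; have [Px|Px] := ltP 0 (P x); last first.
    have -> : P x = 0 by apply/eqP; rewrite eq_le Px P0.
    by rewrite !mul0r mulr0 subr0 big1// => i _; rewrite mul0r.
  rewrite /w ln_div ?posrE ?exprn_gt0 ?pos//; last first.
    by apply: prodr_gt0 => i _; rewrite pos.
  rewrite ln_prod => [|i]; last exact: pos.
  by rewrite lnXn ?pos// mulrBr mulr_sumr -[ln _ *+ k]mulr_natl mulrCA.
rewrite sumrB exchange_big /= -mulr_sumr.
have -> : \sum_i hent (push P (T i)) = - \sum_i \sum_x P x * ln (p i (T i x)).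
  by rewrite -sumrN; apply: eq_bigr => i _; rewrite /hent push_sum.
have -> : hent p0 = - \sum_x P x * ln (p0 (T0 x)) by rewrite /hent push_sum.
by rewrite Ik -natr1 addrK mulrN opprK opprB addrC.
Qed.

End Entropy.

Section StarEntropy.
Variables (R : realType) (D : nat) (M : finType) (P : forall r, star D M r -> R).
Arguments P : clear implicits.
Hypothesis Pinv : inv_family P.

Definition vlaw (m : M) : R := push (P 0%N) fst m.

Lemma edge_push i r : push (P r) (fun x => (own i x, x.2 i)) = edge P (r := r).
Proof.
apply/funext => -[a b]; rewrite -(edge_at Pinv i) /push; apply: eq_bigr => x _.
by rewrite xpair_eqE.
Qed.

(* The star around [o] read off the two branches at an edge. *)
Definition near_star r (i : 'I_D.+1) (ab : br D M r.+1 * br D M r.+1) : star D M r :=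
  (ab.1.1, [ffun j => if unlift i j is Some k then ab.1.2 k else trunc r ab.2]).

Lemma near_star_own r i (x : star D M r.+1) : near_star i (own i x, x.2 i) = strunc x.
Proof.
congr pair; apply/ffunP => j; rewrite !ffunE.
by case: unliftP => [k ->|->] //=; rewrite ffunE.
Qed.

Lemma near_star_push r : push (edge P (r := r.+1)) (near_star ord0) = P r.
Proof.
have [_ Pt _ _] := Pinv; apply/funext => y.
rewrite -(edge_push ord0) push_push -Pt /push; apply: eq_bigr => x _.
by rewrite /comp near_star_own.
Qed.

Lemma edge_swap_push r : push (edge P (r := r)) (fun ab => (ab.2, ab.1)) = edge P (r := r).
Proof.
have [_ _ _ Psym] := Pinv; apply/funext => -[a b]; rewrite /push (bigD1 (b, a))//= eqxx mul1r.
rewrite big1 => [|[c d]]; first by rewrite addr0 Psym.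
by rewrite !xpair_eqE /= => /negbTE ne; rewrite andbC ne mul0r.
Qed.

Lemma edge_trunc_push r :
  push (edge P (r := r.+1)) (fun ab => (trunc r ab.1, trunc r ab.2)) = edge P (r := r).
Proof.
have [_ Pt _ _] := Pinv; apply/funext => y; rewrite -(edge_push ord0) -[in RHS](edge_push ord0).
rewrite push_push.
transitivity (push (push (P r.+1) (@strunc D M r)) (fun x => (own ord0 x, x.2 ord0)) y).
  rewrite push_push /push; apply: eq_bigr => x _; congr (_%:R * _); congr (nat_of_bool (_ == _)).
  rewrite /comp /= ffunE; congr pair; case: r x {y} => [|r] x //=; congr pair.
  by apply/ffunP => k; rewrite !ffunE.
by rewrite /push; apply: eq_bigr => x _; rewrite -Pt.
Qed.

Let Ppmf r : is_pmf (P r). Proof. by have [] := Pinv. Qed.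

(** The edge ball of level [r.+1] is the union of the stars of level [r] at its two ends, which
    share the edge ball of level [r]. *)
Lemma hent_edge_le r : hent (edge P (r := r.+1)) <= 2 * hent (P r) - hent (edge P (r := r)).
Proof.
pose T (i : bool) (ab : br D M r.+1 * br D M r.+1) :=
  if i then near_star ord0 (ab.2, ab.1) else near_star ord0 ab.
pose T0 (ab : br D M r.+1 * br D M r.+1) := (trunc r ab.1, trunc r ab.2).
have near_c (ab : br D M r.+1 * br D M r.+1) :
    (own ord0 (near_star ord0 ab), (near_star ord0 ab).2 ord0) = (trunc r ab.1, trunc r ab.2).
  rewrite /= ffunE unlift_none; congr pair; case: r ab {T T0} => [|r] [a b] //=; congr pair.
  by apply/ffunP => k; rewrite !ffunE liftK.
pose c (i : bool) (x : star D M r) := if i then (x.2 ord0, own ord0 x) else (own ord0 x, x.2 ord0).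
have := @hent_glue R _ _ _ _ (edge P (r := r.+1)) T0 T c (edge_pmf r.+1 Pinv).
rewrite card_bool big_bool /= -[X in _ <= _ - _ * hent X]/(push _ T0) edge_trunc_push.
have -> : push (edge P (r:=r.+1)) (T true) = P r.
  by rewrite -near_star_push -[X in push X (near_star _)]edge_swap_push; apply/funext => y; rewrite push_push.
have -> : push (edge P (r:=r.+1)) (T false) = P r by rewrite -near_star_push.
move=> h; suff : hent (edge P (r:=r.+1)) <= hent (P r) + hent (P r) - (2 - 1) * hent (edge P (r:=r)) by lra.
apply: h => //.
  case=> ab; rewrite /c /T /T0; last exact: near_c.
  by have := near_c (ab.2, ab.1) => /= -[-> ->].
move=> [[a1 a2] [b1 b2]] [[a1' a2'] [b1' b2']] h.
have := h true; have := h false; rewrite /T /near_star /= => -[-> /ffunP ea] [-> /ffunP eb].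
congr ((_, _), (_, _)); apply/ffunP => k.
  by have := ea (lift ord0 k); rewrite !ffunE liftK.
by have := eb (lift ord0 k); rewrite !ffunE liftK.
Qed.

(** The star of level [r.+1] is the union of the [D.+1] edge balls of level [r.+1] at its root,
    which share the star of level [r]. Bounding the entropy of these edge balls by [hent_edge_le]
    leaves exactly [sig P r]. *)
Lemma sig_dec r : sig P r.+1 <= sig P r.
Proof.
have h1 : hent (P r.+1) <= \sum_(i < D.+1) hent (edge P (r := r.+1)) - (#|'I_D.+1|%:R - 1) * hent (P r).
  have := @hent_glue R _ _ _ 'I_D.+1 (P r.+1) (@strunc D M r) (fun i x => (own i x, x.2 i)) (@near_star r) (Ppmf r.+1).
  have -> : push (P r.+1) (@strunc D M r) = P r.
    by have [_ Pt _ _] := Pinv; apply/funext => y; rewrite -Pt.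
  under eq_bigr do rewrite edge_push.
  apply; rewrite ?card_ord//; first by move=> i x; exact: near_star_own.
  move=> [m x] [m' x'] h; have := h ord0 => -[/= -> _ _]; congr pair; apply/ffunP => i.
  by have [_ _ ->] := h i.
have h2 := hent_edge_le r.
rewrite sumr_const card_ord -[_ *+ _]mulr_natl in h1.
rewrite /sig; have d0 : 0 < D.+1%:R :> R by rewrite ltr0n.
have := ler_wpM2l (ltW d0) h2; move: h1; lra.
Qed.

Lemma sig_mono r s : (r <= s)%N -> sig P s <= sig P r.
Proof.
move/subnKC<-; elim: (s - r)%N => [|k IH]; first by rewrite addn0.
by rewrite addnS; apply: le_trans (sig_dec _) IH.
Qed.

(** The same gluing at the bottom: a star of level 0 consists of edges that share the root, and an
    edge of two vertices. *)
Lemma sig_le_vlaw r : sig P r <= hent vlaw.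
Proof.
apply: (le_trans (sig_mono (leq0n r))).
have h1 : hent (P 0%N) <= \sum_(i < D.+1) hent (edge P (r := 0)) - (#|'I_D.+1|%:R - 1) * hent vlaw.
  have := @hent_glue R _ _ _ 'I_D.+1 (P 0%N) fst (fun i x => (own i x, x.2 i)) (fun i ab => ab.1) (Ppmf 0%N).
  under eq_bigr do rewrite edge_push.
  apply; rewrite ?card_ord//.
  move=> [m x] [m' x'] h; have := h ord0 => -[/= -> _]; congr pair; apply/ffunP => i.
  by have [_ ->] := h i.
have h2 : hent (edge P (r := 0)) <= 2 * hent vlaw.
  have := @hent_glue R _ _ _ bool (edge P (r := 0)) (fun=> tt) (fun i ab => if i then ab.2 else ab.1)
    (fun _ _ => tt) (edge_pmf 0%N Pinv).
  have e1 : push (edge P (r := 0)) (fun ab => ab.1) = vlaw.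
    by rewrite -(edge_push ord0); apply/funext => m; rewrite push_push.
  have e2 : push (edge P (r := 0)) (fun ab => ab.2) = vlaw.
    by rewrite -e1 -[X in push X (fun ab => ab.1)]edge_swap_push; apply/funext => m; rewrite push_push.
  rewrite card_bool big_bool /= e1 e2.
  have := hent_ge0 (push_pmf (fun=> tt) (edge_pmf 0%N Pinv)).
  move=> t0 h; have : hent (edge P (r:=0)) <= hent vlaw + hent vlaw - (2 - 1) * hent (push (edge P (r:=0)) (fun=> tt)).
    apply: h => //; move=> [a b] [a' b'] h; have := h true; have := h false => /= -> ->; by [].
  lra.
rewrite sumr_const card_ord -[_ *+ _]mulr_natl in h1.
rewrite /sig; have d0 : 0 < D.+1%:R :> R by rewrite ltr0n.
have := ler_wpM2l (ltW d0) h2; move: h1; lra.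
Qed.

Lemma sig_le_card r : sig P r <= ln #|M|%:R.
Proof. by apply: (le_trans (sig_le_vlaw r)); apply: hent_le_card; exact: push_pmf. Qed.

End StarEntropy.

(** * Few short cycles *)

Section UniformColoring.
Variables (R : realType) (D : nat) (K : finType).
Hypothesis K0 : (0 < #|K|)%N.

Lemma card_node (A B : finType) n (a : A) (F : 'I_n -> {set B}) :
  #|[set x : A * {ffun 'I_n -> B} | (x.1 == a) && [forall i, x.2 i \in F i]]| = (\prod_i #|F i|)%N.
Proof.
transitivity #|finset.setX [set a] [set z : {ffun 'I_n -> B} | z \in family F]|.
  apply: eq_card => -[b z]; rewrite finset.in_setX; apply/idP/idP.
    by rewrite inE => /andP[/= /eqP-> /forallP h]; rewrite finset.in_set1 eqxx inE; apply/familyP.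
  move=> /andP[]; rewrite finset.in_set1 => /eqP->; rewrite inE => /familyP h.
  by rewrite inE eqxx; apply/forallP.
rewrite cardsX cards1 mul1n cardsE card_family.
by rewrite foldrE big_map bigop.big_enum.
Qed.

Fixpoint fibc (r : nat) : nat := if r is r'.+1 then (fibc r' ^ D)%N else (#|K| ^ D)%N.

Lemma card_trunc_fiber r (y : br D K r) :
  #|[set x : br D K r.+1 | trunc r x == y]| = fibc r.
Proof.
elim: r y => [|r IH] y.
  have -> : [set x : br D K 1 | trunc 0 x == y] = [set x : K * {ffun 'I_D -> K} | (x.1 == y) && [forall i, x.2 i \in [set: K]]].
    by apply/setP => x; rewrite !inE; case: eqP => //= _; apply/esym/forallP => i; rewrite inE.
  by rewrite card_node prod_nat_const card_ord cardsT.
have -> : [set x : br D K r.+2 | trunc r.+1 x == y] =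
    [set x : K * {ffun 'I_D -> br D K r.+1} | (x.1 == y.1) && [forall i, x.2 i \in [set b | trunc r b == y.2 i]]].
  apply/setP => x; rewrite !inE; apply/eqP/andP => [<-|[/eqP xy /forallP h]].
    by split => //; apply/forallP => i; rewrite inE /= ffunE.
  rewrite [y]surjective_pairing -xy; congr pair; apply/ffunP => i; rewrite ffunE.
  by have := h i; rewrite inE => /eqP.
by rewrite card_node (eq_bigr (fun=> fibc r)) ?prod_nat_const ?card_ord.
Qed.

Definition unif r (x : star D K r) : R := #|star D K r|%:R^-1.
Arguments unif : clear implicits.

Lemma card_br_gt0 r : (0 < #|br D K r|)%N.
Proof.
elim: r => [|r IH] //=; rewrite card_prod muln_gt0 K0 card_ffun expn_gt0.
by rewrite IH.
Qed.

Lemma card_star r : #|star D K r| = (#|K| * #|br D K r| ^ D.+1)%N.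
Proof. by rewrite card_prod card_ffun card_ord. Qed.

Lemma card_star_gt0 r : (0 < #|star D K r|)%N.
Proof. by rewrite card_star muln_gt0 K0 expn_gt0 card_br_gt0. Qed.

Lemma unif_pmf r : is_pmf (unif r).
Proof.
split=> [x|]; first by rewrite invr_ge0.
by rewrite sumr_const -[_ *+ _]mulr_natl mulfV// pnatr_eq0 -lt0n card_star_gt0.
Qed.

Lemma card_strunc_fiber r (y : star D K r) :
  #|[set x : star D K r.+1 | strunc x == y]| = (fibc r ^ D.+1)%N.
Proof.
have -> : [set x : star D K r.+1 | strunc x == y] =
    [set x : K * {ffun 'I_D.+1 -> br D K r.+1} | (x.1 == y.1) && [forall i, x.2 i \in [set b | trunc r b == y.2 i]]].
  apply/setP => x; rewrite !inE; apply/eqP/andP => [<-|[/eqP xy /forallP h]].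
    by split => //; apply/forallP => i; rewrite inE /= ffunE.
  rewrite [y]surjective_pairing -xy; congr pair; apply/ffunP => i; rewrite ffunE.
  by have := h i; rewrite inE => /eqP.
by rewrite card_node (eq_bigr (fun=> fibc r)) ?prod_nat_const ?card_ord// => i _; exact: card_trunc_fiber.
Qed.

Lemma card_edge_fiber r (a b : br D K r) :
  #|[set x : star D K r | (own ord0 x == a) && (x.2 ord0 == b)]| = (if r is r'.+1 then fibc r' ^ D else #|K| ^ D)%N.
Proof.
pose F (i : 'I_D.+1) : {set br D K r} :=
  if unlift ord0 i is Some k then
    (match r return br D K r -> 'I_D -> {set br D K r} with
     | 0 => fun _ _ => [set: K] | r'.+1 => fun a k => [set c | trunc r' c == a.2 k] end) a k
  else [set b].
have -> : [set x : star D K r | (own ord0 x == a) && (x.2 ord0 == b)] =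
   [set x : K * {ffun 'I_D.+1 -> br D K r} | (x.1 == trunc 0 a) && [forall i, x.2 i \in F i]].
  apply/setP => x; rewrite !inE; apply/andP/andP => [[/eqP ao /eqP xb]|[/eqP xa /forallP h]].
    split; first by rewrite -ao trunc0_own.
    apply/forallP => i; rewrite /F; case: unliftP => [k ->|->]; last by rewrite inE xb.
    case: r a b x F ao xb => [|r'] a b x F ao xb; rewrite inE// -ao /=.
    by rewrite ffunE.
  split; last by have := h ord0; rewrite /F unlift_none inE.
  case: r a b x @F xa h => [|r'] a b x F xa h; first by rewrite -[a]/(trunc 0 a) -xa.
  rewrite [a]surjective_pairing -[a.1]/(trunc 0 a) -xa; apply/eqP; congr pair; apply/ffunP => k.
  by have := h (lift ord0 k); rewrite /F liftK inE ffunE => /eqP.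
rewrite card_node big_ord_recl /F unlift_none cards1 mul1n.
rewrite (eq_bigr (fun=> if r is r'.+1 then fibc r' else #|K|)); last first.
  by move=> i _; rewrite liftK; case: r a {b F} => [|r] a; rewrite ?cardsT ?card_trunc_fiber.
by rewrite prod_nat_const card_ord; case: r a {b F}.
Qed.

Lemma unif_inv : inv_family unif.
Proof.
have frac (X : finType) (Q : pred X) (c : R) : \sum_x (Q x)%:R * c = #|[set x | Q x]|%:R * c.
  by rewrite -mulr_suml sum_indicator.
split.
- exact: unif_pmf.
- move=> r y; rewrite /unif frac card_strunc_fiber.
  have e : (#|star D K r.+1| = #|star D K r| * fibc r ^ D.+1)%N.
    rewrite -[LHS]sum1_card (partition_big (@strunc D K r) predT)//= -sum_nat_const.
    by apply: eq_bigr => z _; rewrite sum1_card -(card_strunc_fiber z) cardsE.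
  rewrite e natrM invfM mulrCA mulfV ?mulr1// pnatr_eq0 -lt0n.
  by have := card_star_gt0 r.+1; rewrite e muln_gt0 => /andP[].
- by move=> r g x.
- by move=> r a b; rewrite /edge /unif !frac !card_edge_fiber.
Qed.

(** The star has entropy [ln #|K| + D.+1 * ln #|br D K r|], the edge at most [2 * ln #|br D K r|],
    and the branch terms cancel. *)
Lemma sig_unif r : ln #|K|%:R <= sig unif r.
Proof.
have h1 : hent (unif r) = ln #|K|%:R + D.+1%:R * ln #|br D K r|%:R.
  rewrite /hent /unif -mulr_suml (proj2 (unif_pmf r)) mul1r lnV ?posrE ?ltr0n ?card_star_gt0// opprK.
  rewrite card_star natrM lnM ?posrE ?ltr0n ?expn_gt0 ?card_br_gt0// natrX lnXn ?ltr0n ?card_br_gt0//.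
  by rewrite -[ln _ *+ _]mulr_natl.
have := hent_le_card (edge_pmf r unif_inv).
rewrite card_prod natrM lnM ?posrE ?ltr0n ?card_br_gt0// => h2.
rewrite /sig h1; have d0 : 0 < D.+1%:R :> R by rewrite ltr0n.
have := ler_wpM2l (ltW d0) h2; lra.
Qed.

(** Uniform colors are extremal: every coloring by pairs has [sig <= 2 * ln #|K| <= 2 * sig unif],
    so any level and any [eps] do. *)
Lemma unif_sub (delta : R) (R0 : nat) : 0 < delta ->
  exists r, (R0 <= r)%N /\ exists2 eps : R, 0 < eps &
  forall (V : finType) (p : V * 'I_D.+1 -> V * 'I_D.+1) (F : V -> K * K),
    (0 < #|V|)%N -> involutive p ->
    l1 (Plab R p (fun v => (F v).1) (r := r)) (unif r) <= eps ->
    l1 (Plab R p (fun v => (F v).2) (r := r)) (unif r) <= eps ->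
    sig (Plab R p F) r <= 2 * sig unif r + delta.
Proof.
move=> delta0; exists R0; split=> //; exists 1 => // V p F V0 pK _ _.
have := sig_le_card (Plab_inv R F V0 pK) R0.
rewrite card_prod natrM lnM ?posrE ?ltr0n//; have := sig_unif R0; lra.
Qed.

End UniformColoring.

Section Labels.
Variable D : nat.
Implicit Types M : finType.

(** For the coloring [id] this lists the vertices met by a branch of the cover; a list without
    repetitions means that the cover is injective there. *)
Fixpoint lab M r : br D M r -> seq M :=
  match r return br D M r -> seq M with
  | 0 => fun x => [:: x]
  | r'.+1 => fun x => x.1 :: flatten [seq @lab M r' (x.2 i) | i <- enum 'I_D]
  end.

Definition slab M r (x : star D M r) : seq M :=
  x.1 :: flatten [seq lab (x.2 i) | i <- enum 'I_D.+1].

Fixpoint bsize (r : nat) : nat := if r is r'.+1 then (D * bsize r').+1 else 1.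

Lemma size_flatten_const (T : Type) n (F : 'I_n -> seq T) k :
  (forall i, size (F i) = k) -> size (flatten [seq F i | i <- enum 'I_n]) = (n * k)%N.
Proof.
move=> Fk; rewrite size_flatten /shape -map_comp (eq_map (g := fun=> k)) => [|i]; last exact: Fk.
rewrite -[in RHS](size_enum_ord n); elim: (enum 'I_n) => //= a s ->; by rewrite mulSn.
Qed.

Lemma size_lab M r (x : br D M r) : size (lab x) = bsize r.
Proof.
by elim: r x => [|r IH] //= [m x] /=; rewrite (@size_flatten_const _ _ _ (bsize r)).
Qed.

Lemma size_slab M r (x : star D M r) : size (slab x) = (D.+1 * bsize r).+1.
Proof. by rewrite /= (@size_flatten_const _ _ _ (bsize r))// => i; exact: size_lab. Qed.

Lemma flatten_inj (T : eqType) n (F G : 'I_n -> seq T) : (forall i, size (F i) = size (G i)) ->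
  flatten [seq F i | i <- enum 'I_n] = flatten [seq G i | i <- enum 'I_n] -> forall i, F i = G i.
Proof.
move=> sz e i; have := mem_enum 'I_n i; elim: (enum _) e => //= j s IH /eqP.
rewrite eqseq_cat// => /andP[/eqP e1 /eqP e2]; rewrite inE => /orP[/eqP->//|].
exact: IH.
Qed.

Lemma lab_inj M r : injective (@lab M r).
Proof.
elim: r => [x y []//|r IH [m x] [n y] /= [-> e]]; congr pair; apply/ffunP => i; apply: IH; move: i.
by apply: flatten_inj e => i; rewrite !size_lab.
Qed.

Lemma slab_inj M r : injective (@slab M r).
Proof.
move=> [m x] [n y] /= [-> e]; congr pair; apply/ffunP => i; apply: (@lab_inj M r); move: i.
by apply: flatten_inj e => i; rewrite !size_lab.
Qed.

Lemma sumn_enum n (f : 'I_n -> nat) : sumn [seq f i | i <- enum 'I_n] = (\sum_i f i)%N.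
Proof.
rewrite sumnE big_map.
by rewrite bigop.big_enum.
Qed.

Lemma perm_flatten_ord (T : eqType) n (F G : 'I_n -> seq T) (s : 'S_n) :
  (forall i, perm_eq (F i) (G (s i))) ->
  perm_eq (flatten [seq F i | i <- enum 'I_n]) (flatten [seq G i | i <- enum 'I_n]).
Proof.
move=> FG; apply/seq.permP => a.
have e (F0 : 'I_n -> seq T) : count a (flatten [seq F0 i | i <- enum 'I_n]) = (\sum_i count a (F0 i))%N.
  by rewrite count_flatten -map_comp -(sumn_enum (fun i => count a (F0 i))).
rewrite !e.
by rewrite [RHS](reindex_inj (@perm_inj _ s)); apply: eq_bigr => i _; apply/seq.permP.
Qed.

Lemma perm_lab_act M r (g : bg D r) (x : br D M r) : perm_eq (lab (act g x)) (lab x).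
Proof.
elim: r g x => [|r IH] g x //=; rewrite perm_cons; apply: (perm_flatten_ord (s := g.1)) => i.
by rewrite ffunE.
Qed.

Lemma perm_slab_act M r (g : ng D D.+1 r) (x : star D M r) : perm_eq (slab (sact g x)) (slab x).
Proof.
rewrite /slab /= perm_cons; apply: (perm_flatten_ord (s := g.1)) => i.
by rewrite ffunE perm_lab_act.
Qed.

Lemma lab_unf M (V : finType) p (f : V -> M) r h : lab (unf p f r h) = map f (lab (unf p id r h)).
Proof.
elim: r h => [|r IH] h //=; rewrite map_flatten -map_comp; congr (_ :: flatten _).
by apply: eq_map => i /=; rewrite !ffunE.
Qed.

Lemma slab_sunf M (V : finType) p (f : V -> M) r v : slab (sunf p f r v) = map f (slab (sunf p id r v)).
Proof.
rewrite /slab /= map_flatten -map_comp; congr (_ :: flatten _).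
by apply: eq_map => i /=; rewrite !ffunE lab_unf.
Qed.

(** Birthday bound, multiplied by [k] to avoid a division: at most a fraction [N ^ 2 / k] of the
    words of length [N] repeats a letter. *)
Lemma falling_ge k N : (k ^ N * k <= k ^_ N * k + N ^ 2 * k ^ N)%N.
Proof.
elim: N => [|N IH]; first by rewrite ffactn0 leq_addr.
rewrite expnSr ffactnSr.
have h1 : (k ^_ N * k <= k ^_ N * (k - N) + N * k ^ N)%N.
  rewrite [(N * _)%N]mulnC; apply: (@leq_trans (k ^_ N * (k - N) + k ^_ N * N)%N).
    by rewrite -mulnDr leq_mul2l; apply/orP; right; lia.
  rewrite leq_add2l leq_mul2r; apply/orP; right.
  by elim: (N) => // m IHm; rewrite ffactnSr expnSr leq_mul// leq_subr.
have h2 := leq_mul IH (leqnn k); have h3 := leq_mul h1 (leqnn k).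
move: h2 h3; rewrite !mulnDl; set a := (k ^ N)%N; set b := (k ^_ N)%N; set c := (b * (k - N))%N.
have h4 : (N ^ 2 * a * k + N * a * k <= N.+1 ^ 2 * (a * k))%N.
  rewrite (_ : N ^ 2 * a * k + N * a * k = (N ^ 2 + N) * (a * k))%N; last by rewrite mulnDl !mulnA.
  rewrite leq_mul2r; apply/orP; right; rewrite -[N.+1]addn1 sqrnD; lia.
lia.
Qed.

Lemma card_uniq_slab (K : finType) r (N := (D.+1 * bsize r).+1) :
  #|[set x : star D K r | uniq (slab x)]| = (#|K| ^_ N)%N /\ #|star D K r| = (#|K| ^ N)%N.
Proof.
have szP (x : star D K r) : size (slab x) == N by rewrite size_slab.
pose T x : N.-tuple K := Tuple (szP x).
have Ti : injective T by move=> x y /(congr1 val); exact: slab_inj.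
have cb r' : #|br D K r'| = (#|K| ^ bsize r')%N.
  elim: r' => [|r' IH] /=; first by rewrite expn1.
  by rewrite card_prod card_ffun card_ord IH -expnM mulnC -expnSr mulnC.
have cs : #|star D K r| = (#|K| ^ N)%N.
  by rewrite card_prod card_ffun card_ord cb -expnM mulnC -expnSr mulnC.
split=> //; rewrite -card_uniq_tuples -(card_imset _ Ti); apply: eq_card => t.
have Tb : codom T =i predT by apply/inj_card_onto => //; rewrite card_tuple -cs.
have /codomP[x ->] : t \in codom T by rewrite Tb.
by rewrite (mem_imset _ _ Ti) !inE (_ : all _ _ = true)//; apply/allP.
Qed.

(** A coloring by [k] colors whose stars look uniform seldom repeats a color in a star, by the
    birthday bound, and distinct colors require distinct vertices. [almost_all_matchings] provides
    such a coloring outside an exponentially small set. *)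
Lemma few_repeats (R : realType) r (eps : R) : 0 < eps ->
  exists2 kappa : R, 0 < kappa & exists N0 : nat, forall V : finType, (N0 <= #|V|)%N ->
  #|[set p in matchings (V * 'I_D.+1)%type |
     eps * #|V|%:R < #|[set v | ~~ uniq (slab (sunf p id r v))]|%:R]|%:R <=
  #|matchings (V * 'I_D.+1)%type|%:R * expR (- (kappa * #|V|%:R)).
Proof.
move=> eps0; pose N := (D.+1 * bsize r).+1.
(* Makes the birthday bound [N ^ 2 / k] at most [eps / 2]; the other half is for the distance to
   [unif]. *)
pose k := (Num.bound `|2 * (N ^ 2)%:R / eps|).+1.
have kP : (N ^ 2)%:R / k%:R <= eps / 2.
  rewrite ler_pdivrMr ?ltr0n//; apply: (@le_trans _ _ (eps / 2 * (2 * (N ^ 2)%:R / eps))).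
    by rewrite le_eqVlt; apply/orP; left; apply/eqP; field; rewrite gt_eqF.
  rewrite ler_pM2l ?divr_gt0//; apply: (le_trans (ler_norm _)).
  apply: (@le_trans _ _ (Num.bound `|2 * (N ^ 2)%:R / eps|)%:R); last by rewrite ler_nat.
  by apply/ltW/archi_boundP.
pose K : finType := 'I_k; have K0 : (0 < #|K|)%N by rewrite card_ord.
have e2 : 0 < eps / 2 by rewrite divr_gt0.
have [kap kap0 [N0 hN]] := almost_all_matchings (unif_inv R D K0) (@unif_sub R D K K0) r e2.
exists kap => //; exists (maxn 1 N0) => V; rewrite geq_max => /andP[V0 V1].
apply: le_trans (hN V V1); rewrite ler_nat; apply: subset_leq_card.
apply/fintype.subsetP => p; rewrite !inE => /andP[pM bad]; rewrite pM /=.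
apply: contraL bad => /existsP[f fu]; rewrite -leNgt.
set n : R := #|V|%:R; have np : 0 < n by rewrite ltr0n.
pose B (x : star D K r) : R := (~~ uniq (slab x))%:R.
have SBB z : \sum_x SB R z x * B x = B z.
  rewrite /SB; under eq_bigr do rewrite mulrAC mulr_suml.
  rewrite -mulr_suml exchange_big /= (eq_bigr (fun=> B z)) => [|g _].
    by rewrite sumr_const -[X in X / _]mulr_natr mulfK// pnatr_eq0 -lt0n card_ng_gt0.
  rewrite (bigD1 (sact g z))//= eqxx mul1r [X in _ + X]big1 ?addr0 => [|x /negbTE]; last first.
    by rewrite eq_sym => ->; rewrite mul0r.
  by rewrite /B (perm_uniq (perm_slab_act g z)).
have PB : \sum_x Plab R p f x * B x = (\sum_v B (sunf p f r v)) / n.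
  rewrite /Plab; under eq_bigr do rewrite mulrAC mulr_suml.
  by rewrite -mulr_suml exchange_big /=; congr (_ / _); apply: eq_bigr => v _; rewrite SBB.
have UB : \sum_x unif R x * B x <= (N ^ 2)%:R / k%:R.
  have [u1 u2] := card_uniq_slab K r; rewrite -/N card_ord in u1 u2.
  rewrite /unif -mulr_sumr /B sum_indicator mulrC ler_pdivrMr; last first.
    by rewrite ltr0n u2 expn_gt0.
  rewrite mulrAC ler_pdivlMr ?ltr0n// -!natrM ler_nat.
  have := cardsC [set x : star D K r | uniq (slab x)]; rewrite u1 u2.
  have -> : ~: [set x : star D K r | uniq (slab x)] = [set x | ~~ uniq (slab x)].
    by apply/setP => x; rewrite !inE.
  move=> e; have := falling_ge k N; rewrite -e mulnDl leq_add2l.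
  by rewrite e.
have : \sum_v B (sunf p f r v) <= eps * n.
  rewrite -ler_pdivrMr// -PB; apply: (@le_trans _ _ (\sum_x unif R x * B x + \sum_x `|Plab R p f x - unif R x|)).
    rewrite -[leRHS]big_split /=; apply: ler_sum => x _; rewrite /B; case: uniq => /=.
      by rewrite !mulr0 add0r.
    by rewrite !mulr1 addrC -lerBlDr ler_norm.
  by rewrite [eps]splitr; apply: lerD; [exact: le_trans UB kP|exact: fu].
apply: le_trans; rewrite -sum_indicator; apply: ler_sum => v _; rewrite /B.
case: (boolP (uniq (slab (sunf p f r v)))) => [u|_]; last by case: uniq.
by rewrite slab_sunf in u; rewrite (map_uniq u).
Qed.

End Labels.

(** * From matchings to simple regular graphs *)

Section Simple.
Variables (D : nat) (V : finType).
Notation d := D.+1.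
Notation H := (V * 'I_D.+1)%type.
Implicit Types (p : {perm H}) (h a b y z : H).

Definition badh p h : bool :=
  ((p h).1 == h.1) || [exists y, [&& y != h, y.1 == h.1 & (p y).1 == (p h).1]].

Definition nbad p : nat := #|[set h | badh p h]|.

Definition simples : {set {perm H}} := [set p in matchings H | nbad p == 0%N].

Lemma conj_count_le (g : {perm H}) (A B : pred {perm H}) :
  (forall p, p \in matchings H -> A p -> B (p ^ g)%g) ->
  (#|[set p in matchings H | A p]| <= #|[set p in matchings H | B p]|)%N.
Proof.
move=> AB; rewrite -(card_imset _ (@conjg_inj _ g)); apply: subset_leq_card.
apply/fintype.subsetP => q /imsetP[p]; rewrite !inE => /andP[pM Ap] ->.
by rewrite matchings_conj// AB.
Qed.

(** Conjugation by transpositions makes [p a] equidistributed over the other half-edges; [count_two]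
    is the same for two values. *)
Lemma count_one a b : a != b ->
  (#|[set p in matchings H | p a == b]| * #|{: H}|.-1 <= #|matchings H|)%N.
Proof.
move=> ab; rewrite -(cardsC1 a) mulnC -sum_nat_const.
apply: (@leq_trans (\sum_(c in [set~ a]) #|[set p in matchings H | p a == c]|)).
  apply: leq_sum => c; rewrite !inE => ca.
  apply: (@conj_count_le (tperm b c)) => p _ /eqP pa.
  have ba : b != a by rewrite eq_sym.
  by rewrite -{1}(tpermD ba ca) permJ pa tpermL.
rewrite -[X in (_ <= X)%N]sum1_card (partition_big (fun p => p a) predT)//=.
rewrite [X in (_ <= X)%N](bigID (mem [set~ a])) /= -[X in (X <= _)%N]addn0 leq_add//.
by apply: leq_sum => c _; rewrite -sum1_card; apply/eq_leq/eq_bigl => p; rewrite inE.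
Qed.

Lemma count_two h h' b b' : h != h' -> b != b' ->
  b \notin [set h; h'] -> b' \notin [set h; h'] ->
  (#|[set p in matchings H | (p h == b) && (p h' == b')]| *
     ((#|{: H}| - 2) * (#|{: H}| - 3)) <= #|matchings H|)%N.
Proof.
move=> hh' bb' bS bS'; pose S := ~: [set h; h'].
have Sc : #|S| = (#|{: H}| - 2)%N by rewrite cardsCs finset.setCK cards2 hh'.
pose Q := [set c : H * H | [&& c.1 \in S, c.2 \in S & c.1 != c.2]].
have Qc : #|Q| = ((#|{: H}| - 2) * (#|{: H}| - 3))%N.
  rewrite -sum1_card (eq_bigl (fun c => (c.1 \in S) && (c.2 \in S :\ c.1))) => [|c]; last first.
    by rewrite !inE (eq_sym c.2); case: (c.1 == c.2); rewrite /= ?andbF ?andbT.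
  rewrite -(pair_big_dep (mem S) (fun c1 c2 => c2 \in S :\ c1) (fun _ _ => 1%N)) /=.
  rewrite (eq_bigr (fun=> #|{: H}| - 3)%N) => [|c cS]; first by rewrite sum_nat_const Sc.
  by rewrite sum1_card; have := cardsD1 c S; rewrite cS Sc => e; lia.
rewrite -Qc mulnC -sum_nat_const.
apply: (@leq_trans (\sum_(c in Q) #|[set p in matchings H | (p h == c.1) && (p h' == c.2)]|)).
  apply: leq_sum => -[c c']; rewrite inE /= => /and3P[cS cS' cc'].
  pose g1 := tperm b c; pose g := (g1 * tperm (g1 b') c')%g.
  have fix1 x : x \in [set h; h'] -> g1 x = x.
    move=> xS; rewrite tpermD//; first by apply: contraNneq bS => ->.
    by apply: contraTneq cS => ->; rewrite inE xS.
  have g1b' : g1 b' \notin [set h; h'].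
    by apply: contra bS' => xS; rewrite -[b'](tpermK b c) -/g1 (fix1 _ xS).
  have gfix x : x \in [set h; h'] -> g x = x.
    move=> xS; rewrite permM (fix1 _ xS) tpermD//; first by apply: contraNneq g1b' => ->.
    by apply: contraTneq cS' => ->; rewrite inE xS.
  have gb : g b = c.
    rewrite permM tpermL tpermD// 1?eq_sym//.
    apply: contraNneq bb' => e; apply/eqP; apply: (@perm_inj _ g1); rewrite -e /g1 tpermL; by [].
  have gb' : g b' = c' by rewrite permM tpermL.
  apply: (@conj_count_le g) => p _ /andP[/eqP ph /eqP ph'].
  have {1}<- : g h = h by rewrite gfix// !inE eqxx.
  have {1}<- : g h' = h' by rewrite gfix// !inE eqxx orbT.
  by rewrite !permJ ph ph' gb gb' !eqxx.
rewrite -[X in (_ <= X)%N]sum1_card (partition_big (fun p => (p h, p h')) predT)//=.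
rewrite [X in (_ <= X)%N](bigID (mem Q)) /= -[X in (X <= _)%N]addn0 leq_add//.
by apply: leq_sum => -[c1 c2] _; rewrite -sum1_card; apply/eq_leq/eq_bigl => p; rewrite inE xpair_eqE.
Qed.

(** Union bound over loops ([L]) and pairs of parallel edges ([B]). With [N = #|H|] and up to powers
    of [d], these are [N] events of probability [1 / (N - 1)] and [N ^ 2] events of probability
    [1 / ((N - 2) * (N - 3))]. From [6 <= N] on, [N ^ 2 <= 3 * ((N - 2) * (N - 3))]. *)
Lemma sum_nbad : (6 <= #|{: H}|)%N ->
  (\sum_(p in matchings H) nbad p <= (2 * d + 3 * d ^ 2) * #|matchings H|)%N.
Proof.
move=> H6; set m := #|matchings H|.
pose L p h i := (p h == (h.1, i)) : nat.
pose B p h (t : 'I_d * (V * ('I_d * 'I_d))) := [&& t.1 != h.2, t.2.1 != h.1, t.2.2.1 != t.2.2.2,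
  p h == (t.2.1, t.2.2.1) & p (h.1, t.1) == (t.2.1, t.2.2.2)].
have HE : #|{: H}| = (#|V| * d)%N by rewrite card_prod card_ord.
apply: (@leq_trans (\sum_(p in matchings H) (\sum_h \sum_i L p h i + \sum_h \sum_t B p h t))).
  apply: leq_sum => p pM; rewrite /nbad -sum1_card big_mkcond -big_split /=.
  apply: leq_sum => h _; rewrite inE; case: ifP => //.
  rewrite /badh => bh; case: eqP bh => [e _|/eqP e /= /existsP[y /and3P[yh /eqP y1 /eqP y2]]].
    rewrite (bigD1 (p h).2)//= /L -e -surjective_pairing eqxx; lia.
  have pyh : p y != p h by rewrite (inj_eq perm_inj).
  rewrite [X in (_ <= _ + X)%N](bigD1 (y.2, ((p h).1, ((p h).2, (p y).2))))//= /B /= -y1 -y2 -!surjective_pairing y2 -surjective_pairing !eqxx y1 e !andbT.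
  have n1 : y.2 != h.2.
    by apply: contraNneq yh => e0; rewrite [y]surjective_pairing y1 e0 -surjective_pairing.
  have n2 : (p h).2 != (p y).2.
    by apply: contraNneq pyh => e0; rewrite [p y]surjective_pairing y2 -e0 -surjective_pairing.
  by rewrite n1 n2; lia.
rewrite big_split /= mulnDl; apply: leq_add.
  rewrite exchange_big /=.
  have h1 h : (\sum_(p in matchings H) \sum_i L p h i * #|{: H}|.-1 <= d * m)%N.
    rewrite exchange_big /= -[X in (_ <= X * _)%N](card_ord d) -sum_nat_const; apply: leq_sum => i _.
    rewrite -big_distrl /=.
    have [e|ne] := eqVneq h (h.1, i).
      rewrite big1 ?mul0n// => p pM; rewrite /L -e; have [_ pn] := matchingsP _ pM.
      by rewrite (negbTE (pn h)).
    apply: leq_trans (count_one ne); rewrite leq_mul2r; apply/orP; right.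
    rewrite -sum1_card big_mkcond [X in (_ <= X)%N]big_mkcond /=; apply: leq_sum => p _.
    by rewrite inE /L; case: (p \in matchings H) => //=; case: eqP.
  have h2 : ((\sum_h \sum_(p in matchings H) \sum_i L p h i) * #|{: H}|.-1 <= #|{: H}| * (d * m))%N.
    rewrite big_distrl /= -sum_nat_const; apply: leq_sum => h _; apply: leq_trans (h1 h).
    by rewrite big_distrl /=; apply: leq_sum => p _; rewrite big_distrl.
  rewrite -(leq_pmul2r (m := #|{: H}|.-1)); last lia.
  apply: (leq_trans h2); rewrite -mulnA mulnC -!mulnA; nia.
have h1 h t : ((\sum_(p in matchings H) B p h t) * ((#|{: H}| - 2) * (#|{: H}| - 3)) <= m)%N.
  case: t => i [v [j j']]; have [c|nc] := boolP [&& i != h.2, v != h.1 & j != j']; last first.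
    rewrite big1 ?mul0n// => p _; rewrite /B /=; move: nc.
    by case: (i != h.2) => //=; case: (v != h.1) => //=; case: (j != j').
  have /and3P[ih vh jj'] := c.
  apply: leq_trans (@count_two h (h.1, i) (v, j) (v, j') _ _ _ _).
  - rewrite leq_mul2r; apply/orP; right.
    rewrite -sum1_card big_mkcond [X in (_ <= X)%N]big_mkcond /=; apply: leq_sum => p _.
    by rewrite inE /B /= ih vh jj' /=; case: (p \in matchings H) => //=; case: andP.
  - by apply: contraNneq ih => e; rewrite {1}e.
  - by apply: contraNneq jj' => -[->].
  - by rewrite !inE negb_or; apply/andP; split; [apply: contraNneq vh => <-|apply: contraNneq vh => -[->]].
  - by rewrite !inE negb_or; apply/andP; split; [apply: contraNneq vh => <-|apply: contraNneq vh => -[->]].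
rewrite exchange_big /=.
have h2 : ((\sum_h \sum_(p in matchings H) \sum_t B p h t) * ((#|{: H}| - 2) * (#|{: H}| - 3))
    <= #|{: H}| * ((d * (#|V| * (d * d))) * m))%N.
  rewrite big_distrl /= -[X in (_ <= X)%N]sum_nat_const; apply: leq_sum => h _.
  rewrite exchange_big /= big_distrl /=.
  have -> : (d * (#|V| * (d * d)))%N = #|{: 'I_d * (V * ('I_d * 'I_d))}| by rewrite !card_prod !card_ord.
  by rewrite -sum_nat_const; apply: leq_sum => t _.
rewrite -(leq_pmul2r (m := (#|{: H}| - 2) * (#|{: H}| - 3))); last by rewrite muln_gt0; lia.
apply: (leq_trans h2).
have -> : (#|{: H}| * (d * (#|V| * (d * d)) * m) = #|{: H}| * #|{: H}| * (d ^ 2 * m))%N.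
  by rewrite HE expnS expn1; ring.
have -> : (3 * d ^ 2 * m * ((#|{: H}| - 2) * (#|{: H}| - 3)) = 3 * ((#|{: H}| - 2) * (#|{: H}| - 3)) * (d ^ 2 * m))%N by ring.
rewrite leq_mul2r; apply/orP; right; move: H6; set N := #|_|; nia.
Qed.

Lemma half_few_bad : (6 <= #|{: H}|)%N -> (#|matchings H| <=
  2 * #|[set p in matchings H | nbad p <= 2 * (2 * d + 3 * d ^ 2)]|)%N.
Proof.
move=> H6; set C := (2 * d + 3 * d ^ 2)%N; have C0 : (0 < C)%N by rewrite /C; lia.
have sb := sum_nbad H6; rewrite -/C in sb.
set S := [set _ in _ | _]; pose S' := [set p in matchings H | (2 * C < nbad p)%N].
have e : (#|matchings H| = #|S| + #|S'|)%N.
  rewrite -(cardsID [set p | nbad p <= 2 * C]%N); congr (_ + _)%N; apply: eq_card => p; rewrite !inE//.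
  by rewrite -ltnNge andbC.
suff : (2 * #|S'| <= #|matchings H|)%N by lia.
rewrite -(leq_pmul2l C0); apply: leq_trans sb.
apply: (@leq_trans (\sum_(p in S') nbad p)).
  rewrite mulnA [(C * 2)%N]mulnC [(_ * #|S'|)%N]mulnC -sum_nat_const; apply: leq_sum => p.
  by rewrite inE => /andP[_ /ltnW].
rewrite [X in (X <= _)%N]big_mkcond [X in (_ <= X)%N]big_mkcond; apply: leq_sum => p _.
by rewrite inE; case: (p \in matchings H) => //=; case: ifP.
Qed.

(** With [a = p h], the pairs [h, a] and [b, p b] are replaced by [h, b] and [a, p b]. If [b] is not
    bad and neither [b] nor [p b] sits at an end of the bad edge or at a neighbor of one, then no
    bad half-edge arises and [h] is repaired; the size bound leaves such a [b]. *)
Lemma switch p h : p \in matchings H -> badh p h ->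
  (nbad p + 2 * (d * (2 + 2 * d)) < #|{: H}|)%N ->
  exists x y, (nbad (p ^ tperm x y)%g < nbad p)%N.
Proof.
move=> pM bh big; have [pK pn] := matchingsP _ pM; set a := p h.
pose Nb := [set h.1; a.1] :|: [set (p (h.1, i)).1 | i : 'I_d] :|: [set (p (a.1, i)).1 | i : 'I_d].
have Nbc : (#|Nb| <= 2 + 2 * d)%N.
  have c1 : (#|[set h.1; a.1]| <= 2)%N by rewrite cards2; case: (_ != _).
  have im (u : V) : (#|[set (p (u, i)).1 | i : 'I_d]| <= d)%N.
    by apply: leq_trans (leq_imset_card _ _) _; rewrite card_ord.
  rewrite /Nb; apply: leq_trans (leq_card_setU _ _) _.
  have [u1 _] := leq_card_setU [set h.1; a.1] [set (p (h.1, i)).1 | i : 'I_d].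
  have := im h.1; have := im a.1; lia.
pose X := [set b | badh p b] :|: finset.setX Nb [set: 'I_d] :|: p @^-1: (finset.setX Nb [set: 'I_d]).
have Xc : (#|X| < #|{: H}|)%N.
  apply: leq_ltn_trans big; apply: leq_trans (leq_card_setU _ _) _.
  rewrite card_preimset; last exact: perm_inj.
  have [u1 _] := leq_card_setU [set b | badh p b] (finset.setX Nb [set: 'I_d]).
  have : (#|finset.setX Nb [set: 'I_d]| <= d * (2 + 2 * d))%N.
    by rewrite cardsX cardsT card_ord mulnC leq_mul2l Nbc orbT.
  move: u1; rewrite -/(nbad p); set s := #|finset.setX _ _|; lia.
have [b bX] : exists b, b \notin X.
  apply/existsP; rewrite -negb_forall; apply: contraL Xc => /forallP h0.
  by rewrite -leqNgt -cardsT; apply: subset_leq_card; apply/fintype.subsetP => x _; exact: h0.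
move: bX; rewrite !inE !negb_or !andbT -!andbA => /and5P[bb0 _ bh1 ba1 /and5P[bNh bNa ph1 pa1 /andP[pNh pNa]]].
have bb : b.1 != (p b).1 by rewrite eq_sym.
have A1 y : y.1 = h.1 -> (p y).1 != b.1.
  move=> y1; apply: contraNneq bNh => <-; apply/imsetP; exists y.2 => //.
  by rewrite -y1 -surjective_pairing.
have A2 y : y.1 = b.1 -> (p y).1 != h.1.
  by move=> y1; apply/eqP => /A1; rewrite pK y1 eqxx.
have A3 y : y.1 = a.1 -> (p y).1 != (p b).1.
  move=> y1; apply: contraNneq pNa => <-; apply/imsetP; exists y.2 => //.
  by rewrite -y1 -surjective_pairing.
have A4 y : y.1 = (p b).1 -> (p y).1 != a.1.
  by move=> y1; apply/eqP => /A3; rewrite pK y1 eqxx.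
have Vne (y z : H) : y.1 != z.1 -> y != z by apply: contraNneq => ->.
have hb := Vne _ _ bh1; have ab := Vne _ _ ba1.
have hpb := Vne _ _ ph1; have apb := Vne _ _ pa1; have bpb := Vne _ _ bb.
have ha : h != a by rewrite eq_sym; exact: pn.
set t := tperm a b; pose q z := ((p ^ t)%g z).1.
have qJ z : (p ^ t)%g (t z) = t (p z) by rewrite permJ.
have tD z : z != a -> z != b -> t z = z by move=> za zb; rewrite /t tpermD 1?eq_sym.
have th : t h = h by rewrite tD// eq_sym.
have tpb : t (p b) = p b by rewrite tD// eq_sym.
have qh : q h = b.1 by have := qJ h; rewrite /q th => ->; rewrite -/a /t tpermL.
have qb : q b = h.1 by have := qJ a; rewrite /q {1}/t tpermL pK th => ->.
have qa : q a = (p b).1 by have := qJ b; rewrite /q {1}/t tpermR tpb => ->.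
have qpb : q (p b) = a.1 by have := qJ (p b); rewrite /q tpb pK => ->; rewrite /t tpermR.
have qz z : z != h -> z != a -> z != b -> z != p b -> q z = (p z).1.
  move=> zh za zb zpb; have := qJ z; rewrite /q (tD z)// => ->; rewrite tD//.
    by rewrite (can2_eq pK pK) pK.
  by rewrite (can2_eq pK pK).
have imp z : badh (p ^ t)%g z -> badh p z && (z != h).
  rewrite /badh -/(q z) => bz.
  have [zh|zh] := eqVneq z h.
    exfalso; move: bz; rewrite zh qh (negbTE bh1) /= => /existsP[y /and3P[yh /eqP y1]]; rewrite -/(q y).
    have [ya|ya] := eqVneq y a; first by rewrite ya qa eq_sym (negbTE bb).
    have [yb|yb] := eqVneq y b; first by move: bh1; rewrite -y1 yb eqxx.
    have [yp|yp] := eqVneq y (p b); first by move: ph1; rewrite -y1 yp eqxx.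
    by rewrite qz// (negbTE (A1 _ y1)).
  rewrite andbT.
  have [za|za] := eqVneq z a.
    exfalso; move: bz; rewrite za qa (negbTE pa1) /= => /existsP[y /and3P[ya /eqP y1]]; rewrite -/(q y).
    have [yh|yh] := eqVneq y h; first by rewrite yh qh (negbTE bb).
    have [yb|yb] := eqVneq y b; first by move: ba1; rewrite -y1 yb eqxx.
    have [yp|yp] := eqVneq y (p b); first by move: pa1; rewrite -y1 yp eqxx.
    by rewrite qz// (negbTE (A3 _ y1)).
  have [zb|zb] := eqVneq z b.
    exfalso; move: bz; rewrite zb qb eq_sym (negbTE bh1) /= => /existsP[y /and3P[yb /eqP y1]]; rewrite -/(q y).
    have [yh|yh] := eqVneq y h; first by move: bh1; rewrite -y1 yh eqxx.
    have [ya|ya] := eqVneq y a; first by move: ba1; rewrite -y1 ya eqxx.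
    have [yp|yp] := eqVneq y (p b); first by move: bb; rewrite -y1 yp eqxx.
    by rewrite qz// (negbTE (A2 _ y1)).
  have [zp|zp] := eqVneq z (p b).
    exfalso; move: bz; rewrite zp qpb eq_sym (negbTE pa1) /= => /existsP[y /and3P[yp /eqP y1]]; rewrite -/(q y).
    have [yh|yh] := eqVneq y h; first by move: ph1; rewrite -y1 yh eqxx.
    have [ya|ya] := eqVneq y a; first by move: pa1; rewrite -y1 ya eqxx.
    have [yb|yb] := eqVneq y b; first by move: bb; rewrite -y1 yb eqxx.
    by rewrite qz// (negbTE (A4 _ y1)).
  move: bz; rewrite qz// => /orP[->//|/existsP[y /and3P[yz /eqP y1]]]; rewrite -/(q y).
  have [yh|yh] := eqVneq y h.
    by rewrite yh qh eq_sym (negbTE (A1 z _))// -y1 yh.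
  have [ya|ya] := eqVneq y a.
    by rewrite ya qa eq_sym (negbTE (A3 z _))// -y1 ya.
  have [yb|yb] := eqVneq y b.
    by rewrite yb qb eq_sym (negbTE (A2 z _))// -y1 yb.
  have [yp|yp] := eqVneq y (p b).
    by rewrite yp qpb eq_sym (negbTE (A4 z _))// -y1 yp.
  by rewrite qz// => y2; apply/orP; right; apply/existsP; exists y; rewrite yz y1 eqxx.
exists a, b; apply: proper_card; apply/properP; split.
  by apply/fintype.subsetP => z; rewrite !inE => /imp/andP[].
exists h; rewrite inE//; apply/negP => /imp; by rewrite eqxx andbF.
Qed.

(** By [switch], a matching with [k.+1] bad half-edges is a conjugate by a transposition of one with
    at most [k]. The choice of two points, or of no conjugation, gives the factor [#|H| ^ 2 + 1]. *)
Lemma few_bad_le k : (k + 2 * (d * (2 + 2 * d)) < #|{: H}|)%N ->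
  (#|[set p in matchings H | nbad p <= k]| <= #|simples| * (#|{: H}| ^ 2).+1 ^ k)%N.
Proof.
elim: k => [_|k IH kH].
  rewrite muln1; apply: subset_leq_card; apply/fintype.subsetP => p.
  by rewrite !inE leqn0.
have {}IH : (#|[set p in matchings H | nbad p <= k]| <= #|simples| * (#|{: H}| ^ 2).+1 ^ k)%N by apply: IH; lia.
set S := [set _ in _ | _] in IH.
pose G (x : {perm H} * option (H * H)) : {perm H} :=
  if x.2 is Some ab then (x.1 ^ tperm ab.1 ab.2)%g else x.1.
apply: (@leq_trans #|G @: finset.setX S [set: option (H * H)]|).
  apply: subset_leq_card; apply/fintype.subsetP => p; rewrite inE => /andP[pM pk].
  have [pk'|pk'] := leqP (nbad p) k.
    by apply/imsetP; exists (p, None) => //; rewrite !inE pM pk'.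
  have [h hb] : exists h, badh p h.
    have : (0 < nbad p)%N by lia.
    by move=> /card_gt0P[h]; rewrite inE; exists h.
  have [x [y xy]] := switch pM hb ltac:(lia).
  apply/imsetP; exists ((p ^ tperm x y)%g, Some (x, y)).
    by rewrite !inE matchings_conj//= andbT; lia.
  by rewrite /G /= -conjgM tperm2 conjg1.
apply: leq_trans (leq_imset_card _ _) _; rewrite cardsX cardsT card_option card_prod.
by rewrite expnSr mulnA -mulnn leq_mul2r IH orbT.
Qed.

Lemma simples_ge (K := (2 * (2 * d + 3 * d ^ 2))%N) :
  (K + 2 * (d * (2 + 2 * d)) < #|{: H}|)%N ->
  (#|matchings H| <= 2 * (#|simples| * (#|{: H}| ^ 2).+1 ^ K))%N.
Proof.
move=> KH; apply: leq_trans (half_few_bad _) _; first by rewrite /K in KH; nia.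
by rewrite leq_mul2l few_bad_le.
Qed.

Lemma matchings_neq0 : ~~ odd #|{: H}| -> (0 < #|matchings H|)%N.
Proof.
move=> ev; pose f (k : 'I_#|{: H}|) : nat := if odd k then k.-1 else k.+1.
have fl k : (f k < #|{: H}|)%N.
  rewrite /f; case: ifP => ok; first by have := ltn_ord k; lia.
  have := ltn_ord k; move: ev ok; move: (nat_of_ord k) => m; clear; move: #|_| => N; lia.
pose g h : H := enum_val (Ordinal (fl (enum_rank h))).
have gK : involutive g.
  move=> h; rewrite /g; apply: (canLR (@enum_rankK _)); apply: val_inj; rewrite /= /f enum_valK /=.
  case: (nat_of_ord (enum_rank h)) => [|k] //=.
  by case: (boolP (odd k)) => ok; rewrite /= ?ok //= ; case: k ok => //= k; rewrite negbK => ->.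
apply/card_gt0P; exists (perm (inv_inj gK)); apply/matchingsP; split.
  by move=> h; rewrite !permE gK.
move=> h; rewrite permE; apply/eqP => /(congr1 (@enum_rank _)); rewrite enum_valK.
move=> /(congr1 val) /= e; suff : f (enum_rank h) != enum_rank h by rewrite e eqxx.
rewrite /f; move: (nat_of_ord _) => k; case: ifP => o; lia.
Qed.

End Simple.

(** * Matchings over a given simple graph *)

Section Fibers.
Variables (D n : nat).
Notation d := D.+1.
Notation V := 'I_n.
Notation H := ('I_n * 'I_D.+1)%type.
Implicit Types (p : {perm H}) (h : H) (v w : V) (E : {set {set V}}).

Definition nbh E v : {set V} := [set w | (v != w) && ([set v; w] \in E)].

Definition Eof p : {set {set V}} := [set [set h.1; (p h).1] | h : H].

Lemma simplesP p : reflect [/\ involutive p, forall h, (p h).1 != h.1 &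
    forall h y, y.1 = h.1 -> (p y).1 = (p h).1 -> y = h] (p \in simples D V).
Proof.
apply: (iffP idP) => [|[pK p1 p2]].
  rewrite inE => /andP[/matchingsP[pK pn]]; rewrite cards_eq0 => /eqP e.
  have nb h : ~~ badh p h.
    by apply/negP => bh; suff : h \in [set h | badh p h]; [rewrite e inE|rewrite inE].
  split=> // h; first by have := nb h; rewrite negb_or => /andP[].
  move=> y y1 y2; apply/eqP; have := nb h; rewrite negb_or => /andP[_].
  by rewrite negb_exists => /forallP/(_ y); rewrite y1 y2 !eqxx !andbT negbK.
rewrite inE; apply/andP; split.
  apply/matchingsP; split => // h; apply/eqP => e; by have := p1 h; rewrite e eqxx.
rewrite cards_eq0; apply/eqP/setP => h; rewrite !inE; apply/negbTE; rewrite negb_or p1 /=.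
rewrite negb_exists; apply/forallP => y; apply/negP => /and3P[yh /eqP y1 /eqP y2].
by move: yh; rewrite (p2 h y)// eqxx.
Qed.

Lemma set2_eq v w x y : [set v; w] = [set x; y] -> v = x /\ w = y \/ v = y /\ w = x.
Proof.
move=> e; have: v \in [set x; y] by rewrite -e !inE eqxx.
have: w \in [set x; y] by rewrite -e !inE eqxx orbT.
have: x \in [set v; w] by rewrite e !inE eqxx.
have: y \in [set v; w] by rewrite e !inE eqxx orbT.
by rewrite !inE => /orP[]/eqP a1 /orP[]/eqP a2 /orP[]/eqP a3 /orP[]/eqP a4;
  first [left; split; congruence | right; split; congruence].
Qed.

Lemma Eof_nbh p v : p \in simples D V -> nbh (Eof p) v = [set (p (v, i)).1 | i : 'I_d].
Proof.
move=> /simplesP[pK p1 p2]; apply/setP => w; rewrite inE; apply/andP/imsetP.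
  move=> [vw /imsetP[h _ /set2_eq[[-> ->]|[-> ->]]]].
    by exists h.2 => //; rewrite -surjective_pairing.
  by exists (p h).2 => //; rewrite -surjective_pairing pK.
move=> [i _ ->]; split; first by rewrite eq_sym; exact: p1 (v, i).
by apply/imsetP; exists (v, i).
Qed.

Lemma regularP E : reflect ((forall e, e \in E -> #|e| = 2%N) /\ forall v, #|nbh E v| = d)
  (E \in regular_graphs n d).
Proof.
have star E' v : (forall e, e \in E' -> #|e| = 2%N) -> [set e in E' | v \in e] = [set [set v; w] | w in nbh E' v].
  move=> E2; apply/setP => e; rewrite inE; apply/andP/imsetP.
    move=> [eE ve]; have /eqP/cards2P[x [y [xy exy]]] := E2 _ eE; rewrite exy in eE ve *.
    move: ve; rewrite !inE => /orP[] /eqP->; [exists y|exists x]; rewrite ?inE ?xy ?eE//.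
      by rewrite eq_sym xy /= finset.setUC.
    by rewrite finset.setUC.
  by move=> [w]; rewrite inE => /andP[vw wE] ->; rewrite !inE eqxx.
have inj E' v : {in nbh E' v &, injective (fun w => [set v; w])}.
  move=> w x; rewrite !inE => /andP[vw _] /andP[vx _] /set2_eq[[]//|[e _]].
  by rewrite e eqxx in vx.
rewrite inE; apply: (iffP andP) => -[h1 h2].
  have E2 e : e \in E -> #|e| = 2%N by move=> eE; apply/eqP; exact: (forall_inP h1).
  split=> // v; have /eqP := forallP h2 v; rewrite star// card_in_imset//; exact: inj.
split; first by apply/forall_inP => e /h1->.
by apply/forallP => v; rewrite star// card_in_imset ?h2//; exact: inj.
Qed.

Lemma Eof_regular p : p \in simples D V -> Eof p \in regular_graphs n d.
Proof.
move=> pS; have /simplesP[pK p1 p2] := pS; apply/regularP; split.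
  by move=> e /imsetP[h _ ->]; rewrite cards2 eq_sym p1.
move=> v; rewrite Eof_nbh// card_in_imset ?card_ord// => i j _ _ e.
by have := p2 (v, j) (v, i) erefl e => -[].
Qed.

Definition Fib E : {set {perm H}} := [set p in simples D V | Eof p == E].

(** A simple matching over [E] amounts to a bijection from directions to neighbors at each vertex:
    as there are no multiple edges, the two bijections at the ends of an edge determine the matched
    half-edges. *)
Lemma card_Fib E : E \in regular_graphs n d -> #|Fib E| = (d`! ^ n)%N.
Proof.
move=> /regularP[E2 En].
pose X v : {set {ffun 'I_d -> V}} := [set f in ffun_on (mem (nbh E v)) | injectiveb f].
have Xc v : #|X v| = d`! by rewrite card_inj_ffuns_on card_ord En ffactnn.
pose phi p : {ffun V -> {ffun 'I_d -> V}} := [ffun v => [ffun i => (p (v, i)).1]].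
have XP v (f : {ffun 'I_d -> V}) : f \in X v -> injective f /\ forall w, w \in nbh E v -> exists i, f i = w.
  rewrite inE => /andP[/ffun_onP fo /injectiveP fi]; split => // w wv.
  have /eqP im : [set f i | i : 'I_d] == nbh E v.
    rewrite eqEcard En card_imset// card_ord leqnn andbT.
    by apply/fintype.subsetP => x /imsetP[i _ ->]; exact: fo.
  by move: wv; rewrite -im => /imsetP[i _ ->]; exists i.
have -> : (d`! ^ n)%N = #|[set F : {ffun V -> {ffun 'I_d -> V}} | F \in family (fun v => mem (X v))]|.
  rewrite cardsE card_family foldrE big_map bigop.big_enum /= (eq_bigr (fun=> d`!)) => [|v _]; last exact: Xc.
  by rewrite prod_nat_const card_ord.
have phi_inj : {in simples D V &, injective phi}.
  move=> p q /simplesP[pK p1 p2] /simplesP[qK q1 q2] /ffunP e.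
  have e1 h : (p h).1 = (q h).1.
    by case: h => v i; have := e v; rewrite !ffunE => /ffunP/(_ i); rewrite !ffunE.
  apply/permP => h; rewrite [LHS]surjective_pairing [RHS]surjective_pairing; congr pair => //.
  have -> // : q h = p h.
  by apply: p2; [rewrite e1|rewrite e1 qK pK].
rewrite -(card_in_imset (f := phi) (D := Fib E)); last first.
  by move=> p q; rewrite !inE => /andP[pS _] /andP[qS _]; apply: phi_inj; rewrite inE.
apply: eq_card => F; rewrite [RHS]inE; apply/imsetP/familyP.
  move=> [p]; rewrite inE => /andP[pS /eqP pE] -> v; have /simplesP[pK p1 p2] := pS.
  rewrite !inE; apply/andP; split.
    apply/ffun_onP => i; rewrite !ffunE -pE Eof_nbh//; by apply/imsetP; exists i.
  apply/injectiveP => i j; rewrite !ffunE => e.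
  by have := p2 (v, j) (v, i) erefl e => -[].
move=> FX.
have nbC v w : (w \in nbh E v) = (v \in nbh E w) by rewrite !inE eq_sym finset.setUC.
have Fn v i : F v i \in nbh E v.
  by have := FX v; rewrite inE => /andP[/ffun_onP/(_ i)].
(* The partner of [h] sits at the neighbor in direction [h.2], in the direction in which that
   neighbor sees [h.1]. *)
pose g h : H := (F h.1 h.2, odflt ord0 [pick j | F (F h.1 h.2) j == h.1]).
have gP h : F (g h).1 (g h).2 = h.1.
  rewrite /g /=; case: pickP => [j /eqP//|no]; exfalso.
  have [_ /(_ h.1)] := XP _ _ (FX (F h.1 h.2)); rewrite -nbC => /(_ (Fn _ _)) [j ej].
  by have := no j; rewrite ej eqxx.
have Finj v i j : F v i = F v j -> i = j by have [fi _] := XP _ _ (FX v); exact: fi.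
have gK : involutive g.
  move=> h; have e1 : (g (g h)).1 = h.1 by rewrite {1}/g /= gP.
  rewrite [LHS]surjective_pairing [RHS]surjective_pairing; congr pair => //.
  apply: (Finj h.1); rewrite -{1}e1 gP /g //=.
pose p := perm (inv_inj gK).
have pE h : p h = g h by rewrite permE.
have pS : p \in simples D V.
  apply/simplesP; split.
  - by move=> h; rewrite !pE gK.
  - move=> h; rewrite pE /g /=; have := Fn h.1 h.2; rewrite inE => /andP[+ _]; by rewrite eq_sym.
  - move=> h y y1; rewrite !pE /g /= y1 => /Finj y2.
    by rewrite [y]surjective_pairing [h]surjective_pairing y1 y2.
have FE : F = phi p by apply/ffunP => v; apply/ffunP => i; rewrite !ffunE pE.
exists p => //; rewrite !inE; apply/andP; split; first by move: pS; rewrite inE.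
apply/eqP/setP => e; apply/imsetP/idP => [[h _ ->]|eE].
  by rewrite pE /g /=; have := Fn h.1 h.2; rewrite inE => /andP[_].
have /eqP/cards2P[x [y [xy exy]]] := E2 _ eE.
have yx : y \in nbh E x by rewrite inE xy -exy.
have [_ /(_ _ yx)[i ei]] := XP _ _ (FX x).
by exists (x, i) => //; rewrite pE /g /= ei.
Qed.

Lemma simples_partition : #|simples D V| = (#|regular_graphs n d| * d`! ^ n)%N.
Proof.
rewrite -sum_nat_const -sum1_card (partition_big Eof (mem (regular_graphs n d))) /=; last first.
  by move=> p; exact: Eof_regular.
apply: eq_bigr => E ER; rewrite -(card_Fib ER) -sum1_card; apply: eq_bigl => p.
by rewrite [in RHS]inE.
Qed.

End Fibers.

Lemma sqrS_ge m : ((m ^ 2).+1 <= m.+1 ^ 2)%N.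
Proof. by rewrite -!mulnn; nia. Qed.

Section Transfer.
Variables (R : realType) (D : nat).
Notation d := D.+1.

(* The number of matchings exceeds that of simple ones by a polynomial factor
   only, so an exponentially small set of matchings stays negligible. *)
Lemma transfer (good : forall n, pred {perm ('I_n * 'I_d)}) (kappa : R) (N0 : nat) : 0 < kappa ->
  (forall n, (N0 <= n)%N ->
     #|[set p in matchings ('I_n * 'I_d)%type | ~~ good n p]|%:R
       <= #|matchings ('I_n * 'I_d)%type|%:R * expR (- (kappa * n%:R))) ->
  forall eps : R, 0 < eps -> exists N1 : nat, forall n, (N1 <= n)%N -> ~~ odd (n * d) ->
    (0 < #|regular_graphs n d|)%N /\
    (1 - eps) * #|regular_graphs n d|%:R <=
    #|[set E in regular_graphs n d | [exists p in Fib D E, good n p]]|%:R.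
Proof.
move=> k0 hN eps eps0.
pose K := (2 * (2 * d + 3 * d ^ 2))%N.
have k2 : 0 < kappa / 2 by rewrite divr_gt0.
have [N2 hN2] := log_small (2 * K)%:R d k2.
have e2 : 0 < eps / 2 by rewrite divr_gt0.
have [N3 hN3] := expR_natr_small k2 e2.
exists (maxn (maxn N0 N2) (maxn N3 (K + 2 * (d * (2 + 2 * d))).+1)) => n.
rewrite !geq_max => /andP[/andP[n0 n2] /andP[n3 n4]] ev.
have HE : #|{: 'I_n * 'I_d}| = (n * d)%N by rewrite card_prod !card_ord.
have sg := @simples_ge D 'I_n; rewrite -/K HE in sg.
have {}sg : (#|matchings ('I_n * 'I_d)%type| <= 2 * (#|simples D 'I_n| * ((n * d) ^ 2).+1 ^ K))%N.
  by apply: sg; apply: leq_trans n4 _; rewrite leq_pmulr.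
have m0 : (0 < #|matchings ('I_n * 'I_d)%type|)%N by apply: matchings_neq0; rewrite HE.
set mt := #|matchings _| in sg m0 *.
have s0 : (0 < #|simples D 'I_n|)%N by move: sg; case: #|simples D 'I_n| => //; lia.
have f0 : (0 < d`! ^ n)%N by rewrite expn_gt0 fact_gt0.
have r0 : (0 < #|regular_graphs n d|)%N.
  by move: s0; rewrite simples_partition muln_gt0 => /andP[].
split=> //; set G := [set E in _ | _].
pose B := regular_graphs n d :\: G.
have BG : #|regular_graphs n d| = (#|G| + #|B|)%N.
  rewrite -(cardsID G (regular_graphs n d)); congr (_ + _)%N; apply: eq_card => E.
  by rewrite finset.in_setI; apply: andb_idl; rewrite inE => /andP[].
have Bb : (#|B| * d`! ^ n <= #|[set p in matchings ('I_n * 'I_d)%type | ~~ good n p]|)%N.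
  rewrite -sum_nat_const -sum1_card (partition_big (@Eof D n) predT)//=.
  rewrite [X in (_ <= X)%N](bigID (mem B)) /= -[X in (X <= _)%N]addn0 leq_add//.
  apply: leq_sum => E EB; have /setDP[ER EG] := EB; rewrite -(card_Fib ER) -sum1_card.
  rewrite [X in (X <= _)%N]big_mkcond [X in (_ <= X)%N]big_mkcond; apply: leq_sum => p _.
  case: ifP => // pF; suff -> : (p \in [set p in matchings ('I_n * 'I_d)%type | ~~ good n p]) && (Eof p == E) by [].
  have /andP[pS ->] : (p \in simples D 'I_n) && (Eof p == E) by move: pF; rewrite /Fib finset.in_set.
  have pM : p \in matchings ('I_n * 'I_d)%type by move: pS; rewrite /simples finset.in_set => /andP[].
  rewrite andbT finset.in_set pM /=; apply: contra EG => gp; rewrite finset.in_set ER /=.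
  by apply/existsP; exists p; rewrite pF.
have fR : 0 < (d`! ^ n)%:R :> R by rewrite ltr0n.
have q0 : 0 < ((n * d) ^ 2).+1%:R ^+ K :> R by rewrite exprn_gt0.
have h1 : #|B|%:R * (d`! ^ n)%:R <= mt%:R * expR (- (kappa * n%:R)) :> R.
  by rewrite -natrM; apply: le_trans (hN _ n0); rewrite ler_nat.
have h2 : mt%:R <= 2 * (#|regular_graphs n d|%:R * (d`! ^ n)%:R * ((n * d) ^ 2).+1%:R ^+ K) :> R.
  by rewrite -natrM -simples_partition -natrX -!natrM ler_nat.
have h3 : ((n * d) ^ 2).+1%:R ^+ K * expR (- (kappa * n%:R)) <= eps / 2 :> R.
  apply: le_trans (hN3 _ n3).
  rewrite -[X in X ^+ K]lnK ?posrE// -expRM_natl -expRD ler_expR.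
  have := hN2 _ n2; rewrite [(d * n)%N]mulnC => l1.
  have : K%:R * ln ((n * d) ^ 2).+1%:R <= (2 * K)%:R * (1 + ln (n * d).+1%:R) :> R.
    have a1 : ln ((n * d) ^ 2).+1%:R <= 2 * ln (n * d).+1%:R :> R.
      rewrite mulr_natl -lnXn// ler_ln ?posrE ?exprn_gt0// -natrX ler_nat; exact: sqrS_ge.
    rewrite natrM; have := ler_wpM2l (ler0n R K) a1; have := ler0n R K; lra.
  move: l1; lra.
have h4 : #|B|%:R <= eps * #|regular_graphs n d|%:R :> R.
  rewrite -(ler_pM2r fR); apply: (le_trans h1).
  apply: (le_trans (ler_wpM2r (expR_ge0 _) h2)).
  rewrite -!mulrA ; set a := #|regular_graphs n d|%:R; set b := (d`! ^ n)%:R.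
  have ab : 0 <= a * b by rewrite mulr_ge0.
  have := ler_wpM2l ab h3; lra.
move: h4; rewrite BG natrD; lra.
Qed.

End Transfer.

(** * Invariant processes on the tree *)

Section Words.
Variables (D : nat).
Notation d := D.+1.
Notation troot := (tree_root d).
Implicit Types (u v w : tree d).

Definition deg v : nat := if val v is [::] then d else D.

(** Indices start at 0, the letters of words at 1. For [k >= deg v] the word is not in the tree, and
    [insubd] returns [v] itself. *)
Definition child v (k : nat) : tree d := insubd v (rcons (val v) k.+1).

Lemma tree_word_rcons (w : seq nat) j : tree_word d (rcons w j) =
  tree_word d w && (1 <= j <= if w is [::] then d else D)%N.
Proof.
case: w => [|i w] //=; first by rewrite andbT.
by rewrite all_rcons [in LHS]andbCA [in RHS]andbC.
Qed.

Lemma val_child v k : (k < deg v)%N -> val (child v k) = rcons (val v) k.+1.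
Proof.
move=> kv; rewrite val_insubd.
have -> // : tree_word d (rcons (val v) k.+1) by rewrite tree_word_rcons (valP v); exact: kv.
Qed.

Lemma size_child v k : (k < deg v)%N -> size (val (child v k)) = (size (val v)).+1.
Proof. by move=> kv; rewrite val_child// size_rcons. Qed.

Lemma child_neq_root v k : (k < deg v)%N -> val (child v k) != [::].
Proof. by move=> kv; rewrite val_child// -size_eq0 size_rcons. Qed.

Lemma deg_nroot v : val v != [::] -> deg v = D.
Proof. by rewrite /deg; case: (val v). Qed.

Lemma deg_child v k : (k < deg v)%N -> deg (child v k) = D.
Proof. by move=> kv; rewrite deg_nroot// child_neq_root. Qed.

Lemma child_inj2 u v k l : (k < deg u)%N -> (l < deg v)%N ->
  child u k = child v l -> u = v /\ k = l.
Proof.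
move=> ku lv /(congr1 val); rewrite !val_child// => /rcons_inj[uv ->]; split=> //.
exact: val_inj.
Qed.

Lemma rootP v : val v = [::] -> v = troot.
Proof. by move=> v0; apply: val_inj. Qed.

Lemma treeP v : v = troot \/ exists u k, (k < deg u)%N /\ v = child u k.
Proof.
case/lastP e : (val v) => [|s k]; first by left; exact: rootP.
right; have := valP v; rewrite e tree_word_rcons => /andP[sw /andP[k0 kd]].
exists (exist _ s sw), k.-1; have kd' : (k.-1 < deg (exist _ s sw))%N.
  by rewrite /deg /=; case: (s) kd; lia.
split=> //; apply: val_inj; rewrite val_child//= e prednK//.
Qed.

Lemma tree_rect_child (P : tree d -> Prop) : P troot ->
  (forall u k, (k < deg u)%N -> P u -> P (child u k)) -> forall v, P v.
Proof.
move=> P0 PS v; move: {2}(size _) (leqnn (size (val v))) => n; elim: n v => [|n IH] v.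
  by rewrite leqn0 size_eq0 => /eqP/rootP->.
case: (treeP v) => [->//|[u [k [ku ->]]]]; rewrite size_child// ltnS => /IH; exact: PS.
Qed.

Lemma tree_childP u v : reflect (exists2 k, (k < deg u)%N & v = child u k) (tree_child u v).
Proof.
apply: (iffP eqP) => [e|[k ku ->]]; last by rewrite val_child// last_rcons.
have := valP v; rewrite e tree_word_rcons => /andP[_ /andP[l0 ld]].
have ld' : ((last 0 (val v)).-1 < deg u)%N by rewrite /deg; case: (val u) ld; lia.
by exists (last 0 (val v)).-1 => //; apply: val_inj; rewrite val_child// prednK.
Qed.

Lemma adj_size u v : tree_adj u v -> size (val v) = (size (val u)).+1 \/ size (val u) = (size (val v)).+1.
Proof. by move=> /orP[] /tree_childP[k ku ->]; rewrite size_child//; [left|right]. Qed.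

Lemma adj_child u k : (k < deg u)%N -> tree_adj u (child u k).
Proof. by move=> ku; apply/orP; left; apply/tree_childP; exists k. Qed.

Lemma vertex_ballE r v : vertex_ball d r v <-> (size (val v) <= r)%N.
Proof.
elim: r v => [|r IH] v /=.
  by rewrite /vertex_ball /= leqn0 size_eq0; split => [->|/eqP].
split=> [[/IH/leqW//|[u /IH ur /adj_size[->|e]]]|]; first by rewrite ltnS.
  by apply/leqW/(leq_trans _ ur); rewrite e.
case: (treeP v) => [->|[u [k [ku ->]]]]; first by left; apply/IH.
rewrite size_child// ltnS => ur; right; exists u; [exact/IH|exact: adj_child].
Qed.

Definition near_edge (r : nat) v : bool :=
  (size (val v) <= r)%N || prefix [:: 1%N] (val v) && (size (val v) <= r.+1)%N.

Lemma edge_ballE r v : edge_ball d r.+1 v <-> near_edge r v.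
Proof.
rewrite /edge_ball /near_edge /=; elim: r v => [|r IH] v.
  rewrite /= leqn0 size_eq0; split.
    by case=> ->; rewrite //= orbT.
  case: (val v) => [|a [|b s]] //=; first by left.
    by move=> /andP[/andP[/eqP<- _] _]; right.
  by rewrite andbF.
split=> [[/IH|[u /IH]]|].
- by move=> /orP[vr|/andP[-> vr]]; apply/orP; [left|right]; lia.
- move=> ur uv; case/orP: ur => [ur|/andP[p1 ur]].
    apply/orP; left; case: (adj_size uv) => /= e; first by rewrite e ltnS.
  by apply/leqW/(leq_trans _ ur); rewrite e.
  case/orP: uv => /tree_childP[k ku e].
    apply/orP; right; rewrite e size_child// ltnS ur andbT val_child//.
    by move: p1; rewrite -[sval u]/(val u); case: (val u) => //= a s /andP[-> _]; case: s.
  by apply/orP; left; move: ur; rewrite e -[sval (child v k)]/(val (child v k)) size_child// => /ltnW.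
case: (treeP v) => [->|[u [k [ku ->]]]] => [_|]; first by left; apply/IH.
rewrite size_child// val_child// => h.
right; exists u; last exact: adj_child.
apply/IH; rewrite -[sval u]/(val u); case/orP: h => [|/andP[p1 s1]]; first by rewrite ltnS => ->.
apply/orP; have [u0|u0] := eqVneq (val u) [::]; first by left; rewrite u0.
by right; rewrite -ltnS s1 andbT; move: p1; case: (val u) u0 => //= a s _ /andP[-> _]; case: s.
Qed.

Section Reading.
Variables (M : finType).
Implicit Type c : tree d -> M.

Fixpoint brf c v (r : nat) : br D M r :=
  match r return br D M r with
  | 0 => c v
  | r'.+1 => (c v, [ffun i : 'I_D => brf c (child v i) r'])
  end.

Definition start c (r : nat) : star D M r := (c troot, [ffun i : 'I_d => brf c (child troot i) r]).

Lemma trunc_brf c v k r : (k <= r)%N -> trunc k (brf c v r) = brf c v k.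
Proof.
elim: k r v => [|k IH] [|r] v //= kr; congr pair; apply/ffunP => i.
by rewrite !ffunE IH.
Qed.

Lemma strunc_start c r : strunc (start c r.+1) = start c r.
Proof. congr pair; apply/ffunP => k; rewrite !ffunE; exact: (trunc_brf _ _ (leqnSn r)). Qed.

Lemma own_start c r : own ord0 (start c r) =
  match r return br D M r with 0 => c troot | r'.+1 => (c troot, [ffun k : 'I_D => brf c (child troot k.+1) r']) end.
Proof.
case: r => [|r] //=; congr pair; apply/ffunP => k; rewrite !ffunE.
by rewrite -[RHS](trunc_brf c (child troot k.+1) (leqnSn r)).
Qed.

Lemma prefix_child v u : prefix (val v) (val u) -> u = v \/
  exists2 k, (k < deg v)%N & prefix (val (child v k)) (val u).
Proof.
move=> /prefixP[[|k s] e]; first by left; apply: val_inj; rewrite e cats0.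
right; have := valP u; rewrite e -cat_rcons => tw.
have : tree_word d (rcons (val v) k).
  elim/last_ind: s tw {e} => [|s x IH]; first by rewrite cats0.
  by rewrite -rcons_cat => tw; apply: IH; move: tw; rewrite tree_word_rcons => /andP[].
rewrite tree_word_rcons => /andP[_ /andP[k0 kd]].
have kd' : (k.-1 < deg v)%N by rewrite /deg; case: (val v) kd; lia.
by exists k.-1 => //; rewrite val_child// prednK// prefix_prefix.
Qed.

Lemma brf_eq c c' v r : val v != [::] -> (brf c v r = brf c' v r <->
  forall u, prefix (val v) (val u) -> (size (val u) <= size (val v) + r)%N -> c u = c' u).
Proof.
elim: r v => [|r IH] v v0; split.
- move=> e u pu; rewrite addn0 => su; have -> // : u = v.
  case: (prefix_child pu) => [//|[k kv /size_prefix h]].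
  by have := leq_trans h su; rewrite size_child// ltnn.
- by move=> h; apply: h; [exact: prefix_refl|rewrite addn0].
- move=> [cv /ffunP h] u /prefix_child[->//|[k kv pu]] su.
  have kD : (k < D)%N by rewrite -(deg_nroot v0).
  have := h (Ordinal kD); rewrite !ffunE /= => /(IH _ (child_neq_root kv)); apply => //.
  by rewrite size_child//; lia.
- move=> h /=; congr pair; first by apply: h; [exact: prefix_refl|lia].
  apply/ffunP => i; have iv : (i < deg v)%N by rewrite deg_nroot.
  rewrite !ffunE; apply/IH; first exact: child_neq_root.
  move=> u pu su; apply: h; last by move: su; rewrite size_child//; lia.
  by apply: prefix_trans pu; rewrite val_child// -cats1 prefix_prefix.
Qed.

Lemma start_eq c c' r : start c r = start c' r <->
  forall u, (size (val u) <= r.+1)%N -> c u = c' u.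
Proof.
split=> [[c0 /ffunP h] u su|h].
  have := prefix_child (v := troot) (u := u) (prefix0s _) => -[->//|[k kd pu]].
  have := h (Ordinal kd : 'I_d); rewrite !ffunE /= => /(brf_eq _ _ _ (child_neq_root kd)).
  by apply=> //; rewrite size_child.
congr pair; first exact: h.
apply/ffunP => i; have iv : (i < deg troot)%N by exact: ltn_ord.
rewrite !ffunE; apply/brf_eq; first exact: child_neq_root.
by move=> u pu su; apply: h; move: su; rewrite size_child.
Qed.

Lemma edge_eq c c' r :
  (own ord0 (start c r), (start c r).2 ord0) = (own ord0 (start c' r), (start c' r).2 ord0) <->
  forall u, near_edge r u -> c u = c' u.
Proof.
have d0 : (0 < deg troot)%N by [].
have br0 : (start c r).2 ord0 = (start c' r).2 ord0 <->
    forall u, prefix [:: 1%N] (val u) -> (size (val u) <= r.+1)%N -> c u = c' u.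
  rewrite !ffunE; split=> [/(brf_eq _ _ _ (child_neq_root d0)) h u pu su|h].
    by apply: h; rewrite ?size_child// val_child.
  apply/(brf_eq _ _ _ (child_neq_root d0)) => u; rewrite size_child// val_child//; exact: h.
split=> [[h1 /br0 h2] u /orP[su|/andP[pu su]]|h]; last 2 first.
- exact: h2.
- congr pair; last by apply/br0 => u pu su; apply: h; apply/orP; right; rewrite pu.
  rewrite !own_start; case: r h {br0} => [|r] h; first by apply: h; apply/orP; left.
  congr pair; first by apply: h; apply/orP; left.
  apply/ffunP => k; have kd : (k.+1 < deg troot)%N by rewrite /deg /= ltnS.
  rewrite !ffunE; apply/brf_eq; first exact: child_neq_root.
  by move=> u pu su; apply: h; apply/orP; left; move: su; rewrite size_child.
have := prefix_child (v := troot) (u := u) (prefix0s _) => -[->|[k kd pu]].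
  by move: h1; rewrite !own_start; case: (r) => [|r'] // [].
case: k kd pu => [|k] kd pu.
  by apply: h2; [move: pu; rewrite val_child|lia].
move: h1; rewrite !own_start; case: r su {h2 br0} => [|r] su.
  by have := leq_trans (size_prefix pu) su; rewrite size_child.
move=> [_ /ffunP h1]; have kD : (k < D)%N by [].
have := h1 (Ordinal kD); rewrite !ffunE /= => /(brf_eq _ _ _ (child_neq_root kd)); apply => //.
by rewrite size_child.
Qed.

End Reading.
End Words.

Section Laws.
Variables (R : realType) (D : nat) (M : colorType).
Notation d := D.+1.
Notation troot := (tree_root d).
Implicit Types (u v w : tree d) (c : tree d -> M) (mu : probability (config d M) R).

Notation stf r := (fun c : tree d -> M => start c r).

Definition agree (S : seq (tree d)) c c0 : Prop := forall u, u \in S -> c u = c0 u.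

(** Finite dependence stands in for measurability: as there are finitely many colors, every event of
    such a [T] is measurable, whatever the codomain ([measurable_findep]). *)
Definition findep (X : Type) (T : (tree d -> M) -> X) : Prop :=
  exists S : seq (tree d), forall c c', agree S c c' -> T c = T c'.

Lemma measurable_agree (S : seq (tree d)) c0 :
  measurable ([set c : tree d -> M | agree S c c0]%classic : set (config d M)).
Proof.
elim: S => [|v S IH].
  by rewrite (_ : [set _ | _]%classic = setT) //; apply/seteqP; split.
rewrite (_ : [set _ | _]%classic = ([set x | x v = c0 v] `&` [set c | agree S c c0])%classic).
  apply: measurableI => //; apply: sub_sigma_algebra.
  by exists v, (c0 v).
apply/seteqP; split=> c /=.
  move=> cS; split; first by apply: cS; rewrite mem_head.
  by move=> u uS; apply: cS; rewrite inE uS orbT.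
by move=> [cv cS] u; rewrite inE => /orP[/eqP->//|]; exact: cS.
Qed.

Definition extend (S : seq (tree d)) (y : {ffun seq_sub S -> M}) (u : tree d) : M :=
  if insub u is Some s then y s else point.

Lemma extendE (S : seq (tree d)) c : agree S (extend [ffun s : seq_sub S => c (val s)]) c.
Proof. by move=> u uS; rewrite /extend insubT ffunE. Qed.

Lemma measurable_findep (X : Type) (T : (tree d -> M) -> X) (A : set X) : findep T ->
  measurable ([set c : tree d -> M | A (T c)]%classic : set (config d M)).
Proof.
move=> [S TS].
rewrite (_ : [set _ | _]%classic = (\bigcup_(y : {ffun seq_sub S -> M})
   (if `[< A (T (extend y)) >] then [set c | agree S c (extend y)] else set0))%classic).
  apply: countable_bigcupT_measurable => [|y]; first exact: countableP.
  by case: ifP => _; [exact: measurable_agree|exact: measurable0].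
apply/seteqP; split => c /=.
  move=> Ac; exists [ffun s => c (val s)] => //.
  have e : T (extend [ffun s : seq_sub S => c (val s)]) = T c by apply: TS; exact: extendE.
  by rewrite asboolT ?e// => u uS; rewrite /= extendE.
move=> [y _]; case: asboolP => // Ay cy; by rewrite (TS _ _ cy).
Qed.

Definition law (X : finType) mu (T : (tree d -> M) -> X) (x : X) : R :=
  fine (mu [set c | T c = x]%classic).

Lemma law_seq (X : finType) mu (T : (tree d -> M) -> X) (s : seq X) : findep T -> uniq s ->
  mu [set c | T c \in s]%classic = (\sum_(x <- s) law mu T x)%:E.
Proof.
move=> Tf; have mT (A : set X) : measurable ([set c : tree d -> M | A (T c)]%classic : set (config d M)).
  exact: measurable_findep.
elim: s => [_|x s IH /= /andP[xs us]].
  by rewrite big_nil (_ : [set _ | _]%classic = set0) ?measure0//; apply/seteqP; split.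
rewrite big_cons EFinD -IH//.
rewrite (_ : [set _ | _]%classic = ([set c | T c = x] `|` [set c | T c \in s])%classic); last first.
  apply/seteqP; split=> c /=; rewrite inE; first by move=> /orP[/eqP|]; [left|right].
  by move=> [->|->]; rewrite ?eqxx ?orbT.
rewrite measureU.
- rewrite /law fineK// fin_num_measure//; exact: (mT (fun y => y = x)).
- exact: (mT (fun y => y = x)).
- exact: (mT (fun y => y \in s)).
- by apply/seteqP; split => // c /= [->]; rewrite (negbTE xs).
Qed.

Lemma law_pred (X : finType) mu (T : (tree d -> M) -> X) (A : pred X) : findep T ->
  mu [set c | A (T c)]%classic = (\sum_(x | A x) law mu T x)%:E.
Proof.
move=> Tf; rewrite -big_filter -law_seq ?filter_uniq ?index_enum_uniq//.
congr (mu _); apply/seteqP; split=> c /=; by rewrite mem_filter mem_index_enum andbT.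
Qed.

Lemma law_pmf (X : finType) mu (T : (tree d -> M) -> X) : findep T -> is_pmf (law mu T).
Proof.
move=> Tf; split=> [x|]; first by rewrite fine_ge0.
apply: EFin_inj; rewrite -(law_pred mu predT Tf) -(probability_setT mu).
by congr (mu _); apply/seteqP; split.
Qed.

Lemma law_push (X Y : finType) mu (T : (tree d -> M) -> X) (h : X -> Y) : findep T ->
  law mu (h \o T) = push (law mu T) h.
Proof.
move=> Tf; apply/funext => y; rewrite /law.
rewrite (_ : [set _ | _]%classic = [set c | [pred x | h x == y] (T c)]%classic); last first.
  by apply/seteqP; split => c /= /eqP.
rewrite law_pred//= /push big_mkcond; apply: eq_bigr => x _ /=.
by case: eqP; rewrite ?mul1r ?mul0r.
Qed.

(** Only the partition matters: [T] separates exactly what the colors on [S] separate, and its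
    further values have probability 0. *)
Lemma entropy_law (X : finType) mu (T : (tree d -> M) -> X) (S : {fset tree d}) :
  (forall c c', T c = T c' <-> forall u, u \in S -> c u = c' u) ->
  entropy mu S = hent (law mu T).
Proof.
move=> TS; rewrite /entropy /hent; congr (- _).
pose ex (y : {ffun S -> M}) (u : tree d) : M := if insub u is Some s then y s else point.
have exE (y : {ffun S -> M}) (s : S) : ex y (val s) = y s by rewrite /ex valK.
have exT c (y : {ffun S -> M}) : (forall s : S, c (val s) = y s) <-> T c = T (ex y).
  rewrite TS; split => [h u uS|h s]; last by rewrite h ?exE// fsvalP.
  by rewrite -[u]/(val (FSetSub uS)) exE h.
have Ti : injective (fun y => T (ex y)).
  by move=> y z /exT h; apply/ffunP => s; rewrite -h exE.
rewrite [RHS](bigID (mem [set T (ex y) | y : {ffun S -> M}])) /= [X in _ = _ + X]big1 ?addr0.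
  rewrite big_imset /=; last by move=> y z _ _; exact: Ti.
  apply: eq_bigr => y _; rewrite /law.
  by rewrite (_ : [set x | forall s, _]%classic = [set c | T c = T (ex y)]%classic)//;
    apply/seteqP; split => c /= /exT.
move=> x xn; rewrite /law (_ : [set _ | _]%classic = set0) ?measure0 ?mul0r//.
apply/seteqP; split => // c /= Tc; move/negP: xn; apply; apply/imsetP.
exists [ffun s => c (val s)] => //; rewrite -Tc; apply/exT => s; by rewrite ffunE.
Qed.

Lemma findep_ball (X : Type) (T : (tree d -> M) -> X) r :
  (forall c c', (forall u, (size (val u) <= r)%N -> c u = c' u) -> T c = T c') -> findep T.
Proof.
move=> h; have fB : finite_set (vertex_ball d r).
  apply: finite_tree_ball; rewrite (_ : [set _ | _]%classic = [set troot]%classic)//.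
  by apply/seteqP; split=> v /=; [exact: rootP|move=> ->].
have [s sB] := (finite_seqP (vertex_ball d r)).1 fB; exists s => c c' cs; apply: h => u /vertex_ballE.
by rewrite sB => /cs.
Qed.

Lemma findep_start r : findep (stf r).
Proof. by apply: (@findep_ball _ _ r.+1) => c c' h; apply/start_eq. Qed.

Lemma findep_comp (X Y : Type) (T : (tree d -> M) -> X) (h : X -> Y) : findep T -> findep (h \o T).
Proof. by move=> [S hS]; exists S => c c' /hS /= ->. Qed.

Definition slaw mu (r : nat) : star D M r -> R := law mu (stf r).
Arguments slaw : clear implicits.

Lemma edge_law mu r :
  law mu (fun c => (own ord0 (start c r), (start c r).2 ord0)) = edge (slaw mu) (r := r).
Proof.
rewrite (law_push mu (fun x : star D M r => (own ord0 x, x.2 ord0)) (findep_start r)).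
by apply/funext => -[a b]; rewrite /push /edge; apply: eq_bigr => x _; rewrite xpair_eqE.
Qed.

Lemma annealed_sig mu r : annealed_entropy mu r.+1 = sig (slaw mu) r.
Proof.
have fin1 S : finite_set S -> finite_set (gball (@tree_adj d) S r.+1) /\ finite_set (gball (@tree_adj d) S r).
  by move=> fS; split; exact: finite_tree_ball.
rewrite /annealed_entropy /sig; congr (_ - _ * _).
  apply: entropy_law => c c'; rewrite start_eq; split=> h u.
    rewrite in_fset_set; last first.
      apply: finite_tree_ball; rewrite (_ : [set _ | _]%classic = [set troot]%classic)//.
      by apply/seteqP; split=> v /=; [exact: rootP|move=> ->].
    by rewrite inE => /vertex_ballE; exact: h.
  move=> su; apply: h; rewrite in_fset_set.
    by rewrite inE; apply/vertex_ballE.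
  apply: finite_tree_ball; rewrite (_ : [set _ | _]%classic = [set troot]%classic)//.
  by apply/seteqP; split=> v /=; [exact: rootP|move=> ->].
have fE : finite_set (edge_ball d r.+1).
  apply: finite_tree_ball; apply: (@sub_finite_set _ _ [set` [:: troot; child troot 0]]%classic) => //.
  move=> v /= [/rootP->|v1]; first by rewrite mem_head.
  by rewrite !inE; apply/orP; right; apply/eqP; apply: val_inj; rewrite val_child.
rewrite -edge_law; apply: entropy_law => c c'; rewrite edge_eq; split=> h u.
  by rewrite in_fset_set// inE => /edge_ballE; exact: h.
by move=> su; apply: h; rewrite in_fset_set// inE; apply/edge_ballE.
Qed.

End Laws.
Arguments slaw {R D M} mu r.
Arguments findep_start {D M} r.

(** * Automorphisms of the tree: rotations at the root and reversal of an edge *)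

Section Automorphisms.
Variables (D : nat).
Notation d := D.+1.
Notation troot := (tree_root d).
Implicit Types (u v w : tree d).

(** A permutation of the first [n] integers as a function on [nat], because the number of children
    varies with the vertex. *)
Definition permN (n : nat) (f : nat -> nat) : Prop :=
  [/\ forall k, (k < n)%N -> (f k < n)%N,
      forall k l, (k < n)%N -> (l < n)%N -> f k = f l -> k = l &
      forall l, (l < n)%N -> exists2 k, (k < n)%N & f k = l].

Lemma aut_of_children (psi : tree d -> tree d) (s : tree d -> nat -> nat) :
  psi troot = troot -> (forall u, permN (deg u) (s u)) ->
  (forall u k, (k < deg u)%N -> psi (child u k) = child (psi u) (s u k)) -> tree_aut psi.
Proof.
move=> psi0 sP psiS.
have dE u : deg (psi u) = deg u.
  elim/tree_rect_child: u => [|u k ku dE]; first by rewrite psi0.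
  have [s1 _ _] := sP u; rewrite psiS// !deg_child// dE; exact: s1.
have sl u k : (k < deg u)%N -> (s u k < deg (psi u))%N.
  by move=> ku; rewrite dE; have [s1 _ _] := sP u; exact: s1.
have psi_child u v : tree_child (psi u) (psi v) = tree_child u v.
  apply/tree_childP/tree_childP => [[k]|[k ku ->]]; last first.
    by exists (s u k); [exact: sl|rewrite psiS].
  rewrite dE => ku e.
  case: (treeP v) e => [->|[u' [k' [ku' ->]]]].
    rewrite psi0 => e; have : val (child (psi u) k) != [::] by rewrite child_neq_root// dE.
    by rewrite -e.
  rewrite psiS// => e.
  have := child_inj2 (sl _ _ ku') _ e; rewrite dE => /(_ ku)[e1 _].
  suff -> : u = u' by exists k'.
  move: e1; clear -psi0 sP psiS dE sl; move=> e1; apply/esym.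
  elim/tree_rect_child: u' u e1 => [|u' k ku IH] u.
    rewrite psi0; case: (treeP u) => [->//|[w [l [lw ->]]]]; rewrite psiS// => e.
    have : val (child (psi w) (s w l)) != [::] by rewrite child_neq_root// sl.
    by rewrite -e.
  case: (treeP u) => [->|[w [l [lw ->]]]].
    rewrite psi0 psiS// => e.
    have : val (child (psi u') (s u' k)) != [::] by rewrite child_neq_root// sl.
    by rewrite e.
  rewrite !psiS// => /(child_inj2 (sl _ _ ku) (sl _ _ lw))[/IH e1 e2].
  have [_ s2 _] := sP u'; rewrite e1; congr child; apply: s2 => //; first by rewrite e1.
  by rewrite e2 e1.
have inj : injective psi.
  move=> u'; elim/tree_rect_child: u' => [|u' k ku IH] u.
    rewrite psi0; case: (treeP u) => [->//|[w [l [lw ->]]]]; rewrite psiS// => e.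
    have : val (child (psi w) (s w l)) != [::] by rewrite child_neq_root// sl.
    by rewrite -e.
  case: (treeP u) => [->|[w [l [lw ->]]]].
    rewrite psi0 psiS// => e.
    have : val (child (psi u') (s u' k)) != [::] by rewrite child_neq_root// sl.
    by rewrite e.
  rewrite !psiS// => /(child_inj2 (sl _ _ ku) (sl _ _ lw))[/IH e1 e2].
  have [_ s2 _] := sP u'; rewrite e1; congr child; apply: s2 => //; first by rewrite e1.
  by rewrite e2 e1.
have surj v : exists u, psi u = v.
  elim/tree_rect_child: v => [|v k kv [u uv]]; first by exists troot.
  have [_ _ s3] := sP u; have [l lu sl'] : exists2 l, (l < deg u)%N & s u l = k.
    by apply: s3; rewrite -dE uv.
  by exists (child u l); rewrite psiS// uv sl'.
split; last by move=> u v; rewrite /tree_adj !psi_child.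
have [g gP] := boolp.choice surj.
by exists g => // u; apply: inj; rewrite gP.
Qed.

Section Walk.
Variable s : tree d -> nat -> nat.

(** Follows a word from [src] and builds its image from [dst], where [s src] permutes the children
    of [src]. *)
Fixpoint pwalk (src dst : tree d) (l : seq nat) : tree d :=
  if l is k :: l' then pwalk (child src k.-1) (child dst (s src k.-1)) l' else dst.

Definition psi v := pwalk troot troot (val v).

Fixpoint swalk (src : tree d) (l : seq nat) : tree d :=
  if l is k :: l' then swalk (child src k.-1) l' else src.

Lemma swalk_rcons src l k : swalk src (rcons l k) = child (swalk src l) k.-1.
Proof. by elim: l src => //= a l IH src; rewrite IH. Qed.

Lemma pwalk_rcons src dst l k :
  pwalk src dst (rcons l k) = child (pwalk src dst l) (s (swalk src l) k.-1).
Proof. by elim: l src dst => //= a l IH src dst; rewrite IH. Qed.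

Lemma swalk_val v : swalk troot (val v) = v.
Proof.
elim/tree_rect_child: v => [//|u k ku IH]; by rewrite val_child// swalk_rcons IH.
Qed.

Lemma psi_child u k : (k < deg u)%N -> psi (child u k) = child (psi u) (s u k).
Proof. by move=> ku; rewrite /psi val_child// pwalk_rcons swalk_val. Qed.

End Walk.

(** The permutation of children that [g] prescribes at the vertex reached by the word; the identity
    below the depth of [g]. *)
Fixpoint look r : bg D r -> seq nat -> nat -> nat :=
  match r return bg D r -> seq nat -> nat -> nat with
  | 0 => fun _ _ k => k
  | r'.+1 => fun g l k => match l with
     | [::] => if insub k is Some i then val (g.1 i) else k
     | a :: l' => if insub a.-1 is Some i then @look r' (g.2 i) l' k else k end
  end.

Definition rlook r (g : ng D d r) (l : seq nat) (k : nat) : nat :=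
  match l with
  | [::] => if insub k is Some i then val (g.1 i) else k
  | a :: l' => if insub a.-1 is Some i then look (g.2 i) l' k else k
  end.

Lemma permN_id n : permN n id.
Proof. by split=> // l ln; exists l. Qed.

Lemma permN_perm n (t : 'S_n) : permN n (fun k => if insub k is Some i then val (t i) else k).
Proof.
split=> [k kn|k l kn ln|l ln]; first by rewrite insubT; exact: ltn_ord.
  by rewrite !insubT => /val_inj/perm_inj/(congr1 val).
exists (val (t^-1 (Ordinal ln))%g); first exact: ltn_ord.
by rewrite valK permKV.
Qed.

Lemma permN_look r (g : bg D r) l : permN D (look g l).
Proof.
elim: r g l => [|r IH] g [|a l] /=; try exact: permN_id; first exact: permN_perm.
by case: insubP => [i _ _|_]; [exact: IH|exact: permN_id].
Qed.

Lemma permN_rlook r (g : ng D d r) u : permN (deg u) (rlook g (val u)).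
Proof.
rewrite /deg /rlook; case: (val u) => [|a l]; first exact: permN_perm.
by case: insubP => [i _ _|_]; [exact: permN_look|exact: permN_id].
Qed.

Definition gaut r (g : ng D d r) : tree d -> tree d := psi (fun u => rlook g (val u)).

Lemma gaut_aut r (g : ng D d r) : tree_aut (gaut g).
Proof.
apply: (aut_of_children (s := fun u => rlook g (val u))) => //.
  by move=> u; exact: permN_rlook.
exact: psi_child.
Qed.

Lemma start_gaut (M : finType) r (g : ng D d r) (c : tree d -> M) :
  start (fun v => c (gaut g v)) r = sact g (start c r).
Proof.
have sub k (h : bg D k) u w : val u != [::] -> val w != [::] -> gaut g u = w ->
    (forall v l, val v = val u ++ l -> rlook g (val v) = look h l) ->
    brf (fun v => c (gaut g v)) u k = act h (brf c w k).
  elim: k h u w => [|k IH] h u w u0 w0 uw hl /=; first by rewrite uw.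
  rewrite uw; congr pair; apply/ffunP => i; rewrite !ffunE /=.
  have iu : (i < deg u)%N by rewrite deg_nroot.
  have hw : (h.1 i < deg w)%N by rewrite deg_nroot.
  apply: IH; try exact: child_neq_root.
    rewrite /gaut psi_child// -/(gaut g u) uw; congr child.
    by rewrite (hl u [::]) ?cats0//= valK.
  move=> v l; rewrite val_child// cat_rcons => /hl -> /=.
  by rewrite valK.
congr pair; apply/ffunP => i; rewrite !ffunE /=.
have iu : (i < deg troot)%N by exact: ltn_ord.
have gu : (g.1 i < deg troot)%N by exact: ltn_ord.
apply: sub; try exact: child_neq_root.
  by rewrite /gaut psi_child//=; congr child; rewrite valK.
move=> v l; rewrite val_child//= => ->; by rewrite /rlook /= valK.
Qed.

(** Reversal of the edge from the root to its child 1: the children [1 .. d-1] of the latter become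
    the children [2 .. d] of the root, and conversely. *)
Definition flw (l : seq nat) : seq nat :=
  match l with
  | [::] => [:: 1]
  | [:: 1] => [::]
  | 1 :: j :: l' => j.+1 :: l'
  | j :: l' => 1 :: j.-1 :: l'
  end%N.

Hypothesis D0 : (0 < D)%N.

Lemma flw_tree l : tree_word d l -> tree_word d (flw l).
Proof.
case: l => [|[|[|a]] [|b l]] //=; rewrite ?andbT; lia.
Qed.

Lemma flwK l : tree_word d l -> flw (flw l) = l.
Proof. by case: l => [|[|[|a]] [|[|b] l]]. Qed.

Definition flip v : tree d := insubd v (flw (val v)).

Lemma val_flip v : val (flip v) = flw (val v).
Proof. by rewrite val_insubd flw_tree// (valP v). Qed.

Lemma flipK : involutive flip.
Proof. by move=> v; apply: val_inj; rewrite !val_flip flwK// (valP v). Qed.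

Lemma flip_root : flip troot = child troot 0.
Proof. by apply: val_inj; rewrite [RHS]val_child// val_flip. Qed.

Lemma flip_child u k : (k < deg u)%N -> val u != [::] -> val u != [:: 1%N] ->
  deg (flip u) = D /\ flip (child u k) = child (flip u) k.
Proof.
move=> ku u0 u1; have fu : val (flip u) != [::].
  by rewrite val_flip; move: u0 u1; case: (val u) => [|[|[|a]] [|b l]].
have df := deg_nroot fu; split=> //; apply: val_inj.
rewrite val_flip !val_child ?df -?(deg_nroot u0)// val_flip.
by move: u0 u1; case: (val u) => [|[|[|a]] [|b l]].
Qed.

Lemma flip_child1 k : (k < D)%N -> flip (child (child troot 0) k) = child troot k.+1.
Proof.
move=> kD; have k1 : (k < deg (child troot 0))%N by rewrite deg_child.
by apply: val_inj; rewrite val_flip !val_child.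
Qed.

Lemma flip_aut : tree_aut flip.
Proof.
split; first by exists flip; exact: flipK.
have half u v : tree_child u v -> tree_adj (flip u) (flip v).
  move=> /tree_childP[k ku ->].
  have [/rootP u0|u0] := eqVneq (val u) [::].
    subst u; rewrite flip_root; case: k ku => [|k] ku.
      by rewrite -flip_root flipK /tree_adj; apply/orP; right; apply/tree_childP; exists 0%N => //; rewrite flip_root.
    by rewrite -flip_child1// flipK adj_child// deg_child.
  have [u1|u1] := eqVneq (val u) [:: 1%N].
    have -> : u = child troot 0 by apply: val_inj; rewrite val_child.
    rewrite deg_nroot// in ku.
    rewrite flip_child1// -flip_root flipK adj_child//.
  have [df ->] := flip_child ku u0 u1; rewrite adj_child// df -(deg_nroot u0)//.
have half2 u v : tree_adj u v -> tree_adj (flip u) (flip v).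
  by move=> /orP[/half//|/half]; rewrite /tree_adj orbC.
move=> u v; apply/idP/idP; last exact: half2.
by move/half2; rewrite !flipK.
Qed.

Lemma brf_flip (M : finType) (c : tree d -> M) v r : val v != [::] -> val v != [:: 1%N] ->
  brf (fun w => c (flip w)) v r = brf c (flip v) r.
Proof.
elim: r v => [//|r IH] v v0 v1 /=; congr pair; apply/ffunP => i; rewrite !ffunE.
have iv : (i < deg v)%N by rewrite deg_nroot.
have [df <-] := flip_child iv v0 v1; apply: IH; first exact: child_neq_root.
rewrite val_child//; apply/eqP => /(congr1 size); rewrite size_rcons => -[e].
by move: v0; rewrite -size_eq0 e.
Qed.

Lemma brf_flip1 (M : finType) (c : tree d -> M) r :
  brf (fun w => c (flip w)) (child troot 0) r = own ord0 (start c r).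
Proof.
have f1 : flip (child troot 0) = troot by rewrite -flip_root flipK.
rewrite own_start; case: r => [|r] /=; rewrite f1//; congr pair; apply/ffunP => k; rewrite !ffunE.
have kd : (k < deg (child troot 0))%N by rewrite deg_child.
rewrite brf_flip ?flip_child1//; first exact: child_neq_root.
by rewrite !val_child.
Qed.

Lemma edge_flip (M : finType) (c : tree d -> M) r :
  (own ord0 (start (fun w => c (flip w)) r), (start (fun w => c (flip w)) r).2 ord0) =
  ((start c r).2 ord0, own ord0 (start c r)).
Proof.
congr pair; last by rewrite ffunE brf_flip1.
rewrite -brf_flip1 ffunE.
by have -> : (fun w => c (flip (flip w))) = c by apply/funext => w; rewrite flipK.
Qed.

End Automorphisms.

Section InvariantLaw.
Variables (R : realType) (D : nat) (M : colorType) (mu : probability (config D.+1 M) R).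
Hypothesis D0 : (0 < D)%N.
Hypothesis muI : invariant_process mu.

Lemma law_aut (X : finType) (T : (tree D.+1 -> M) -> X) phi : findep T -> tree_aut phi ->
  law mu (fun c => T (fun v => c (phi v))) = law mu T.
Proof.
move=> Tf ap; apply/funext => x; rewrite /law; congr fine.
exact: (muI ap (measurable_findep (fun y => y = x) Tf)).
Qed.

(** Two kinds of automorphisms suffice: [gaut] realizes the rotations of a star, and [flip] reverses
    the edge in direction [ord0]. *)
Lemma slaw_inv : inv_family (slaw mu).
Proof.
split.
- by move=> r; apply: law_pmf; exact: findep_start.
- move=> r y; rewrite -/(push (slaw mu r.+1) (@strunc D M r) y).
  rewrite -(law_push mu (@strunc D M r) (findep_start r.+1)) /slaw; congr (law mu _ y).
  by apply/funext => c; rewrite /= strunc_start.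
- move=> r g x.
  transitivity (law mu (fun c : tree D.+1 -> M => start (fun v => c (gaut g v)) r) (sact g x)).
    by rewrite (law_aut (findep_start r) (gaut_aut g)).
  rewrite /slaw /law.
  congr (fine (mu _)); apply/seteqP; split => c /=; rewrite start_gaut.
    by move/sact_inj.
  by move->.
- move=> r a b; rewrite -!edge_law.
  pose T (c : tree D.+1 -> M) := (own ord0 (start c r), (start c r).2 ord0).
  transitivity (law mu (fun c => T (fun v => c (flip v))) (a, b)).
    rewrite (law_aut _ (flip_aut D0))//.
    exact: (findep_comp (fun x : star D M r => (own ord0 x, x.2 ord0)) (findep_start r)).
  rewrite /law /T.
  congr (fine (mu _)); apply/seteqP; split => c /=; rewrite edge_flip//.
    by move=> [-> ->].
  by move=> [-> ->].
Qed.

End InvariantLaw.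

(** * Extension of invariant families *)

Section Starts.
Variables (D : nat) (M : finType).
Notation d := D.+1.
Notation troot := (tree_root d).
Implicit Types (u v w : tree d).

Fixpoint rdb r : br D M r -> seq nat -> M :=
  match r return br D M r -> seq nat -> M with
  | 0 => fun b _ => b
  | r'.+1 => fun b l => match l with
     | [::] => b.1
     | a :: l' => if insub a.-1 is Some i then @rdb r' (b.2 i) l' else b.1 end
  end.

(** Extends a star to a coloring of the whole tree; beyond the depth of the star the color of the
    last vertex read is repeated, an arbitrary choice. *)
Definition cof r (x : star D M r) v : M :=
  match val v with
  | [::] => x.1
  | a :: l => if insub a.-1 is Some i then rdb (x.2 i) l else x.1
  end.

Lemma start_cof r (x : star D M r) : start (cof x) r = x.
Proof.
have sub k (b : br D M k) u : val u != [::] ->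
    (forall v l, val v = val u ++ l -> cof x v = rdb b l) -> brf (cof x) u k = b.
  elim: k b u => [|k IH] b u u0 hl /=; first by rewrite (hl u [::]) ?cats0.
  rewrite [RHS]surjective_pairing; congr pair; first by rewrite (hl u [::]) ?cats0.
  apply/ffunP => i; rewrite ffunE; have iu : (i < deg u)%N by rewrite deg_nroot.
  apply: IH; first exact: child_neq_root.
  by move=> v l; rewrite val_child// cat_rcons => /hl -> /=; rewrite valK.
rewrite [RHS]surjective_pairing; congr pair; apply/ffunP => i; rewrite ffunE.
have iu : (i < deg troot)%N by exact: ltn_ord.
apply: sub; first exact: child_neq_root.
by move=> v l; rewrite val_child// /cof => -> /=; rewrite valK.
Qed.

Lemma start_trunc (c c' : tree d -> M) k r : (k <= r)%N -> start c r = start c' r -> start c k = start c' k.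
Proof. by move=> kr /start_eq h; apply/start_eq => u su; apply: h; apply: leq_trans su _. Qed.

End Starts.

Section RootAut.
Variables (D : nat) (phi : tree D.+1 -> tree D.+1).
Notation d := D.+1.
Notation troot := (tree_root d).
Implicit Types (u v w : tree d).
Hypothesis phiA : tree_aut phi.
Hypothesis phi0 : phi troot = troot.

Let phi_inj : injective phi. Proof. by case: phiA => /bij_inj. Qed.

Let phi_adj u v : tree_adj (phi u) (phi v) = tree_adj u v. Proof. by case: phiA. Qed.

(** Induction on the depth. If [phi] sent a child of [w] towards the root, it would land on the
    parent of [phi w], which is already the image of the parent of [w]. *)
Lemma aut_size u : size (val (phi u)) = size (val u).
Proof.
move: {2}(size _) (leqnn (size (val u))) => n; elim: n u => [|n IH] u.
  by rewrite leqn0 size_eq0 => /eqP/rootP->; rewrite phi0.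
case: (treeP u) => [->|[w [k [kw ->]]]]; first by rewrite phi0.
rewrite size_child// ltnS => wn; have sw := IH _ wn.
have := phi_adj w (child w k); rewrite (adj_child kw) => /orP[]/tree_childP[l lw e].
  by rewrite e size_child// sw.
exfalso; case: (treeP w) => [w0|[w' [j [jw' e']]]].
  have : size (val (phi w)) = (size (val (phi (child w k)))).+1 by rewrite {1}e size_child.
  by rewrite w0 phi0.
have sw' : size (val (phi w')) = size (val w').
  by apply: IH; apply: leq_trans wn; rewrite e' size_child// leqnSn.
have := phi_adj w' w; rewrite {2}e' (adj_child jw') => /orP[]/tree_childP[m mw e2].
  have [e3 _] := child_inj2 lw mw (etrans (esym e) e2).
  have := phi_inj e3 => e4; have : size (val (child w k)) = size (val w') by rewrite e4.
  by rewrite size_child// e' size_child//; lia.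
have : size (val (phi w')) = (size (val (phi w))).+1 by rewrite {1}e2 size_child.
by rewrite sw' sw e' size_child//; lia.
Qed.

Lemma aut_child u k : (k < deg u)%N -> exists2 l, (l < deg (phi u))%N & phi (child u k) = child (phi u) l.
Proof.
move=> ku; have := phi_adj u (child u k); rewrite (adj_child ku) => /orP[]/tree_childP[l lw e].
  by exists l.
have := aut_size u; rewrite {1}e size_child// aut_size size_child//; lia.
Qed.

Lemma deg_aut u : deg (phi u) = deg u.
Proof.
rewrite /deg; have := aut_size u; by case: (val u) => [|a l]; case: (val (phi u)).
Qed.

Lemma aut_perm u n : deg u = n -> exists s : 'S_n, forall i : 'I_n, phi (child u i) = child (phi u) (s i).
Proof.
move=> un; have f (i : 'I_n) : exists j : 'I_n, phi (child u i) = child (phi u) j.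
  have iu : (i < deg u)%N by rewrite un.
  have [l lu ->] := aut_child iu; rewrite deg_aut un in lu; by exists (Ordinal lu).
have [s sP] := fin_all_exists f.
have si : injective s.
  move=> i j ij; apply: val_inj; have := sP i; rewrite ij -sP => /phi_inj e.
  by have [] := child_inj2 (u := u) (v := u) (k := i) (l := j) _ _ e; rewrite ?un.
by exists (perm si) => i; rewrite permE.
Qed.

Lemma aut_prefix u v : prefix (val u) (val v) -> prefix (val (phi u)) (val (phi v)).
Proof.
elim/tree_rect_child: v => [|v k kv IH].
  rewrite prefixs0 => /eqP/rootP->; exact: prefix_refl.
have [->|ne] := eqVneq u (child v k); first by move=> _; exact: prefix_refl.
move=> pu.
have [l lv ->] := aut_child kv.
apply: (@prefix_trans _ (val (phi v))); last by rewrite val_child// -cats1 prefix_prefix.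
apply: IH; move: pu; rewrite val_child// => /prefixP[s e].
case/lastP: s e => [|s j]; first by rewrite cats0 => e; case/eqP: ne; apply: val_inj; rewrite val_child.
by rewrite -rcons_cat => /rcons_inj[e _]; apply/prefixP; exists s; exact: e.
Qed.

Lemma root_aut_act (M : finType) r : exists g : ng D d r, forall c : tree d -> M,
  start (fun v => c (phi v)) r = sact g (start c r).
Proof.
have nroot u : val u != [::] -> val (phi u) != [::] by rewrite -!size_eq0 aut_size.
have sub k u : val u != [::] -> exists g : bg D k, forall c : tree d -> M,
    brf (fun v => c (phi v)) u k = act g (brf c (phi u) k).
  elim: k u => [|k IH] u u0; first by exists tt.
  have [s sP] := aut_perm (deg_nroot u0).
  have f (i : 'I_D) : exists g : bg D k, forall c : tree d -> M,
     brf (fun v => c (phi v)) (child u i) k = act g (brf c (phi (child u i)) k).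
    by apply: IH; apply: child_neq_root; rewrite deg_nroot.
  have [g gP] := fin_all_exists f.
  exists (s, [ffun i => g i]) => c /=; congr pair; apply/ffunP => i; rewrite !ffunE /=.
  by rewrite gP sP.
have [s sP] := @aut_perm troot d erefl.
have f (i : 'I_d) : exists g : bg D r, forall c : tree d -> M,
   brf (fun v => c (phi v)) (child troot i) r = act g (brf c (phi (child troot i)) r).
  by apply: sub; apply: child_neq_root; exact: ltn_ord.
have [g gP] := fin_all_exists f.
exists (s, [ffun i => g i]) => c; rewrite /sact /start /= phi0; congr pair; apply/ffunP => i.
by rewrite !ffunE /= gP sP phi0.
Qed.

End RootAut.

Section AutGroup.
Variable d : nat.
Implicit Types phi psi : tree d -> tree d.

Lemma aut_comp phi psi : tree_aut phi -> tree_aut psi -> tree_aut (fun v => psi (phi v)).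
Proof.
move=> [b1 h1] [b2 h2]; split; first exact: bij_comp b2 b1.
by move=> u v; rewrite h2 h1.
Qed.

Lemma aut_inv phi : tree_aut phi -> exists psi, [/\ tree_aut psi, cancel phi psi & cancel psi phi].
Proof.
move=> [[psi K1 K2] h]; exists psi; split=> //; split; first by exists phi.
by move=> u v; rewrite -h !K2.
Qed.

End AutGroup.

Section Uniqueness.
Variables (R : realType) (D : nat) (M : colorType).
Notation d := D.+1.
Implicit Types (c : tree d -> M).

(** Two star events are nested or disjoint, so with the empty set they form a pi-system; it
    generates the sigma-algebra because each coordinate is a function of a star. *)
Lemma config_unique (m1 m2 : {measure set (config d M) -> \bar R}) : (m1 setT < +oo)%E ->
  m1 setT = m2 setT ->
  (forall r (x : star D M r), m1 [set c : tree d -> M | start c r = x]%classic = m2 [set c : tree d -> M | start c r = x]%classic) ->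
  forall A : set (config d M), measurable A -> m1 A = m2 A.
Proof.
move=> fin tot eqs.
pose G : set (set (config d M)) := [set A | A = set0 \/ (A = setT \/
  exists r (x : star D M r), A = [set c : tree d -> M | start c r = x]%classic)]%classic.
have GI : setI_closed G.
  have two r s (x : star D M r) (y : star D M s) : (r <= s)%N ->
      G ([set c : tree d -> M | start c r = x] `&` [set c : tree d -> M | start c s = y])%classic.
    move=> rs; have [cx|cx] := pselect (start (cof y) r = x).
      right; right; exists s, y; apply/seteqP; split=> c /= [].
        by move=> _ ->.
      by move=> cy; split => //; rewrite -cx; apply: (start_trunc rs); rewrite start_cof.
    left; apply/seteqP; split => // c /= [c1 c2]; apply: cx; rewrite -c1.
    by apply: (start_trunc rs); rewrite start_cof.
  move=> A B [->|[->|[r [x ->]]]]; first by rewrite set0I; left.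
    by rewrite setTI.
  move=> [->|[->|[s [y ->]]]]; first by rewrite setI0; left.
    by rewrite setIT; right; right; exists r, x.
  have [rs|/ltnW sr] := leqP r s; first exact: two.
  by rewrite setIC; exact: two.
have mG : @measurable _ (config d M) = (<<s G >>)%classic.
  apply/seteqP; split.
    apply: smallest_sub; first exact: smallest_sigma_algebra.
    move=> _ [v [m ->]].
    have -> : [set x : tree d -> M | x v = m]%classic = (\bigcup_(y : star D M (size (val v)))
       (if `[< cof y v = m >] then [set c : tree d -> M | start c (size (val v)) = y] else set0))%classic.
      have h c c' : start c (size (val v)) = start c' (size (val v)) -> c v = c' v.
        by move=> /start_eq; apply.
      apply/seteqP; split=> c /=.
        move=> cv; exists (start c (size (val v))) => //; rewrite asboolT//.
        by rewrite -cv; apply: h; rewrite start_cof.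
      move=> [y _]; case: asboolP => // ym cy; rewrite -ym; apply: h; by rewrite start_cof.
    apply: (@countable_bigcupT_measurable _ (g_sigma_algebraType G)) => [|y]; first exact: countableP.
    case: ifP => _; last exact: (@measurable0 _ (g_sigma_algebraType G)).
    by apply: sub_sigma_algebra; right; right; exists (size (val v)), y.
  apply: smallest_sub; first exact: (@sigma_algebra_measurable _ (config d M)).
  move=> A [->|[->|[r [x ->]]]]; [exact: measurable0|exact: measurableT|].
  exact: (measurable_findep (fun y => y = x) (findep_start r)).
apply: (measure_unique G (fun=> setT)) => //.
- by move=> _; right; left.
- by rewrite bigcup_const.
- by move=> A [->|[->//|[r [x ->]]]]; rewrite ?measure0.
Qed.

Lemma measurable_config (N : colorType) (Phi : (tree d -> N) -> (tree d -> M)) :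
  (forall v, findep (fun c1 : tree d -> N => Phi c1 v)) ->
  measurable_fun setT (Phi : config d N -> config d M).
Proof.
move=> h; apply: (@measurability _ _ _ _ setT (Phi : config d N -> config d M) (@cylinder d M)) => //.
move=> _ [U [v [m ->]] <-]; rewrite setTI.
exact: (measurable_findep (fun y => y = m) (h v)).
Qed.

End Uniqueness.

(** * Kolmogorov extension by sampling from Lebesgue measure on the unit interval *)

Section Sampling.
Variable R : realType.

(** Cuts an interval into pieces of lengths [w x] in the order of [s]. [off] gives the left end of a
    piece, and [x0] is returned only beyond the last one. *)
Fixpoint pick_from (X : Type) (w : X -> R) (x0 : X) (s : seq X) (t : R) : X * R :=
  if s is x :: s' then if t < w x then (x, t) else pick_from w x0 s' (t - w x) else (x0, t).

Fixpoint off (X : eqType) (w : X -> R) (s : seq X) (x : X) : R :=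
  if s is y :: s' then if x == y then 0 else w y + off w s' x else 0.

Lemma off_ge0 (X : eqType) (w : X -> R) s x : (forall x, 0 <= w x) -> 0 <= off w s x.
Proof. by move=> w0; elim: s => //= y s IH; case: ifP => // _; rewrite addr_ge0. Qed.

Lemma off_le (X : eqType) (w : X -> R) s x : (forall x, 0 <= w x) -> x \in s ->
  off w s x + w x <= \sum_(y <- s) w y.
Proof.
move=> w0; elim: s => //= y s IH; rewrite inE big_cons.
have [->|_ /= /IH h] := eqVneq x y; last by rewrite -addrA lerD2l.
by move=> _; rewrite add0r lerDl; apply: sumr_ge0.
Qed.

Lemma pick_fromP (X : eqType) (w : X -> R) x0 s x t : (forall x, 0 <= w x) -> x \in s ->
  off w s x <= t < off w s x + w x -> pick_from w x0 s t = (x, t - off w s x).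
Proof.
move=> w0; elim: s t => //= y s IH t; rewrite inE.
have [->|xy /= xs /andP[t1 t2]] := eqVneq x y; first by rewrite add0r subr0 => _ /andP[_ ->].
rewrite ltNge (le_trans _ t1) ?lerDl ?off_ge0//= IH//; last first.
  by apply/andP; split; lra.
by congr pair; lra.
Qed.

Lemma off_exists (X : eqType) (w : X -> R) s t : uniq s -> 0 <= t < \sum_(y <- s) w y ->
  exists2 x, x \in s & off w s x <= t < off w s x + w x.
Proof.
elim: s t => [|y s IH] t; first by rewrite big_nil => _ /andP[a b]; lra.
rewrite big_cons /= => /andP[ys us] => /andP[t0 t1]; have [ty|ty] := ltP t (w y).
  by exists y; rewrite ?mem_head//= eqxx add0r t0.
have [|x xs xt] := IH (t - w y) us; first by apply/andP; split; lra.
have xy : x != y by apply: contraNneq ys => <-.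
exists x; first by rewrite inE xs orbT.
by rewrite /= (negbTE xy); case/andP: xt => a b; apply/andP; split; lra.
Qed.

End Sampling.

Section Extension.
Variables (R : realType) (D : nat) (M : colorType) (Q : forall r, star D M r -> R).
Arguments Q : clear implicits.
Notation d := D.+1.
Hypothesis Qp : forall r, is_pmf (Q r).
Hypothesis Qt : forall r y, \sum_x (strunc x == y)%:R * Q r.+1 x = Q r y.

Definition dflt r : star D M r := start (fun=> point) r.

Definition fiber r (y : star D M r) : seq (star D M r.+1) :=
  [seq x <- enum {: star D M r.+1} | strunc x == y].

(* Nested partitions of [0, 1[ into intervals of lengths [Q r x]: [samp r t]
   is the interval containing [t] and the position of [t] in it. *)
Fixpoint samp r (t : R) : star D M r * R :=
  match r return star D M r * R with
  | 0 => pick_from (Q 0%N) (dflt 0) (enum {: star D M 0}) t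
  | r'.+1 => pick_from (Q r'.+1) (dflt r'.+1) (fiber (samp r' t).1) (samp r' t).2
  end.

Fixpoint loc r : star D M r -> R :=
  match r return star D M r -> R with
  | 0 => off (Q 0%N) (enum {: star D M 0})
  | r'.+1 => fun x => @loc r' (strunc x) + off (Q r'.+1) (fiber (strunc x)) x
  end.

Let Q0 r x : 0 <= Q r x. Proof. by have [] := Qp r. Qed.

Lemma fiber_sum r (y : star D M r) : \sum_(x <- fiber y) Q r.+1 x = Q r y.
Proof.
rewrite /fiber big_filter bigop.big_enum_cond /= -Qt big_mkcond; apply: eq_bigr => x _ /=.
by case: (strunc x == y); rewrite ?mul1r ?mul0r.
Qed.

Lemma enum_sum : \sum_(x <- enum {: star D M 0}) Q 0%N x = 1.
Proof. by rewrite bigop.big_enum; have [_ <-] := Qp 0. Qed.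

Lemma mem_fiber r (x : star D M r.+1) y : (x \in fiber y) = (strunc x == y).
Proof. by rewrite mem_filter mem_enum andbT. Qed.

Lemma samp_exists r t : 0 <= t < 1 -> exists x, loc x <= t < loc x + Q r x.
Proof.
elim: r t => [|r IH] t t01.
  have [|x _ xt] := @off_exists R _ (Q 0%N) (enum {: star D M 0}) t (enum_uniq _).
    by rewrite enum_sum.
  by exists x.
have [y /andP[y1 y2]] := IH t t01.
have [||x xs /andP[x1 x2]] := @off_exists R _ (Q r.+1) (fiber y) (t - loc y).
- by rewrite filter_uniq ?enum_uniq.
- by rewrite fiber_sum; apply/andP; split; lra.
move: xs; rewrite mem_fiber => /eqP xy; exists x => /=; rewrite xy; apply/andP; split; lra.
Qed.

Lemma samp_loc r x t : loc x <= t < loc x + Q r x -> samp r t = (x, t - loc x).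
Proof.
elim: r x t => [|r IH] x t /= xt.
  by rewrite (pick_fromP _ (Q0 (r := 0%N)) _ xt) ?mem_enum.
have xf : x \in fiber (strunc x) by rewrite mem_fiber.
have o0 := off_ge0 (fiber (strunc x)) x (Q0 (r := r.+1)).
have o1 := off_le (Q0 (r := r.+1)) xf; rewrite fiber_sum in o1.
case/andP: xt => x1 x2; rewrite (IH (strunc x)) /=; last by apply/andP; split; lra.
rewrite (pick_fromP _ (Q0 (r := r.+1)) xf); last by apply/andP; split; lra.
by congr pair; lra.
Qed.

Lemma loc_bounds r x : 0 <= loc x /\ loc x + Q r x <= 1.
Proof.
elim: r x => [|r IH] x /=.
  by split; [exact: off_ge0|rewrite -enum_sum; apply: off_le => //; rewrite mem_enum].
have xf : x \in fiber (strunc x) by rewrite mem_fiber.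
have o0 := off_ge0 (fiber (strunc x)) x (Q0 (r := r.+1)).
have o1 := off_le (Q0 (r := r.+1)) xf; rewrite fiber_sum in o1.
have [l0 l1] := IH (strunc x); split; lra.
Qed.

(** By [samp_strunc] the samples of all depths are consistent, so each vertex may read its color at
    a depth of its own. *)
Definition conf (t : R) (v : tree d) : M := cof (samp (size (val v)) t).1 v.

Lemma samp_strunc r t : 0 <= t < 1 -> strunc (samp r.+1 t).1 = (samp r t).1.
Proof.
move=> t01; have [x xt] := samp_exists r.+1 t01.
have xf : x \in fiber (strunc x) by rewrite mem_fiber.
have o0 := off_ge0 (fiber (strunc x)) x (Q0 (r := r.+1)).
have o1 := off_le (Q0 (r := r.+1)) xf; rewrite fiber_sum in o1.
rewrite (samp_loc xt) (samp_loc (x := strunc x))//; move: xt => /= /andP[x1 x2].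
by apply/andP; split; lra.
Qed.

Lemma start_conf r t : 0 <= t < 1 -> start (conf t) r = (samp r t).1.
Proof.
move=> t01.
have sub k j : start (cof (samp (k + j) t).1) k = (samp k t).1.
  elim: j => [|j IH]; first by rewrite addn0 start_cof.
  rewrite -IH addnS -(samp_strunc (k + j) t01).
  apply/esym; rewrite -[in LHS](start_cof (samp (k + j).+1 t).1) strunc_start.
  apply: (start_trunc (leq_addr j k)); by rewrite start_cof.
rewrite -[RHS]start_cof; apply/start_eq => u su.
rewrite /conf; set s := size (val u).
have [sr|rs] := leqP s r.
  have e : start (cof (samp s t).1) s = start (cof (samp r t).1) s.
    by rewrite start_cof -(subnKC sr) sub.
  by move/start_eq: e; apply; rewrite -/s.
have sE : s = r.+1 by apply/eqP; rewrite eqn_leq su rs.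
have e : start (cof (samp s t).1) r = start (cof (samp r t).1) r.
  by rewrite start_cof sE -(addn1 r) sub.
by move/start_eq: e; apply.
Qed.

Definition unitI : set (measurableTypeR R) := `[0, 1[%classic.

Lemma unitIE (t : R) : unitI t <-> 0 <= t < 1.
Proof. by rewrite /unitI /= in_itv. Qed.

Lemma samp_set r (x : star D M r) :
  (unitI `&` [set t | (samp r t).1 = x])%classic = `[loc x, loc x + Q r x[%classic.
Proof.
apply/seteqP; split=> t /=.
  move=> -[t01]; have [y yt] := samp_exists r t01.
  by rewrite (samp_loc yt) /= => <-.
move=> xt; split; last by rewrite (samp_loc xt).
apply/unitIE; have [l0 l1] := loc_bounds x; move: xt; rewrite in_itv /= => /andP[t1 t2].
by rewrite (le_trans l0 t1) (lt_le_trans t2 l1).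
Qed.

Lemma measurable_conf : measurable_fun unitI (conf : measurableTypeR R -> config d M).
Proof.
apply: (@measurability _ _ _ _ unitI (conf : _ -> config d M) (@cylinder d M)) => //.
move=> _ [U [v [m ->]] <-].
have -> : (unitI `&` conf @^-1` [set x | x v = m])%classic =
   (\bigcup_(y : star D M (size (val v)))
     (if `[< cof y v = m >] then `[loc y, loc y + Q _ y[ else set0))%classic.
  apply/seteqP; split=> t /=.
    move=> -[t01 tv]; exists (samp (size (val v)) t).1 => //.
    by rewrite asboolT// -samp_set; split=> //; apply/unitIE.
  move=> [y _]; case: asboolP => // ym; rewrite -samp_set => -[t01 sy]; split=> //.
  by rewrite /conf sy.
apply: countable_bigcupT_measurable => [|y]; first exact: countableP.
by case: ifP => _; [exact: measurable_itv|exact: measurable0].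
Qed.

Definition extm (A : set (config d M)) : \bar R :=
  lebesgue_measure (unitI `&` (conf : _ -> config d M) @^-1` A)%classic.

Let mI : measurable unitI. Proof. exact: measurable_itv. Qed.

Let extm0 : extm set0 = 0%E.
Proof. by rewrite /extm preimage_set0 setI0 measure0. Qed.

Let extm_ge0 A : (0 <= extm A)%E.
Proof. exact: measure_ge0. Qed.

Let extm_additive : semi_sigma_additive extm.
Proof.
move=> F mF tF mUF; rewrite /extm preimage_bigcup setI_bigcupr.
apply: measure_semi_sigma_additive.
- by move=> i; exact: measurable_conf.
- apply/trivIsetP => i j _ _ ij; rewrite setIACA setIid -preimage_setI.
  by move/trivIsetP : tF => -> //; rewrite preimage_set0 setI0.
- by rewrite -setI_bigcupr -preimage_bigcup; exact: measurable_conf.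
Qed.

HB.instance Definition _ := isMeasure.Build _ _ _ extm extm0 extm_ge0 extm_additive.

Let extm_setT : extm setT = 1%E.
Proof.
rewrite /extm preimage_setT setIT /unitI lebesgue_measure_itv /= lte_fin ltr01.
by rewrite -EFinB subr0.
Qed.

HB.instance Definition _ := Measure_isProbability.Build _ _ _ extm extm_setT.

Lemma extm_start r (x : star D M r) : extm [set c : tree d -> M | start c r = x]%classic = (Q r x)%:E.
Proof.
have -> : extm [set c : tree d -> M | start c r = x]%classic = lebesgue_measure (`[loc x, loc x + Q r x[%classic : set R).
  rewrite /extm -samp_set; congr (lebesgue_measure _); apply/seteqP; split=> t /= [tI].
    by rewrite start_conf//; apply/unitIE.
  by move=> e; split=> //; rewrite start_conf//; apply/unitIE.
rewrite lebesgue_measure_itv /= lte_fin -EFinB addrAC subrr add0r ltrDl.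
by case: ltP => // q0; congr EFin; apply/eqP; rewrite eq_le q0 Q0.
Qed.

Lemma family_extension : exists nu : probability (config d M) R, forall r, slaw nu r = Q r.
Proof. exists extm => r; apply/funext => x; rewrite /slaw /law.
by rewrite -[X in fine X]/(extm [set c : tree d -> M | start c r = x]%classic) extm_start. Qed.

End Extension.

Section InvariantExtension.
Variables (R : realType) (D : nat) (M : colorType) (nu : probability (config D.+1 M) R).
Notation d := D.+1.
Notation troot := (tree_root d).
Hypothesis D0 : (0 < D)%N.
Hypothesis nuI : inv_family (slaw nu).

Let invar (phi : tree d -> tree d) := forall A : set (config d M), measurable A ->
  nu [set x : tree d -> M | A (fun v => x (phi v))]%classic = nu A.

Let mphi (phi : tree d -> tree d) :
  measurable_fun setT ((fun x : tree d -> M => fun v => x (phi v)) : config d M -> config d M).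
Proof.
by apply: measurable_config => v; exists [:: phi v] => c c' h; apply: h; rewrite mem_head.
Qed.

Let invar_start (phi : tree d -> tree d) :
  (forall r (x : star D M r), nu [set c : tree d -> M | start (fun v => c (phi v)) r = x]%classic =
     nu [set c : tree d -> M | start c r = x]%classic) -> invar phi.
Proof.
move=> h A mA.
apply: (@config_unique R D M (measure_function_pushforward__canonical__measure_function_Measure nu (mphi phi)) nu _ _ _ A mA).
- by rewrite /= /pushforward preimage_setT probability_setT ltry.
- by rewrite /= /pushforward preimage_setT.
- move=> r x; exact: h.
Qed.

Let slawE r (x : star D M r) : nu [set c : tree d -> M | start c r = x]%classic = (slaw nu r x)%:E.
Proof.
rewrite /slaw /law fineK// fin_num_measure//.
exact: (measurable_findep (fun y => y = x) (findep_start r)).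
Qed.

Let invar_comp phi psi : invar phi -> invar psi -> invar (fun v => psi (phi v)).
Proof.
move=> h1 h2 A mA.
have mB : measurable ([set x : tree d -> M | A (fun v => x (phi v))]%classic : set (config d M)).
  by have := mphi phi measurableT mA; rewrite setTI.
by rewrite -(h1 A mA) -(h2 _ mB).
Qed.

Let invar_root phi : tree_aut phi -> phi troot = troot -> invar phi.
Proof.
move=> pA p0; apply: invar_start => r x; have [g gP] := root_aut_act pA p0 M r.
have [_ _ Qa _] := nuI.
rewrite slawE -(Qa r (nginv g) x) -slawE; congr (nu _); apply/seteqP; split=> c /=; rewrite gP.
  by move<-; rewrite sact_invK.
move=> ->; have := @sact_inj D M r (nginv g) (sact g (sact (nginv g) x)) x; apply.
by rewrite sact_invK.
Qed.

(** The star at the other end of the edge is read off the edge law one level deeper by [near_star],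
    and that law is symmetric. *)
Let invar_flip : invar (@flip D).
Proof.
apply: invar_start => r x.
have -> : [set c : tree d -> M | start (fun v => c (flip v)) r = x]%classic =
   [set c : tree d -> M | [pred ab : br D M r.+1 * br D M r.+1 | near_star ord0 (ab.2, ab.1) == x]
      (own ord0 (start c r.+1), (start c r.+1).2 ord0)]%classic.
  have e (c : tree d -> M) : start (fun v => c (flip v)) r =
      near_star ord0 ((start c r.+1).2 ord0, own ord0 (start c r.+1)).
    by rewrite -edge_flip// near_star_own strunc_start.
  by apply/seteqP; split=> c /=; rewrite e => /eqP.
have fd : findep (fun c : tree d -> M => (own ord0 (start c r.+1), (start c r.+1).2 ord0)).
  exact: (findep_comp (fun x : star D M r.+1 => (own ord0 x, x.2 ord0)) (findep_start r.+1)).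
rewrite (law_pred nu _ fd) edge_law slawE; congr EFin.
rewrite -[RHS](congr1 (@^~ x) (near_star_push nuI r)) -[X in push X _](edge_swap_push nuI r.+1).
rewrite push_push /push [LHS]big_mkcond; apply: eq_bigr => ab _ /=.
by case: eqP; rewrite ?mul1r ?mul0r.
Qed.

(** Induction on the depth of [phi troot]: a rooted automorphism moves it below child 1, and then
    [flip] brings it one step closer to the root. *)
Lemma invariant_extension : invariant_process nu.
Proof.
move=> phi pA; rewrite -/(invar phi).
move: {2}(size _) (leqnn (size (val (phi troot)))) => n; elim: n phi pA => [|n IH] phi pA.
  by rewrite leqn0 size_eq0 => /eqP/rootP; exact: invar_root.
case: (eqVneq (val (phi troot)) [::]) => [/rootP p0 _|p0 sn]; first exact: invar_root.
have [e|[k kd pk]] := prefix_child (v := troot) (u := phi troot) (prefix0s _); first by rewrite e in p0.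
pose g : ng D d 0 := (tperm (Ordinal kd) ord0, [ffun=> tt]).
have gA := gaut_aut g; have g0 : gaut g troot = troot by [].
have gk : gaut g (child troot k) = child troot 0.
  by rewrite /gaut psi_child//= /rlook /= insubT /= tpermL.
have := aut_prefix gA g0 pk; rewrite gk => p1.
have fA : tree_aut (fun v => flip (gaut g (phi v))).
  exact: (aut_comp (aut_comp pA gA) (flip_aut D0)).
have fS : (size (val (flip (gaut g (phi troot)))) <= n)%N.
  have := aut_size gA g0 (phi troot); move: p1; rewrite val_child//.
  rewrite val_flip//; move: sn p0; case: (val (phi troot)) => // a l sn _.
  by case: (val (gaut g (phi troot))) sn => [|[|[|b]] [|j m]]//= sn _ []; lia.
have [rho [rA rK Kr]] := aut_inv gA.
have r0 : rho troot = troot by rewrite -{1}g0 rK.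
have := invar_comp (IH _ fA fS) (invar_comp invar_flip (invar_root rA r0)).
congr invar; apply/funext => v; by rewrite flipK// rK.
Qed.

End InvariantExtension.

(** * Compactness of couplings *)

Section Recolor.
Variables (R : realType) (D : nat) (M N : finType) (f : M -> N).
Notation d := D.+1.

Fixpoint brmap r : br D M r -> br D N r :=
  match r return br D M r -> br D N r with
  | 0 => f
  | r'.+1 => fun x => (f x.1, [ffun i => @brmap r' (x.2 i)])
  end.

Definition smap r (x : star D M r) : star D N r := (f x.1, [ffun i => brmap (x.2 i)]).

Lemma start_smap (c : tree d -> M) r : start (f \o c) r = smap (start c r).
Proof.
have h k u : brf (f \o c) u k = brmap (brf c u k).
  by elim: k u => [|k IH] u //=; congr pair; apply/ffunP => i; rewrite !ffunE IH.
by congr pair; apply/ffunP => i; rewrite !ffunE h.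
Qed.

Lemma sunf_smap (V : finType) p (F : V -> M) r v : sunf p (f \o F) r v = smap (sunf p F r v).
Proof.
have h k u : unf p (f \o F) k u = brmap (unf p F k u).
  by elim: k u => [|k IH] u //=; congr pair; apply/ffunP => i; rewrite !ffunE IH.
by congr pair; apply/ffunP => i; rewrite !ffunE h.
Qed.

Lemma brmap_act r (g : bg D r) x : brmap (act g x) = act g (brmap x).
Proof.
by elim: r g x => [|r IH] g x //=; congr pair; apply/ffunP => i; rewrite !ffunE IH.
Qed.

Lemma smap_sact r (g : ng D d r) x : smap (sact g x) = sact g (smap x).
Proof. by congr pair; apply/ffunP => i; rewrite !ffunE brmap_act. Qed.

Lemma brmap_trunc k r (x : br D M r) : (k <= r)%N -> brmap (trunc k x) = trunc k (brmap x).
Proof.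
by elim: k r x => [|k IH] [|r] x //= kr; congr pair; apply/ffunP => i; rewrite !ffunE IH.
Qed.

Lemma smap_strunc r (x : star D M r.+1) : smap (strunc x) = strunc (smap x).
Proof. by congr pair; apply/ffunP => i; rewrite !ffunE brmap_trunc. Qed.

Lemma smap_own r i (x : star D M r) : own i (smap x) = brmap (own i x).
Proof.
case: r x => [|r] x //=; congr pair; apply/ffunP => k; rewrite !ffunE.
by rewrite brmap_trunc.
Qed.

Lemma SB_smap r (z : star D M r) : push (SB R z) (@smap r) = SB R (smap z).
Proof.
apply/funext => y; rewrite /push /SB.
under eq_bigr do rewrite mulrA mulr_sumr.
rewrite -mulr_suml exchange_big /=; congr (_ / _); apply: eq_bigr => g _.
rewrite (bigD1 (sact g z))//= eqxx mulr1 big1 ?addr0 ?smap_sact// => x /negbTE.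
by rewrite eq_sym => ->; rewrite mulr0.
Qed.

Lemma Plab_smap (V : finType) p (F : V -> M) r :
  Plab R p (f \o F) (r := r) = push (Plab R p F (r := r)) (@smap r).
Proof.
apply/funext => y; rewrite /push /Plab.
under [RHS]eq_bigr do rewrite mulrA mulr_sumr.
rewrite -[RHS]mulr_suml exchange_big /=; congr (_ / _); apply: eq_bigr => v _.
by rewrite sunf_smap -SB_smap.
Qed.

Variable P : forall r, star D M r -> R.
Arguments P : clear implicits.
Hypothesis Pinv : inv_family P.

Definition recolor r : star D N r -> R := push (P r) (@smap r).
Arguments recolor : clear implicits.

Lemma edge_recolor r : edge recolor (r := r) = push (edge P (r := r)) (fun ab => (brmap ab.1, brmap ab.2)).
Proof.
rewrite -(edge_push Pinv ord0); apply/funext => -[a b]; rewrite push_push /edge /recolor.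
rewrite (eq_bigr (fun y => push (P r) (@smap r) y * ((own ord0 y == a) && (y.2 ord0 == b))%:R)).
  rewrite push_sum /push; apply: eq_bigr => x _; rewrite mulrC /= smap_own ffunE xpair_eqE.
  by [].
by move=> y _; rewrite mulrC.
Qed.

Lemma recolor_inv : inv_family recolor.
Proof.
have [Pp Pt Pa Ps] := Pinv; split.
- by move=> r; exact: push_pmf.
- move=> r y; rewrite -/(push (recolor r.+1) (@strunc D N r) y) /recolor push_push.
  transitivity (push (push (P r.+1) (@strunc D M r)) (@smap r) y).
    by rewrite push_push /push; apply: eq_bigr => x _; rewrite /= smap_strunc.
  by rewrite /push; apply: eq_bigr => x _; rewrite -Pt.
- move=> r g y; rewrite /recolor /push (reindex_inj (@sact_inj D M r g)) /=.
  by apply: eq_bigr => x _; rewrite Pa smap_sact (inj_eq (@sact_inj D N r g)).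
- move=> r a b; rewrite !edge_recolor /push.
  have sw : involutive (fun ab : br D M r * br D M r => (ab.2, ab.1)) by case.
  rewrite (reindex_inj (inv_inj sw)) /=; apply: eq_bigr => -[x y] _ /=.
  by rewrite Ps !xpair_eqE andbC.
Qed.

Lemma hent_push_inj (X A : finType) (p : X -> R) (T : X -> A) : injective T -> hent (push p T) = hent p.
Proof.
move=> Ti; have e x : push p T (T x) = p x.
  rewrite /push (bigD1 x)//= eqxx mul1r big1 ?addr0// => y /negbTE ne.
  by rewrite (inj_eq Ti) ne mul0r.
rewrite /hent push_sum; congr (- _); apply: eq_bigr => x _; by rewrite e.
Qed.

Lemma sig_recolor r : injective f -> sig recolor r = sig P r.
Proof.
move=> fi; have bi k : injective (@brmap k).
  elim: k => [|k IH]; first exact: fi.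
  move=> [m x] [m' x'] /= [/fi -> /ffunP e]; congr pair; apply/ffunP => i; apply: IH.
  by have := e i; rewrite !ffunE.
have si : injective (@smap r).
  move=> [m x] [m' x'] [/fi -> /ffunP e]; congr pair; apply/ffunP => i; apply: (bi r).
  by have := e i; rewrite !ffunE.
have pi : injective (fun ab : br D M r * br D M r => (brmap ab.1, brmap ab.2)).
  by move=> [a b] [a' b'] [/(bi r) -> /(bi r) ->].
by rewrite /sig edge_recolor /recolor (hent_push_inj _ si) (hent_push_inj _ pi).
Qed.

End Recolor.

Section Limits.
Variable R : realType.
Local Open Scope classical_set_scope.

Lemma cvg_fsum (I : Type) (s : seq I) (U : set_system nat) (F : I -> nat -> R) (a : I -> R) :
  ProperFilter U -> (forall i, F i @ U --> a i) ->
  (fun n => \sum_(i <- s) F i n) @ U --> \sum_(i <- s) a i.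
Proof.
move=> UF Fa; elim: s => [|i s IH].
  rewrite big_nil (_ : (fun _ => _) = cst 0); first exact: cvg_cst.
  by apply/funext => n; rewrite big_nil.
rewrite big_cons (_ : (fun _ => _) = (F i \+ (fun n => \sum_(j <- s) F j n))%R).
  by apply: cvgD; [exact: Fa|exact: IH].
by apply/funext => n; rewrite big_cons.
Qed.

(** Limits along an ultrafilter replace a diagonal extraction of subsequences over all levels and
    stars. *)
Lemma ultra_lim (U : set_system nat) (u : nat -> R) : UltraFilter U ->
  (forall n, 0 <= u n <= 1) -> exists l : R, u @ U --> l.
Proof.
move=> UU u01; have UF : ProperFilter U by exact: ultra_proper.
have uU : UltraFilter (u @ U).
  apply: Build_UltraFilter => G GF uG; apply/seteqP; split=> A; last exact: uG.
  move=> GA; have [//|nA] := in_ultra_setVsetC (u @^-1` A) UU.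
  have /uG GnA : (u @ U) (~` A) by [].
  have [x [Ax nAx]] := filter_ex (filterI GA GnA); exfalso; exact: nAx Ax.
have := @segment_compact R 0 1; rewrite compact_ultra => /(_ _ uU)[].
  by apply: (@filterS _ U _ setT); [move=> n _ /=; rewrite in_itv /= u01|exact: filterT].
by move=> l [_ ul]; exists l.
Qed.

(** Apply [ln y <= y - 1] to the reciprocal of [Num.sqrt x]. This is the continuity of [x * ln x] at
    0, which makes the entropies continuous. *)
Lemma xlnx_bound (x : R) : 0 <= x -> x <= 1 -> `|x * ln x| <= 2 * Num.sqrt x.
Proof.
rewrite le_eqVlt => /orP[/eqP<- _|x0 x1]; first by rewrite mul0r normr0 mulr_ge0 ?sqrtr_ge0.
have s0 : 0 < Num.sqrt x by rewrite sqrtr_gt0.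
have e : x = Num.sqrt x ^+ 2 by rewrite sqr_sqrtr// ltW.
have l0 : ln x <= 0 by rewrite ln_le0.
rewrite normrM (gtr0_norm x0) (ler0_norm l0) {1 2}e lnXn// -[ln _ *+ 2]mulr_natl.
have : ln (Num.sqrt x)^-1 <= (Num.sqrt x)^-1 - 1.
  have q0 : 0 < (Num.sqrt x)^-1 by rewrite invr_gt0.
  rewrite -[X in ln X](subrK 1) [X in ln X]addrC; apply: le_ln1Dx; lra.
rewrite lnV ?posrE// => h.
have : Num.sqrt x ^+ 2 * - ln (Num.sqrt x) <= Num.sqrt x ^+ 2 * (Num.sqrt x)^-1.
  by rewrite ler_pM2l ?exprn_gt0//; lra.
rewrite [X in _ <= X](_ : _ = Num.sqrt x); last by rewrite expr2 mulfK// gt_eqF.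
lra.
Qed.

Lemma cvg_xlnx (U : set_system nat) (u : nat -> R) (a : R) : ProperFilter U ->
  (forall n, 0 <= u n <= 1) -> u @ U --> a -> (fun n => u n * ln (u n)) @ U --> a * ln a.
Proof.
move=> UF u01 ua.
have a0 : 0 <= a.
  by apply: (cvgr_to_ge ua); apply: nearW => n; have /andP[] := u01 n.
move: a0; rewrite le_eqVlt => /orP[/eqP a0|a0]; last first.
  apply: cvgM => //; apply: (cvg_comp _ _ ua); exact: continuous_ln.
rewrite -a0 in ua *; rewrite mul0r; apply: norm_cvg0.
apply: (@squeeze_cvgr _ U _ R (cst 0) (fun n => 2 * Num.sqrt (u n))).
- apply: nearW => n; rewrite normr_ge0 /=; have /andP[u0 u1] := u01 n; exact: xlnx_bound.
- exact: cvg_cst.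
- rewrite -[X in _ --> X](mulr0 2); apply: cvgM; first exact: cvg_cst.
  rewrite -[X in _ --> X](@sqrtr0 R); apply: (cvg_comp _ _ ua); exact: sqrt_continuous.
Qed.

Lemma cvg_hent (X : finType) (U : set_system nat) (p : nat -> X -> R) (q : X -> R) : ProperFilter U ->
  (forall n, is_pmf (p n)) -> (forall x, p ^~ x @ U --> q x) -> (fun n => hent (p n)) @ U --> hent q.
Proof.
move=> UF pp pq; rewrite /hent; apply: cvgN.
apply: cvg_fsum => x; apply: cvg_xlnx => // n.
by have [p0 _] := pp n; rewrite p0 (pmf_le1 x (pp n)).
Qed.

Lemma cvg_push (X A : finType) (U : set_system nat) (p : nat -> X -> R) (q : X -> R) (T : X -> A) a :
  ProperFilter U -> (forall x, p ^~ x @ U --> q x) -> (fun n => push (p n) T a) @ U --> push q T a.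
Proof.
by move=> UF pq; apply: cvg_fsum => x; apply: cvgM; [exact: cvg_cst|exact: pq].
Qed.

Variables (D : nat) (M : finType).
Variables (U : set_system nat) (Q : nat -> forall r, star D M r -> R) (q : forall r, star D M r -> R).
Arguments Q : clear implicits.
Arguments q : clear implicits.
Hypothesis UF : ProperFilter U.
Hypothesis Qinv : forall n, inv_family (Q n).
Hypothesis Qq : forall r x, (fun n => Q n r x) @ U --> q r x.

Let lim_eq (f : nat -> R) (a b : R) : f @ U --> a -> f @ U --> b -> a = b.
Proof. exact: (cvg_unique (@Rhausdorff R)). Qed.

Lemma lim_inv : inv_family q.
Proof.
split.
- move=> r; split=> [x|].
    apply: (cvgr_to_ge (Qq (x := x))); apply: nearW => n.
    by have [Pp _ _ _] := Qinv n; have [] := Pp r.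
  apply: (@lim_eq (fun n => \sum_x Q n r x)); first by apply: cvg_fsum.
  rewrite (_ : (fun _ => _) = cst 1); first exact: cvg_cst.
  by apply/funext => n; have [Pp _ _ _] := Qinv n; have [] := Pp r.
- move=> r y; apply: (@lim_eq (fun n => Q n r y)); last exact: Qq.
  rewrite (_ : (fun _ => _) = (fun n => push (Q n r.+1) (@strunc D M r) y)); first exact: cvg_push.
  by apply/funext => n; have [_ Pt _ _] := Qinv n; rewrite -Pt.
- move=> r g x; apply: (@lim_eq (fun n => Q n r x)); last exact: Qq.
  rewrite (_ : (fun _ => _) = (fun n => Q n r (sact g x))); first exact: Qq.
  by apply/funext => n; have [_ _ Pa _] := Qinv n; rewrite Pa.
- move=> r a b; pose T (x : star D M r) := (own ord0 x, x.2 ord0).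
  have e (P : forall r, star D M r -> R) a' b' : edge P (a', b') = push (@P r) T (a', b').
    by rewrite /edge /push; apply: eq_bigr => x _; rewrite xpair_eqE.
  rewrite !e; apply: (@lim_eq (fun n => push (Q n r) T (a, b))); first exact: cvg_push.
  rewrite (_ : (fun _ => _) = (fun n => push (Q n r) T (b, a))); first exact: cvg_push.
  by apply/funext => n; have [_ _ _ Ps] := Qinv n; rewrite -!e Ps.
Qed.

Lemma cvg_sig r : (fun n => sig (Q n) r) @ U --> sig q r.
Proof.
rewrite /sig; apply: cvgB.
  apply: (@cvg_hent _ U (fun n => Q n r)) => // n; by have [Pp _ _ _] := Qinv n.
apply: cvgM; first exact: cvg_cst.
apply: (@cvg_hent _ U (fun n => edge (Q n) (r := r))) => [n|ab]; first exact: edge_pmf.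
by apply: cvg_fsum => x; apply: cvgM; [exact: cvg_cst|exact: Qq].
Qed.

End Limits.

Section Coupling.
Variables (R : realType) (D : nat) (M : colorType) (mu : probability (config D.+1 M) R) (rk : nat -> nat).
Notation d := D.+1.
Hypothesis D0 : (0 < D)%N.
Hypothesis muI : invariant_process mu.
Hypothesis rk1 : forall k, (1 <= k)%N -> (1 <= rk k)%N.
Hypothesis rk_lt : forall k l, (1 <= k)%N -> (k < l)%N -> (rk k < rk l)%N.
Hypothesis rkH : forall nu : probability (config d (M * M)%type) R,
     invariant_coupling mu nu ->
     forall k, (1 <= k)%N -> annealed_entropy nu (rk k) <= 2 * annealed_entropy mu (rk k).

Notation P := (slaw mu).
Notation MM := ((M * M)%type : colorType).

(** The family extends to a process whose invariance and marginals need only be checked on stars, so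
    the hypothesis on processes becomes one on families. *)
Lemma coupling_family (Q : forall r, star D MM r -> R) : inv_family Q ->
  (forall r, push (Q r) (@smap D MM M fst r) = P r) ->
  (forall r, push (Q r) (@smap D MM M snd r) = P r) ->
  forall k, (1 <= k)%N -> sig Q (rk k).-1 <= 2 * sig P (rk k).-1.
Proof.
move=> Qinv Q1 Q2; have [Qp Qt _ _] := Qinv.
have [nu nuE] := family_extension Qp Qt.
have QE : Q = slaw nu by apply: functional_extensionality_dep => r; rewrite nuE.
have marg (f : MM -> M) : (forall r, push (Q r) (@smap D MM M f r) = P r) ->
    forall A : set (config d M), measurable A -> nu [set y : tree d -> MM | A (fun v => f (y v))]%classic = mu A.
  move=> Qf A mA.
  have mf : measurable_fun setT ((fun (y : tree d -> MM) v => f (y v)) : config d MM -> config d M).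
    apply: measurable_config => v; exists [:: v] => c c' h; congr f; apply: h; exact: mem_head.
  apply: (@config_unique R D M (measure_function_pushforward__canonical__measure_function_Measure nu mf) mu _ _ _ A mA).
  - by rewrite /= /pushforward preimage_setT probability_setT ltry.
  - by rewrite /= /pushforward preimage_setT !probability_setT.
  - move=> r x; rewrite /= /pushforward.
    have fin : mu [set c : tree d -> M | start c r = x]%classic = (P r x)%:E.
      rewrite /slaw /law fineK// fin_num_measure//.
      exact: (measurable_findep (fun y => y = x) (findep_start r)).
    rewrite fin -Qf QE.
    have -> : push (slaw nu r) (@smap D MM M f r) x = law nu (@smap D MM M f r \o (fun c : tree d -> MM => start c r)) x.
      by rewrite (law_push nu (@smap D MM M f r) (findep_start r)).
    rewrite /law fineK; last first.
      rewrite fin_num_measure//.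
      exact: (measurable_findep (fun y => y = x) (findep_comp (@smap D MM M f r) (findep_start r))).
    congr (nu _); apply/seteqP; split=> c /=; by rewrite -start_smap.
have nuC : invariant_coupling mu nu.
  split; [|exact: marg Q1|exact: marg Q2].
  by apply: invariant_extension => //; rewrite -QE.
move=> k k1; have := rkH nuC k1.
(* Level [rk k] of the annealed entropy is level [(rk k).-1] of [sig]. *)
by rewrite -(prednK (rk1 k1)) !annealed_sig -QE.
Qed.

Lemma rk_ge k : (k <= (rk k.+1).-1)%N.
Proof.
elim: k => // k IH; have := @rk_lt k.+1 k.+2 isT (leqnn _); have := rk1 (k := k.+1) isT; lia.
Qed.

(** The diagonal coupling has the same [sig] as [P], so the hypothesis reads
    [sig P s <= 2 * sig P s] at a level [s] of the sequence; monotonicity covers the other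
    levels. *)
Lemma sig_ge0 r : 0 <= sig P r.
Proof.
have Pinv := slaw_inv D0 muI.
apply: le_trans (sig_mono Pinv (leq_trans (leqnSn r) (rk_ge r.+1))).
set s := (rk r.+2).-1.
have di : injective (fun m : M => (m, m)) by move=> m m' [].
have sd s' : sig (recolor (fun m : M => (m, m) : MM) P) s' = sig P s' by exact: sig_recolor.
have := @coupling_family (recolor (fun m : M => (m, m) : MM) P) (recolor_inv _ Pinv).
have id1 (f : MM -> M) r' : (forall m, f (m, m) = m) ->
    push (recolor (fun m : M => (m, m) : MM) P (r := r')) (@smap D MM M f r') = P r'.
  move=> fE; have bE k (x : br D M k) : brmap f (brmap (fun m : M => (m, m) : MM) x) = x.
    elim: k x => [|k IH] x /=; first exact: fE.
    rewrite [RHS]surjective_pairing fE; congr pair; apply/ffunP => i; by rewrite !ffunE IH.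
  apply/funext => y.
  rewrite -[LHS]/(push (push (P r') (@smap D M MM (fun m : M => (m, m)) r')) (@smap D MM M f r') y).
  rewrite push_push /push (bigD1 y)//=.
  have e x : smap f (smap (fun m : M => (m, m) : MM) x) = x :> star D M r'.
    rewrite [RHS]surjective_pairing /smap /= fE; congr pair; apply/ffunP => i; by rewrite !ffunE bE.
  rewrite e eqxx mul1r big1 ?addr0// => x /negbTE ne; by rewrite e ne mul0r.
move=> /(_ (fun r' => id1 fst r' (fun m => erefl)) (fun r' => id1 snd r' (fun m => erefl)) r.+2 isT).
rewrite sd -/s; lra.
Qed.

(** Otherwise there are approximate couplings [Q n], with errors tending to 0, which violate the
    bound at levels [s n] tending to infinity. Their ultrafilter limit [q] is an exact coupling, so
    [sig q r <= 2 * sig P r] at the levels of the sequence, while monotonicity of [sig (Q n)] gives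
    [2 * inf A + delta <= sig q r]. This fails at a level where [sig P] is within [delta / 2] of its
    infimum. *)
Lemma coupling_compact (delta : R) (R0 : nat) : 0 < delta ->
  exists r, (R0 <= r)%N /\ exists2 eps : R, 0 < eps &
  forall (V : finType) (p : V * 'I_D.+1 -> V * 'I_D.+1) (F : V -> M * M),
    (0 < #|V|)%N -> involutive p ->
    l1 (Plab R p (fun v => (F v).1) (r := r)) (P r) <= eps ->
    l1 (Plab R p (fun v => (F v).2) (r := r)) (P r) <= eps ->
    sig (Plab R p F) r <= 2 * sig P r + delta.
Proof.
move=> delta0; apply: contrapT => no; have Pinv := slaw_inv D0 muI.
pose s n := (rk (R0 + n).+1).-1.
have s_ge n : (R0 + n <= s n)%N by exact: rk_ge.
have bad n : exists Q : forall r, star D MM r -> R, [/\ inv_family Q,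
    l1 (push (Q (s n)) (@smap D MM M fst (s n))) (P (s n)) <= n.+1%:R^-1,
    l1 (push (Q (s n)) (@smap D MM M snd (s n))) (P (s n)) <= n.+1%:R^-1 &
    2 * sig P (s n) + delta < sig Q (s n)].
  apply: contrapT => nQ; apply: no; exists (s n); split; first by apply: leq_trans (s_ge n); exact: leq_addr.
  exists n.+1%:R^-1; first by rewrite invr_gt0.
  move=> V p F V0 pK c1 c2; rewrite leNgt; apply/negP => big; apply: nQ.
  exists (Plab R p F); split => //; first exact: Plab_inv.
    by rewrite -Plab_smap.
  by rewrite -Plab_smap.
have [Q QP] := boolp.choice bad.
have [U [UU oU]] := ultraFilterLemma eventually_filter.
have UF : ProperFilter U := @ultra_proper _ _ UU.
have Qinv n : inv_family (Q n) by have [] := QP n.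
have lx r x : exists l : R, ((fun n => Q n r x) @ U --> l)%classic.
  apply: ultra_lim => // n; have [Pp _ _ _] := Qinv n.
  by have [-> _] := Pp r; rewrite (pmf_le1 x (Pp r)).
pose q r x := sval (cid (lx r x)).
have qP r x : ((fun n => Q n r x) @ U --> q r x)%classic by exact: svalP (cid (lx r x)).
have qinv : inv_family q by exact: (lim_inv UF Qinv qP).
have marg (f : MM -> M) : (forall n, l1 (push (Q n (s n)) (@smap D MM M f (s n))) (P (s n)) <= n.+1%:R^-1) ->
    forall r, push (q r) (@smap D MM M f r) = P r.
  move=> c r; apply/funext => y.
  have c1 := @cvg_push R _ _ U (fun n => Q n r) (q r) (@smap D MM M f r) y UF (qP r).
  apply: (cvg_unique (@Rhausdorff R) c1).
  apply/cvgrPdist_lt => e e0; apply: oU.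
  have [k _ kP] := near_infty_natSinv_lt (PosNum e0).
  exists (maxn r k) => // n /=; rewrite geq_max => /andP[rn kn].
  apply: le_lt_trans (kP n kn); rewrite distrC; apply: le_trans (c n).
  have rs : (r <= s n)%N by apply: leq_trans (s_ge n); apply: leq_trans rn _; exact: leq_addl.
  apply: le_trans (l1_strunc (recolor_inv f (Qinv n)) Pinv rs).
  by rewrite /l1 (bigD1 y)//= lerDl sumr_ge0.
have q1 := marg fst (fun n => let: And4 _ h _ _ := QP n in h).
have q2 := marg snd (fun n => let: And4 _ _ h _ := QP n in h).
have cf := coupling_family qinv q1 q2.
pose A : set R := [set sig P r | r in [set: nat]]%classic.
have Ai : has_inf A.
  split; first by exists (sig P 0%N); exists 0%N.
  by exists 0 => _ [r _ <-]; exact: sig_ge0.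
have d2 : 0 < delta / 2 by rewrite divr_gt0.
have [_ [r0 _ <-] rI] := inf_adherent d2 Ai.
pose r := (rk r0.+1).-1.
have rr : sig P r <= sig P r0 by apply: sig_mono => //; exact: rk_ge.
have up : sig q r <= 2 * sig P r by exact: cf.
have lo : 2 * inf A + delta <= sig q r.
  apply: (cvgr_to_ge (cvg_sig UF Qinv qP (r := r))).
  apply: oU; exists r => // n /= rn.
  have rs : (r <= s n)%N by apply: leq_trans (s_ge n); apply: leq_trans rn _; exact: leq_addl.
  apply: (@le_trans _ _ (sig (Q n) (s n))); last exact: sig_mono.
  have [_ _ _ /ltW h] := QP n; apply: le_trans h; rewrite lerD2r ler_pM2l//.
  apply: ge_inf; first by have [] := Ai.
  by exists (s n).
lra.
Qed.

End Coupling.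

(** * Breadth-first search in a tree-like neighborhood *)

Section Independence.
Variables (R : realType) (V X : finType).
Implicit Types (s : {ffun V -> X}) (F G : {ffun V -> X} -> R).

Definition mix (A : pred V) s s' : {ffun V -> X} := [ffun v => if A v then s v else s' v].

(** Exchanging the coordinates outside [A] between two samples is a bijection; it turns [F s * G s']
    into [F s * G s]. *)
Lemma sum_indep (A : pred V) F G :
  (forall s s', (forall v, A v -> s v = s' v) -> F s = F s') ->
  (forall s s', (forall v, ~~ A v -> s v = s' v) -> G s = G s') ->
  (\sum_s F s) * (\sum_s G s) = #|{ffun V -> X}|%:R * \sum_s F s * G s.
Proof.
move=> FA GA; pose sw (ss : {ffun V -> X} * {ffun V -> X}) := (mix A ss.1 ss.2, mix A ss.2 ss.1).
have swK : involutive sw.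
  by move=> [s s']; congr pair; apply/ffunP => v; rewrite !ffunE; case: (A v).
transitivity (\sum_(ss : {ffun V -> X} * {ffun V -> X}) F ss.1 * G ss.2).
  rewrite mulr_suml -(pair_bigA _ (fun s s' => F s * G s')) /=.
  by apply: eq_bigr => s _; rewrite mulr_sumr.
rewrite (reindex_inj (inv_inj swK)) /=.
rewrite (eq_bigr (fun ss => F ss.1 * G ss.1)) => [|[s s'] _ /=]; last first.
  congr (_ * _); first by apply: FA => v Av; rewrite ffunE Av.
  by apply: GA => v Av; rewrite ffunE (negbTE Av).
rewrite -(pair_bigA _ (fun s (_ : {ffun V -> X}) => F s * G s)) /= mulr_sumr.
by apply: eq_bigr => s _; rewrite sumr_const -[_ *+ _]mulr_natl.
Qed.

Hypothesis X0 : (0 < #|X|)%N.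

Definition avg F : R := (\sum_s F s) / #|{ffun V -> X}|%:R.

Let N0 : #|{ffun V -> X}|%:R != 0 :> R.
Proof. by rewrite pnatr_eq0 card_ffun -lt0n expn_gt0 X0. Qed.

Lemma avg_cst (a : R) : avg (fun=> a) = a.
Proof. by rewrite /avg sumr_const -[_ *+ _]mulr_natr mulfK. Qed.

Lemma avg_mul (A : pred V) F G :
  (forall s s', (forall v, A v -> s v = s' v) -> F s = F s') ->
  (forall s s', (forall v, ~~ A v -> s v = s' v) -> G s = G s') ->
  avg (fun s => F s * G s) = avg F * avg G.
Proof. by move=> FA GA; rewrite /avg mulrACA (sum_indep FA GA) [_ * (\sum__ _)]mulrC -mulrA mulVKf. Qed.

Lemma avg_prod n (F : 'I_n -> {ffun V -> X} -> R) (A : 'I_n -> seq V) :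
  (forall k s s', (forall v, v \in A k -> s v = s' v) -> F k s = F k s') ->
  (forall k l v, v \in A k -> v \in A l -> k = l) ->
  avg (fun s => \prod_k F k s) = \prod_k avg (F k).
Proof.
elim: n F A => [|n IH] F A FA disj.
  rewrite big_ord0 -[RHS](avg_cst 1); congr avg; apply/funext => s; by rewrite big_ord0.
rewrite big_ord_recl -(IH (fun k => F (lift ord0 k)) (fun k => A (lift ord0 k))).
- rewrite -(@avg_mul (mem (A ord0))).
  + by congr avg; apply/funext => s; rewrite big_ord_recl.
  + by move=> s s' h; apply: FA.
  + move=> s s' h; apply: eq_bigr => k _; apply: FA => v vk; apply: h.
    by apply/negP => v0; have := disj _ _ _ v0 vk.
- by move=> k s s' h; apply: FA.
- by move=> k l v vk vl; apply: (@lift_inj _ ord0); exact: disj vk vl.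
Qed.

Lemma avg_coord (v0 : V) (g : X -> R) : avg (fun s => g (s v0)) = (\sum_x g x) / #|X|%:R.
Proof.
have X0' : #|X|%:R != 0 :> R by rewrite pnatr_eq0 -lt0n.
suff e x : avg (fun s => (s v0 == x)%:R) = #|X|%:R^-1.
  transitivity (\sum_x g x * avg (fun s => (s v0 == x)%:R)).
    rewrite /avg; under [RHS]eq_bigr do rewrite mulrA mulr_sumr.
    rewrite -[RHS]mulr_suml exchange_big /=; congr (_ / _); apply: eq_bigr => s _.
    rewrite (bigD1 (s v0))//= eqxx mulr1 big1 ?addr0// => x /negbTE; rewrite eq_sym => ->.
    by rewrite mulr0.
  by rewrite mulr_suml; apply: eq_bigr => x _; rewrite e.
have cst x' : avg (fun s => (s v0 == x)%:R) = avg (fun s => (s v0 == x')%:R).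
  pose b s : {ffun V -> X} := [ffun v => tperm x x' (s v)].
  have bK : involutive b by move=> s; apply/ffunP => v; rewrite !ffunE tpermK.
  rewrite /avg; congr (_ / _); rewrite [RHS](reindex_inj (inv_inj bK)) /=.
  apply: eq_bigr => s _; rewrite ffunE; congr (nat_of_bool _)%:R.
  apply/eqP/eqP => [->|e]; first by rewrite tpermL.
  by apply: (@perm_inj _ (tperm x x')); rewrite tpermL.
have : \sum_x' avg (fun s => (s v0 == x')%:R) = 1.
  rewrite /avg -mulr_suml exchange_big /= (eq_bigr (fun=> 1)).
    by rewrite sumr_const divff.
  by move=> s _; rewrite (bigD1 (s v0))//= eqxx big1 ?addr0// => y /negbTE; rewrite eq_sym => ->.
rewrite (eq_bigr (fun=> avg (fun s => (s v0 == x)%:R))) => [|x' _]; last by rewrite -cst.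
rewrite sumr_const -[_ *+ _]mulr_natl => h.
by apply: (mulfI X0'); rewrite mulfV//; exact: h.
Qed.

End Independence.

Section Orderings.
Variables (R : realType) (D : nat) (M V X : finType).
Notation d := D.+1.
Notation H := (V * 'I_D.+1)%type.
Variables (p : H -> H) (f : V -> M) (o : V -> X -> 'S_D.+1).
Hypothesis X0 : (0 < #|X|)%N.
(** Says that the order at [u] is uniform, in a form that passes to the order induced on the
    directions other than a given one ([rho_mul]). *)
Hypothesis o_equi : forall u (th : 'S_d), exists2 b : X -> X, injective b & forall x, o u (b x) = (o u x * th)%g.
Implicit Types (s : {ffun V -> X}) (h : H).

(** Any two values differ by some [th], which a permutation of [X] realizes, so all values are
    equally likely. *)
Lemma equi_uniform n (q : X -> 'S_n) (tau : 'S_n) :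
  (forall th : 'S_n, exists2 b : X -> X, injective b & forall x, q (b x) = (q x * th)%g) ->
  (\sum_x (q x == tau)%:R) / #|X|%:R = (n`!%:R : R)^-1.
Proof.
move=> qb; have X0' : #|X|%:R != 0 :> R by rewrite pnatr_eq0 -lt0n.
have cst t : \sum_x (q x == t)%:R = \sum_x (q x == tau)%:R :> R.
  have [b bi bq] := qb (tau^-1 * t)%g.
  rewrite [LHS](reindex_inj bi) /=; apply: eq_bigr => x _; rewrite bq; congr (nat_of_bool _)%:R.
  apply/eqP/eqP => [e|->]; last by rewrite mulKVg.
  by apply: (mulIg (tau^-1 * t)%g); rewrite e mulKVg.
have : \sum_t \sum_x (q x == t)%:R = #|X|%:R :> R.
  rewrite exchange_big /= (eq_bigr (fun=> 1)) ?sumr_const// => x _.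
  by rewrite (bigD1 (q x))//= eqxx big1 ?addr0// => t /negbTE; rewrite eq_sym => ->.
rewrite (eq_bigr _ (fun t _ => cst t)) sumr_const card_Sn -[_ *+ _]mulr_natl => <-.
rewrite invfM mulrCA mulfV ?mulr1//.
apply: contraNneq X0' => e0; move: cst; rewrite e0 => cst.
have [x _] := card_gt0P X0; have := cst (q x); rewrite (bigD1 x)//= eqxx => /eqP.
rewrite gt_eqF// ltr_pwDl// sumr_ge0//.
Qed.

(* The order which [th] induces on the directions other than [i]. *)
Definition rho (th : 'S_d) (i : 'I_d) : 'S_D :=
  odflt 1%g [pick t : 'S_D | [forall k, th (lift ((th^-1)%g i) k) == lift i (t k)]].

Lemma rhoP (th : 'S_d) i k : th (lift ((th^-1)%g i) k) = lift i (rho th i k).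
Proof.
rewrite /rho; case: pickP => [t /forallP/(_ k)/eqP//|no].
have [t tP] := perm_lift th ((th^-1)%g i); have := no t; rewrite permKV in tP.
by move/forallP; case=> l; rewrite tP.
Qed.

Lemma rho_mul (th : 'S_d) i (t : 'S_D) : rho (th * lift_perm i i t)%g i = (rho th i * t)%g.
Proof.
apply/permP => k; apply: (@lift_inj _ i); rewrite -rhoP invMg !permM.
have -> : ((lift_perm i i t)^-1)%g i = i.
  by apply: (@perm_inj _ (lift_perm i i t)); rewrite permKV lift_perm_id.
by rewrite rhoP lift_perm_lift.
Qed.

(** The cover read in the order of exploration: from [h] the other directions are visited in the
    order that remains when the half-edge of arrival is removed. *)
Fixpoint ounf s r h : br D M r :=
  match r return br D M r with
  | 0 => f h.1
  | r'.+1 => (f h.1, [ffun k => ounf s r' (p (h.1, lift h.2 (rho (o h.1 (s h.1)) h.2 k)))])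
  end.

Definition ostar s r v : star D M r := (f v, [ffun i => ounf s r (p (v, o v (s v) i))]).

Lemma ounf_dep r h s s' : (forall v, v \in lab (unf p id r h) -> s v = s' v) ->
  ounf s r h = ounf s' r h.
Proof.
elim: r h => [//|r IH] h /= e; rewrite (e h.1) ?mem_head//; congr pair; apply/ffunP => k.
rewrite !ffunE; apply: IH => v vl; apply: e; rewrite inE; apply/orP; right.
apply/flattenP; exists (lab (unf p id r (p (h.1, lift h.2 (rho (o h.1 (s' h.1)) h.2 k))))) => //.
apply/mapP; exists (rho (o h.1 (s' h.1)) h.2 k); first by rewrite mem_enum.
by rewrite ffunE.
Qed.

Lemma uniq_flatten_ord n (F : 'I_n -> seq V) : uniq (flatten [seq F i | i <- enum 'I_n]) ->
  (forall i, uniq (F i)) /\ forall i j v, v \in F i -> v \in F j -> i = j.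
Proof.
have h (e : seq 'I_n) : uniq (flatten [seq F i | i <- e]) ->
   (forall i, i \in e -> uniq (F i)) /\ forall i j v, i \in e -> j \in e -> v \in F i -> v \in F j -> uniq e -> i = j.
  elim: e => //= a e IH; rewrite cat_uniq => /and3P[ua /hasPn na /IH[u1 u2]]; split.
    by move=> i; rewrite inE => /orP[/eqP->//|/u1].
  have out i v : i \in e -> v \in F i -> v \notin F a.
    by move=> ie vi; apply: na; apply/flattenP; exists (F i) => //; apply: map_f.
  move=> i j v; rewrite !inE => /orP[/eqP->|ie] /orP[/eqP->|je] vi vj /andP[ae ue]//.
  - by have := out _ _ je vj; rewrite vi.
  - by have := out _ _ ie vi; rewrite vj.
  - exact: u2 ie je vi vj ue.
move=> /h[u1 u2]; split=> [i|i j v vi vj]; first by apply: u1; rewrite mem_enum.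
by apply: u2 vi vj (enum_uniq _); rewrite mem_enum.
Qed.

(* Conditionally on the ordering at [w], the branches hanging from [w] are
   independent because they explore disjoint sets of vertices. *)
Lemma law_node n r (w : V) (q : X -> 'S_n) (z : 'I_n -> H) (y : {ffun 'I_n -> br D M r}) :
  (forall th : 'S_n, exists2 b : X -> X, injective b & forall x, q (b x) = (q x * th)%g) ->
  (forall k, w \notin lab (unf p id r (z k))) ->
  (forall k l v, v \in lab (unf p id r (z k)) -> v \in lab (unf p id r (z l)) -> k = l) ->
  (forall k b, avg (fun s => (ounf s r (z k) == b)%:R) = Borb R (unf p f r (z k)) b) ->
  avg (fun s => ([ffun k => ounf s r (z (q (s w) k))] == y)%:R) =
    norb R [ffun k => unf p f r (z k)] y.
Proof.
move=> qb wz disj IH; rewrite norbE.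
pose G (t : 'S_n) s : R := \prod_k (ounf s r (z (t k)) == y k)%:R.
have e s : ([ffun k => ounf s r (z (q (s w) k))] == y)%:R = \sum_t (q (s w) == t)%:R * G t s :> R.
  rewrite (bigD1 (q (s w)))//= eqxx mul1r [X in _ + X]big1 ?addr0 => [|t /negbTE]; last first.
    by rewrite eq_sym => ->; rewrite mul0r.
  rewrite /G prod_indicator; congr (nat_of_bool _)%:R.
  apply/eqP/forallP => [<- k|h]; first by rewrite ffunE.
  by apply/ffunP => k; rewrite ffunE (eqP (h k)).
transitivity (\sum_t avg (fun s => (q (s w) == t)%:R * G t s)).
  rewrite /avg -mulr_suml exchange_big /=; congr (_ / _); apply: eq_bigr => s _; exact: e.
rewrite mulr_suml; apply: eq_bigr => t _.
rewrite (@avg_mul R V X X0 (pred1 w))//.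
- rewrite (avg_coord X0 w (fun x => (q x == t)%:R)) equi_uniform// mulrC; congr (_ * _).
  rewrite (@avg_prod R V X X0 n _ (fun k => lab (unf p id r (z (t k)))))//.
  + by apply: eq_bigr => k _; rewrite IH ffunE.
  + by move=> k s s' h; rewrite (ounf_dep h).
  + by move=> k l v vk vl; apply: (@perm_inj _ t); exact: disj vk vl.
- by move=> s s' h; rewrite (h w)//=.
- move=> s s' h; apply: eq_bigr => k _; rewrite (@ounf_dep _ _ s s')// => v vl; apply: h.
  by apply: contraNneq (wz (t k)) => <-.
Qed.

Lemma law_ounf r h y : uniq (lab (unf p id r h)) ->
  avg (fun s => (ounf s r h == y)%:R) = Borb R (unf p f r h) y.
Proof.
elim: r h y => [|r IH] h y; first by move=> _; rewrite Borb0 /= avg_cst.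
move=> /=; set F := fun k : 'I_D => lab (unf p id r (p (h.1, lift h.2 k))).
have -> : [seq lab ([ffun k => unf p id r (p (h.1, lift h.2 k))] i) | i <- enum 'I_D] = [seq F i | i <- enum 'I_D].
  by apply: eq_map => i; rewrite ffunE.
move=> /andP[hF /uniq_flatten_ord[u1 u2]].
rewrite BorbS /= -(@law_node D r h.1 (fun x => rho (o h.1 x) h.2) (fun k => p (h.1, lift h.2 k)) y.2).
- have -> : (fun s => ((f h.1, [ffun k => ounf s r (p (h.1, lift h.2 (rho (o h.1 (s h.1)) h.2 k)))]) == y)%:R) =
    (fun s => (f h.1 == y.1)%:R * ([ffun k => ounf s r (p (h.1, lift h.2 (rho (o h.1 (s h.1)) h.2 k)))] == y.2)%:R) :> ({ffun V -> X} -> R).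
    by apply/funext => s; case: y => y1 y2; rewrite xpair_eqE -mulnb natrM.
  by rewrite /avg -mulr_sumr mulrA.
- move=> th; have [b bi bo] := o_equi h.1 (lift_perm h.2 h.2 th); exists b => // x.
  by rewrite bo rho_mul.
- by move=> k; apply: contra hF => hk; apply/flattenP; exists (F k) => //; apply: map_f; rewrite mem_enum.
- by move=> k l v; exact: u2.
- by move=> k b; apply: IH; exact: u1.
Qed.

Lemma law_ostar r v x : uniq (slab (sunf p id r v)) ->
  avg (fun s => (ostar s r v == x)%:R) = SB R (sunf p f r v) x.
Proof.
rewrite /slab /=; set F := fun k : 'I_d => lab (unf p id r (p (v, k))).
have -> : [seq lab ([ffun k => unf p id r (p (v, k))] i) | i <- enum 'I_d] = [seq F i | i <- enum 'I_d].
  by apply: eq_map => i; rewrite ffunE.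
move=> /andP[vF /uniq_flatten_ord[u1 u2]].
rewrite SBE /= -(@law_node d r v (o v) (fun k => p (v, k)) x.2).
- have -> : (fun s => (ostar s r v == x)%:R) =
    (fun s => (f v == x.1)%:R * ([ffun k => ounf s r (p (v, o v (s v) k))] == x.2)%:R) :> ({ffun V -> X} -> R).
    by apply/funext => s; case: x => x1 x2; rewrite /ostar xpair_eqE -mulnb natrM.
  by rewrite /avg -mulr_sumr mulrA.
- exact: o_equi.
- by move=> k; apply: contra vF => hk; apply/flattenP; exists (F k) => //; apply: map_f; rewrite mem_enum.
- by move=> k l w; exact: u2.
- by move=> k b; apply: law_ounf; exact: u1.
Qed.

End Orderings.

Section BreadthFirst.
Variables (V : eqType) (nb : V -> seq V) (root : V).
Hypothesis nbU : forall u, uniq (nb u).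
Notation bfs := (bfs nb root).

Lemma bfsS_cat k : exists2 s, bfs k.+1 = bfs k ++ s &
  forall q, q \in s -> exists u l j, [/\ onth (bfs k) k = Some (u, l), q.2 = rcons l j & q.1 \in nb u].
Proof.
rewrite /= /bfs_step; case e: (onth _ _) => [[u l]|]; last by exists [::]; rewrite ?cats0.
eexists; first by [].
move=> [y w] /mem_zipP[]; rewrite mem_filter => /andP[_ yu] /mapP[j _ ->].
by exists u, l, j.
Qed.

Lemma bfs_cat k m : exists s, bfs (k + m) = bfs k ++ s.
Proof.
elim: m => [|m [s IH]]; first by exists [::]; rewrite addn0 cats0.
by have [s' e _] := bfsS_cat (k + m); exists (s ++ s'); rewrite addnS e IH catA.
Qed.

Lemma onth_catl (T : Type) (s t : seq T) i y : onth s i = Some y -> onth (s ++ t) i = Some y.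
Proof. by move=> e; rewrite onth_cat -onthTE e. Qed.

Lemma onth_bfs k m i q : onth (bfs k) i = Some q -> (i <= m)%N -> onth (bfs m) i = Some q.
Proof.
elim: k => [|k IH].
  by move=> h _; have [s] := bfs_cat 0 m; rewrite add0n => ->; exact: onth_catl.
move=> h im; have [mk|km] := leqP k.+1 m.
  by have [s] := bfs_cat k.+1 (m - k.+1); rewrite subnKC// => ->; exact: onth_catl.
apply: IH => //; move: h; rewrite /= /bfs_step; case e: (onth _ k) => [[u l]|]//.
rewrite onth_cat -onthTE; case e': (onth _ i) => [//|] /= _.
have kB : (k < size (bfs k))%N by rewrite -onthTE e.
have : (i < size (bfs k))%N by apply: leq_ltn_trans kB; exact: leq_trans im km.
by rewrite -onthTE e'.
Qed.

Lemma bfs_uniq k : uniq (unzip1 (bfs k)).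
Proof.
elim: k => //= k IH; rewrite /bfs_step; case: (onth _ _) => [[u l]|]//.
rewrite /unzip1 map_cat -[map _ (zip _ _)]/(unzip1 _) unzip1_zip ?size_map ?size_iota// cat_uniq IH.
rewrite filter_uniq// andbT /=; apply/hasPn => y; rewrite mem_filter => /andP[]//.
Qed.

Lemma bfs_label_inj x l l' : bfs_label nb root x l -> bfs_label nb root x l' -> l = l'.
Proof.
wlog: l l' / exists k, (x, l) \in bfs k /\ (x, l') \in bfs k.
  move=> h [k xl] [k' xl']; apply: (h l l'); [|by exists k|by exists k'].
  exists (k + k')%N; split; first by have [s ->] := bfs_cat k k'; rewrite mem_cat xl.
  by have [s] := bfs_cat k' k; rewrite addnC => ->; rewrite mem_cat xl'.
move=> [k [xl xl']] _ _; have := bfs_uniq k; elim: (bfs k) xl xl' => //= -[y m] B IH.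
have out w : (x, w) \in B -> x \in unzip1 B by move=> h; apply/mapP; exists (x, w).
rewrite !inE !xpair_eqE => h1 h2 /andP[yB uB]; case/orP: h1; case/orP: h2.
- by move=> /andP[_ /eqP->] /andP[_ /eqP->].
- by move=> xl' /andP[/eqP e _]; rewrite -e (out _ xl') in yB.
- by move=> /andP[/eqP e _] xl; rewrite -e (out _ xl) in yB.
- by move=> xl' xl; exact: IH.
Qed.

(* The queue is sorted by depth and spans at most two levels from its head on. *)
Lemma bfs_sorted k i j q q' : onth (bfs k) i = Some q -> onth (bfs k) j = Some q' -> (i <= j)%N ->
  (size q.2 <= size q'.2)%N /\ ((k <= i)%N -> (size q'.2 <= (size q.2).+1)%N).
Proof.
elim: k i j q q' => [|k IH] i j q q'.
  by move=> /onth1P[-> <-] /onth1P[-> <-].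
rewrite /= /bfs_step; case e: (onth _ k) => [[u l]|]; last first.
  move=> hi hj ij; have [h1 h2] := IH _ _ _ _ hi hj ij; split=> // /ltnW; exact: h2.
set new := zip _ _; have newP c : c \in new -> size c.2 = (size l).+1.
  by case: c => y w /mem_zipP[_ /mapP[m _ ->]]; rewrite size_rcons.
rewrite !onth_cat; case: ltnP => iB hi; case: ltnP => jB hj ij.
- have [h1 h2] := IH _ _ _ _ hi hj ij; split=> // /ltnW; exact: h2.
- have -> : size q'.2 = (size l).+1 by apply: newP; apply/onthP; exists (j - size (bfs k))%N.
  have [ik|ki] := leqP i k.
    have [h1 _] := IH _ _ _ _ hi e ik; split; [exact: leqW|lia].
  have [h1 h2] := IH _ _ _ _ e hi (ltnW ki); split; [exact: h2|by rewrite ltnS].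
- lia.
- rewrite !newP//; apply/onthP; [by exists (j - size (bfs k))%N|by exists (i - size (bfs k))%N].
Qed.

End BreadthFirst.

Section TreeQueue.
Variable D : nat.
Notation d := D.+1.
Implicit Types u v w x : tree d.

Definition kids u : seq (tree d) := [seq child u j | j <- iota 0 (deg u)].

(** The queue of the search in the tree itself, where each vertex is its own label. *)
Fixpoint tqueue k : seq (tree d) :=
  if k is k'.+1 then
    if onth (tqueue k') k' is Some u then tqueue k' ++ kids u else tqueue k'
  else [:: tree_root d].

Lemma kidsP u x : reflect (exists2 j, (j < deg u)%N & x = child u j) (x \in kids u).
Proof.
by apply: (iffP mapP) => -[j]; [rewrite mem_iota => jd ->; exists j|move=> jd ->; exists j; rewrite ?mem_iota].
Qed.

Lemma kids_uniq u : uniq (kids u).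
Proof.
rewrite map_inj_in_uniq ?iota_uniq// => i j; rewrite !mem_iota => id jd.
by case/child_inj2.
Qed.

Lemma tqueue_parent k x : x \in tqueue k -> x = tree_root d \/
  exists u i j, [/\ (i < k)%N, onth (tqueue k) i = Some u, (j < deg u)%N & x = child u j].
Proof.
elim: k x => [|k IH] x /=; first by rewrite inE => /eqP->; left.
case e: (onth _ k) => [u|]; last first.
  by case/IH => [|[u [i [j [ik]]]]]; [left|right; exists u, i, j; split=> //; exact: ltnW].
rewrite mem_cat => /orP[/IH[x0|[u' [i [j [ik Qi jd xE]]]]]|/kidsP[j jd xE]].
- by left.
- by right; exists u', i, j; split=> //; [exact: ltnW|exact: onth_catl].
- by right; exists u, k, j; split=> //; exact: onth_catl.
Qed.

Lemma tqueue_fresh k u j : uniq (tqueue k) -> onth (tqueue k) k = Some u -> (j < deg u)%N ->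
  child u j \notin tqueue k.
Proof.
move=> uQ Qk jd; apply/negP => /tqueue_parent[c0|[u' [i [j' [ik Qi jd' e]]]]].
  by have := child_neq_root jd; rewrite c0.
have [uu _] := child_inj2 jd jd' e; rewrite uu in Qk.
have ss : (k < size (tqueue k))%N by rewrite -onthTE Qk.
have : i = k by apply: onth_inj uQ _ _; [by rewrite gtn_min ss ?orbT|rewrite Qi Qk].
by move=> ii; rewrite ii ltnn in ik.
Qed.

Lemma tqueue_uniq k : uniq (tqueue k).
Proof.
elim: k => //= k IH; case e: (onth _ k) => [u|]//.
rewrite cat_uniq IH kids_uniq andbT /=; apply/hasPn => c /kidsP[j jd ->].
exact: tqueue_fresh.
Qed.

End TreeQueue.

Section Labels.
Variables (D : nat) (M : finType) (c : tree D.+1 -> M).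
Notation d := D.+1.
Notation troot := (tree_root D.+1).
Implicit Types u v w : tree d.

Lemma mem_lab_brf r v u : val v != [::] -> prefix (val v) (val u) -> (size (val u) <= size (val v) + r)%N ->
  c u \in lab (brf c v r).
Proof.
elim: r v => [|r IH] v v0 pu su; have [->|[k kv ku]] := prefix_child pu; rewrite /= ?mem_head//.
  by have := leq_trans (size_prefix ku) su; rewrite addn0 size_child// ltnn.
have kD : (k < D)%N by rewrite -(deg_nroot v0).
rewrite inE; apply/orP; right; apply/flattenP; exists (lab (brf c (child v k) r)).
  by apply/mapP; exists (Ordinal kD); rewrite ?mem_enum// ffunE.
by apply: IH ku _; [exact: child_neq_root|rewrite size_child//; apply: leq_trans su _; rewrite addnS addSn].
Qed.

Lemma brf_inj r v u w : val v != [::] -> uniq (lab (brf c v r)) ->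
  prefix (val v) (val u) -> (size (val u) <= size (val v) + r)%N ->
  prefix (val v) (val w) -> (size (val w) <= size (val v) + r)%N -> c u = c w -> u = w.
Proof.
elim: r v => [|r IH] v v0 /= uq pu su pw sw cuw.
  have [->|[k kv ku]] := prefix_child pu.
    have [->//|[l lv lw]] := prefix_child pw.
    by have := leq_trans (size_prefix lw) sw; rewrite addn0 size_child// ltnn.
  by have := leq_trans (size_prefix ku) su; rewrite addn0 size_child// ltnn.
pose F (i : 'I_D) := lab (brf c (child v i) r).
have Fe : [seq lab ([ffun i : 'I_D => brf c (child v i) r] i) | i <- enum 'I_D] = [seq F i | i <- enum 'I_D].
  by apply: eq_map => i; rewrite ffunE.
move: uq; rewrite Fe => /andP[vF /uniq_flatten_ord[u1 u2]].
have mem x k (kv : (k < deg v)%N) (kD : (k < D)%N) : prefix (val (child v k)) (val x) ->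
    (size (val x) <= size (val v) + r.+1)%N -> c x \in F (Ordinal kD).
  move=> kx sx; apply: mem_lab_brf kx _; first exact: child_neq_root.
  by rewrite size_child//; apply: leq_trans sx _; rewrite addnS addSn.
have out x k (kv : (k < deg v)%N) : prefix (val (child v k)) (val x) ->
    (size (val x) <= size (val v) + r.+1)%N -> c v <> c x.
  move=> kx sx e; move/negP: vF; apply; rewrite e.
  have kD : (k < D)%N by rewrite -(deg_nroot v0).
  apply/flattenP; exists (F (Ordinal kD)); [by apply: map_f; rewrite mem_enum|exact: mem].
have [uv|[k kv ku]] := prefix_child pu; have [wv|[l lv lw]] := prefix_child pw.
- by rewrite uv wv.
- by case: (out _ _ lv lw sw); rewrite -cuw uv.
- by case: (out _ _ kv ku su); rewrite cuw wv.
- have kD : (k < D)%N by rewrite -(deg_nroot v0).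
  have lD : (l < D)%N by rewrite -(deg_nroot v0).
  have mu := mem _ _ kv kD ku su; have mw := mem _ _ lv lD lw sw; rewrite -cuw in mw.
  have [kl] := u2 _ _ _ mu mw; rewrite -kl in lw.
  have sz x : (size (val x) <= size (val v) + r.+1)%N -> (size (val x) <= size (val (child v k)) + r)%N.
    by rewrite size_child// addSn addnS.
  by apply: (IH (child v k)) => //; [exact: child_neq_root|exact: u1 (Ordinal kD)|exact: sz|exact: sz].
Qed.

Lemma start_inj r : uniq (slab (start c r)) ->
  forall u w, (size (val u) <= r.+1)%N -> (size (val w) <= r.+1)%N -> c u = c w -> u = w.
Proof.
pose F (i : 'I_d) := lab (brf c (child troot i) r).
rewrite /slab /=.
have -> : [seq lab ([ffun i : 'I_d => brf c (child troot i) r] i) | i <- enum 'I_d] = [seq F i | i <- enum 'I_d].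
  by apply: eq_map => i; rewrite ffunE.
move=> /andP[vF /uniq_flatten_ord[u1 u2]] u w su sw cuw.
have kE k : (k < deg troot)%N -> (k < d)%N by [].
have mem x k (kv : (k < deg troot)%N) : prefix (val (child troot k)) (val x) ->
    (size (val x) <= r.+1)%N -> c x \in F (Ordinal (kE _ kv)).
  by move=> kx sx; apply: mem_lab_brf kx _; [exact: child_neq_root|rewrite size_child].
have out x k (kv : (k < deg troot)%N) : prefix (val (child troot k)) (val x) ->
    (size (val x) <= r.+1)%N -> c troot <> c x.
  move=> kx sx e; move/negP: vF; apply; rewrite e.
  apply/flattenP; exists (F (Ordinal (kE _ kv))); [by apply: map_f; rewrite mem_enum|exact: mem].
have [uv|[k kv ku]] := prefix_child (v := troot) (u := u) (prefix0s _);
  have [wv|[l lv lw]] := prefix_child (v := troot) (u := w) (prefix0s _).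
- by rewrite uv wv.
- by case: (out _ _ lv lw sw); rewrite -cuw uv.
- by case: (out _ _ kv ku su); rewrite cuw wv.
- have mu := mem _ _ kv ku su; have mw := mem _ _ lv lw sw; rewrite -cuw in mw.
  have [kl] := u2 _ _ _ mu mw; rewrite -kl in lw.
  apply: (@brf_inj r (child troot k)) => //; rewrite ?size_child//; first exact: child_neq_root.
  exact: u1 (Ordinal (kE _ kv)).
Qed.

End Labels.

Section Unfolding.
Variables (D : nat) (V X : finType).
Notation d := D.+1.
Notation troot := (tree_root D.+1).
Notation H := (V * 'I_D.+1)%type.
Variables (p : H -> H) (o : V -> X -> 'S_D.+1) (s : {ffun V -> X}) (v : V).
Implicit Types (u w : tree d) (h : H).

Definition hchild h k : H :=
  if insub k is Some i then p (h.1, lift h.2 (rho (o h.1 (s h.1)) h.2 i)) else h.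

Definition hroot k : H := if insub k is Some i then p (v, o v (s v) i) else (v, ord0).

(** The half-edge of arrival at the image of [u]; it points back to the image of the parent. At the
    root the direction [ord0] is a dummy. *)
Definition hmap u : H :=
  if val u is i :: w then foldl (fun h j => hchild h j.-1) (hroot i.-1) w else (v, ord0).

Definition walk u : V := (hmap u).1.

Lemma hmap_root (i : 'I_d) : hmap (child troot i) = p (v, o v (s v) i).
Proof.
have id : (i < deg troot)%N by exact: ltn_ord.
by rewrite /hmap val_child//= /hroot valK.
Qed.

Lemma hmap_child u (i : 'I_D) : val u != [::] ->
  hmap (child u i) = p ((hmap u).1, lift (hmap u).2 (rho (o (hmap u).1 (s (hmap u).1)) (hmap u).2 i)).
Proof.
move=> u0; have id : (i < deg u)%N by rewrite deg_nroot.
rewrite /hmap val_child//; case: (val u) u0 => //= a w _.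
by rewrite foldl_rcons /= {1}/hchild valK.
Qed.

Lemma brf_walk (M : finType) (f : V -> M) r u : val u != [::] ->
  brf (f \o walk) u r = ounf p f o s r (hmap u).
Proof.
elim: r u => [//|r IH] u u0 /=; congr pair; apply/ffunP => i.
by rewrite !ffunE -hmap_child// IH// child_neq_root// deg_nroot.
Qed.

Lemma start_walk (M : finType) (f : V -> M) r : start (f \o walk) r = ostar p f o s r v.
Proof.
congr pair; apply/ffunP => i; rewrite !ffunE -hmap_root brf_walk//.
by rewrite child_neq_root//; exact: ltn_ord.
Qed.

Lemma perm_lab_ounf r h : perm_eq (lab (ounf p id o s r h)) (lab (unf p id r h)).
Proof.
elim: r h => [//|r IH] h /=; rewrite perm_cons.
by apply: (perm_flatten_ord (s := rho (o h.1 (s h.1)) h.2)) => i; rewrite !ffunE.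
Qed.

(** The star read along [walk] is that of the cover with its branches permuted, so it lists the same
    vertices. *)
Lemma walk_inj r : uniq (slab (sunf p id r v)) ->
  forall u w, (size (val u) <= r.+1)%N -> (size (val w) <= r.+1)%N -> walk u = walk w -> u = w.
Proof.
move=> uq; apply: start_inj; have -> : walk = id \o walk by [].
rewrite start_walk; move: uq; rewrite (perm_uniq (s2 := slab (ostar p id o s r v)))//.
rewrite perm_sym /slab /= perm_cons; apply: (perm_flatten_ord (s := o v (s v))) => i.
rewrite !ffunE; exact: perm_lab_ounf.
Qed.

Section Exploration.
Variables (M : Type) (nb : V -> seq V) (f : V -> M) (r : nat).
Hypothesis pK : involutive p.
Hypothesis p_simple : forall h y, y.1 = h.1 -> (p y).1 = (p h).1 -> y = h.
Hypothesis nbE : forall x : V, nb x = [seq (p (x, o x (s x) k)).1 | k <- enum 'I_d].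
Hypothesis vU : uniq (slab (sunf p id r v)).

Lemma nb_inj (u : V) (i j : 'I_d) : (p (u, o u (s u) i)).1 = (p (u, o u (s u) j)).1 -> i = j.
Proof. by move=> e; have [] := @p_simple (u, o u (s u) j) (u, o u (s u) i) erefl e; exact: perm_inj. Qed.

Lemma nb_uniq (u : V) : uniq (nb u).
Proof. by rewrite nbE map_inj_uniq ?enum_uniq// => i j; exact: nb_inj. Qed.

Lemma nb_root : nb (walk troot) = map walk (kids troot).
Proof.
rewrite nbE /kids -[iota 0 _](val_enum_ord d) -!map_comp; apply: eq_map => i /=.
by rewrite /walk hmap_root.
Qed.

Lemma hmap_back u k : (k < deg u)%N -> (p (hmap (child u k))).1 = walk u.
Proof.
move=> ku; have [/rootP u0|u0] := eqVneq (val u) [::].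
  by rewrite u0 in ku *; rewrite (hmap_root (Ordinal (ku : (k < d)%N))) pK.
have kD : (k < D)%N by rewrite -(deg_nroot u0).
by rewrite (hmap_child (Ordinal kD) u0) pK.
Qed.

Lemma enum_lift n (h : 'I_n.+1) : [seq m <- enum 'I_n.+1 | m != h] = map (lift h) (enum 'I_n).
Proof.
apply: (inj_map val_inj).
apply: (irr_sorted_eq ltn_trans ltnn).
- have -> : [seq \val i | i <- enum 'I_n.+1 & i != h] = [seq m <- iota 0 n.+1 | m != h :> nat].
    by rewrite -(val_enum_ord n.+1) filter_map.
  by apply: sorted_filter; [exact: ltn_trans|exact: iota_ltn_sorted].
- rewrite -map_comp sorted_map.
  have := iota_ltn_sorted 0 n; rewrite -(val_enum_ord n) sorted_map.
  apply: sub_sorted => i j /= ij; rewrite /bump; lia.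
- move=> k; apply/mapP/mapP => -[x].
    rewrite mem_filter => /andP[xh _] ->; case: (unliftP h x) => [j ->|xE].
      by exists (lift h j) => //; apply: map_f; rewrite mem_enum.
    by rewrite xE eqxx in xh.
  move=> /mapP[j _ ->] ->; exists (lift h j) => //.
  by rewrite mem_filter mem_enum eq_sym neq_lift.
Qed.

(** Away from the root, [rho] is the order of the list [nb] with the parent left out. *)
Lemma nb_child u k : (k < deg u)%N ->
  walk u \in nb (walk (child u k)) /\
  [seq y <- nb (walk (child u k)) | y != walk u] = map walk (kids (child u k)).
Proof.
move=> ku; set w := child u k; set h := hmap w; have w0 : val w != [::] by exact: child_neq_root.
set t := o h.1 (s h.1); pose m := (t^-1)%g h.2.
have pm : (p (h.1, t m)).1 = walk u by rewrite permKV -surjective_pairing hmap_back.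
have e j : ((p (h.1, t j)).1 == walk u) = (j == m).
  by apply/eqP/eqP => [|->//]; rewrite -pm; exact: nb_inj.
rewrite /walk -/h nbE -/t; split.
  by apply/mapP; exists m; rewrite ?mem_enum//.
rewrite filter_map (eq_filter (a2 := fun j => j != m)) => [|j]; last by rewrite /= -e.
rewrite enum_lift -map_comp /kids (deg_nroot w0) -(val_enum_ord D) -!map_comp.
by apply: eq_map => i /=; rewrite hmap_child// -/h rhoP.
Qed.

Lemma walk_adj u y : y \in nb (walk u) <-> exists2 w, tree_adj u w & y = walk w.
Proof.
have adjC (a b : tree d) : tree_adj a b = tree_adj b a by rewrite /tree_adj orbC.
have kid a w : w \in kids a -> tree_adj a w by case/kidsP => j ja ->; exact: adj_child.
have adj0 w : tree_adj troot w -> w \in kids troot.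
  case/orP => /tree_childP[j ja e]; first by apply/kidsP; exists j.
  by have := child_neq_root ja; rewrite -e.
case: (treeP u) => [->|[a [k [ka ->]]]].
  rewrite nb_root; split=> [/mapP[w wk ->]|[w wk ->]]; first by exists w => //; exact: kid.
  by apply: map_f; exact: adj0.
have [n1 n2] := nb_child ka; split=> [yn|[w /orP[] /tree_childP[j ja e] ->]].
- have [->|ya] := eqVneq y (walk a); first by exists a => //; rewrite adjC; exact: adj_child.
  have : y \in map walk (kids (child a k)) by rewrite -n2 mem_filter ya.
  by move=> /mapP[w wk ->]; exists w => //; exact: kid.
- have : walk w \in map walk (kids (child a k)) by apply: map_f; apply/kidsP; exists j.
  by rewrite -n2 mem_filter => /andP[].
- by have [<- _] := child_inj2 ka ja e.
Qed.

(** As long as only vertices of depth at most [r] have been explored, [walk] is injective on what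
    has been discovered. So the parent is the only neighbor met before, and the search copies that
    in the tree. *)
Lemma walk_bfs k : (forall i q, (i < k)%N -> onth (bfs nb v k) i = Some q -> (size q.2 <= r)%N) ->
  bfs nb v k = [seq (walk u, val u) | u <- tqueue D k].
Proof.
elim: k => [_|k IH good]; first by rewrite /= /walk /hmap.
have goodk i q : (i < k)%N -> onth (bfs nb v k) i = Some q -> (size q.2 <= r)%N.
  move=> ik h; apply: (good i) => //; first exact: ltnW.
  by apply: onth_bfs h _; exact/ltnW/ltnW.
have e := IH goodk; rewrite /= /bfs_step.
have Tsize x : x \in tqueue D k -> (size (val x) <= r.+1)%N.
  move=> /tqueue_parent[->//|[u [i [j [ik iu ju ->]]]]]; rewrite size_child// ltnS.
  by apply: (goodk i (walk u, val u) ik); rewrite e onth_map iu.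
have walkT x : (size (val x) <= r.+1)%N -> (walk x \in unzip1 (bfs nb v k)) = (x \in tqueue D k).
  move=> sx; rewrite e /unzip1 -map_comp; apply/mapP/idP => [[y yT]|xT]; last by exists x.
  by move/(walk_inj vU) => ->//; exact: Tsize.
case ke: (onth (tqueue D k) k) => [u|]; last by rewrite e onth_map ke.
have bu : onth (bfs nb v k) k = Some (walk u, val u) by rewrite e onth_map ke.
have su : (size (val u) <= r)%N.
  apply: (good k (walk u, val u)) => //; apply: onth_bfs bu _; exact: leqnSn.
have fresh w : w \in kids u -> walk w \notin unzip1 (bfs nb v k).
  move=> /kidsP[j ju ->]; rewrite walkT ?size_child//.
  exact: (tqueue_fresh (tqueue_uniq D k) ke).
rewrite bu; set new := [seq y <- _ | _].
have -> : new = map walk (kids u).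
  have id_kids : [seq y <- map walk (kids u) | y \notin unzip1 (bfs nb v k)] = map walk (kids u).
    by apply/all_filterP/allP => _ /mapP[w wk ->]; exact: fresh.
  case: (treeP u) => [u0|[a [j [ja ue]]]].
    by rewrite /new -id_kids u0 nb_root.
  have aT : a \in tqueue D k.
    have : u \in tqueue D k by apply/onthP; exists k.
    move=> /tqueue_parent[u0|[a' [i [j' [_ iT j'a']]]]].
      by have := child_neq_root ja; rewrite -ue u0.
    by rewrite ue => /(child_inj2 ja j'a')[-> _]; apply/onthP; exists i.
  have [_ nE] := nb_child ja; rewrite -ue in nE; rewrite -nE.
  rewrite /new; apply: eq_in_filter => y; rewrite ue => yn.
  have [->|ya] := eqVneq y (walk a); first by rewrite walkT ?aT//; exact: Tsize.
  have : y \in map walk (kids u) by rewrite -nE ue mem_filter ya.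
  by move=> /mapP[w wk ->]; rewrite fresh.
rewrite e map_cat; congr cat; rewrite size_map /kids size_map size_iota.
rewrite (iotaDl 1 0) -!map_comp zip_map; apply/eq_in_map => j; rewrite mem_iota => ju /=.
by congr pair; rewrite val_child.
Qed.

Lemma bfs_label_walk u : (size (val u) <= r.+1)%N -> bfs_label nb v (walk u) (val u).
Proof.
elim/tree_rect_child: u => [_|u j ju IH]; first by exists 0%N; rewrite inE.
rewrite size_child// ltnS => su; have [k /onthP[i ki]] := IH (leqW su).
have good i' q : (i' < i.+1)%N -> onth (bfs nb v i.+1) i' = Some q -> (size q.2 <= r)%N.
  move=> ii h; apply: leq_trans su.
  have h' := onth_bfs ki (leqnSn i).
  by have [] := bfs_sorted h h' ii.
exists i.+1; rewrite (walk_bfs good); apply/mapP; exists (child u j) => //.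
have := onth_bfs ki (leqnn i); rewrite walk_bfs => [|i' q ii h]; last first.
  by apply: (good i') => //; [exact: ltnW|apply: onth_bfs h _; exact/ltnW/ltnW].
rewrite onth_map /=; case: (onth _ _) => [u'|]//= [_ /val_inj->].
by rewrite mem_cat; apply/orP; right; apply/kidsP; exists j.
Qed.

Lemma bfs_labelP x l : bfs_label nb v x l -> (size l <= r.+1)%N -> exists2 u, x = walk u & l = val u.
Proof.
case=> k; elim: k x l => [|k IH] x l.
  by rewrite inE => /eqP[-> ->] _; exists troot.
have [s' e h] := bfsS_cat nb v k; rewrite e mem_cat => /orP[|xs]; first exact: IH.
have [u [w [j [kw /= le xu]]]] := h _ xs; rewrite le size_rcons ltnS => wr.
suff : (x, l) \in [seq (walk u, val u) | u <- tqueue D k.+1].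
  by move=> /mapP[y _ [-> le']]; exists y; rewrite // -le le'.
rewrite -walk_bfs => [|i q ik hi]; first by rewrite e mem_cat xs orbT.
have h' := onth_bfs kw (leqnSn k).
by apply: leq_trans wr; have [] := bfs_sorted hi h' ik.
Qed.

Let g := bfs_graph nb v f.
Let g' := tree_lgraph (f \o walk).

Lemma bfs_edge u l : (size (val u) <= r)%N ->
  (ledge g (val u) l <-> exists2 w, tree_adj u w & l = val w) /\
  (ledge g l (val u) <-> exists2 w, tree_adj u w & l = val w).
Proof.
move=> su; have adjC (a b : tree d) : tree_adj a b = tree_adj b a by rewrite /tree_adj orbC.
have adjS w : tree_adj u w -> (size (val w) <= r.+1)%N.
  by move=> /adj_size[->//|e]; apply/leqW/(leq_trans _ su); rewrite e.
have nbC x y : x \in nb y -> y \in nb x.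
  rewrite !nbE => /mapP[i _ ->]; set h := (y, _); apply/mapP.
  exists ((o (p h).1 (s (p h).1))^-1 (p h).2)%g; rewrite ?mem_enum//.
  by rewrite permKV -surjective_pairing pK.
have lu : bfs_label nb v (walk u) (val u) by apply: bfs_label_walk; exact: leqW.
have key x y : bfs_label nb v x (val u) -> bfs_label nb v y l -> y \in nb x ->
    exists2 w, tree_adj u w & l = val w.
  move=> xu yl; have [u' xu' /val_inj uu] := bfs_labelP xu (leqW su).
  rewrite xu' -uu => /walk_adj[w uw ye]; exists w => //.
  by apply: (bfs_label_inj nb_uniq yl); rewrite ye; apply: bfs_label_walk; exact: adjS.
split; split=> [[x [y [h1 h2 h3]]]|[w uw ->]].
- exact: key h1 h2 h3.
- exists (walk u), (walk w); split=> //; first by apply: bfs_label_walk; exact: adjS.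
  by apply/walk_adj; exists w.
- by apply: key h2 h1 _; exact: nbC.
- exists (walk w), (walk u); split=> //; first by apply: bfs_label_walk; exact: adjS.
  by apply: nbC; apply/walk_adj; exists w.
Qed.

Lemma lball_bfs m l : (m <= r.+1)%N -> lball g m l <-> exists2 u : tree d, (size (val u) <= m)%N & val u = l.
Proof.
elim: m l => [|m IH] l mr; rewrite /lball /=.
  split=> [->|[u]]; first by exists troot.
  by rewrite leqn0 size_eq0 => /eqP-> ->.
split=> [[/(IH _ (ltnW mr))[u um ul]|[l' /(IH _ (ltnW mr))[u um <-]]]|[u um ul]].
- by exists u => //; exact: leqW.
- have [h _] := bfs_edge l (leq_trans um (mr : (m <= r)%N)); move=> /h[w /adj_size ww ->].
  by exists w => //; case: ww => e; rewrite ?e//; apply/leqW/(leq_trans _ um); rewrite e.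
- have [um'|mu] := leqP (size (val u)) m; first by left; apply/(IH _ (ltnW mr)); exists u.
  right; case: (treeP u) => [u0|[a [k [ka ue]]]]; first by move: mu; rewrite u0.
  have am : (size (val a) <= m)%N by move: um; rewrite ue size_child.
  exists (val a); first by apply/(IH _ (ltnW mr)); exists a.
  have [h _] := bfs_edge l (leq_trans am (mr : (m <= r)%N)).
  by apply/h; exists u => //; rewrite ue; exact: adj_child.
Qed.

(** Labels agree up to depth [r.+1], one level beyond the ball, so the neighbors of every vertex in
    the ball are known. *)
Lemma lrestrict_walk m : (m <= r)%N -> lrestrict g m = lrestrict g' m.
Proof.
move=> mr.
have ball l : lball g' m l <-> exists2 u : tree d, (size (val u) <= m)%N & val u = l.
  split=> [/lball_tree[u /vertex_ballE um ul]|[u um <-]]; first by exists u.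
  elim: m {mr} u um => [|m IH] u; first by rewrite leqn0 size_eq0 /lball /= => /eqP.
  rewrite /lball /= => um; have [um'|mu] := leqP (size (val u)) m; first by left; exact: IH.
  right; case: (treeP u) => [u0|[a [k [ka ue]]]]; first by move: mu; rewrite u0.
  exists (val a); first by apply: IH; move: um; rewrite ue size_child.
  by exists a, u; split=> //; rewrite ue; exact: adj_child.
have ballE l : lball g m l = lball g' m l.
  by apply/propext; rewrite ball; exact: (lball_bfs _ (leqW mr)).
rewrite /lrestrict; congr LGraph.
- apply/funext => -[l a]; apply/propext; rewrite /= ballE ball; split=> -[h [u um ul]].
    split; last by exists u.
    case: h => x /= xl xa; exists u => //=; rewrite -xa /=; congr f.
    have lr : (size l <= r.+1)%N by rewrite -ul; exact: leq_trans um (leqW mr).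
    by have [w -> le] := bfs_labelP xl lr; congr walk; apply: val_inj; rewrite ul le.
  split; last by exists u.
  case: h => w /= wl wa; exists (walk w) => //=; rewrite -wl; apply: bfs_label_walk.
  by rewrite -[val w]/(sval w) wl -ul; exact: leq_trans um (leqW mr).
- apply/funext => l; apply/funext => l'; apply/propext; rewrite !ballE.
  split=> -[h hl hl']; split=> //; have := hl; rewrite ball => -[u um ul].
    move: h; rewrite -ul; have [-> _] := bfs_edge l' (leq_trans um mr).
    by move=> [w uw ->]; exists u, w.
  case: h => x [y [xl yl xy]]; rewrite -ul; have [h _] := bfs_edge l' (leq_trans um mr).
  apply/h; exists y => //; suff <- : x = u by [].
  by apply: val_inj; rewrite xl ul.
Qed.

End Exploration.
End Unfolding.

(** * Weak topology *)

Section AverageIntegral.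
Local Open Scope classical_set_scope.
Context dT (T : measurableType dT) (R : realType) (I : finType).
Variables (P : I -> probability T R) (I0 : (0 < #|I|)%N).

Lemma integrable_bounded (Q : probability T R) (f : T -> R) (C : R) :
  measurable_fun setT f -> (forall x, `|f x| <= C) -> Q.-integrable setT (EFin \o f).
Proof.
move=> mf fC; apply: measurable_bounded_integrable => //.
  by rewrite (le_lt_trans (probability_le1 _ _))// ltry.
by exists C; split; [exact: num_real|move=> M /ltW CM x _; exact: le_trans (fC x) CM].
Qed.

Lemma ge0_integral_average (f : T -> R) : measurable_fun setT f -> (forall x, 0 <= f x) ->
  (\int[average P I0]_x (f x)%:E = (#|I|%:R^-1)%:E * \sum_i \int[P i]_x (f x)%:E)%E.
Proof.
move=> mf f0.
(* [msum] sums measures indexed by [nat], so the index type is enumerated; past its end the zero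
   measure is used. *)
pose m_ (k : nat) : {measure set T -> \bar R} := if insub k is Some i then P (enum_val (i : 'I_#|I|)) else mzero.
have m_E (i : 'I_#|I|) : m_ i = P (enum_val i) by rewrite /m_ valK.
have c0 : (0 <= (#|I|%:R : R)^-1) by rewrite invr_ge0.
transitivity (\int[mscale (NngNum c0) (msum m_ #|I|)]_x (f x)%:E)%E.
  apply: eq_measure_integral => A mA _; rewrite /average /mscale /= /msum; congr (_ * _)%E.
  by rewrite (reindex_onto _ _ (fun x _ => enum_rankK x)); apply: eq_big => i;
    rewrite ?enum_valK ?eqxx// m_E.
have mfE : measurable_fun setT (fun x => (f x)%:E) by exact/measurable_EFinP.
rewrite ge0_integral_mscale//; last by move=> x _; rewrite lee_fin.
rewrite ge0_integral_measure_sum//; last first.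
  by move=> x _; rewrite lee_fin.
congr (_ * _)%E; rewrite [RHS](reindex_onto _ _ (fun x _ => enum_rankK x)).
  by apply: eq_big => i; rewrite ?enum_valK ?eqxx// m_E.
Qed.

Lemma Rintegral_average (f : T -> R) (C : R) : measurable_fun setT f -> (forall x, `|f x| <= C) ->
  \int[average P I0]_x f x = (\sum_i \int[P i]_x f x) / #|I|%:R.
Proof.
(* The shift by [C] makes the integrand nonnegative, as [ge0_integral_average] requires. *)
move=> mf fC; pose g x := f x + C.
have mg : measurable_fun setT g by exact: measurable_funD.
have g0 x : 0 <= g x by have := fC x; rewrite ler_norml /g => /andP[]; lra.
have gC x : `|g x| <= C + C by rewrite ger0_norm// /g; have := fC x; rewrite ler_norml => /andP[]; lra.
have shift (Q : probability T R) : \int[Q]_x f x = \int[Q]_x g x - C.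
  have := @RintegralD _ _ _ Q setT f (fun=> C) measurableT.
  rewrite Rintegral_cst//= probability_setT mulr1 => ->; rewrite ?addrK//.
  - exact: integrable_bounded fC.
  - by apply: (@integrable_bounded _ (cst C) `|C|).
have fin (Q : probability T R) : (\int[Q]_x (g x)%:E)%E \is a fin_num.
  by apply: integrable_fin_num => //; exact: integrable_bounded gC.
rewrite shift /Rintegral (ge0_integral_average mg g0).
have -> : (\sum_i \int[P i]_x (g x)%:E = (\sum_i \int[P i]_x g x)%:E)%E.
  by rewrite -sumEFin; apply: eq_bigr => i _; rewrite /Rintegral fineK//; exact: fin.
rewrite -EFinM /= (eq_bigr _ (fun i _ => shift (P i))) big_split /= sumrN sumr_const.
have : #|I|%:R != 0 :> R by rewrite pnatr_eq0 -lt0n.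
by move=> ?; rewrite -[C *+ _]mulr_natr /Rintegral; field.
Qed.

End AverageIntegral.

Section Continuity.
Local Open Scope classical_set_scope.
Variables (R : realType) (D : nat) (M : colorType).
Notation d := D.+1.
Implicit Types (g h : rooted_graph R M) (c : tree d -> M).

Lemma rdist_small g h r :
  (forall m, (m <= r)%N -> lrestrict (sval g) m = lrestrict (sval h) m) -> rdist g h <= 2^-1 ^+ r.
Proof.
move=> gh.
have term0 m : (m <= r)%N -> rdist_term g h m = 0.
  move=> mr; rewrite /rdist_term (_ : `[< _ >] = false) ?mulr0//.
  by apply/asboolPn => /(_ (gh _ mr)).
apply: limr_le; first exact: is_cvg_rdist.
exists r.+1 => // n /= rn; rewrite /series /= (big_cat_nat (n := r.+1))//= big_nat_cond big1 ?add0r; last first.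
  by move=> m /andP[/andP[_ mr] _]; exact: term0.
apply: (@le_trans _ _ (\sum_(r.+1 <= i < n) 2^-1 ^+ i)).
  by apply: ler_sum => i _; apply: le_trans (rdist_term_le g h i) _; rewrite /geometric /= mul1r.
rewrite -{1}(subnKC rn) geometric_partial_tail.
apply: (@le_trans _ _ (2^-1 ^+ r.+1 / (1 - 2^-1))); first by apply: geometric_le_lim; rewrite ?ger0_norm//; lra.
rewrite exprSr le_eqVlt; apply/orP; left; apply/eqP; field => //.
Qed.

Definition tgraph c : rooted_graph R M := exist _ _ (tree_labeling c).

Lemma lrestrict_start c c' r m : (m <= r)%N -> start c r = start c' r ->
  lrestrict (tree_lgraph c) m = lrestrict (tree_lgraph c') m.
Proof.
move=> mr /start_eq cc.
have ball (x : tree d -> M) v : lball (tree_lgraph x) m (val v) -> c v = c' v.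
  by move=> /lball_tree[u /vertex_ballE um /val_inj uv]; apply: cc; rewrite -uv leqW// (leq_trans um).
rewrite /lrestrict; congr LGraph.
apply/funext => -[l a]; apply/propext; split=> -[[v /= vl va] h]; split=> //; exists v => //=.
  by rewrite -va; apply/esym/(ball c); rewrite [val v]vl.
by rewrite -va; apply: (ball c'); rewrite [val v]vl.
Qed.

Lemma continuous_local (phi : rooted_graph R M -> R) c (eps : R) : continuous phi -> 0 < eps ->
  exists r, forall g, (forall m, (m <= r)%N -> lrestrict (sval g) m = lrestrict (tree_lgraph c) m) ->
    `|phi (tgraph c) - phi g| < eps.
Proof.
move=> phiC eps0; have /cvgrPdist_lt/(_ _ eps0) := phiC (tgraph c).
move=> /nbhs_ballP[e /= e0 eU].
have [r _ re] := near_infty_natSinv_expn_lt (PosNum e0).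
exists r => g gc; apply: eU; rewrite ballEmdist /=.
apply: (@le_lt_trans _ _ (2^-1 ^+ r)); last first.
  by have /= := re r (leqnn r); rewrite div1r exprVn.
by apply: rdist_small => m mr; rewrite gc.
Qed.

(* The colorings of the tree form a compact space, through which [r] can be
   chosen uniformly. *)
Lemma continuous_uniform (phi : rooted_graph R M -> R) (eps : R) : continuous phi -> 0 < eps ->
  exists r, forall g c, (forall m, (m <= r)%N -> lrestrict (sval g) m = lrestrict (tree_lgraph c) m) ->
    `|phi (tgraph c) - phi g| <= eps.
Proof.
move=> phiC eps0; apply: contrapT => no.
have bad r : exists gc : rooted_graph R M * (tree d -> M),
    (forall m, (m <= r)%N -> lrestrict (sval gc.1) m = lrestrict (tree_lgraph gc.2) m) /\
    eps < `|phi (tgraph gc.2) - phi gc.1|.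
  apply: contrapT => nb; apply: no; exists r => g c gc; rewrite leNgt; apply/negP => h.
  by apply: nb; exists (g, c).
have [gc gcP] := choice bad; pose g r := (gc r).1; pose c r := (gc r).2.
have [U [UU oU]] := ultraFilterLemma eventually_filter.
have UF : ProperFilter U := @ultra_proper _ _ UU.
(* At each vertex the ultrafilter selects one of the finitely many colors; [c0] is the limit
   coloring. *)
have ex u : exists m, U [set r | c r u = m].
  apply: contrapT => nm.
  have h : \near U, forall m : M, c U u <> m.
    apply: (@filter_forall _ M (fun m => [set r | c r u <> m])) => m.
    have [h|//] := in_ultra_setVsetC [set r | c r u = m] UU.
    by case: nm; exists m.
  by have [r /(_ (c r u))] := filter_ex h.
have [c0 c0P] := choice ex.
have [r1 r1P] := continuous_local c0 phiC (divr_gt0 eps0 (ltr0n R 2)).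
have [S SP] := @findep_start D M r1.
have cS : U [set r | agree S (c r) c0].
  elim: S {SP} => [|u S IH].
    by rewrite (_ : [set _ | _] = setT); [exact: filterT|apply/seteqP; split].
  apply: filterS (filterI (c0P u) IH) => r /= [cu cS] w.
  by rewrite inE => /orP[/eqP->//|]; exact: cS.
have big : U [set r | (r1 <= r)%N] by apply: oU; exists r1.
have [r [cr rr]] := filter_ex (filterI cS big).
have cc : start (c r) r1 = start c0 r1 by exact: SP.
have [gcr] := gcP r; rewrite -/(c r) -/(g r) => far.
have h1 := r1P (tgraph (c r)) (fun m mr => lrestrict_start mr cc).
have h2 := r1P (g r) (fun m mr => etrans (gcr m (leq_trans mr rr)) (lrestrict_start mr cc)).
have : `|phi (tgraph (c r)) - phi (g r)| < eps.
  rewrite [X in `|X|](_ : _ = (phi (tgraph c0) - phi (g r)) - (phi (tgraph c0) - phi (tgraph (c r)))); last by ring.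
  apply: le_lt_trans (ler_normB _ _) _; lra.
by move=> /(lt_trans far); rewrite ltxx.
Qed.

Lemma measurable_continuous (phi : rooted_graph R M -> R) : continuous phi ->
  measurable_fun setT (phi : rborel R M -> R).
Proof.
move=> /continuousP phiC.
apply: (measurability (rT := measurableTypeR R) _ (measurable_realfun.RGenOpens.measurableE R)).
move=> _ [_ [a [b ->]] <-]; rewrite setTI; apply: sub_sigma_algebra; apply: phiC.
exact: interval_open.
Qed.

End Continuity.

(** * Uniform shuffles as uniform orders of the half-edges *)

Section Shuffles.
Variables (n D : nat) (p : {perm ('I_n * 'I_D.+1)}).
Hypothesis pS : p \in simples D 'I_n.
Notation d := D.+1.
Notation V := 'I_n.
Notation H := ('I_n * 'I_D.+1)%type.
Let E := Eof p.

Definition shuffled (u : V) (x : {perm V}) : seq V :=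
  [seq y <- [seq x z | z <- enum V] | edge_rel E u y].

(** The order in which the shuffle [x] lists the half-edges at [u]; by [shuffled_ord] the default is
    never taken. *)
Definition ord (u : V) (x : {perm V}) : 'S_d :=
  odflt 1%g [pick t : 'S_d | shuffled u x == [seq (p (u, t k)).1 | k <- enum 'I_d]].

Lemma nbr_inj (u : V) : injective (fun i : 'I_d => (p (u, i)).1).
Proof. by have /simplesP[_ _ h] := pS; move=> i j e; have [] := h (u, j) (u, i) erefl e. Qed.

Lemma edge_relP u y : edge_rel E u y = (y \in [seq (p (u, i)).1 | i <- enum 'I_d]).
Proof.
have : (y \in nbh E u) = (y \in [set (p (u, i)).1 | i : 'I_d]) by rewrite Eof_nbh.
rewrite /nbh finset.in_set -/(edge_rel E u y) => ->; apply/imsetP/mapP => -[i _ ->]; exists i => //; by rewrite mem_enum.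
Qed.

Lemma shuffled_ord u x : shuffled u x = [seq (p (u, ord u x k)).1 | k <- enum 'I_d].
Proof.
rewrite /ord; case: pickP => [t /eqP//|no].
have pe : perm_eq (shuffled u x) (map_tuple (fun i : 'I_d => (p (u, i)).1) (ord_tuple d)).
  apply: uniq_perm.
  - by rewrite filter_uniq// map_inj_uniq ?enum_uniq//; exact: perm_inj.
  - by rewrite map_inj_uniq ?enum_uniq//; exact: nbr_inj.
  - move=> y; rewrite mem_filter edge_relP /= [y \in map x _](_ : _ = true) ?andbT//.
    by apply/mapP; exists ((x^-1)%g y); rewrite ?mem_enum ?permKV.
have [t te] := tuple_permP pe; have := no t; rewrite te /= => /eqP[].
by apply: eq_map => k; rewrite tnth_map tnth_ord_tuple.
Qed.

Lemma ord_unique u x (t : 'S_d) : shuffled u x = [seq (p (u, t k)).1 | k <- enum 'I_d] -> ord u x = t.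
Proof.
rewrite shuffled_ord => /eq_in_map h; apply/permP => k; apply: (@nbr_inj u).
by apply: h; rewrite mem_enum.
Qed.

(** Compose the shuffle with the permutation of the vertices that moves the neighbors of [u]
    according to [th] and fixes all others. *)
Lemma ord_equi u (th : 'S_d) :
  exists2 b : {perm V} -> {perm V}, injective b & forall x, ord u (b x) = (ord u x * th)%g.
Proof.
pose N := [seq (p (u, i)).1 | i <- enum 'I_d].
pose g y := if [pick i | (p (u, i)).1 == y] is Some i then (p (u, th i)).1 else y.
have gN i : g (p (u, i)).1 = (p (u, th i)).1.
  rewrite /g; case: pickP => [j /eqP/nbr_inj->//|/(_ i)]; by rewrite eqxx.
have gout y : y \notin N -> g y = y.
  move=> yN; rewrite /g; case: pickP => // i /eqP e; case/negP: yN; rewrite -e.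
  by apply/mapP; exists i; rewrite ?mem_enum.
have NP y : reflect (exists i, y = (p (u, i)).1) (y \in N).
  by apply: (iffP mapP) => [[i _ ->]|[i ->]]; exists i; rewrite ?mem_enum.
have gmem y : (g y \in N) = (y \in N).
  have [/NP[i ->]|yN] := boolP (y \in N); last by rewrite gout// (negbTE yN).
  by rewrite gN; apply/NP; exists (th i).
have gi : injective g.
  move=> y z e; have := gmem y; rewrite e gmem.
  have [/NP[i yE]|yN] := boolP (y \in N) => zN.
    by move: e; have /NP[j ->] := zN; rewrite yE !gN => /nbr_inj/perm_inj->.
  by move: e; rewrite !gout ?zN.
exists (fun x => (x * perm gi)%g); first by move=> x y; exact: mulIg.
move=> x; apply: ord_unique; rewrite /shuffled.
have -> : [seq (x * perm gi)%g z | z <- enum V] = map g (map x (enum V)).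
  by rewrite -[RHS]map_comp; apply: eq_map => z /=; rewrite permM permE.
rewrite filter_map (eq_filter (a2 := edge_rel E u)) => [|y]; last by rewrite /= !edge_relP gmem.
rewrite -/(shuffled u x) shuffled_ord -map_comp; apply: eq_map => k /=.
by rewrite gN permM.
Qed.

End Shuffles.

Section WeakEstimate.
Local Open Scope classical_set_scope.
Variables (R : realType) (D : nat) (M : colorType).
Notation d := D.+1.
Variables (phi : rooted_graph R M -> R) (C eps : R) (r : nat).
Hypothesis phiC : continuous phi.
Hypothesis phi_bd : forall g, `|phi g| <= C.
Hypothesis phi_loc : forall g (c : tree d -> M),
  (forall m, (m <= r)%N -> lrestrict (sval g) m = lrestrict (tree_lgraph c) m) ->
  `|phi (tgraph R c) - phi g| <= eps.

(** [phi] as a function of a star: up to [eps] the way in which [cof] extends the star does not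
    matter. *)
Let F (x : star D M r) : R := phi (tgraph R (cof x)).

Let phi_start (c : tree d -> M) : `|F (start c r) - phi (tgraph R c)| <= eps.
Proof. by apply: phi_loc => m mr; apply: (lrestrict_start mr); rewrite start_cof. Qed.

Lemma tree_law_estimate (mu : probability (config d M) R) :
  `|\int[tree_law mu]_g phi g - \sum_x slaw mu r x * F x| <= eps.
Proof.
pose h (c : config d M) : R := F (start c r).
pose A x : set (config d M) := [set c : tree d -> M | start c r = x].
have mst (Y : set (star D M r)) : measurable ([set c : tree d -> M | Y (start c r)] : set (config d M)).
  by apply: measurable_findep; exact: findep_start.
have mh : measurable_fun setT h.
  by move=> _ Y mY; rewrite setTI; exact: (mst (fun x => Y (F x))).
have hC c : `|h c| <= C by exact: phi_bd.
have ih : mu.-integrable setT (EFin \o h) by exact: integrable_bounded hC.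
pose f (c : config d M) : R := phi (tgraph R c).
have mf : measurable_fun setT f.
  apply: (measurableT_comp (measurable_continuous phiC)); exact: measurable_tree_map.
have fC c : `|f c| <= C by exact: phi_bd.
have if_ : mu.-integrable setT (EFin \o f) by exact: integrable_bounded fC.
have -> : \int[tree_law mu]_g phi g = \int[mu]_c f c.
  congr fine; apply: integral_distribution => //.
  by apply/measurable_EFinP; exact: measurable_continuous.
have -> : \sum_x slaw mu r x * F x = \int[mu]_c h c.
  rewrite /Rintegral.
  have i1 x : mu.-integrable setT (fun c => (\1_(A x) c)%:E).
    apply: (@integrable_bounded _ _ R mu (\1_(A x)) 1) => [|c].
      by apply: measurable_indic; exact: (mst (fun y => y = x)).
    by rewrite indicE; case: (_ \in _); rewrite ?normr1 ?normr0.
  transitivity (fine (\int[mu]_c \sum_x ((F x)%:E * (\1_(A x) c)%:E))%E).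
    rewrite integral_sum//; last by move=> x; exact: integrableZl.
    rewrite -[LHS]/(fine (\sum_x slaw mu r x * F x)%:E) -sumEFin; congr fine; apply: eq_bigr => x _.
    rewrite integralZl// integral_indic//; last exact: (mst (fun y => y = x)).
    rewrite setIT mulrC EFinM; congr (_ * _)%E; rewrite /slaw /law fineK//.
    by rewrite fin_num_measure//; exact: (mst (fun y => y = x)).
  congr fine; apply: eq_integral => c _.
  rewrite (bigD1 (start c r))//= [X in (_ + X)%E]big1 ?adde0 => [|x xc].
    by rewrite indicE mem_set// mule1.
  by rewrite indicE memNset ?mule0//= => e; rewrite e eqxx in xc.
rewrite -RintegralB//.
apply: le_trans (le_normr_Rintegral measurableT _) _.
  by apply: (@integrable_bounded _ _ R mu _ (C + C)) => [|c]; [exact: measurable_realfun.measurable_funB|rewrite (le_trans (ler_normB _ _))// lerD].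
have epsE : \int[mu]_c (cst eps c) = eps.
  have muT : fine (mu setT) = 1 by rewrite probability_setT.
  by rewrite -[RHS]mulr1 -muT; exact: Rintegral_cst.
rewrite -epsE.
apply: le_Rintegral => //.
- apply: (@integrable_bounded _ _ R mu _ (C + C)) => [|c].
    by apply: measurableT_comp => //; exact: measurable_realfun.measurable_funB.
  by rewrite normr_id (le_trans (ler_normB _ _))// lerD.
- by apply: (@integrable_bounded _ _ R mu _ `|eps|).
- by move=> c _; rewrite distrC; exact: phi_start.
Qed.

Section Graph.
Variables (n : nat) (p : {perm ('I_n * 'I_D.+1)}) (f : 'I_n -> M).
Hypothesis pS : p \in simples D 'I_n.
Notation V := 'I_n.
Let E := Eof p.

Definition explored (s : {ffun V -> {perm V}}) (v : V) : rooted_graph R M :=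
  exist _ _ (shuffled_labeling E f s v).

Lemma perm_gt0 : (0 < #|{perm V}|)%N.
Proof. by apply/card_gt0P; exists 1%g. Qed.

(** Without repetitions the exploration looks like the tree by [lrestrict_walk], and [law_ostar]
    gives the law of the star explored. *)
Lemma vertex_estimate v : uniq (slab (sunf p id r v)) ->
  `|avg (fun s => phi (explored s v)) - \sum_x SB R (sunf p f r v) x * F x| <= eps.
Proof.
move=> vU; have X0 := perm_gt0.
have -> : \sum_x SB R (sunf p f r v) x * F x = avg (fun s => F (ostar p f (ord p) s r v)).
  under eq_bigr do rewrite -(law_ostar R f X0 (ord_equi pS))//.
  rewrite /avg; under eq_bigr do rewrite mulrAC mulr_suml.
  rewrite -mulr_suml exchange_big /=; congr (_ / _); apply: eq_bigr => s _.
  rewrite (bigD1 (ostar p f (ord p) s r v))//= eqxx mul1r big1 ?addr0// => x /negbTE.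
  by rewrite eq_sym => ->; rewrite mul0r.
have N0 : 0 < #|{ffun V -> {perm V}}|%:R :> R.
  by rewrite ltr0n card_ffun expn_gt0 X0.
rewrite /avg -mulrBl -sumrB normrM [X in _ * X]gtr0_norm ?invr_gt0// ler_pdivrMr//.
apply: le_trans (ler_norm_sum _ _ _) _; rewrite mulr_natr -sumr_const; apply: ler_sum => s _.
rewrite -(start_walk p (ord p) s v f r) distrC; apply: phi_loc => m mr.
rewrite -(lrestrict_start mr (esym (start_cof _))) /explored /=.
have [pK _ p2] := simplesP _ pS.
by apply: (@lrestrict_walk D V {perm V} p (ord p) s v M _ f r) => // x; exact: shuffled_ord.
Qed.

Lemma graph_law_estimate (V0 : (0 < #|V|)%N) :
  `|\int[graph_distr R E f V0]_g phi g - \sum_x Plab R p f x * F x| <=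
    eps + 2 * C * (#|[set v : V | ~~ uniq (slab (sunf p id r v))]%SET|%:R / #|V|%:R).
Proof.
have mphi := measurable_continuous phiC; have N0 : 0 < #|V|%:R :> R by rewrite ltr0n.
have C0 : 0 <= C by exact: le_trans (phi_bd point).
have -> : \int[graph_distr R E f V0]_g phi g = (\sum_v avg (fun s => phi (explored s v))) / #|V|%:R.
  rewrite (Rintegral_average _ _ mphi phi_bd); congr (_ / _); apply: eq_bigr => v _.
  rewrite (Rintegral_average _ _ mphi phi_bd) /avg; congr (_ / _); apply: eq_bigr => s _.
  rewrite /Rintegral integral_dirac//; last by apply/measurable_EFinP.
  by rewrite diracT mul1e.
have -> : \sum_x Plab R p f x * F x = (\sum_v \sum_x SB R (sunf p f r v) x * F x) / #|V|%:R.
  rewrite /Plab; under eq_bigr do rewrite mulrAC mulr_suml.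
  by rewrite -mulr_suml exchange_big.
rewrite -mulrBl -sumrB normrM [X in _ * X]gtr0_norm ?invr_gt0// ler_pdivrMr//.
rewrite mulrDl -[X in _ + X]mulrA mulfVK ?gt_eqF//.
apply: le_trans (ler_norm_sum _ _ _) _.
rewrite -[X in _ <= _ + _ * X]sum_indicator mulr_sumr mulr_natr -sumr_const -big_split.
apply: ler_sum => v _; case: (boolP (uniq _)) => vU; rewrite [X in _ <= X]/=; first by rewrite mulr0 addr0; exact: vertex_estimate.
have eps0 : 0 <= eps by have := phi_start (cof (sunf p f r v)); exact: le_trans.
rewrite mulr1; apply: (@le_trans _ _ (C + C)); last by lra.
apply: le_trans (ler_normB _ _) _; apply: lerD.
  rewrite /avg normrM [X in _ * X]gtr0_norm ?invr_gt0 ?ltr0n ?card_ffun ?expn_gt0 ?perm_gt0//.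
  rewrite ler_pdivrMr ?ltr0n ?expn_gt0 ?perm_gt0// (le_trans (ler_norm_sum _ _ _))//.
  by rewrite -card_ffun mulr_natr -sumr_const; apply: ler_sum.
have [S0 S1] := SB_pmf R (sunf p f r v); rewrite (le_trans (ler_norm_sum _ _ _))//.
rewrite -[leRHS]mul1r -S1 mulr_suml; apply: ler_sum => x _.
by rewrite normrM ger0_norm// ler_wpM2l// phi_bd.
Qed.

Lemma weak_estimate (mu : probability (config d M) R) (V0 : (0 < #|V|)%N) :
  `|\int[graph_distr R E f V0]_g phi g - \int[tree_law mu]_g phi g| <=
    eps + eps + 2 * C * (#|[set v : V | ~~ uniq (slab (sunf p id r v))]%SET|%:R / #|V|%:R) +
    C * l1 (Plab R p f (r := r)) (slaw mu r).
Proof.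
have C0 : 0 <= C by exact: le_trans (phi_bd point).
have h1 := graph_law_estimate V0; have h2 := tree_law_estimate mu.
have h3 : `|\sum_x Plab R p f x * F x - \sum_x slaw mu r x * F x| <= C * l1 (Plab R p f (r := r)) (slaw mu r).
  rewrite -sumrB /l1 mulr_sumr (le_trans (ler_norm_sum _ _ _))//; apply: ler_sum => x _.
  by rewrite -mulrBl normrM mulrC ler_wpM2r// phi_bd.
move: h1 h2 h3; rewrite !ler_norml => /andP[a1 a2] /andP[b1 b2] /andP[c1 c2].
apply/andP; split; lra.
Qed.

End Graph.
End WeakEstimate.

Section RepeatsMonotone.
Variable D : nat.

Lemma subseq_flatten_map (I : Type) (T : eqType) (F G : I -> seq T) (e : seq I) :
  (forall i, subseq (F i) (G i)) ->
  subseq (flatten [seq F i | i <- e]) (flatten [seq G i | i <- e]).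
Proof. by move=> FG; elim: e => //= i e IH; exact: cat_subseq. Qed.

Lemma subseq_lab_trunc (M : finType) r (x : br D M r.+1) : subseq (lab (trunc r x)) (lab x).
Proof.
elim: r x => [|r IH] x; first by rewrite /= eqxx sub0seq.
apply: (@cat_subseq _ [:: x.1] _ [:: x.1]) => //.
by apply: subseq_flatten_map => i; rewrite ffunE; exact: IH.
Qed.

Lemma uniq_slab_le (V : finType) p r s (v : V) : (r <= s)%N ->
  uniq (slab (sunf (D := D) p id s v)) -> uniq (slab (sunf (D := D) p id r v)).
Proof.
move=> /subnKC<-; elim: (s - r)%N => [|k IH]; first by rewrite addn0.
rewrite addnS => u; apply: IH; move: u; apply: subseq_uniq; rewrite -strunc_sunf.
move: (sunf p id (r + k).+1 v) => x; apply: (@cat_subseq _ [:: x.1] _ [:: x.1]) => //.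
by apply: subseq_flatten_map => i; rewrite ffunE; exact: subseq_lab_trunc.
Qed.

End RepeatsMonotone.

Section WeakTopology.
Local Open Scope classical_set_scope.

Lemma cvg_initial (S : choiceType) (T : topologicalType) (f : S -> T) (F : set_system S) (s : S) :
  Filter F -> f @ F --> f s -> F --> (s : initial_topology f).
Proof.
move=> FF cf A; rewrite nbhsE => -[B [[W oW WB] Bs] BA]; apply: (filterS BA); rewrite -WB.
by apply: cf; apply: open_nbhs_nbhs; split=> //; move: Bs; rewrite -WB.
Qed.

Variables (R : realType) (M : colorType).

Lemma cvg_weak (Q : nat -> probability (rborel R M) R) (P : probability (rborel R M) R) :
  (forall phi : bounded_continuous R M, \int[Q k]_g sval phi g @[k --> \oo] --> \int[P]_g sval phi g) ->
  Q @ \oo --> (P : initial_topology (@expectations R M)).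
Proof.
move=> cQ; apply: cvg_initial; apply/cvg_sup => phi.
by apply: cvg_initial; exact: cQ.
Qed.

Variables (dist : probability (rborel R M) R -> probability (rborel R M) R -> R) (D : nat).
Notation d := D.+1.
Variable mu : probability (config d M) R.
Hypothesis wm : weak_metric dist.
Hypothesis D0 : (0 < D)%N.
Hypothesis muI : invariant_process mu.

(** As [dist] is only known to generate the weak topology, [r] and [eta] come from a contradiction:
    counterexamples for [r = k] and [eta = 1 / (k + 1)] converge weakly to [tree_law mu] by
    [weak_estimate], hence in [dist]. *)
Lemma weak_close (eps : R) : 0 < eps -> exists (r : nat) (eta : R), 0 < eta /\
  forall (n : nat) (p : {perm ('I_n * 'I_D.+1)}) (f : 'I_n -> M) (n0 : (0 < #|'I_n|)%N),
    p \in simples D 'I_n ->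
    l1 (Plab R p f (r := r)) (slaw mu r) <= eta ->
    #|[set v : 'I_n | ~~ uniq (slab (sunf p id r v))]%SET|%:R <= eta * #|'I_n|%:R ->
    dist (graph_distr R (Eof p) f n0) (tree_law mu) <= eps.
Proof.
move=> eps0; apply: contrapT => no; have [_ distC _ nbhsP] := wm.
have bad k : exists Q : probability (rborel R M) R, eps < dist Q (tree_law mu) /\
    exists (n : nat) (p : {perm ('I_n * 'I_D.+1)}) (f : 'I_n -> M) (n0 : (0 < #|'I_n|)%N),
    [/\ p \in simples D 'I_n, l1 (Plab R p f (r := k)) (slaw mu k) <= k.+1%:R^-1,
      #|[set v : 'I_n | ~~ uniq (slab (sunf p id k v))]%SET|%:R <= k.+1%:R^-1 * #|'I_n|%:R :> R &
      Q = graph_distr R (Eof p) f n0].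
  apply: contrapT => nb; apply: no; exists k, k.+1%:R^-1; split; first by rewrite invr_gt0.
  move=> n p f n0 pS h1 h2; rewrite leNgt; apply/negP => h; apply: nb.
  by exists (graph_distr R (Eof p) f n0); split=> //; exists n, p, f, n0.
have [Q QP] := choice bad.
have cQ : Q @ \oo --> (tree_law mu : initial_topology (@expectations R M)).
  apply: cvg_weak => -[phi [phiC [C phi_bd]]] /=.
  have C0 : 0 <= C by exact: le_trans (phi_bd point).
  apply/cvgrPdist_lt => e e0; have e4 : 0 < e / 4 by rewrite divr_gt0.
  have [r phi_loc] := continuous_uniform D phiC e4.
  have t0 : 0 < e / (8 * (C + 1)) by rewrite divr_gt0// mulr_gt0// ltr_wpDl.
  have [k1 _ k1P] := near_infty_natSinv_lt (PosNum t0).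
  exists (maxn r k1) => // k /=; rewrite geq_max => /andP[rk /k1P/= kt].
  have [_ [n [p [f [n0 [pS h1 h2 ->]]]]]] := QP k.
  have [pK _ _] := simplesP _ pS.
  have h1' : l1 (Plab R p f (r := r)) (slaw mu r) <= k.+1%:R^-1.
    by apply: le_trans h1; apply: l1_strunc rk; [exact: Plab_inv|exact: slaw_inv].
  have h2' : #|[set v : 'I_n | ~~ uniq (slab (sunf p id r v))]%SET|%:R / #|'I_n|%:R <= k.+1%:R^-1 :> R.
    rewrite ler_pdivrMr ?ltr0n//; apply: le_trans h2; rewrite ler_nat; apply: subset_leq_card.
    by apply/fintype.subsetP => v; rewrite !finset.in_set; apply: contra; exact: uniq_slab_le.
  rewrite distrC; apply: (le_lt_trans (weak_estimate phiC phi_bd phi_loc f pS mu n0)).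
  have m1 := ler_wpM2l C0 h1'; have m2 := ler_wpM2l C0 h2'.
  have m3 : C * k.+1%:R^-1 <= e / 8.
    apply: (@le_trans _ _ ((C + 1) * (e / (8 * (C + 1))))).
      by apply: ler_pM => //; [lra|exact: ltW].
    rewrite le_eqVlt; apply/orP; left; apply/eqP; field; rewrite gt_eqF//; lra.
  rewrite -[X in _ + X + _]mulrA.
  move: m1 m2 m3; set a := C * l1 _ _; set b := C * (_ / _); set c := C / _ => m1 m2 m3.
  have e0' : (0 : R) < e by [].
  lra.
have : nbhs (tree_law mu : initial_topology (@expectations R M)) [set Q | dist (tree_law mu) Q < eps].
  by rewrite nbhsP; exists eps.
move=> /cQ [k _ /(_ k (leqnn k))/=]; have [/ltW h _] := QP k.
by rewrite distC ltNge h.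
Qed.

End WeakTopology.

Section Conclusion.
Local Open Scope classical_set_scope.
Variables (R : realType) (M : colorType) (D : nat).
Notation d := D.+1.

Lemma typical_prob_cvg1 (dist : probability (rborel R M) R -> probability (rborel R M) R -> R)
    (mu : probability (config d M) R) (rk : nat -> nat) (eps : R) :
  weak_metric dist -> (0 < D)%N -> invariant_process mu ->
  (forall k, (1 <= k)%N -> (1 <= rk k)%N) ->
  (forall k l, (1 <= k)%N -> (k < l)%N -> (rk k < rk l)%N) ->
  (forall nu : probability (config d (M * M)%type) R, invariant_coupling mu nu ->
     forall k, (1 <= k)%N -> annealed_entropy nu (rk k) <= 2 * annealed_entropy mu (rk k)) ->
  0 < eps ->
  typical_prob dist mu eps n @[n --> within [set n | ~~ odd (n * d)] \oo] --> (1 : R).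
Proof.
move=> wm D0 muI rk1 rk_lt rkH eps0.
have [r [eta [eta0 close]]] := weak_close wm D0 muI eps0.
have [k1 k10 [N1 N1P]] := almost_all_matchings (slaw_inv D0 muI) (coupling_compact D0 muI rk1 rk_lt rkH) r eta0.
have [k2 k20 [N2 N2P]] := few_repeats D r eta0.
pose few n (p : {perm ('I_n * 'I_D.+1)}) : bool :=
  #|[set v : 'I_n | ~~ uniq (slab (sunf p id r v))]%SET|%:R <= eta * #|'I_n|%:R :> R.
pose fit n (p : {perm ('I_n * 'I_D.+1)}) : bool :=
  [exists f : {ffun 'I_n -> M}, l1 (Plab R p f (r := r)) (slaw mu r) <= eta].
pose good n : pred {perm ('I_n * 'I_D.+1)} := fun p => fit n p && few n p.
pose k0 := Num.min k1 k2; have k00 : 0 < k0 by rewrite lt_min k10.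
have k0' : 0 < k0 / 2 by rewrite divr_gt0.
(* Halving the rate [k0] absorbs the factor 2 of the union bound once [n >= 2 / k0]. *)
have badle n : (maxn (maxn N1 N2) (Num.bound (2 / k0)) <= n)%N ->
    #|[set p in matchings ('I_n * 'I_D.+1)%type | ~~ good n p]%SET|%:R <=
    #|matchings ('I_n * 'I_D.+1)%type|%:R * expR (- (k0 / 2 * n%:R)) :> R.
  rewrite !geq_max => /andP[/andP[n1 n2] n3].
  have := N1P 'I_n; rewrite card_ord => /(_ n1) h1; have := N2P 'I_n; rewrite card_ord => /(_ n2) h2.
  apply: (@le_trans _ _ (#|[set p in matchings ('I_n * 'I_D.+1)%type | ~~ fit n p]%SET|%:R +
      #|[set p in matchings ('I_n * 'I_D.+1)%type | eta * n%:R <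
         #|[set v : 'I_n | ~~ uniq (slab (sunf p id r v))]%SET|%:R]%SET|%:R)).
    rewrite -natrD ler_nat; apply: leq_trans (leq_card_setU _ _); apply: subset_leq_card.
    apply/fintype.subsetP => p; rewrite !finset.in_set /good /few card_ord negb_and -real_ltNge ?num_real//.
    by move=> /andP[-> /orP[->|->]]; rewrite ?orbT.
  apply: le_trans (lerD h1 h2) _; rewrite -mulrDr ler_wpM2l//.
  have e k : k0 <= k -> expR (- (k * n%:R)) <= expR (- (k0 * n%:R)).
    by move=> kk; rewrite ler_expR lerN2 ler_wpM2r.
  have e1 : expR (- (k1 * n%:R)) <= expR (- (k0 * n%:R)) by apply: e; rewrite ge_min lexx.
  have e2 : expR (- (k2 * n%:R)) <= expR (- (k0 * n%:R)) by apply: e; rewrite ge_min lexx orbT.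
  apply: le_trans (lerD e1 e2) _.
  have -> : k0 * n%:R = k0 / 2 * n%:R + k0 / 2 * n%:R by field.
  rewrite opprD expRD; set x := expR _; have x0 : 0 <= x by exact: expR_ge0.
  suff x1 : 2 * x <= 1 by have := ler_wpM2r x0 x1; lra.
  rewrite /x expRN ler_pdivrMr ?expR_gt0// mul1r; apply: le_trans (expR_ge1Dx _).
  have : 2 / k0 <= n%:R.
    apply: le_trans (_ : (Num.bound (2 / k0))%:R <= _); last by rewrite ler_nat.
    by apply/ltW/archi_boundP; rewrite divr_ge0// ltW.
  rewrite ler_pdivrMr// => h; lra.
apply/cvgrPdist_le => e e0.
have [N NP] := transfer k0' badle e0.
exists (maxn N 1) => // n /=; rewrite geq_max => /andP[nN n1] nd.
have [reg0 regP] := NP n nN nd; have n0 : (0 < #|'I_n|)%N by rewrite card_ord.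
have reg0' : 0 < #|regular_graphs n d|%:R :> R by rewrite ltr0n.
rewrite /typical_prob; set B := [set E in _ | _]%SET.
have sub : (#|[set E in regular_graphs n d | [exists p in Fib D E, good n p]]%SET| <= #|B|)%N.
  apply: subset_leq_card; apply/fintype.subsetP => E; rewrite !finset.in_set => /andP[-> /exists_inP[p]].
  rewrite finset.in_set => /andP[pS /eqP<-] /andP[/existsP[f h1] h2] /=.
  by apply/asboolP; exists n0, f; exact: close.
have Ble : (#|B| <= #|regular_graphs n d|)%N.
  by apply: subset_leq_card; apply/fintype.subsetP => E; rewrite finset.in_set => /andP[].
rewrite ger0_norm ?subr_ge0 ?ler_pdivrMr ?mul1r ?ler_nat//.
rewrite lerBlDr addrC -lerBlDr ler_pdivlMr//.
by apply: le_trans regP _; rewrite ler_nat.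
Qed.

End Conclusion.

Local Open Scope classical_set_scope.
Local Open Scope ring_scope.

Theorem corollary1p8 (R : realType) (M : colorType)
    (dist : probability (rborel R M) R -> probability (rborel R M) R -> R)
    (d : nat) (mu : probability (config d M) R) (r : nat -> nat) :
  weak_metric dist ->
  (3 <= d)%N ->
  invariant_process mu ->
  (forall k, (1 <= k)%N -> (1 <= r k)%N) ->
  (forall k l, (1 <= k)%N -> (k < l)%N -> (r k < r l)%N) ->
  (forall nu : probability (config d (M * M)%type) R,
     invariant_coupling mu nu ->
     forall k, (1 <= k)%N ->
       annealed_entropy nu (r k) <= 2 * annealed_entropy mu (r k)) ->
  strongly_typical dist mu.
Proof.
case: d mu => // D mu wm; rewrite ltnS => D2 muI r1 r_lt rH.
(* The inner limit is already 1 for each [eps]. *)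
exists (fun=> 1); split; last exact: cvg_cst.
by move=> eps; apply: typical_prob_cvg1 wm _ muI r1 r_lt rH; exact: ltnW.
Qed.
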